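(* Let $X_1,X_2,\ldots$ be i.i.d. integer-valued random variables with finite negative mean $\mathbf{E}X_1\in(-\infty,0)$, and assume aperiodicity: $\gcd\{k-n:\ \mathbf{P}(X_1=k)\mathbf{P}(X_1=n)>0\}=1$. Let $\varphi(t)=\mathbf{E}e^{tX_1}$, $t\ge 0$, and assume that there is $\lambda>0$ with $\varphi(\lambda)=1$, and that $\varphi'(\lambda)<\infty$ and $\varphi''(\lambda)<\infty$. Let $\tau$, $A_\tau$ and $I$ be as defined in the context. Then there exists $\Delta^2>0$ such that, as $x\to\infty$ along the integers, $$\sup_{k}\left|x^{1/4}\,\mathbf{P}(\tau=k\mid A_\tau=x)-\frac{1}{\sqrt{2\pi\Delta^2}}\exp\left\{-\frac{(k-I^{-1/2}x^{1/2})^2}{2\Delta^2x^{1/2}}\right\}\right|\to0,$$ where the supremum is over positive integers $k$.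
   Context: $S_n:=X_1+\dots+X_n$ for $n\ge1$; $\tau:=\min\{n\ge1:\ S_n\le 0\}$; $A_\tau:=\sum_{k=1}^{\tau-1}S_k$ (an empty sum is $0$). The derivatives at $\lambda$ are understood as $\varphi'(\lambda)=\mathbf{E}[X_1e^{\lambda X_1}]$ and $\varphi''(\lambda)=\mathbf{E}[X_1^2e^{\lambda X_1}]$. Define $\psi(u):=-\frac1\lambda\log\varphi(\lambda(1-u))$ for $u\in[0,1]$ and $I:=\int_0^1\psi(u)\,du$. *)

(* Defs.v *)
From HB Require Import structures.
From mathcomp Require Import all_boot all_order all_algebra.
From mathcomp Require Import finmap.
From mathcomp Require Import all_classical all_reals all_analysis.

Set Implicit Arguments.
Unset Strict Implicit.
Unset Printing Implicit Defensive.

Import Order.TTheory GRing.Theory Num.Theory.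
Import numFieldNormedType.Exports.

Local Open Scope classical_set_scope.
Local Open Scope ring_scope.

(* Sequences are indexed from 0: [X n] is the variable X_(n+1) of the usual
   notation, so that [walk X n = X 0 + ... + X n.-1] has n terms and [X 0] plays
   the role of X_1. *)

Definition independent_seq d (T : measurableType d) (R : realType)
    (P : probability T R) (X : nat -> T -> R) : Prop :=
  forall (J : {fset nat}) (B : nat -> set R), (forall i, measurable (B i)) ->
    P (\bigcap_(i in [set` J]) (X i @^-1` B i)) =
    (\prod_(i <- J) P (X i @^-1` B i))%E.

Definition identically_distributed d (T : measurableType d) (R : realType)
    (P : probability T R) (X : nat -> T -> R) : Prop :=
  forall (n : nat) (B : set R), measurable B ->
    P (X n @^-1` B) = P (X 0%N @^-1` B).

Definition is_gcd (D : set int) (g : int) : Prop :=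
  [/\ 0 <= g,
      forall m, D m -> (g %| m)%Z &
      forall h : int, (forall m, D m -> (h %| m)%Z) -> (h %| g)%Z].

Definition support_differences d (T : measurableType d) (R : realType)
    (P : probability T R) (X : T -> R) : set int :=
  [set m | exists k n : int,
     (0 < P [set w | X w = k%:~R] * P [set w | X w = n%:~R])%E /\ m = k - n].

Definition walk (T : Type) (R : realType) (X : nat -> T -> R) (n : nat) (w : T) : R :=
  \sum_(0 <= i < n) X i w.

(* The value 0, which is not a possible value of the minimum, encodes
   tau = +oo, i.e. the case where no n >= 1 satisfies S_n <= 0. *)
Definition tau (T : Type) (R : realType) (X : nat -> T -> R) (w : T) : nat :=
  match pselect (exists n : nat, (0 < n)%N && (walk X n w <= 0)) with
  | left ex => ex_minn ex
  | right _ => 0%N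
  end.

Definition A_tau (T : Type) (R : realType) (X : nat -> T -> R) (w : T) : R :=
  \sum_(1 <= k < tau X w) walk X k w.

(* Conditional probability P(E | F); it is 0 by the convention r / 0 = 0 when
   P F = 0. *)
Definition cond_prob d (T : measurableType d) (R : realType)
    (P : probability T R) (E F : set T) : R :=
  fine (P (E `&` F)) / fine (P F).

(* ['M_ P X t] is E(exp(t X)) as an extended real; under the hypotheses
   E(exp(l X)) = 1 and 0 < l it is finite for t between 0 and l. *)
Definition psi d (T : measurableType d) (R : realType)
    (P : probability T R) (X : T -> R) (l u : R) : R :=
  - (l^-1 * ln (fine ('M_ P X (l * (1 - u))))).

Definition I_psi d (T : measurableType d) (R : realType)
    (P : probability T R) (X : T -> R) (l : R) : R :=
  \int[@lebesgue_measure R]_(u in `[0, 1]) psi P X l u.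

(* Main.v *)
(* Tilt the k-th step backwards in time: the step that is followed by i further
   positions gets the exponential tilt lam * i / n.  The tilts multiply up to
   exp(lam * A / n), so P(tau = n, A = x) is an explicit exponential factor times
   the probability, for independent tilted steps, that the walk stays positive
   and has area x.  As the logarithm of phi is convex with zeros 0 and lam, the
   tilted walk drifts away from 0 at both ends; hence positivity only constrains
   a bounded number of steps at each end, and these blocks contribute a positive
   constant.  The middle block satisfies a local limit theorem for (end point,
   area) at scale (sqrt n, n^(3/2)), by Fourier inversion; its covariance is an
   integral of variances of tilted laws, dominated near the tilt 0 by a
   moment that is integrable because E|X| < oo.  Riemann sums for log phi turn
   the exponential factor into exp(-2 lam sqrt(I x) - lam (sqrt x - n sqrt I)^2 / n),
   whose fluctuation is of the same order as that of the local limit; summing over n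
   by dominated convergence gives P(A = x) and then the ratio. *)
Require Import Defs.
From HB Require Import structures.
From mathcomp Require Import all_boot all_order all_algebra.
From mathcomp Require Import finmap.
From mathcomp Require Import all_classical all_reals all_analysis.
From mathcomp Require Import measurable_realfun ring lra zify.

Set Implicit Arguments.
Unset Strict Implicit.
Unset Printing Implicit Defensive.

Import Order.TTheory GRing.Theory Num.Theory.
Import numFieldNormedType.Exports.

Local Open Scope classical_set_scope.
Local Open Scope ring_scope.

(** The moment hypotheses shape the proof. Second moments are available for tilts in []0, lam]]
    only, so the variances of the last steps may be unbounded; third moments may be infinite at the
    tilt [lam]. Hence Riemann sums are controlled by a nonincreasing majorant that may be infinite
    at 0, and [sin x - x] is dominated by a square. The step that ends the excursion is summed out:
    from the height [z] it contributes [P (X <= - z)], a weight whose sum over [z >= 1] is at most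
    [E|X|]. The end point of the remaining path is therefore free and is summed over as well. An
    excursion of area [x] has heights at most [x], hence steps of modulus at most [x]. So the
    cut-off [K] is exact as soon as [K >= x], and estimates valid for [K] large depending on [n]
    suffice. Positivity near the two ends is compared with events on [m] steps of modulus at most
    [M]; the parameters are fixed in the order [m], [M], [n], [K]. The limiting constant is never
    computed: the approximating constants form a Cauchy sequence with a positive lower bound. *)

Notation mfun_ f := (measurable_fun setT f).
Notation Itg mu f := (mu.-integrable setT (EFin \o f)).

(** * Integrals of real functions: linearity, domination, dominated convergence, products *)

Section integral_toolkit.
Context d (T : measurableType d) (R : realType) (mu : {measure set T -> \bar R}).
Implicit Types f g h : T -> R.

Lemma itg_measurable f : Itg mu f -> mfun_ f.
Proof. by move=> /measurable_int/measurable_EFinP. Qed.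

Lemma itg_dominated f g : mfun_ f -> Itg mu g -> (forall x, `|f x| <= g x) ->
  Itg mu f.
Proof.
move=> mf ig fg; apply: (le_integrable _ _ _ ig) => //.
  exact/measurable_EFinP.
move=> x _ /=; rewrite lee_fin (le_trans (fg x))//; exact: ler_norm.
Qed.

Lemma itgD f g : Itg mu f -> Itg mu g -> Itg mu (fun x => f x + g x).
Proof. by move=> *; exact: (integrableD measurableT (f:=EFin \o f) (g:=EFin \o g)). Qed.

Lemma itgB f g : Itg mu f -> Itg mu g -> Itg mu (fun x => f x - g x).
Proof. by move=> *; exact: (integrableB measurableT (f:=EFin \o f) (g:=EFin \o g)). Qed.

Lemma itgZ c f : Itg mu f -> Itg mu (fun x => c * f x).
Proof. by move=> *; exact: (integrableZl measurableT c (f:=EFin \o f)). Qed.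

Lemma itg0 : Itg mu (fun=> 0 : R).
Proof. exact: integrable0. Qed.

Lemma itg_sum (I : Type) (s : seq I) (f : I -> T -> R) :
  (forall i, Itg mu (f i)) -> Itg mu (fun x => \sum_(i <- s) f i x).
Proof.
move=> itf; elim: s => [|i s ih].
  by under eq_fun do rewrite big_nil; exact: itg0.
by under eq_fun do rewrite big_cons; apply: itgD.
Qed.

Lemma intD f g : Itg mu f -> Itg mu g ->
  \int[mu]_x (f x + g x) = \int[mu]_x f x + \int[mu]_x g x.
Proof. by move=> *; apply: RintegralD. Qed.

Lemma intB f g : Itg mu f -> Itg mu g ->
  \int[mu]_x (f x - g x) = \int[mu]_x f x - \int[mu]_x g x.
Proof. by move=> *; apply: RintegralB. Qed.

Lemma intZ c f : Itg mu f -> \int[mu]_x (c * f x) = c * \int[mu]_x f x.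
Proof. by move=> *; apply: RintegralZl. Qed.

Lemma int0 : \int[mu]_x (0 : R) = 0.
Proof. by rewrite /Rintegral integral0. Qed.

Lemma int_sum (I : Type) (s : seq I) (f : I -> T -> R) :
  (forall i, Itg mu (f i)) ->
  \int[mu]_x (\sum_(i <- s) f i x) = \sum_(i <- s) \int[mu]_x f i x.
Proof.
move=> itf; elim: s => [|i s ih].
  by under eq_Rintegral do rewrite big_nil; rewrite int0 big_nil.
under eq_Rintegral do rewrite big_cons.
by rewrite intD ?big_cons ?ih//; exact: itg_sum.
Qed.

Lemma int_le f g : Itg mu f -> Itg mu g -> (forall x, f x <= g x) ->
  \int[mu]_x f x <= \int[mu]_x g x.
Proof. by move=> *; apply: le_Rintegral. Qed.

Lemma int_abs_le f g : mfun_ f -> Itg mu g -> (forall x, `|f x| <= g x) ->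
  `|\int[mu]_x f x| <= \int[mu]_x g x.
Proof.
move=> mf ig fg; have if_ := itg_dominated mf ig fg.
apply: (le_trans (le_normr_Rintegral _ if_)) => //.
apply: int_le => //; apply: (itg_dominated _ ig).
  exact: measurableT_comp.
by move=> x; rewrite normr_id.
Qed.

Lemma int_dct (f_ : nat -> T -> R) f g :
  (forall n, mfun_ (f_ n)) -> Itg mu g ->
  (forall n x, `|f_ n x| <= g x) ->
  (forall x, f_ ^~ x @ \oo --> f x) ->
  Itg mu f /\ (\int[mu]_x f_ n x) @[n --> \oo] --> \int[mu]_x f x.
Proof.
move=> mf ig fg cf.
have mlim : mfun_ f by apply: (measurable_fun_cvg mf).
have h1 : {ae mu, forall x, setT x ->
    (fun n => (EFin \o f_ n) x) @ \oo --> (EFin \o f) x}.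
  apply: aeW => x _ /=; apply/fine_cvgP; split; last exact: cf.
  exact: nearW.
have h2 : {ae mu, forall x n, setT x -> (`|(EFin \o f_ n) x| <= (EFin \o g) x)%E}.
  by apply: aeW => x n _ /=; rewrite lee_fin.
have [itf _ ci] := @dominated_convergence _ _ _ mu setT measurableT
   (fun n => EFin \o f_ n) (EFin \o f) (EFin \o g)
   (fun n => (measurable_EFinP _ _).2 (mf n)) ((measurable_EFinP _ _).2 mlim)
   h1 ig h2.
split => //; move: ci.
have fin : (\int[mu]_x (EFin \o f) x)%E = (\int[mu]_x f x)%:E.
  by rewrite fineK//; exact: integrable_fin_num.
by rewrite fin => /fine_cvgP [].
Qed.

End integral_toolkit.

Section product_integrals.
Context d1 d2 (T1 : measurableType d1) (T2 : measurableType d2) (R : realType).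
Variables (m1 : {sigma_finite_measure set T1 -> \bar R})
          (m2 : {sigma_finite_measure set T2 -> \bar R}).

Lemma int_fubini (f : T1 * T2 -> R) : Itg (m1 \x m2)%E f ->
  \int[(m1 \x m2)%E]_z f z = fine (\int[m1]_x \int[m2]_y (f (x, y))%:E).
Proof. by move=> itf; rewrite /Rintegral -integral12_prod_meas1. Qed.

Lemma itg_prod (f : T1 -> R) (g : T2 -> R) : Itg m1 f -> Itg m2 g ->
  Itg (m1 \x m2)%E (fun z => f z.1 * g z.2) /\
  \int[(m1 \x m2)%E]_z (f z.1 * g z.2) = (\int[m1]_x f x) * (\int[m2]_y g y).
Proof.
move=> itf itg_.
have mf := itg_measurable itf; have mg := itg_measurable itg_.
have it : Itg (m1 \x m2)%E (fun z => f z.1 * g z.2).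
  apply/integrable12ltyP.
    apply/measurable_EFinP; apply: measurable_funM.
      by apply: (measurableT_comp mf); exact: measurable_fst.
    by apply: (measurableT_comp mg); exact: measurable_snd.
  rewrite (eq_integral (fun x => `|f x|%:E * (\int[m2]_y `|(EFin \o g) y|))%E); last first.
    move=> x _ /=.
    rewrite -ge0_integralZl_EFin//; last first.
      by apply/measurable_EFinP; exact: measurableT_comp.
    by apply: eq_integral => y _; rewrite /= normrM EFinM.
  have /integrableP[_ gfin] := itg_.
  have /integrableP[_ ffin] := itf.
  rewrite ge0_integralZr//; last 2 first.
    by apply/measurable_EFinP; exact: measurableT_comp.
    by apply: integral_ge0.
  apply: lte_mul_pinfty => //.
    exact: integral_ge0.
  rewrite ge0_fin_numE//; exact: integral_ge0.
split => //.
rewrite int_fubini//=.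
under eq_integral => x _.
  under eq_integral do rewrite EFinM.
  rewrite integralZl//.
  rewrite -[X in (_ * X)%E]fineK; last exact: integrable_fin_num.
  rewrite -EFinM.
  over.
rewrite -/(Rintegral _ _ _) RintegralZr//.
Qed.

End product_integrals.

(** * Sequence limits, pointwise derivatives and elementary inequalities *)

Section sequences_toolkit.
Context {R : realType}.
Implicit Types (u v w : nat -> R) (l : R).

Lemma cvgn_le u l : (forall e : R, 0 < e -> exists N : nat, forall n, (N <= n)%N -> `|u n - l| <= e) ->
  u @ \oo --> l.
Proof.
move=> h; apply/cvgrPdist_le => e e0; have [N hN] := h e e0.
by exists N => // n /= Nn; rewrite distrC; exact: hN.
Qed.

Lemma cvgn_dist u l : u @ \oo --> l ->
  forall e : R, 0 < e -> exists N : nat, forall n, (N <= n)%N -> `|u n - l| <= e.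
Proof.
move=> /cvgrPdist_le h e e0; have [N _ hN] := h e e0.
by exists N => n Nn; rewrite distrC; exact: hN.
Qed.

Lemma cvgn_eq N u v l : (forall n, (N <= n)%N -> u n = v n) ->
  v @ \oo --> l -> u @ \oo --> l.
Proof.
move=> uv /cvgn_dist h; apply: cvgn_le => e /h[M hM].
exists (maxn N M) => n; rewrite geq_max => /andP[Nn Mn].
by rewrite uv//; exact: hM.
Qed.

Lemma cvgn_cst N u l : (forall n, (N <= n)%N -> u n = l) -> u @ \oo --> l.
Proof. by move=> h; apply: (cvgn_eq h); exact: cvg_cst. Qed.

Lemma cvgn_squeeze0 N u w : (forall n, (N <= n)%N -> `|u n| <= w n) ->
  w @ \oo --> (0 : R) -> u @ \oo --> (0 : R).
Proof.
move=> uw /cvgn_dist h; apply: cvgn_le => e /h[M hM].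
exists (maxn N M) => n; rewrite geq_max => /andP[Nn Mn].
rewrite subr0 (le_trans (uw _ Nn))//; have := hM n Mn; rewrite subr0.
exact: le_trans (ler_norm _).
Qed.

Lemma cvgn_ge N u l (c : R) : (forall n, (N <= n)%N -> c <= u n) ->
  u @ \oo --> l -> c <= l.
Proof.
move=> h /cvgn_dist cv; rewrite leNgt; apply/negP => lc.
have [|M hM] := cv ((c - l) / 2); first by rewrite divr_gt0// subr_gt0.
have := hM _ (leq_maxr N M); have := h _ (leq_maxl N M).
by rewrite ler_norml => h1 /andP[_ h2]; lra.
Qed.

Lemma cvgn_leq N u l (c : R) : (forall n, (N <= n)%N -> u n <= c) ->
  u @ \oo --> l -> l <= c.
Proof.
move=> h /cvgN cv; rewrite -lerN2; apply: (@cvgn_ge N (fun n => - u n)) => //.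
by move=> n Nn; rewrite lerN2 h.
Qed.

End sequences_toolkit.

Section pointwise_derivatives.
Context {R : realType}.
Implicit Types (f g : R -> R) (x a b : R).

Lemma derD f g x a b : is_derive x 1 f a -> is_derive x 1 g b ->
  is_derive x 1 (fun y => f y + g y) (a + b).
Proof. exact: is_deriveD. Qed.

Lemma derN f x a : is_derive x 1 f a -> is_derive x 1 (fun y => - f y) (- a).
Proof. exact: is_deriveN. Qed.

Lemma derM f g x a b : is_derive x 1 f a -> is_derive x 1 g b ->
  is_derive x 1 (fun y => f y * g y) (f x * b + g x * a).
Proof. exact: is_deriveM. Qed.

Lemma der_cst c x : is_derive x 1 (fun=> c : R) 0.
Proof. exact: is_derive_cst. Qed.

Lemma der_id x : is_derive x 1 (fun y : R => y) 1.
Proof. exact: is_derive_id. Qed.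

Lemma derX f n x a : is_derive x 1 f a ->
  is_derive x 1 (fun y => f y ^+ n) (n%:R * f x ^+ n.-1 * a).
Proof. by move=> fa; have := is_deriveX n fa; rewrite exprfctE. Qed.

Lemma der_comp (h dh : R -> R) f x a : (forall y : R, is_derive y (1 : R) h (dh y)) ->
  is_derive x 1 f a -> is_derive x 1 (fun y => h (f y)) (a * dh (f x)).
Proof.
move=> hd fd; have := @is_derive1_comp _ h f x (dh (f x)) a (hd _) fd.
by rewrite mulrC. Qed.

Lemma der_expR f x a : is_derive x 1 f a ->
  is_derive x 1 (fun y => expR (f y)) (a * expR (f x)).
Proof. by move=> fd; apply: der_comp. Qed.

Lemma der_cos f x a : is_derive x 1 f a ->
  is_derive x 1 (fun y => cos (f y)) (a * - sin (f x)).
Proof. by move=> fd; apply: (der_comp (h := cos)). Qed.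

Lemma der_sin f x a : is_derive x 1 f a ->
  is_derive x 1 (fun y => sin (f y)) (a * cos (f x)).
Proof. by move=> fd; apply: (der_comp (h := sin)). Qed.

Lemma der_eq f x a b : is_derive x 1 f a -> a = b -> is_derive x 1 f b.
Proof. by move=> ? <-. Qed.

End pointwise_derivatives.

(** Builds the derivative along the syntax of the function and leaves the equation between the
    expression found and the one claimed. *)
Ltac der := notypeclasses refine (der_eq _ _); first by
  repeat (first [notypeclasses refine (der_cst _ _) | notypeclasses refine (der_id _) | notypeclasses refine (derD _ _)
  | notypeclasses refine (derN _) | notypeclasses refine (derX _ _) | notypeclasses refine (der_expR _)
  | notypeclasses refine (der_cos _) | notypeclasses refine (der_sin _) | notypeclasses refine (derM _ _)]).

Section real_inequalities.
Context {R : realType}.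
Implicit Types x y u v : R.

Lemma is_derive_continuous (f : R -> R) (df : R -> R) :
  (forall x, is_derive x 1 f (df x)) -> continuous f.
Proof.
move=> d x; apply: differentiable_continuous; apply/derivable1_diffP.
by have [] := d x.
Qed.

Lemma ge0_derive_ge (f df : R -> R) : (forall x, is_derive x 1 f (df x)) ->
  (forall x, 0 <= x -> 0 <= df x) -> forall x, 0 <= x -> f 0 <= f x.
Proof.
move=> d df0 x; rewrite le_eqVlt => /orP[/eqP <- //|x0].
have [c /[!in_itv]/= /andP[c0 cx] e] := @MVT R f df 0 x x0
  (fun y _ => d y) (continuous_subspaceT (is_derive_continuous d)).
by rewrite -subr_ge0 e subr0 mulr_ge0 ?df0 // ltW.
Qed.

Lemma sin_le_id x : 0 <= x -> sin x <= x.
Proof.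
move=> x0; suff : (fun x => x - sin x) 0 <= (fun x => x - sin x) x.
  by rewrite /= sin0 subr0 subr_ge0.
by apply: (@ge0_derive_ge (fun x => x - sin x) (fun x => 1 - cos x)) => // y _; rewrite subr_ge0 cos_le1.
Qed.

Lemma norm_sin_le x : `|sin x| <= `|x|.
Proof.
wlog x0 : x / 0 <= x => [h|].
  have [/h//|/ltW] := leP 0 x; rewrite -oppr_ge0 => /h.
  by rewrite sinN !normrN.
have [x1|x1] := leP x (pi / 2).
  rewrite ger0_norm ?ger0_norm ?sin_le_id// sin_ge0_pi// x0/=.
  by rewrite (le_trans x1)// ler_pdivrMr// ler_peMr ?pi_ge0// ler1n.
apply: (le_trans (sin_max x)); rewrite ger0_norm//.
by apply: le_trans (ltW x1); exact: pihalf_ge1.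
Qed.

Lemma cos_ge_sqr x : 1 - x ^+ 2 / 2 <= cos x.
Proof.
wlog x0 : x / 0 <= x => [h|].
  have [/h//|/ltW] := leP 0 x; rewrite -oppr_ge0 => /h.
  by rewrite cosN sqrrN.
suff : (fun x => cos x + x ^+ 2 / 2) 0 <= (fun x => cos x + x ^+ 2 / 2) x.
  by rewrite /= cos0 expr0n/= mul0r addr0 lerBlDr.
apply: (@ge0_derive_ge (fun x => cos x + x ^+ 2 / 2) (fun x => - sin x + x)) => // [y|y y0].
  by der; rewrite /=; field.
by rewrite addrC subr_ge0 sin_le_id.
Qed.

Lemma sin_ge_cub x : 0 <= x -> x - x ^+ 3 / 6 <= sin x.
Proof.
move=> x0.
suff : (fun x => sin x + x ^+ 3 / 6 - x) 0 <= (fun x => sin x + x ^+ 3 / 6 - x) x.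
  by rewrite /= sin0 expr0n/= mul0r addr0 subr0; lra.
apply: (@ge0_derive_ge (fun x => sin x + x ^+ 3 / 6 - x) (fun x => cos x + x ^+ 2 / 2 - 1)) => // [y|y y0].
  by der; rewrite /=; field.
by have := cos_ge_sqr y; lra.
Qed.

Lemma sin_sub_le x : `|sin x - x| <= `|x| ^+ 3 / 6.
Proof.
wlog x0 : x / 0 <= x => [h|].
  have [/h//|/ltW] := leP 0 x; rewrite -oppr_ge0 => /h.
  by rewrite sinN -opprD !normrN.
rewrite (ger0_norm x0) distrC ger0_norm ?subr_ge0 ?sin_le_id//.
by have := sin_ge_cub x0; lra.
Qed.

(** The cubic bound settles [|x| <= 2], and beyond it [1 + |x| <= x ^ 2]. A bound by a square on the
    whole line is what a finite second moment can dominate. *)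
Lemma sin_sub_le2 x : `|sin x - x| <= x ^+ 2.
Proof.
have [x2|x2] := leP `|x| 2.
  apply: (le_trans (sin_sub_le x)); rewrite -(real_normK (num_real x)).
  rewrite exprS mulrAC ler_piMl ?sqr_ge0//; lra.
rewrite -(real_normK (num_real x)).
apply: (le_trans (ler_normB _ _)); have := sin_max x.
by nra.
Qed.

Lemma onem_cos_le x : 1 - cos x <= x ^+ 2 / 2.
Proof. by have := cos_ge_sqr x; lra. Qed.

(** Half-angle formula with [sin y >= y / 3] for [0 <= y <= 2], which follows from [y - y ^ 3 / 6];
    then [2 * (x / 6) ^ 2 = x ^ 2 / 18]. *)
Lemma onem_cos_ge x : `|x| <= pi -> x ^+ 2 / 18 <= 1 - cos x.
Proof.
wlog x0 : x / 0 <= x => [h|].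
  have [/h//|/ltW] := leP 0 x; rewrite -oppr_ge0 => /h.
  by rewrite cosN sqrrN normrN.
rewrite ger0_norm// => xpi.
have h2 : (x / 2) *+ 2 = x by rewrite -mulr_natr; field.
rewrite -h2 cos_mulr2n cos2sin2 h2.
have xl : x / 2 <= 2 by have := @pihalf_lt2 R; lra.
have := @sin_ge_cub (x/2); rewrite divr_ge0// => /(_ isT).
set s := sin _; set y := x / 2 => h.
have y0 : 0 <= y by rewrite divr_ge0.
have : y / 3 <= s.
  apply: le_trans h; rewrite -subr_ge0.
  have -> : y - y ^+ 3 / 6 - y / 3 = y * (4 - y ^+ 2) / 6 by field.
  rewrite divr_ge0// mulr_ge0// subr_ge0.
  have -> : (4 : R) = 2 ^+ 2 by rewrite -natrX.
  by rewrite ler_sqr// nnegrE.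
move=> ys; have : (y / 3) ^+ 2 <= s ^+ 2.
  by rewrite ler_sqr// nnegrE ?(le_trans _ ys)// divr_ge0.
have -> : x = y * 2 by rewrite /y; field.
have -> : 1 - ((1 - s ^+ 2) *+ 2 - 1) = 2 * s ^+ 2 by ring.
have -> : (y * 2) ^+ 2 / 18 = 2 * (y / 3) ^+ 2 by field.
by move=> ?; rewrite ler_pM2l.
Qed.

Lemma onem_cos_ge0 x : 0 <= 1 - cos x. Proof. by rewrite subr_ge0 cos_le1. Qed.

(** Since [1 - cos w] is half of [|1 - e^(iw)| ^ 2], this is the parallelogram identity for the
    vectors [1 - e^(iu)] and [e^(iu) * (1 - e^(iv))], whose sum is [1 - e^(i(u + v))]; the two
    squares in [e] form the discarded term. *)
Lemma onem_cosD u v : 1 - cos (u + v) <= 2 * (1 - cos u) + 2 * (1 - cos v).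
Proof.
rewrite cosD; have := cos2Dsin2 u; have := cos2Dsin2 v.
set cu := cos u; set su := sin u; set cv := cos v; set sv := sin v => ev eu.
have h1 := sqr_ge0 (1 - cu - (cu - cu * cv + su * sv)).
have h2 := sqr_ge0 (- su - (su - su * cv - cu * sv)).
have e : (1 - cu - (cu - cu * cv + su * sv)) ^+ 2 +
  (- su - (su - su * cv - cu * sv)) ^+ 2 =
  2 * (2 * (1 - cu) + 2 * (1 - cv) - (1 - (cu * cv - su * sv))).
  have -> : (1 - cu - (cu - cu * cv + su * sv)) ^+ 2 +
    (- su - (su - su * cv - cu * sv)) ^+ 2 = 1 - 2 * (cu * 2 - cu * cv + su * sv)
     + (cu ^+ 2 + su ^+ 2) * (4 - 4 * cv + (cv ^+ 2 + sv ^+ 2)) by ring.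
  by rewrite ev eu; ring.
by lra.
Qed.

Lemma onem_cosB u v : 1 - cos (u - v) <= 2 * (1 - cos u) + 2 * (1 - cos v).
Proof. by have := onem_cosD u (- v); rewrite cosN. Qed.

Lemma expR_ge_pow (k : nat) x : 0 <= x -> (x / k.+1%:R) ^+ k.+1 <= expR x.
Proof.
move=> x0; have {2}-> : x = k.+1%:R * (x / k.+1%:R).
  by rewrite mulrCA divff ?mulr1// pnatr_eq0.
rewrite expRM_natl lerXn2r ?nnegrE ?expR_ge0//.
  by rewrite divr_ge0.
by apply: le_trans (expR_ge1Dx _); rewrite lerDr.
Qed.

Lemma expRN_le_inv x : 0 <= x -> expR (- x) <= (1 + x)^-1.
Proof.
by move=> x0; rewrite expRN lef_pV2 ?posrE ?expR_gt0 ?expR_ge1Dx//; lra.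
Qed.

End real_inequalities.

(** * Lebesgue integrals on the line and Gaussian integrals *)

Section lebesgue_line.
Context {R : realType}.
Notation leb := (@lebesgue_measure R).
Implicit Types (f F : R -> R) (a b c x : R).

Lemma cont_mfun f : continuous f -> mfun_ f.
Proof. exact: continuous_measurable_fun. Qed.

Lemma int_itv_FTC f F a b : a < b -> continuous f ->
  (forall x, is_derive x 1 F (f x)) -> \int[leb]_(x in `[a, b]) f x = F b - F a.
Proof.
move=> ab cf dF; have cF := is_derive_continuous dF.
rewrite /Rintegral (@continuous_FTC2 _ f F)//.
- exact: continuous_subspaceT.
- split.
  + by move=> x _; have [] := dF x.
  + by apply: cvg_at_right_filter; exact: cF.
  + by apply: cvg_at_left_filter; exact: cF.
- by move=> x _; rewrite derive1E; have [] := dF x.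
Qed.

Definition box c x : R := indic `[- c, c]%classic x.

Lemma boxE c x : box c x = ((`|x| <= c)%R : nat)%:R.
Proof. by rewrite /box indicE mem_setE in_itv/= ler_norml. Qed.

Lemma box_measurable c : mfun_ (box c).
Proof. exact: measurable_indic. Qed.

Lemma box_itg c f : continuous f -> Itg leb (fun x => box c x * f x).
Proof.
move=> cf; apply: (@eq_integrable _ _ _ leb setT measurableT (EFin \o (f \_ `[- c, c]%classic))) => //.
  move=> x _; rewrite /= patchE /box indicE; case: ifPn => _; by rewrite ?mul1r ?mul0r.
rewrite -restrict_EFin; apply/integrable_restrict => //=; rewrite setTI.
apply: continuous_compact_integrable; first exact: segment_compact.
exact: continuous_subspaceT.
Qed.

Lemma int_box c f : \int[leb]_x (box c x * f x) = \int[leb]_(x in `[- c, c]) f x.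
Proof.
rewrite [RHS]Rintegral_mkcond; apply: eq_Rintegral => x _.
by rewrite patchE /box indicE; case: ifPn => _; rewrite ?mul1r ?mul0r.
Qed.

Lemma int_derive_eq0 f F : Itg leb f -> continuous f ->
  (forall x, is_derive x 1 F (f x)) ->
  F n%:R @[n --> \oo] --> (0 : R) -> F (- n%:R) @[n --> \oo] --> (0 : R) ->
  \int[leb]_x f x = 0.
Proof.
move=> itf cf dF F1 F2.
have h1 n x : `|box n%:R x * f x| <= `|f x|.
  by rewrite normrM ler_piMl// boxE; case: (`|x| <= _)%R; rewrite ?normr1 ?normr0.
have h2 x : box n%:R x * f x @[n --> \oo] --> f x.
  apply: (@cvgn_cst _ (Num.Def.truncn `|x|).+1) => n xn.
  rewrite boxE (_ : (`|x| <= _)%R = true) ?mul1r//.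
  by rewrite ltW// (lt_le_trans (truncnS_gt _))// ler_nat.
have [_ c1] := @int_dct _ _ R leb _ _ _ (fun n => measurable_funM (box_measurable n%:R) (cont_mfun cf))
  (integrable_norm itf) h1 h2.
have c2 : F n%:R - F (- n%:R) @[n --> \oo] --> (0 : R).
  by rewrite -[0 : R]subr0; apply: cvgB.
apply: (cvg_unique _ c1) => //; apply: cvgn_eq c2 => n n0.
by rewrite int_box (int_itv_FTC _ cf dF)// gtrN// ltr0n; exact: n0.
Qed.

Lemma gaussian_int a m : 0 < a ->
  Itg leb (fun x => expR (- (a * (x - m) ^+ 2))) /\
  \int[leb]_x expR (- (a * (x - m) ^+ 2)) = Num.sqrt (pi / a).
Proof.
(* With this standard deviation the integrand is a multiple of the normal density, whose total mass
   is 1. *)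
move=> a0; pose s := Num.sqrt ((2 * a)^-1).
have s2 : s ^+ 2 = (2 * a)^-1 by rewrite sqr_sqrtr// invr_ge0 mulr_ge0// ltW.
have s0 : s != 0 by rewrite sqrtr_eq0 -ltNge invr_gt0 mulr_gt0.
have a_n0 : a != 0 by rewrite gt_eqF.
pose K := Num.sqrt (pi / a).
have K0 : K != 0 by rewrite sqrtr_eq0 -ltNge divr_gt0// pi_gt0.
have E x : expR (- (a * (x - m) ^+ 2)) = K * normal_pdf m s x.
  rewrite normal_pdfE//= /normal_peak /normal_fun s2.
  have -> : (2 * a)^-1 * pi *+ 2 = pi / a.
    by rewrite -mulr_natr; field.
  set V := (X in _ = _ * (X^-1 * _)); have -> : V = K by [].
  rewrite mulrA mulfV// mul1r; congr expR.
  by rewrite -[(2 * a)^-1 *+ 2]mulr_natr; field.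
have i0 := integrable_normal_pdf m s.
have -> : (fun x => expR (- (a * (x - m) ^+ 2))) = (fun x => K * normal_pdf m s x).
  by apply/funext.
split; first exact: (itgZ K i0).
rewrite (intZ K i0) /Rintegral integral_normal_pdf /=.
by rewrite mulr1.
Qed.

Lemma itg_inv1Dsqr : Itg leb (fun x => (1 + x ^+ 2)^-1).
Proof.
have pos x : 0 < 1 + x ^+ 2 by rewrite ltr_pwDl// sqr_ge0.
have cf : continuous (fun x : R => (1 + x ^+ 2)^-1).
  move=> x; apply: cvgV; first by rewrite gt_eqF.
  by apply: cvgD; [exact: cvg_cst|exact: exprn_continuous].
apply/integrableP; split; first by apply/measurable_EFinP; exact: cont_mfun.
under eq_integral => x _ do rewrite /= ger0_norm ?invr_ge0 ?ltW//.
rewrite ge0_symfun_integralT//.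
- have -> : [set x : R | 0 <= x] = `[0, +oo[%classic.
    by apply/seteqP; split => x /=; rewrite in_itv/= andbT.
  rewrite (@ge0_continuous_FTC2y R _ (@atan R) 0 (pi / 2)).
  + by rewrite -EFinB -EFinM ltry.
  + by move=> x _; rewrite invr_ge0 ltW.
  + exact: continuous_subspaceT.
  + exact: cvgy_atan.
  + by move=> x _; exact: derivable_atan.
  + by apply: cvg_at_right_filter; exact: continuous_atan.
  + by move=> x _; rewrite derive1_atan.
- by move=> x; rewrite invr_ge0 ltW.
- by move=> x /=; rewrite sqrrN.
Qed.

End lebesgue_line.

(** * Fourier analysis on rescaled periods and of the Gaussian *)

Section fourier_line.
Context {R : realType}.
Notation leb := (@lebesgue_measure R).
Notation leb2 := (leb \x leb)%E.
Implicit Types (a b x y : R).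

Lemma sin_pi_int (k : int) : sin (pi * k%:~R) = 0 :> R.
Proof.
have h (n : nat) : sin (pi * n%:R) = 0 :> R.
  elim: n => [|n ih]; first by rewrite mulr0 sin0.
  by rewrite -natr1 mulrDr mulr1 sinDpi ih oppr0.
case: k => n; first exact: h.
by rewrite NegzE mulrNz mulrN sinN h oppr0.
Qed.

Lemma invn_cvg0 : (n%:R : R)^-1 @[n --> \oo] --> (0 : R).
Proof.
apply: cvgn_le => e e0; exists (Num.Def.truncn e^-1).+1 => n en.
have n0 : (0 : R) < n%:R by rewrite ltr0n; exact: leq_trans en.
rewrite subr0 ger0_norm; last by rewrite invr_ge0 ltW.
rewrite -[leRHS]invrK lef_pV2 ?posrE ?invr_gt0// ltW//.
by rewrite (lt_le_trans (truncnS_gt _))// ler_nat.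
Qed.

(** Orthogonality of characters on a period stretched by [a]. The scales used later are [sqrt n] for
    the end point and [n * sqrt n] for the area. *)
Lemma int_box_cos a (k : int) : 0 < a ->
  \int[leb]_x (box (pi * a) x * cos (x * (k%:~R / a))) = 2 * pi * a * (k == 0)%:R.
Proof.
move=> a0; have pa : 0 < pi * a by rewrite mulr_gt0 ?pi_gt0.
rewrite int_box; have [->|k0] := eqVneq k 0.
  under eq_Rintegral => x _ do rewrite mulr0z mul0r mulr0 cos0.
  rewrite mulr1 (@int_itv_FTC _ (fun=> 1) id).
  - by ring.
  - by rewrite gtrN.
  - by move=> x; exact: cvg_cst.
have k0' : (k%:~R : R) != 0 by rewrite intr_eq0.
have dF x : is_derive x 1 (fun x => (a / k%:~R) * sin (x * (k%:~R / a)))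
   (cos (x * (k%:~R / a))).
  by der; rewrite /=; field; rewrite k0' gt_eqF.
have cf : continuous (fun x => cos (x * (k%:~R / a))).
  apply: (@is_derive_continuous _ _ (fun x => - ((k%:~R / a) * sin (x * (k%:~R / a))))) => x.
  by der; rewrite /=; ring.
rewrite mulr0 (int_itv_FTC _ cf dF) ?gtrN// mulNr sinN.
have -> : pi * a * (k%:~R / a) = pi * k%:~R by field; rewrite gt_eqF.
by rewrite sin_pi_int oppr0 !mulr0 subrr.
Qed.

Lemma int_box_sin a (k : int) : 0 < a ->
  \int[leb]_x (box (pi * a) x * sin (x * (k%:~R / a))) = 0.
Proof.
move=> a0; have pa : 0 < pi * a by rewrite mulr_gt0 ?pi_gt0.
have [->|k0] := eqVneq k 0.
  by under eq_Rintegral => x _ do rewrite mulr0z mul0r mulr0 sin0 mulr0; exact: int0.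
rewrite int_box.
have k0' : (k%:~R : R) != 0 by rewrite intr_eq0.
have dF x : is_derive x 1 (fun x => - ((a / k%:~R) * cos (x * (k%:~R / a))))
   (sin (x * (k%:~R / a))).
  by der; rewrite /=; field; rewrite k0' gt_eqF.
have cf : continuous (fun x => sin (x * (k%:~R / a))).
  apply: (@is_derive_continuous _ _ (fun x => ((k%:~R / a) * cos (x * (k%:~R / a))))) => x.
  by der; rewrite /=; ring.
by rewrite (int_itv_FTC _ cf dF) ?gtrN// mulNr cosN subrr.
Qed.

Lemma cont_cosM a : continuous (fun x => cos (x * a)).
Proof.
apply: (@is_derive_continuous _ _ (fun x => - (a * sin (x * a)))) => x.
by der; rewrite /=; ring.
Qed.

Lemma cont_sinM a : continuous (fun x => sin (x * a)).
Proof.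
apply: (@is_derive_continuous _ _ (fun x => a * cos (x * a))) => x.
by der; rewrite /=; ring.
Qed.

Arguments cont_cosM : clear implicits.
Arguments cont_sinM : clear implicits.

Definition box2 a b (z : R * R) : R := box a z.1 * box b z.2.

Lemma box2_cosE a b u v (z : R * R) : box2 a b z * cos (z.1 * u + z.2 * v) =
  (box a z.1 * cos (z.1 * u)) * (box b z.2 * cos (z.2 * v)) -
  (box a z.1 * sin (z.1 * u)) * (box b z.2 * sin (z.2 * v)).
Proof. by rewrite /box2 cosD; ring. Qed.

Lemma itg_box2_cos a b u v :
  Itg leb2 (fun z : R * R => box2 a b z * cos (z.1 * u + z.2 * v)).
Proof.
have [i1 e1] := itg_prod (box_itg a (cont_cosM u)) (box_itg b (cont_cosM v)).
have [i2 e2] := itg_prod (box_itg a (cont_sinM u)) (box_itg b (cont_sinM v)).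
have := itgB i1 i2; congr (is_true (integrable _ _ _)).
by apply/funext => z /=; rewrite box2_cosE.
Qed.

Lemma int_box2_cos a b (k l : int) : 0 < a -> 0 < b ->
  \int[leb2]_z (box2 (pi * a) (pi * b) z * cos (z.1 * (k%:~R / a) + z.2 * (l%:~R / b)))
  = 4 * pi ^+ 2 * a * b * ((k == 0) && (l == 0))%:R.
Proof.
move=> a0 b0.
have [i1 e1] := itg_prod (box_itg (pi * a) (cont_cosM (k%:~R / a)))
  (box_itg (pi * b) (cont_cosM (l%:~R / b))).
have [i2 e2] := itg_prod (box_itg (pi * a) (cont_sinM (k%:~R / a)))
  (box_itg (pi * b) (cont_sinM (l%:~R / b))).
under eq_Rintegral => z _ do rewrite box2_cosE.
rewrite (intB i1 i2) e1 e2 !int_box_cos// !int_box_sin// mul0r subr0.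
by case: eqP => _; case: eqP => _ /=; ring.
Qed.

(** Half of the exponent is spent on the factor [|x|]. The result dominates the derivative in the
    frequency uniformly, as differentiation under the integral requires. *)
Lemma norm_le_gauss a x : 0 < a ->
  `|x| * expR (- (a * x ^+ 2)) <= (1 + 2 / a) * expR (- (a / 2 * (x - 0) ^+ 2)).
Proof.
move=> a0; rewrite subr0.
have -> : - (a * x ^+ 2) = - (a / 2 * x ^+ 2) + - (a / 2 * x ^+ 2) by field.
rewrite expRD mulrA ler_wpM2r ?expR_ge0//.
have h : 0 <= a / 2 * x ^+ 2 by rewrite mulr_ge0 ?sqr_ge0// divr_ge0// ltW.
apply: (@le_trans _ _ (`|x| * (1 + a / 2 * x ^+ 2)^-1)).
  by rewrite ler_wpM2l// expRN_le_inv.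
rewrite ler_pdivrMr; last by lra.
have -> : (1 + 2 / a) * (1 + a / 2 * x ^+ 2) = 1 + 2 / a + a / 2 * x ^+ 2 + x ^+ 2.
  by field; rewrite gt_eqF.
have : 0 <= 2 / a by rewrite divr_ge0// ltW.
rewrite -(real_normK (num_real x)) in h *.
by have := sqr_ge0 (`|x| - 1); rewrite -/(_ ^+ 2) !expr2 in h *; nra.
Qed.

(** As a function of the frequency [c] the integral [F] solves [F' = - c / (2 * a) * F], so
    [F c * exp (c ^ 2 / (4 * a))] is constant and equals its value at 0. *)
Lemma gauss_cos a b : 0 < a ->
  Itg leb (fun x => expR (- (a * x ^+ 2)) * cos (x * b)) /\
  \int[leb]_x (expR (- (a * x ^+ 2)) * cos (x * b)) =
  Num.sqrt (pi / a) * expR (- (b ^+ 2 / (4 * a))).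
Proof.
move=> a0; have a2 : 0 < a / 2 by rewrite divr_gt0.
pose f b x := expR (- (a * x ^+ 2)) * cos (x * b).
have [ig eg] := gaussian_int 0 a0; have [ig2 _] := gaussian_int 0 a2.
have cE : continuous (fun x => expR (- (a * x ^+ 2))).
  apply: (@is_derive_continuous _ _ (fun x => - (2 * a * x) * expR (- (a * x ^+ 2)))) => x.
  by der; rewrite /=; ring.
have mE : mfun_ (fun x => expR (- (a * x ^+ 2))) by exact: cont_mfun.
have itf c : Itg leb (f c).
  apply: (itg_dominated _ ig); first exact: measurable_funM mE (cont_mfun (cont_cosM c)).
  by move=> x; rewrite subr0 normrM ger0_norm ?expR_ge0// ler_piMr ?expR_ge0 ?cos_max.
split; first exact: itf.
have df (c x : R) : is_derive c 1 (f ^~ x) (- (x * expR (- (a * x ^+ 2)) * sin (x * c))).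
  by der; rewrite /=; ring.
pose G x := (1 + 2 / a) * expR (- (a / 2 * (x - 0) ^+ 2)).
have G0 x : 0 <= G x.
  by rewrite mulr_ge0 ?expR_ge0// addr_ge0// divr_ge0// ltW.
have dom c x : `|- (x * expR (- (a * x ^+ 2)) * sin (x * c))| <= G x.
  rewrite normrN !normrM (ger0_norm (expR_ge0 _)).
  apply: le_trans (norm_le_gauss x a0).
  by apply: ler_piMr; rewrite ?sin_max// mulr_ge0// expR_ge0.
have iG := itgZ (1 + 2 / a) ig2.
pose F c := \int[leb]_x f c x.
have d1 c x : partial1of2 f c x = - (x * expR (- (a * x ^+ 2)) * sin (x * c)).
  by rewrite partial1of2E; have [] := df c x.
have itS c : Itg leb (fun x => x * expR (- (a * x ^+ 2)) * sin (x * c)).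
  apply: (itg_dominated _ iG).
    apply: measurable_funM; last exact: cont_mfun (cont_sinM c).
    exact: measurable_funM.
  by move=> x; rewrite -normrN dom.
(* Integration by parts: the derivative of [exp (- a x ^ 2) * sin (x * c)] has integral 0. *)
have parts c : \int[leb]_x (x * expR (- (a * x ^+ 2)) * sin (x * c)) = c / (2 * a) * F c.
  pose h x := - (2 * a) * (x * expR (- (a * x ^+ 2)) * sin (x * c)) + c * f c x.
  have dh (x : R) : is_derive x 1 (fun x => expR (- (a * x ^+ 2)) * sin (x * c)) (h x).
    by der; rewrite /h /f /=; ring.
  have lim0 (s : R) : s ^+ 2 = 1 ->
     expR (- (a * (s * n%:R) ^+ 2)) * sin (s * n%:R * c) @[n --> \oo] --> (0 : R).
    move=> s1; apply: (@cvgn_squeeze0 _ 1 _ (fun n => a^-1 * (n%:R)^-1)); last first.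
      by rewrite -[X in _ --> X](mulr0 a^-1); apply: cvgM; [exact: cvg_cst|exact: invn_cvg0].
    move=> n n1; have n0 : (0 : R) < n%:R by rewrite ltr0n.
    rewrite normrM ger0_norm ?expR_ge0// exprMn s1 mul1r.
    apply: (@le_trans _ _ (expR (- (a * n%:R ^+ 2)))).
      by rewrite ler_piMr ?expR_ge0 ?sin_max.
    apply: (le_trans (expRN_le_inv _)); first by rewrite mulr_ge0 ?sqr_ge0// ltW.
    rewrite -invfM lef_pV2 ?posrE; last 2 first.
      by rewrite ltr_pwDl// mulr_ge0 ?sqr_ge0// ltW.
      by rewrite mulr_gt0.
    apply: (@le_trans _ _ (a * n%:R ^+ 2)); last by rewrite lerDr.
    by rewrite ler_pM2l// expr2 ler_peMl// ler1n.
  have ith : Itg leb h by apply: itgD; [exact: itgZ|exact: itgZ].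
  have ch : continuous h.
    apply: (@is_derive_continuous _ _ (fun x => - (2 * a) * (expR (- (a * x ^+ 2)) * sin (x * c) +
      x * ((- (2 * a * x) * expR (- (a * x ^+ 2))) * sin (x * c) +
        expR (- (a * x ^+ 2)) * (c * cos (x * c))))
      + c * (- (2 * a * x) * expR (- (a * x ^+ 2)) * cos (x * c) -
          expR (- (a * x ^+ 2)) * (c * sin (x * c))))) => x.
    by der; rewrite /=; ring.
  have := int_derive_eq0 ith ch dh.
  have l1 : expR (- (a * n%:R ^+ 2)) * sin (n%:R * c) @[n --> \oo] --> (0 : R).
    have := lim0 1 (expr1n _ _); apply: (@cvgn_eq _ 0%N) => n _; by rewrite mul1r.
  have l2 : expR (- (a * (- n%:R) ^+ 2)) * sin ((- n%:R) * c) @[n --> \oo] --> (0 : R).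
    have := lim0 (-1) _; rewrite sqrrN expr1n => /(_ erefl).
    by apply: (@cvgn_eq _ 0%N) => n _; rewrite mulN1r.
  move=> /(_ l1 l2); rewrite /h (intD (itgZ _ (itS c)) (itgZ _ (itf c))).
  rewrite (intZ _ (itS c)) (intZ _ (itf c)) -/(F c) => e0.
  have a2' : 2 * a != 0 by rewrite gt_eqF// mulr_gt0.
  apply: (mulfI a2'); rewrite (_ : 2 * a * (c / (2 * a) * F c) = c * F c).
    by move: e0; lra.
  by field; rewrite gt_eqF.
have dF (c : R) : is_derive c 1 F (- (c / (2 * a) * F c)).
  have Ic : [set` `](c - 1), (c + 1)[] c by rewrite /= in_itv/=; lra.
  have A1 x : [set` `](c - 1), (c + 1)[] x -> Itg leb (f x) by [].
  have A2 x y : [set` `](c - 1), (c + 1)[] x -> setT y -> derivable (f ^~ y) x 1.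
    by move=> _ _; have [] := df x y.
  have A3 x y : [set` `](c - 1), (c + 1)[] x -> setT y -> `|partial1of2 f x y| <= G y.
    by move=> _ _; rewrite d1 dom.
  have D := @derivable_under_integral R _ _ leb f setT measurableT c (c-1) (c+1) Ic A1 A2 G G0 iG A3.
  have V := @differentiation_under_integral R _ _ leb f setT measurableT c (c-1) (c+1) Ic A1 A2 G G0 iG A3.
  apply: DeriveDef; first exact: D.
  rewrite -derive1E V -parts.
  under eq_Rintegral => x _ do rewrite d1 -mulN1r.
  by rewrite (intZ _ (itS c)) mulN1r.
have dH (c : R) : is_derive c 1 (fun c => F c * expR (c ^+ 2 / (4 * a))) 0.
  have E1 := der_expR (derM (derX 2 (der_id c)) (der_cst (4 * a)^-1 c)).
  apply: (der_eq (derM (dF c) E1)).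
  by rewrite /=; field; rewrite gt_eqF.
have := @is_derive_0_is_cst _ _ b 0 dH.
rewrite expr0n/= mul0r expR0 mulr1.
have -> : F 0 = Num.sqrt (pi / a).
  rewrite -eg; apply: eq_Rintegral => x _.
  by rewrite /f mulr0 cos0 mulr1 subr0.
move=> <-; rewrite -mulrA -expRD subrr expR0 mulr1//.
Qed.

End fourier_line.

(** * Gaussian integrals in the plane and the common integrable majorant *)

Section gaussian_plane.
Context {R : realType}.
Notation leb := (@lebesgue_measure R).
Notation leb2 := (leb \x leb)%E.

(** Completing the square in [z.1] leaves the Schur complement [V = ga - be ^ 2 / al] in [z.2]. Only
    [z.2] carries a phase: a bounded end point is negligible at the scale [sqrt n], so the area
    alone is displaced. *)
Lemma gaussian_plane (al be ga : R) : 0 < al -> 0 < al * ga - be ^+ 2 ->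
  exists G0 V : R, [/\ 0 < G0, 0 < V & forall b,
  Itg leb2 (fun z : R * R => expR (- ((al * z.1 ^+ 2 + 2 * be * z.1 * z.2 + ga * z.2 ^+ 2) / 2))
     * cos (z.2 * b)) /\
  \int[leb2]_z (expR (- ((al * z.1 ^+ 2 + 2 * be * z.1 * z.2 + ga * z.2 ^+ 2) / 2))
     * cos (z.2 * b)) = G0 * expR (- (b ^+ 2 / (2 * V)))].
Proof.
move=> al0 D0; pose V := ga - be ^+ 2 / al.
have V0 : 0 < V.
  by rewrite /V subr_gt0 ltr_pdivrMr// mulrC -subr_gt0.
have a0 : 0 < al / 2 by rewrite divr_gt0.
have v0 : 0 < V / 2 by rewrite divr_gt0.
exists (Num.sqrt (pi / (al / 2)) * Num.sqrt (pi / (V / 2))), V; split => //.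
  by rewrite mulr_gt0// sqrtr_gt0 divr_gt0// pi_gt0.
move=> b; pose m t := - (be / al) * t.
pose h t := expR (- (V / 2 * t ^+ 2)) * cos (t * b).
pose F (z : R * R) := expR (- (al / 2 * (z.1 - m z.2) ^+ 2)) * h z.2.
have -> : (fun z : R * R => expR (- ((al * z.1 ^+ 2 + 2 * be * z.1 * z.2 + ga * z.2 ^+ 2) / 2))
     * cos (z.2 * b)) = F.
  apply/funext => -[x y]; rewrite /F /h /= mulrA -expRD; congr (expR _ * _).
  by rewrite /V /m; field; rewrite gt_eqF.
have [ih eh] := gauss_cos b v0.
have m1 : mfun_ (fun z : R * R => z.1) by exact: measurable_fst.
have m2 : mfun_ (fun z : R * R => z.2) by exact: measurable_snd.
have mF : mfun_ F.
  apply: measurable_funM; last by apply: (measurableT_comp (itg_measurable ih)).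
  apply: measurableT_comp => //; apply: measurableT_comp => //.
  apply: measurable_funM => //; apply: measurable_funX; apply: measurable_funB => //.
  exact: measurable_funM.
have inner y : (\int[leb]_x (F (x, y))%:E)%E = (Num.sqrt (pi / (al / 2)) * h y)%:E.
  have [ig eg] := gaussian_int (m y) a0.
  rewrite /F /=; under eq_integral => x _ do rewrite mulrC EFinM.
  rewrite integralZl//.
  rewrite -[X in (_ * X)%E]fineK; last exact: integrable_fin_num.
  by rewrite -/(Rintegral _ _ _) eg -EFinM mulrC.
have inner2 y : (\int[leb]_x `|(F (x, y))%:E|)%E = (Num.sqrt (pi / (al / 2)) * `|h y|)%:E.
  have [ig eg] := gaussian_int (m y) a0.
  rewrite /F /=; under eq_integral => x _ do rewrite normrM (ger0_norm (expR_ge0 _)) mulrC EFinM.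
  rewrite integralZl//.
  rewrite -[X in (_ * X)%E]fineK; last exact: integrable_fin_num.
  by rewrite -/(Rintegral _ _ _) eg -EFinM mulrC.
have iF : Itg leb2 F.
  apply/integrable21ltyP; first exact/measurable_EFinP.
  under eq_integral => y _ do rewrite inner2.
  have /(itgZ (Num.sqrt (pi / (al / 2)))) ihn := integrable_norm ih.
  have /integrableP[_] := ihn.
  by under eq_integral => y _ do rewrite /= ger0_norm ?mulr_ge0 ?sqrtr_ge0//.
split=> //.
rewrite {1}/Rintegral -integral21_prod_meas1// /fubini_G.
under eq_integral => y _ do rewrite inner.
rewrite -/(Rintegral leb setT (fun y => _ * h y)) intZ// eh [LHS]mulrA.
by congr (_ * expR _); field; rewrite gt_eqF.
Qed.

(** One integrable function that, up to constants, dominates all rescaled Fourier integrands and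
    their Gaussian limit. *)
Definition invquad (z : R * R) : R := (1 + z.1 ^+ 2)^-1 * (1 + z.2 ^+ 2)^-1.

Lemma itg_invquad : Itg leb2 invquad.
Proof. exact: (itg_prod (@itg_inv1Dsqr R) (@itg_inv1Dsqr R)).1. Qed.

Lemma invquad_ge0 z : 0 <= invquad z.
Proof. by rewrite mulr_ge0// invr_ge0 addr_ge0// sqr_ge0. Qed.

End gaussian_plane.

(** * Coercivity of sums of [1 - cos] along arithmetic progressions of phases *)

Section trigonometric_sums.
Context {R : realType}.
Implicit Types (s t : R).

Lemma cos_le0_mid (x : R) : pi / 2 <= x <= 3 * (pi / 2) -> cos x <= 0.
Proof.
move=> /andP[h1 h2]; rewrite -[x](subrK pi) cosDpi oppr_le0.
by apply: cos_ge0_pihalf; lra.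
Qed.

Lemma big_nat_shift_le (g : nat -> R) (a L k : nat) : (k <= L)%N -> (forall i, 0 <= g i) ->
  \sum_(a <= i < a + (L - k)) g (i + k)%N <= \sum_(a <= i < a + L) g i.
Proof.
move=> kL g0.
have -> : \sum_(a <= i < a + L) g i =
   \sum_(a <= i < a + k) g i + \sum_(a + k <= i < a + L) g i.
  by rewrite -big_cat_nat// ?leq_addr// leq_add2l.
by rewrite big_addn -addnBA// lerDr sumr_ge0.
Qed.

(** The phases at [i] and [i + k] differ by [t * k], so pairing each term with its shift eliminates
    [s]. The factor 4 is the 2 of [onem_cosB] for each of the two shifted sums. *)
Lemma onem_cos_sum_ge (s t : R) (a L k : nat) : (k <= L)%N ->
  (L - k)%:R * (1 - cos (t * k%:R)) <= 4 * \sum_(a <= i < a + L) (1 - cos (s + t * i%:R)).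
Proof.
move=> kL; pose g i := 1 - cos (s + t * i%:R : R).
have g0 i : 0 <= g i by exact: onem_cos_ge0.
have h1 := big_nat_shift_le a kL g0.
have h2 : \sum_(a <= i < a + (L - k)) g i <= \sum_(a <= i < a + L) g i.
  rewrite [X in _ <= X](@big_cat_nat _ _ _ (a + (L - k))%N)/=; last 2 first.
  - exact: leq_addr.
  - by rewrite leq_add2l leq_subr.
  by rewrite lerDl sumr_ge0.
have : \sum_(a <= i < a + (L - k)) (1 - cos (t * k%:R)) <=
   2 * \sum_(a <= i < a + (L - k)) g (i + k)%N + 2 * \sum_(a <= i < a + (L - k)) g i.
  rewrite !mulr_sumr -big_split/=; apply: ler_sum => i _.
  have -> : t * k%:R = (s + t * (i + k)%:R) - (s + t * i%:R).
    by rewrite natrD; ring.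
  exact: onem_cosB.
rewrite big_const_nat iter_addr_0 addKn -[_ *+ (L - k)]mulr_natl => h3.
by apply: (le_trans h3); move: h1 h2; set S := \sum_(a <= i < a + L) _; lra.
Qed.

(** If [t * K] stays below [pi], take [k = K]. Otherwise steps of length [t <= pi] cannot jump over
    the interval from [pi / 2] to [3 * pi / 2], where the cosine is at most 0; the first multiple of
    [t] beyond [pi / 2] lies in it. *)
Lemma exists_large_phase (t : R) (K : nat) : (2 <= K)%N -> `|t| <= pi ->
  exists2 k, (k <= K)%N & Num.min 1 ((t * K%:R) ^+ 2 / 18) <= 1 - cos (t * k%:R).
Proof.
move=> K2 tpi.
wlog t0 : t tpi / 0 <= t => [h|].
  have [/(h _ tpi)//|/ltW] := leP 0 t; rewrite -oppr_ge0 => /h.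
  rewrite normrN => /(_ tpi)[k kK]; rewrite !mulNr cosN sqrrN => e.
  by exists k.
have [tK|tK] := leP (t * K%:R) pi.
  exists K => //; rewrite (le_trans (y := (t * K%:R) ^+ 2 / 18)) ?ge_min ?lexx ?orbT//.
  by apply: onem_cos_ge; rewrite ger0_norm// mulr_ge0.
have K0 : (0 : R) < K%:R by rewrite ltr0n (leq_trans _ K2).
have tpos : 0 < t.
  rewrite lt0r t0 andbT; apply/eqP => t00; move: tK.
  by rewrite t00 mul0r ltNge pi_ge0.
have p0 := @pi_gt0 R.
pose k := (Num.Def.truncn (pi / 2 / t)).+1.
have k1 : pi / 2 / t < k%:R by exact: truncnS_gt.
have k2 : k%:R <= pi / 2 / t + 1.
  rewrite /k -natr1 lerD2r truncn_le// divr_ge0//; lra.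
have k3 : pi / 2 < t * k%:R by rewrite [t * _]mulrC -ltr_pdivrMr.
have k4 : t * k%:R <= pi / 2 + t.
  have -> : pi / 2 + t = t * (pi / 2 / t + 1) by field; rewrite gt_eqF.
  by rewrite ler_pM2l.
rewrite (ger0_norm t0) in tpi.
exists k.
  rewrite -(ler_nat R) (le_trans k2)//.
  have : pi / 2 / t <= K%:R / 2.
    by rewrite ler_pdivrMr//; move: tK; lra.
  have : (2 : R) <= K%:R by rewrite ler_nat.
  lra.
apply: (@le_trans _ _ 1); first by rewrite ge_min lexx.
rewrite lerDl oppr_ge0; apply: cos_le0_mid; rewrite (ltW k3)/=; lra.
Qed.

(** Shifts by at most [L / 2] bound [t] without reference to [s]; then [s] is recovered from each
    term as the difference of [s + t * i] and [t * i]. The minimum with [n] is unavoidable because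
    each summand is at most 2. *)
Lemma onem_cos_sum_coercive : exists2 c : R, 0 < c &
  forall (n a L : nat) s t, (a + L <= n)%N -> (n <= 5 * L)%N -> (6 <= L)%N ->
  `|s| <= pi -> `|t| <= pi ->
  c * Num.min n%:R (n%:R * s ^+ 2 + n%:R ^+ 3 * t ^+ 2) <=
  \sum_(a <= i < a + L) (1 - cos (s + t * i%:R)).
Proof.
(* From [n <= 15 * (L / 2)] comes [n ^ 2 t ^ 2 <= 225 (t * (L / 2)) ^ 2], and 18 is the constant of
   [onem_cos_ge]. *)
have [B B1 B2] : exists2 B : R, 1 <= B & 18 * 225 <= B.
  by exists (18 * 225); lra.
have B0 : 0 < B by lra.
(* At least [L - k >= n / 10] pairs are compared and [onem_cos_sum_ge] costs a factor 4, whence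
   40. *)
pose c1 : R := (40 * B)^-1.
have c10 : 0 < c1 by rewrite invr_gt0; lra.
have C0 : 0 < 180 + 91 / c1.
  by apply: addr_gt0 => //; apply: divr_gt0.
exists (180 + 91 / c1)^-1; first by rewrite invr_gt0.
move=> n a L s t aLn n5 L6 spi tpi.
set S := \sum_(_ <= i < _) _.
have S0 : 0 <= S by apply: sumr_ge0 => i _; exact: onem_cos_ge0.
have Ln : (L <= n)%N by apply: leq_trans aLn; exact: leq_addl.
have n0 : (0 : R) < n%:R by rewrite ltr0n; clear -L6 Ln; lia.
have nL : (n%:R : R) <= 5 * L%:R by rewrite -natrM ler_nat.
have LnR : (L%:R : R) <= n%:R by rewrite ler_nat.
pose T := n%:R ^+ 2 * t ^+ 2.
have T0 : 0 <= T by rewrite mulr_ge0// sqr_ge0.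
have e3 : n%:R ^+ 3 * t ^+ 2 = n%:R * T by rewrite /T; ring.
have K2 : (2 <= L./2)%N by clear -L6; lia.
have [k kK kh] := exists_large_phase K2 tpi.
have kL : (k <= L)%N by clear -kK; lia.
have st1 := onem_cos_sum_ge s t a kL; rewrite -/S in st1.
have hT : Num.min 1 T / B <= 1 - cos (t * k%:R).
  apply: le_trans kh; rewrite le_min; apply/andP; split.
    by rewrite ler_pdivrMr// mul1r (le_trans (y := 1))// ge_min lexx.
  apply: (@le_trans _ _ (T / B)).
    by rewrite ler_pM2r ?invr_gt0// ge_min lexx orbT.
  have hk : n%:R <= 15 * (L./2)%:R :> R.
    by rewrite -natrM ler_nat; clear -n5 L6; lia.
  have h : T <= 225 * (t * (L./2)%:R) ^+ 2.
    have -> : 225 * (t * (L./2)%:R) ^+ 2 = (15 * (L./2)%:R) ^+ 2 * t ^+ 2 :> R by ring.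
    by rewrite ler_wpM2r ?sqr_ge0// ler_sqr ?nnegrE ?mulr_ge0.
  rewrite ler_pdivrMr//; have := ler_wpM2l (sqr_ge0 (t * (L./2)%:R)) B2.
  by move: h; set u := (_ * _) ^+ 2; lra.
have st2 : c1 * (n%:R * Num.min 1 T) <= S.
  have m0 : 0 <= Num.min 1 T / B.
    by apply: divr_ge0; [rewrite le_min ler01 T0|exact: ltW].
  have h : n%:R / 10 * (Num.min 1 T / B) <= (L - k)%:R * (1 - cos (t * k%:R)).
    apply: ler_pM => //.
    by rewrite ler_pdivrMr// -natrM ler_nat; clear -kK n5 Ln; lia.
  have e : n%:R / 10 * (Num.min 1 T / B) = 4 * (c1 * (n%:R * Num.min 1 T)).
    by rewrite /c1; field; rewrite gt_eqF.
  by move: (le_trans h st1); rewrite e ler_pM2l.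
have st3 : n%:R * s ^+ 2 / 90 <= 2 * S + n%:R * T.
  have : \sum_(a <= i < a + L) (1 - cos s) <= \sum_(a <= i < a + L)
      (2 * (1 - cos (s + t * i%:R)) + T).
    apply: ler_sum_nat => i /andP[_ ia].
    have -> : s = (s + t * i%:R) - t * i%:R by ring.
    apply: (le_trans (onem_cosB _ _)); rewrite (_ : _ - _ + t * _ = s + t * i%:R); last by ring.
    rewrite lerD2l; have := onem_cos_le (t * i%:R).
    have : (t * i%:R) ^+ 2 <= T.
      rewrite exprMn /T mulrC ler_wpM2r ?sqr_ge0// ler_sqr ?nnegrE// ler_nat.
      by clear -ia aLn; lia.
    by set X := (_ ^+ 2); lra.
  rewrite [X in _ <= X]big_split/= -mulr_sumr -/S !big_const_nat !iter_addr_0 !addKn.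
  rewrite -[_ *+ L in X in X -> _]mulr_natl -[T *+ L]mulr_natl => h.
  have hs := onem_cos_ge spi.
  have s20 := sqr_ge0 s.
  have h1 : n%:R * s ^+ 2 / 90 <= L%:R * (1 - cos s).
    apply: (@le_trans _ _ (L%:R * (s ^+ 2 / 18))).
      by have := ler_wpM2r s20 nL; set w := s ^+ 2; lra.
    by rewrite ler_wpM2l.
  have h2 : L%:R * T <= n%:R * T by rewrite ler_wpM2r.
  by lra.
have E : S * (180 + 91 / c1) = 180 * S + 91 * (S / c1) by field; rewrite gt_eqF.
rewrite mulrC ler_pdivrMr// e3 E.
have [T1|T1] := leP 1 T.
  apply: (@le_trans _ _ n%:R); first by rewrite ge_min lexx.
  move: st2; rewrite min_l// mulr1 mulrC -ler_pdivlMr// => st2.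
  by move: st2 S0; set D := S / c1; lra.
apply: (@le_trans _ _ (n%:R * s ^+ 2 + n%:R * T)); first by rewrite ge_min lexx orbT.
move: st2; rewrite min_r; last exact: ltW.
rewrite mulrC -ler_pdivlMr//.
by move: st3; set D := S / c1; set X1 := n%:R * s ^+ 2; set X2 := n%:R * T; lra.
Qed.

(** If the minimum is [n], the box and [pi <= 4] make the product of the two quadratics at most
    [(17 n) * (17 n ^ 3) = 289 n ^ 4], which [exp (ka * n) >= (ka * n / 4) ^ 4] absorbs. Otherwise
    the exponential factors over the coordinates and each factor is at most [m / (1 + w)]. *)
Lemma expR_min_le_invquad (ka : R) : 0 < ka -> exists2 C : R, 0 < C &
  forall (n : nat) (x y : R), (0 < n)%N -> `|x| <= pi * Num.sqrt n%:R ->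
  `|y| <= pi * (n%:R * Num.sqrt n%:R) ->
  expR (- (ka * Num.min n%:R (x ^+ 2 + y ^+ 2))) <= C * invquad (x, y).
Proof.
move=> ka0.
pose m := Num.max 1 ka^-1; have m1 : 1 <= m by rewrite /m le_max lexx.
have mka : 1 <= m * ka by rewrite -ler_pdivrMr// mul1r /m le_max lexx orbT.
pose C1 := m ^+ 2; pose C2 := 289 * (4 / ka) ^+ 4.
have C10 : 0 < C1 by rewrite exprn_gt0// (lt_le_trans _ m1).
have C20 : 0 < C2 by rewrite mulr_gt0// exprn_gt0// divr_gt0.
exists (C1 + C2); first exact: addr_gt0.
move=> n x y n0 hx hy; rewrite /invquad /=.
have X0 : 0 <= x ^+ 2 by exact: sqr_ge0.
have Y0 : 0 <= y ^+ 2 by exact: sqr_ge0.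
rewrite -invfM ler_pdivlMr; last by rewrite mulr_gt0// ltr_pwDl.
have [h|h] := leP n%:R (x ^+ 2 + y ^+ 2).
  apply: (@le_trans _ _ C2); last by rewrite lerDr ltW.
  have nn0 : (0 : R) < n%:R by rewrite ltr0n.
  have p4 : (pi : R) <= 4 by have := @pihalf_lt2 R; lra.
  have sn : Num.sqrt n%:R ^+ 2 = n%:R :> R by rewrite sqr_sqrtr.
  have hx2 : x ^+ 2 <= 16 * n%:R.
    rewrite -(real_normK (num_real x)) -sn -[16](_ : 4 ^+ 2 = _); last by rewrite -natrX.
    rewrite -exprMn ler_sqr ?nnegrE ?mulr_ge0 ?sqrtr_ge0//.
    by apply: (le_trans hx); rewrite ler_wpM2r ?sqrtr_ge0.
  have hy2 : y ^+ 2 <= 16 * n%:R ^+ 3.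
    have -> : 16 * n%:R ^+ 3 = (4 * (n%:R * Num.sqrt n%:R)) ^+ 2 :> R.
      by rewrite !exprMn sn; ring.
    rewrite -(real_normK (num_real y)).
    rewrite ler_sqr ?nnegrE ?mulr_ge0 ?sqrtr_ge0//.
    by apply: (le_trans hy); rewrite ler_wpM2r ?mulr_ge0 ?sqrtr_ge0.
  have n1 : (1 : R) <= n%:R by rewrite ler1n.
  have n31 : (1 : R) <= n%:R ^+ 3 by rewrite exprn_ege1.
  have b1 : (1 + x ^+ 2) * (1 + y ^+ 2) <= 289 * n%:R ^+ 4.
    have -> : 289 * n%:R ^+ 4 = (17 * n%:R) * (17 * n%:R ^+ 3) :> R by ring.
    by apply: ler_pM; rewrite ?addr_ge0//; lra.
  have e1 := @expR_ge_pow R 3 (ka * n%:R) (mulr_ge0 (ltW ka0) (ltW nn0)).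
  rewrite expRN mulrC ler_pdivrMr ?expR_gt0//; apply: (le_trans b1).
  rewrite /C2 -mulrA ler_pM2l//.
  apply: (@le_trans _ _ ((4 / ka) ^+ 4 * (ka * n%:R / 4) ^+ 4)).
    by rewrite -exprMn (_ : 4 / ka * (ka * n%:R / 4) = n%:R)//; field; rewrite gt_eqF.
  by rewrite ler_wpM2l// exprn_ge0// divr_ge0// ltW.
apply: (@le_trans _ _ C1); last by rewrite lerDl ltW.
rewrite mulrDr opprD expRD /C1 expr2 mulrACA.
have hh (w : R) : 0 <= w -> expR (- (ka * w)) * (1 + w) <= m.
  move=> w0; have kw : 0 <= ka * w by rewrite mulr_ge0// ltW.
  apply: (@le_trans _ _ ((1 + ka * w)^-1 * (1 + w))).
    by rewrite ler_wpM2r ?expRN_le_inv//; lra.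
  rewrite mulrC ler_pdivrMr; last by lra.
  rewrite mulrDr mulr1 mulrA lerD// ler_peMl//.
by apply: ler_pM; rewrite ?mulr_ge0 ?expR_ge0 ?addr_ge0 ?hh.
Qed.

End trigonometric_sums.

(* Unit complex numbers and moduli of products *)
From mathcomp Require Import complex.

Notation nc := Normc.normc.

Section complex_toolkit.
Context {R : realType}.
Implicit Types (x y : R) (z w : R[i]).

Definition cis x : R[i] := Complex (cos x) (sin x).

Lemma cisD x y : cis (x + y) = cis x * cis y.
Proof. by rewrite /cis cosD sinD; congr Complex; rewrite addrC mulrC [X in _ + X]mulrC. Qed.

Lemma cis0 : cis 0 = 1.
Proof. by rewrite /cis cos0 sin0. Qed.

Lemma ncE z : nc z = Num.sqrt (complex.Re z ^+ 2 + complex.Im z ^+ 2).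
Proof. by case: z. Qed.

Lemma nc_cis x : nc (cis x) = 1.
Proof. by rewrite ncE /= cos2Dsin2 sqrtr1. Qed.

Lemma nc_ge0 z : 0 <= nc z. Proof. by rewrite ncE sqrtr_ge0. Qed.

Lemma ncD z w : nc (z + w) <= nc z + nc w. Proof. exact: le_normcD. Qed.

Lemma ncB z w : nc (z - w) <= nc z + nc w.
Proof. by apply: le_trans (ncD _ _) _; rewrite (normcN w). Qed.

Lemma ncM z w : nc (z * w) = nc z * nc w. Proof. exact: Normc.normcM. Qed.

Lemma ncBC z w : nc (z - w) = nc (w - z).
Proof. by rewrite -(normcN (z - w)); congr nc; exact: opprB. Qed.

Lemma nc_Re z : `|complex.Re z| <= nc z.
Proof. by rewrite ncE -sqrtr_sqr ler_wsqrtr// lerDl sqr_ge0. Qed.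

Lemma nc_Im z : `|complex.Im z| <= nc z.
Proof. by rewrite ncE -sqrtr_sqr ler_wsqrtr// lerDr sqr_ge0. Qed.

Lemma nc_le_ReIm z : nc z <= `|complex.Re z| + `|complex.Im z|.
Proof.
rewrite ncE -[leRHS]ger0_norm ?addr_ge0// -sqrtr_sqr ler_wsqrtr// sqrrD.
by rewrite !real_normK ?num_real// lerD2r lerDl mulrn_wge0// mulr_ge0.
Qed.

Lemma nc_real x : nc (x%:C)%C = `|x|.
Proof. by rewrite ncE /= expr0n addr0 sqrtr_sqr. Qed.

Lemma nc_prod (I : Type) (s : seq I) (f : I -> R[i]) :
  nc (\prod_(i <- s) f i) = \prod_(i <- s) nc (f i).
Proof.
elim: s => [|i s ih]; first by rewrite !big_nil Normc.normc1.
by rewrite !big_cons ncM ih.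
Qed.

Lemma nc_prod_le1 (I : Type) (s : seq I) (f : I -> R[i]) :
  (forall i, nc (f i) <= 1) -> nc (\prod_(i <- s) f i) <= 1.
Proof.
move=> h; elim: s => [|i s ih]; first by rewrite big_nil Normc.normc1.
by rewrite big_cons ncM mulr_ile1// ?nc_ge0.
Qed.

(** Telescoping: the factors are replaced one at a time while all the others have modulus at most
    1. *)
Lemma nc_prodB (I : eqType) (s : seq I) (f g : I -> R[i]) :
  (forall i, i \in s -> nc (f i) <= 1) -> (forall i, i \in s -> nc (g i) <= 1) ->
  nc (\prod_(i <- s) f i - \prod_(i <- s) g i) <= \sum_(i <- s) nc (f i - g i).
Proof.
elim: s => [|i s ih] fs gs; first by rewrite !big_nil subrr Normc.normc0.
rewrite !big_cons.
have fs' j : j \in s -> nc (f j) <= 1 by move=> js; rewrite fs// inE js orbT.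
have gs' j : j \in s -> nc (g j) <= 1 by move=> js; rewrite gs// inE js orbT.
have {ih fs' gs'} := ih fs' gs'.
have f1 : nc (f i) <= 1 by rewrite fs// inE eqxx.
have g1 : nc (\prod_(j <- s) g j) <= 1.
  have gs' j : j \in s -> nc (g j) <= 1 by move=> js; rewrite gs// inE js orbT.
  elim: s gs' {fs gs} => [|j s ih] gs; first by rewrite big_nil Normc.normc1.
  rewrite big_cons ncM mulr_ile1 ?nc_ge0 ?gs ?inE ?eqxx//.
  by apply: ih => k ks; rewrite gs// inE ks orbT.
move: (\prod_(j <- s) f j) (\prod_(j <- s) g j) g1 => p q q1 ih.
have -> : f i * p - g i * q = f i * (p - q) + (f i - g i) * q by ring.
apply: le_trans (ncD _ _) _; rewrite addrC lerD// ncM.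
  by rewrite ler_piMr ?nc_ge0.
by apply: le_trans ih; rewrite ler_piMl ?nc_ge0.
Qed.

Lemma Re_sum (I : Type) (s : seq I) (f : I -> R[i]) :
  complex.Re (\sum_(i <- s) f i) = \sum_(i <- s) complex.Re (f i).
Proof.
elim: s => [|i s ih]; first by rewrite !big_nil.
by rewrite !big_cons -ih; case: (f i) (\sum_(j <- s) f j) => ? ? [].
Qed.

Lemma Im_sum (I : Type) (s : seq I) (f : I -> R[i]) :
  complex.Im (\sum_(i <- s) f i) = \sum_(i <- s) complex.Im (f i).
Proof.
elim: s => [|i s ih]; first by rewrite !big_nil.
by rewrite !big_cons -ih; case: (f i) (\sum_(j <- s) f j) => ? ? [].
Qed.

Lemma Re_realM x z : complex.Re ((x%:C)%C * z) = x * complex.Re z.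
Proof. by case: z => a b /=; rewrite mul0r subr0. Qed.

Lemma Im_realM x z : complex.Im ((x%:C)%C * z) = x * complex.Im z.
Proof. by case: z => a b /=; rewrite mul0r addr0. Qed.

End complex_toolkit.

(** * Weighted finite sums over paths and the probability of violating positivity *)

Section path_sums.
Context {R : realType}.

(* Steps are cut off at |a| <= K, so that every expectation over paths below is
   a finite sum; K is sent to infinity only in the Fourier transforms. *)
Definition step_sum (V : zmodType) (K : nat) (h : int -> V) : V :=
  \sum_(k < K.*2.+1) h (k%:Z - K%:Z).

(** The list gives the indices of the successive steps in reading order, so time reversal is [rev]
    on the list. The weights are mostly sub-probabilities, because of the cut-off; with weights 1
    this is a plain sum over paths. *)
Fixpoint path_sum (wt : nat -> int -> R) (K : nat) (l : seq nat)
    (F : seq int -> R) : R :=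
  if l is i :: l' then
    step_sum K (fun a => wt i a * path_sum wt K l' (fun b => F (a :: b)))
  else F [::].

Definition bounded_path (K : nat) (b : seq int) := all (fun a : int => (`|a| <= K)%N) b.

Lemma step_abs K (k : 'I_K.*2.+1) : (`|k%:Z - K%:Z| <= K)%N.
Proof. by case: k => k /= hk; lia. Qed.

Lemma eq_step_sum (V : zmodType) K (h g : int -> V) :
  (forall a : int, (`|a| <= K)%N -> h a = g a) -> step_sum K h = step_sum K g.
Proof. by move=> hg; apply: eq_bigr => k _; apply: hg; exact: step_abs. Qed.

Lemma le_step_sum K (h g : int -> R) :
  (forall a : int, (`|a| <= K)%N -> h a <= g a) -> step_sum K h <= step_sum K g.
Proof. by move=> hg; apply: ler_sum => k _; apply: hg; exact: step_abs. Qed.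

Lemma step_sumD (V : zmodType) K (h g : int -> V) :
  step_sum K (fun a => h a + g a) = step_sum K h + step_sum K g.
Proof. exact: big_split. Qed.

Lemma step_sumZl K (c : R) (h : int -> R) :
  step_sum K (fun a => c * h a) = c * step_sum K h.
Proof. by rewrite /step_sum mulr_sumr. Qed.

Lemma step_sumZr K (c : R) (h : int -> R) :
  step_sum K (fun a => h a * c) = step_sum K h * c.
Proof. by rewrite /step_sum mulr_suml. Qed.

Variables (wt : nat -> int -> R) (K : nat).
Hypothesis wt0 : forall i a, 0 <= wt i a.
Implicit Types (l : seq nat) (b : seq int) (F G : seq int -> R).
Notation PS := (path_sum wt K).

Lemma eq_path_sum l F G :
  (forall b, size b = size l -> bounded_path K b -> F b = G b) -> PS l F = PS l G.
Proof.
elim: l F G => [|i l ih] F G FG /=; first exact: FG.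
apply: eq_step_sum => a aK; congr (_ * _); apply: ih => b sb Kb.
by apply: FG => /=; rewrite ?sb// aK.
Qed.

Lemma le_path_sum l F G :
  (forall b, size b = size l -> bounded_path K b -> F b <= G b) -> PS l F <= PS l G.
Proof.
elim: l F G => [|i l ih] F G FG /=; first exact: FG.
apply: le_step_sum => a aK; rewrite ler_wpM2l//; apply: ih => b sb Kb.
by apply: FG => /=; rewrite ?sb// aK.
Qed.

Lemma path_sum0 l : PS l (fun=> 0) = 0.
Proof.
elim: l => [//|i l ih] /=; rewrite /step_sum big1// => k _.
by rewrite ih mulr0.
Qed.

Lemma path_sum_ge0 l F : (forall b, 0 <= F b) -> 0 <= PS l F.
Proof. by move=> F0; rewrite -(path_sum0 l); apply: le_path_sum. Qed.

Lemma path_sumD l F G : PS l (fun b => F b + G b) = PS l F + PS l G.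
Proof.
elim: l F G => [//|i l ih] F G /=; rewrite -step_sumD.
by apply: eq_step_sum => a _; rewrite ih mulrDr.
Qed.

Lemma path_sumZl l c F : PS l (fun b => c * F b) = c * PS l F.
Proof.
elim: l F => [//|i l ih] F /=; rewrite -step_sumZl.
by apply: eq_step_sum => a _; rewrite ih mulrCA.
Qed.

Lemma path_sumZr l c F : PS l (fun b => F b * c) = PS l F * c.
Proof. by rewrite mulrC -path_sumZl; apply: eq_path_sum => b _ _; rewrite mulrC. Qed.

Lemma path_sumB l F G : PS l (fun b => F b - G b) = PS l F - PS l G.
Proof.
rewrite -mulN1r -path_sumZl -path_sumD; apply: eq_path_sum => b _ _.
by rewrite mulN1r.
Qed.

Lemma path_sum_sum (I : Type) (s : seq I) l (F : I -> seq int -> R) :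
  PS l (fun b => \sum_(i <- s) F i b) = \sum_(i <- s) PS l (F i).
Proof.
elim: s => [|i s ih].
  rewrite big_nil -[RHS](path_sum0 l); apply: eq_path_sum => b _ _.
  by rewrite big_nil.
rewrite big_cons -ih -path_sumD; apply: eq_path_sum => b _ _.
by rewrite big_cons.
Qed.

Lemma path_sum_abs l F : `|PS l F| <= PS l (fun b => `|F b|).
Proof.
rewrite ler_norml -[X in X <= _]mulN1r -path_sumZl; apply/andP; split;
  apply: le_path_sum => b _ _; last exact: ler_norm.
by rewrite mulN1r lerNl -normrN ler_norm.
Qed.

Lemma path_sum_cat l1 l2 F :
  PS (l1 ++ l2) F = PS l1 (fun b1 => PS l2 (fun b2 => F (b1 ++ b2))).
Proof.
elim: l1 F => [//|i l ih] F /=.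
by apply: eq_step_sum => a _; rewrite ih.
Qed.

Lemma path_sum_exchange l1 l2 (F : seq int -> seq int -> R) :
  PS l1 (fun b1 => PS l2 (F b1)) = PS l2 (fun b2 => PS l1 (F^~ b2)).
Proof.
elim: l1 F => [//|i l ih] F /=.
rewrite /step_sum path_sum_sum; apply: eq_bigr => k _.
by rewrite ih path_sumZl.
Qed.

Lemma path_sum_rev l F : PS (rev l) F = PS l (fun b => F (rev b)).
Proof.
elim: l F => [//|i l ih] F.
rewrite rev_cons -cats1 path_sum_cat ih.
rewrite (@path_sum_exchange l [:: i] (fun b b2 => F (rev b ++ b2))) /=.
apply: eq_step_sum => a _; congr (_ * _); apply: eq_path_sum => b _ _.
by rewrite rev_cons cats1.
Qed.

Lemma path_sum_cst_le l c : (forall i, step_sum K (wt i) <= 1) -> 0 <= c ->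
  PS l (fun=> c) <= c.
Proof.
move=> m c0; elim: l => [//|i l ih] /=.
apply: (@le_trans _ _ (step_sum K (fun a => wt i a * c))).
  by apply: le_step_sum => a _; rewrite ler_wpM2l.
by rewrite step_sumZr ler_piMl.
Qed.

Lemma path_sum_le_cst l F c : (forall i, step_sum K (wt i) <= 1) -> 0 <= c ->
  (forall b, size b = size l -> F b <= c) -> PS l F <= c.
Proof.
move=> m c0 Fc; apply: le_trans (path_sum_cst_le l m c0).
by apply: le_path_sum => b sb _; exact: Fc.
Qed.

(* With e = -1 the path is read backwards from its end point h. *)
Fixpoint stays_pos (e h : int) (b : seq int) : bool :=
  if b is a :: b' then (0 < h + e * a) && stays_pos e (h + e * a) b' else true.

(** Union bound over the time [j] of the first violation, each term by the exponential Markov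
    inequality with parameter [del]; the product over the first [j] steps bounds the corresponding
    Laplace transform. *)
Lemma path_sum_viol (e h : int) (del : R) l (r : nat -> R) : 0 <= del ->
  (forall i, step_sum K (wt i) <= 1) ->
  (forall i, 0 <= r i) ->
  (forall i, i \in l -> step_sum K (fun a => wt i a * expR (- (del * (e * a)%:~R))) <= r i) ->
  PS l (fun b => (~~ stays_pos e h b)%:R) <=
  expR (- (del * h%:~R)) * \sum_(1 <= j < (size l).+1) \prod_(i <- take j l) r i.
Proof.
move=> d0 m r0; elim: l h => [|i l ih] h rl /=.
  by rewrite mulr_ge0 ?expR_ge0// big_geq.
have rl' k : k \in l -> step_sum K (fun a => wt k a * expR (- (del * (e * a)%:~R))) <= r k.
  by move=> kl; apply: rl; rewrite inE kl orbT.
set X := \sum_(1 <= j < (size l).+1) \prod_(i <- take j l) r i.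
have X0 : 0 <= X by apply: sumr_ge0 => j _; apply: prodr_ge0.
have -> : \sum_(1 <= j < (size l).+2) \prod_(i0 <- take j (i :: l)) r i0 = r i * (1 + X).
  rewrite big_add1/= (big_nat_recl _ _ _ (leq0n _))/= take0 big_seq1 mulrDr mulr1; congr (_ + _).
  rewrite /X big_add1/= mulr_sumr; apply: eq_bigr => j _.
  by rewrite big_cons.
apply: (@le_trans _ _ (step_sum K (fun a => wt i a * expR (- (del * (e * a)%:~R)) *
   (expR (- (del * h%:~R)) * (1 + X))))); last first.
  rewrite step_sumZr mulrCA; apply: ler_wpM2l; first exact: expR_ge0.
  by rewrite ler_wpM2r ?addr_ge0// rl// inE eqxx.
apply: le_step_sum => a _; rewrite -mulrA ler_wpM2l// mulrA -expRD.
have -> : - (del * (e * a)%:~R) + - (del * h%:~R) = - (del * (h + e * a)%:~R) :> R.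
  by rewrite intrD; ring.
rewrite mulrDr mulr1; have [p|p] := ltP 0 (h + e * a).
  rewrite -[X in X <= _]add0r lerD ?expR_ge0// ih//.
apply: (@le_trans _ _ 1).
  by apply: path_sum_le_cst.
rewrite -[X in X <= _]addr0; apply: lerD; last first.
  by apply: mulr_ge0; first exact: expR_ge0.
rewrite -[X in X <= _]expR0 ler_expR oppr_ge0; apply: mulr_ge0_le0 => //.
by rewrite lerz0.
Qed.

End path_sums.

(** * Fourier inversion for the joint law of end point and area *)

Section path_fourier.
Context {R : realType}.
Notation leb := (@lebesgue_measure R).
Notation leb2 := (leb \x leb)%E.
Variables (wt : nat -> int -> R) (K : nat).
Hypothesis wt0 : forall i a, 0 <= wt i a.
Notation PS := (path_sum wt K).

Definition tot (b : seq int) : int := \sum_(a <- b) a.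

(** A step with index [i] is counted [i] times. Along the indices [n.-1, ..., 1] this is the sum of
    the heights of the path ([sum_heights]). *)
Fixpoint area (l : seq nat) (b : seq int) : int :=
  match l, b with i :: l', a :: b' => i%:Z * a + area l' b' | _, _ => 0 end.

Definition charf i (u : R) : R[i] :=
  step_sum K (fun a => (wt i a)%:C%C * cis (u * a%:~R)).

(** Independence factors the joint transform. The additional phase [al] carries the contribution of
    the steps already read and makes the induction possible. *)
Lemma path_sum_cos l (s t al : R) :
  PS l (fun b => cos (al + s * (tot b)%:~R + t * (area l b)%:~R)) =
  complex.Re (cis al * \prod_(i <- l) charf i (s + t * i%:R)).
Proof.
elim: l al => [|i l ih] al /=.
  by rewrite /tot !big_nil !mulr0 !addr0 mulr1.
rewrite big_cons /charf mulrA [cis al * _]mulrC /step_sum mulr_suml mulr_suml Re_sum.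
apply: eq_bigr => k _; move: (k%:Z - K%:Z) => a {k}.
rewrite -[LHS]/(wt i a * _).
have -> : path_sum wt K l (fun b => cos (al + s * (tot (a :: b))%:~R +
      t * (i%:Z * a + area l b)%:~R)) =
  PS l (fun b => cos ((al + (s + t * i%:R) * a%:~R) + s * (tot b)%:~R + t * (area l b)%:~R)).
  apply: eq_path_sum => b _ _; congr cos.
  by rewrite /tot big_cons !intrD intrM -pmulrn; ring.
rewrite ih cisD -!mulrA Re_realM; congr (_ * complex.Re _).
by rewrite mulrCA.
Qed.

Definition local_prob l (s x : int) : R :=
  PS l (fun b => ((tot b == s) && (area l b == x))%:R).

Lemma path_sum_int d (T : measurableType d) (mu : {measure set T -> \bar R}) l
    (G : seq int -> T -> R) : (forall b, Itg mu (G b)) ->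
  Itg mu (fun z => PS l (fun b => G b z)) /\
  \int[mu]_z PS l (fun b => G b z) = PS l (fun b => \int[mu]_z G b z).
Proof.
elim: l G => [|i l ih] G iG /=; first by split; [exact: iG|].
have H (k : 'I_K.*2.+1) := ih (fun b z => G ((nat_of_ord k : int) - K%:Z :: b) z) (fun b => iG _).
split.
  by apply: itg_sum => k; apply: itgZ; exact: (H k).1.
rewrite /step_sum int_sum; last by move=> k; apply: itgZ; exact: (H k).1.
by apply: eq_bigr => k _; rewrite intZ ?(H k).2//; exact: (H k).1.
Qed.

Definition loc_integrand (p q : R) (chi : nat -> R -> R[i]) l (s x : int) (z : R * R) : R :=
  box2 (pi * p) (pi * q) z *
  complex.Re (cis (- (z.1 * (s%:~R / p) + z.2 * (x%:~R / q))) *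
              \prod_(i <- l) chi i (z.1 / p + z.2 / q * i%:R)).

(** Fourier inversion in both variables, the frequencies being [z.1 / p] and [z.2 / q]; the area is
    an integer too, so a bounded box of frequencies suffices. *)
Lemma local_probE (p q : R) l s x : 0 < p -> 0 < q ->
  Itg leb2 (loc_integrand p q charf l s x) /\
  4 * pi ^+ 2 * p * q * local_prob l s x =
  \int[leb2]_z loc_integrand p q charf l s x z.
Proof.
move=> p0 q0.
have E z : loc_integrand p q charf l s x z = PS l (fun b => box2 (pi * p) (pi * q) z *
    cos (z.1 * ((tot b - s)%:~R / p) + z.2 * ((area l b - x)%:~R / q))).
  rewrite /loc_integrand -path_sum_cos -path_sumZl; apply: eq_path_sum => b _ _.
  congr (_ * cos _); rewrite !intrB. ring.
have -> : loc_integrand p q charf l s x = fun z => PS l (fun b => box2 (pi * p) (pi * q) z *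
    cos (z.1 * ((tot b - s)%:~R / p) + z.2 * ((area l b - x)%:~R / q))).
  exact/funext.
have [i1 e1] := @path_sum_int _ _ leb2 l (fun b (z : R * R) => box2 (pi * p) (pi * q) z *
    cos (z.1 * ((tot b - s)%:~R / p) + z.2 * ((area l b - x)%:~R / q)))
   (fun b => itg_box2_cos _ _ _ _).
split => //; rewrite e1 /local_prob -path_sumZl; apply: eq_path_sum => b _ _.
by rewrite int_box2_cos// !subr_eq0.
Qed.

Lemma local_prob_le (p q : R) l s x (D : R * R -> R) : 0 < p -> 0 < q ->
  Itg leb2 D -> (forall z, `|z.1| <= pi * p -> `|z.2| <= pi * q ->
    \prod_(i <- l) nc (charf i (z.1 / p + z.2 / q * i%:R)) <= D z) ->
  (forall z, 0 <= D z) ->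
  4 * pi ^+ 2 * p * q * local_prob l s x <= \int[leb2]_z D z.
Proof.
move=> p0 q0 iD hD D0; have [i1 ->] := local_probE l s x p0 q0.
apply: int_le => // z; rewrite /loc_integrand /box2 !boxE.
case: (leP `|z.1| _) => h1; last by rewrite !mul0r.
case: (leP `|z.2| _) => h2; last by rewrite mulr0 mul0r.
rewrite !mul1r (le_trans (ler_norm _))// (le_trans (nc_Re _))//.
by rewrite ncM nc_cis mul1r nc_prod hD.
Qed.

End path_fourier.

(** * Convex functions through supporting lines: Riemann sums, slopes and drift *)

Section convex_tangents.
Context {R : realType}.
Notation leb := (@lebesgue_measure R).
Variables (f mu : R -> R) (lam : R).
Hypothesis lam0 : 0 < lam.
Hypothesis tangent : forall x y, 0 <= x <= lam -> 0 <= y <= lam ->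
  f x + mu x * (y - x) <= f y.
Hypothesis f0 : f 0 = 0.
Hypothesis flam : f lam = 0.
Hypothesis fmid : f (lam / 2) < 0.

Let I0 : 0 <= (0 : R) <= lam. Proof. by rewrite lexx ltW. Qed.
Let Il : 0 <= lam <= lam. Proof. by rewrite lexx ltW. Qed.
Let Im : 0 <= lam / 2 <= lam.
Proof. by have l0 := lam0; apply/andP; split; [apply: divr_ge0; rewrite ?ltW|rewrite ler_pdivrMr//; lra]. Qed.

(** The slopes of supporting lines are monotone, so the two end slopes bound them all; the 1 makes
    the bound positive. Working with supporting lines avoids differentiability at the end points. *)
Definition slope_bound : R := `|mu 0| + `|mu lam| + 1.
Notation B := slope_bound.

Lemma slope_bound_gt0 : 0 < B.
Proof. by rewrite /B ltr_wpDl// addr_ge0. Qed.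

Lemma tangent_mono x y : 0 <= x <= lam -> 0 <= y <= lam -> x <= y -> mu x <= mu y.
Proof.
move=> hx hy xy; have h1 := tangent hx hy; have h2 := tangent hy hx.
have [->//|xny] := eqVneq x y.
have p : 0 < y - x by rewrite subr_gt0 lt_neqAle xny.
rewrite -(ler_pM2r p); lra.
Qed.

Lemma tangent_bound x : 0 <= x <= lam -> `|mu x| <= B.
Proof.
move=> hx; have /andP[x0 xl] := hx.
have h1 := tangent_mono I0 hx x0; have h2 := tangent_mono hx Il xl.
rewrite ler_norml /B; have := ler_norm (mu lam); have := ler_norm (- mu 0).
rewrite normrN; have := normr_ge0 (mu lam); have := normr_ge0 (mu 0); lra.
Qed.

Lemma tangent_lipschitz x y : 0 <= x <= lam -> 0 <= y <= lam ->
  `|f x - f y| <= B * `|x - y|.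
Proof.
move=> hx hy; have h1 := tangent hx hy; have h2 := tangent hy hx.
have b1 : `|mu x * (y - x)| <= B * `|x - y|.
  by rewrite normrM distrC ler_wpM2r// tangent_bound.
have b2 : `|mu y * (x - y)| <= B * `|x - y|.
  by rewrite normrM ler_wpM2r// tangent_bound.
move: b1 b2; rewrite !ler_norml; lra.
Qed.

Lemma tangent_le0 x : 0 <= x <= lam -> f x <= 0.
Proof.
move=> hx; have h1 := tangent hx I0; have h2 := tangent hx Il.
rewrite f0 flam in h1 h2; have /andP[x0 xl] := hx.
have [m|m] := leP 0 (mu x).
  have : 0 <= mu x * (lam - x) by rewrite mulr_ge0// subr_ge0.
  lra.
have : 0 <= mu x * (0 - x) by apply: mulr_le0; lra.
lra.
Qed.

(** Averaging the supporting line at [x] over 0 and [lam / 2], with the weights whose barycentre is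
    [x], removes the slope. *)
Lemma chord_left x : 0 <= x <= lam / 2 -> f x <= 2 * (x / lam) * f (lam / 2).
Proof.
move=> /andP[x0 xm]; have hx : 0 <= x <= lam by rewrite x0 (le_trans xm)//; case/andP: Im.
have h1 := tangent hx I0; have h2 := tangent hx Im; rewrite f0 in h1.
have l2 : 0 < lam / 2 by rewrite divr_gt0.
pose r := x / (lam / 2).
have r0 : 0 <= r by rewrite divr_ge0// ltW.
have r1 : 0 <= 1 - r by rewrite subr_ge0 ler_pdivrMr// mul1r.
have xr : x = r * (lam / 2) by rewrite /r divfK// gt_eqF.
have -> : 2 * (x / lam) = r by rewrite /r; field; rewrite gt_eqF.
have g1 := ler_wpM2l r1 h1; have g2 := ler_wpM2l r0 h2.
have e : (1 - r) * (f x + mu x * (0 - x)) + r * (f x + mu x * (lam / 2 - x)) =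
  f x + mu x * (r * (lam / 2) - x) by ring.
rewrite -xr subrr mulr0 addr0 in e.
by have := lerD g1 g2; rewrite e mulr0 add0r.
Qed.

Lemma chord_right x : lam / 2 <= x <= lam -> f x <= 2 * ((lam - x) / lam) * f (lam / 2).
Proof.
move=> /andP[xm xl].
have hx : 0 <= x <= lam by rewrite xl (le_trans _ xm)//; case/andP: Im.
have h1 := tangent hx Il; have h2 := tangent hx Im; rewrite flam in h1.
have l2 : 0 < lam / 2 by rewrite divr_gt0.
pose r := (lam - x) / (lam / 2).
have r0 : 0 <= r by apply: divr_ge0; lra.
have r1 : 0 <= 1 - r by rewrite subr_ge0 ler_pdivrMr// mul1r; lra.
have xr : lam - x = r * (lam / 2) by rewrite /r divfK// gt_eqF.
have -> : 2 * ((lam - x) / lam) = r by rewrite /r; field; rewrite gt_eqF.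
have g1 := ler_wpM2l r1 h1; have g2 := ler_wpM2l r0 h2.
have e : (1 - r) * (f x + mu x * (lam - x)) + r * (f x + mu x * (lam / 2 - x)) =
  f x + mu x * (lam - x - r * (lam / 2)) by field.
rewrite -xr subrr mulr0 addr0 in e.
by have := lerD g1 g2; rewrite e mulr0 add0r.
Qed.

Notation th n i := (lam * (i%:R / n%:R)).

Lemma grid_itv (n i : nat) : (i <= n)%N -> 0 <= th n i <= lam.
Proof.
move=> i_n; case: n i_n => [|n] i_n; first by rewrite invr0 !mulr0 lexx ltW.
rewrite mulr_ge0 ?(ltW lam0)//= ler_piMr ?(ltW lam0)// ler_pdivrMr// mul1r ler_nat//.
Qed.

Lemma gridS (n i : nat) : (0 < n)%N -> th n i.+1 - th n i = lam / n%:R.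
Proof. by move=> n0; rewrite -natr1; field; rewrite pnatr_eq0 -lt0n. Qed.

Lemma slope_ge (n i : nat) : (0 < n)%N -> (i < n)%N ->
  f (th n i.+1) - f (th n i) <= lam / n%:R * mu (th n i.+1).
Proof.
move=> n0 i_n; have := tangent (grid_itv i_n) (grid_itv (ltnW i_n)).
by rewrite -(gridS i n0); lra.
Qed.

Lemma slope_le (n i : nat) : (0 < n)%N -> (i < n)%N ->
  lam / n%:R * mu (th n i) <= f (th n i.+1) - f (th n i).
Proof.
move=> n0 i_n; have := tangent (grid_itv (ltnW i_n)) (grid_itv i_n).
by rewrite -(gridS i n0); lra.
Qed.

Lemma thnn (n : nat) : (0 < n)%N -> th n n = lam.
Proof. by move=> n0; rewrite divff ?mulr1// pnatr_eq0 -lt0n. Qed.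

Lemma th0 (n : nat) : th n 0%N = 0. Proof. by rewrite mul0r mulr0. Qed.

Lemma slope_sum_le0 (n : nat) : (0 < n)%N -> \sum_(0 <= i < n) mu (th n i) <= 0.
Proof.
move=> n0; have h0 : 0 < lam / n%:R by rewrite divr_gt0// ltr0n.
rewrite -(pmulr_rle0 _ h0) mulr_sumr.
apply: (@le_trans _ _ (\sum_(0 <= i < n) (f (th n i.+1) - f (th n i)))).
  by apply: ler_sum_nat => i /andP[_ i_n]; exact: slope_le.
by rewrite telescope_sumr// thnn// th0 f0 flam subrr.
Qed.

Lemma slope_sum_ge0 (n : nat) : (0 < n)%N -> 0 <= \sum_(0 <= i < n) mu (th n i.+1).
Proof.
move=> n0; have h0 : 0 < lam / n%:R by rewrite divr_gt0// ltr0n.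
rewrite -(pmulr_rge0 _ h0) mulr_sumr.
apply: (@le_trans _ _ (\sum_(0 <= i < n) (f (th n i.+1) - f (th n i)))).
  by rewrite telescope_sumr// thnn// th0 f0 flam subrr.
by apply: ler_sum_nat => i /andP[_ i_n]; exact: slope_ge.
Qed.

(** Multiplied by [lam / n], the slopes bracket the increments of [f], which telescope to
    [f lam - f 0 = 0]. Probabilistically, the tilted end point has bounded mean. *)
Lemma slope_sum (n : nat) : (0 < n)%N -> `|\sum_(1 <= i < n) mu (th n i)| <= B.
Proof.
move=> n0; have h1 := slope_sum_le0 n0; have h2 := slope_sum_ge0 n0.
rewrite big_ltn// th0 in h1.
have e : \sum_(0 <= i < n) mu (th n i.+1) = \sum_(1 <= i < n) mu (th n i) + mu lam.
  by rewrite -(big_add1 _ _ 0 n.+1 xpredT (fun i => mu (th n i))) big_nat_recr//= thnn.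
rewrite e in h2.
have := ler_norm (mu lam); have := ler_norm (- mu 0); rewrite normrN /B ler_norml.
have := normr_ge0 (mu lam); have := normr_ge0 (mu 0); lra.
Qed.

(** For [f = log phi] this is the constant [I] of the theorem ([I_psiE]); [slope_moment] identifies
    it as the mean area divided by [n ^ 2]. *)
Definition mean_height : R := - (lam^-1 * \int[leb]_(u in `[0, 1]) f (lam * (1 - u))).
Notation MI := mean_height.

Lemma cont_affine : {within `[(0 : R), 1], continuous (fun u => f (lam * (1 - u)))}.
Proof.
apply/subspace_continuousP => x /=; rewrite in_itv/= => hx.
apply/cvgrPdist_le => e e0; have l1 : 0 < e / (B * lam).
  by rewrite divr_gt0// mulr_gt0// slope_bound_gt0.
rewrite near_withinE; near=> y => hy.
have Iy (z : R) : 0 <= z <= 1 -> 0 <= lam * (1 - z) <= lam.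
  move=> hz; rewrite mulr_ge0 ?(ltW lam0)//=; last lra.
  by rewrite ler_piMr ?(ltW lam0)//; lra.
apply: (le_trans (tangent_lipschitz (Iy _ hx) (Iy _ _))).
  by move: hy; rewrite /= in_itv.
have -> : lam * (1 - x) - lam * (1 - y) = - (lam * (x - y)) by ring.
rewrite normrN normrM gtr0_norm// mulrA -ler_pdivlMl; last by rewrite mulr_gt0// slope_bound_gt0.
rewrite mulrC; near: y; apply/nbhs_ballP; exists (e / (B * lam)) => //= z; exact: ltW.
Unshelve. all: by end_near. Qed.

Lemma itg_affine (a b : R) : 0 <= a -> b <= 1 ->
  leb.-integrable `[a, b] (EFin \o (fun u => f (lam * (1 - u)))).
Proof.
move=> a0 b1; apply: continuous_compact_integrable; first exact: segment_compact.
apply: (continuous_subspaceW _ cont_affine) => x /=; rewrite !in_itv/=; lra.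
Qed.

(** The supporting line at the grid point [th n (n - k)] bounds [f] from below on the cell; from
    above one uses the smallest slope of the cell, taken at the neighbouring lower grid point. The
    linear part integrates to [lam / (2 * n ^ 2)]. *)
Lemma riemann_cell (n k : nat) : (0 < n)%N -> (k < n)%N ->
  f (th n (n - k)%N) / n%:R - mu (th n (n - k)%N) * (lam / (2 * n%:R ^+ 2)) <=
  \int[leb]_(u in `[k%:R / n%:R, k.+1%:R / n%:R]) f (lam * (1 - u)) <=
  f (th n (n - k)%N) / n%:R - mu (th n (n - k).-1) * (lam / (2 * n%:R ^+ 2)).
Proof.
set i := (n - k)%N => n0 kn; set J := Rintegral _ _ _; have nn0 : (0 : R) < n%:R by rewrite ltr0n.
set a : R := k%:R / n%:R; set b : R := k.+1%:R / n%:R.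
have ab : a < b by rewrite ltr_pM2r ?invr_gt0// ltr_nat.
have a0 : 0 <= a by rewrite divr_ge0.
have b1 : b <= 1 by rewrite ler_pdivrMr// mul1r ler_nat.
have ba : b - a = n%:R^-1 by rewrite /a /b -natr1; field; rewrite gt_eqF.
have thi : th n i = lam * (1 - a).
  by rewrite /i natrB 1?ltnW// /a; field; rewrite gt_eqF.
have i0 : (0 < i)%N by rewrite subn_gt0.
have thi1 : th n i.-1 = lam * (1 - b).
  have -> : i.-1%:R = i%:R - 1 :> R by rewrite -subn1 natrB.
  by rewrite /i natrB 1?ltnW// /b -natr1; field; rewrite gt_eqF.
have lin (m : R) : let g := fun u => f (th n i) - m * (lam * (u - a)) in
   leb.-integrable `[a, b] (EFin \o g) /\
   \int[leb]_(u in `[a, b]) g u = f (th n i) / n%:R - m * (lam / (2 * n%:R ^+ 2)).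
  move=> g; have cg : continuous g.
    apply: (@is_derive_continuous _ _ (fun=> - (m * lam))) => u.
    by rewrite /g; der; rewrite /=; ring.
  split.
    apply: continuous_compact_integrable; first exact: segment_compact.
    exact: continuous_subspaceT.
  pose G (u : R) := f (th n i) * u - m * (lam * ((u - a) ^+ 2 / 2)).
  have dG (u : R) : is_derive u 1 G (g u).
    by rewrite /G /g; der; rewrite /=; field.
  rewrite (int_itv_FTC ab cg dG) /G subrr expr0n/= mul0r !mulr0 subr0.
  have -> : f (th n i) * b - m * (lam * ((b - a) ^+ 2 / 2)) - f (th n i) * a =
     f (th n i) * (b - a) - m * (lam * ((b - a) ^+ 2 / 2)) by ring.
  by rewrite ba; field; rewrite gt_eqF.
have itf := itg_affine a0 b1.
have [il1 e1] := lin (mu (th n i)); have [il2 e2] := lin (mu (th n i.-1)).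
have Ii : 0 <= th n i <= lam by apply: grid_itv; exact: leq_subr.
have Ii1 : 0 <= th n i.-1 <= lam.
  by apply: grid_itv; apply: (leq_trans (leq_pred _)); exact: leq_subr.
have Iu (u : R) : `[a, b]%classic u -> [/\ 0 <= lam * (1 - u) <= lam,
    lam * (1 - u) - th n i = - (lam * (u - a)), 0 <= lam * (u - a) &
    th n i.-1 <= lam * (1 - u)].
  rewrite /= in_itv/= => /andP[au ub]; split.
  - rewrite mulr_ge0 ?(ltW lam0)//=; last lra.
    by rewrite ler_piMr ?(ltW lam0)//; lra.
  - by rewrite thi; ring.
  - by rewrite mulr_ge0 ?(ltW lam0)// subr_ge0.
  - by rewrite thi1 ler_pM2l//; lra.
apply/andP; split.
  rewrite -e1; apply: le_Rintegral => // u /Iu[h1 h2 h3 h4].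
  by have := tangent Ii h1; rewrite h2; lra.
rewrite -e2; apply: le_Rintegral => // u /Iu[h1 h2 h3 h4].
have := tangent h1 Ii; have -> : th n i - lam * (1 - u) = lam * (u - a).
  by rewrite -[LHS]opprB h2 opprK.
have := ler_wpM2r h3 (tangent_mono Ii1 h1 h4).
lra.
Qed.

Lemma riemann_split (n k : nat) : (0 < n)%N -> (k <= n)%N ->
  \int[leb]_(u in `[0, k%:R / n%:R]) f (lam * (1 - u)) =
  \sum_(0 <= j < k) \int[leb]_(u in `[j%:R / n%:R, j.+1%:R / n%:R]) f (lam * (1 - u)).
Proof.
move=> n0; have nn0 : (0 : R) < n%:R by rewrite ltr0n.
elim: k => [|k ih] kn.
  by rewrite big_geq// mul0r set_itv1 Rintegral_set1.
rewrite big_nat_recr//= -ih 1?ltnW//.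
have b1 : k.+1%:R / n%:R <= 1 :> R by rewrite ler_pdivrMr// mul1r ler_nat.
have a0 : 0 <= k%:R / n%:R :> R by rewrite divr_ge0.
have ab : k%:R / n%:R <= k.+1%:R / n%:R :> R.
  by rewrite ler_pM2r ?invr_gt0// ler_nat.
have it := itg_affine (lexx 0) b1.
rewrite -[X in _ = _ + X]Rintegral_itv_obnd_cbnd; last first.
  apply: (integrableS _ _ _ (itg_affine a0 b1)) => //.
  by apply: subset_itv; rewrite bnd_simp.
rewrite -(Rintegral_itvB it (x := k%:R / n%:R)) ?bnd_simp//.
by rewrite addrC subrK.
Qed.

(** The errors of the cells add up to [lam / (2 * n)] times a sum of slopes, and that sum is
    bounded. So the unnormalised sum is approximated up to [O(1/n)], where bounding the slopes one
    by one would only give [O(1)]. *)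
Lemma riemann_sum (n : nat) : (0 < n)%N ->
  `|\sum_(1 <= i < n) f (th n i) + n%:R * (lam * MI)| <= lam * B / n%:R.
Proof.
move=> n0; have nn0 : (0 : R) < n%:R by rewrite ltr0n.
have E : n%:R * (lam * MI) = - (n%:R * \sum_(0 <= j < n)
   \int[leb]_(u in `[j%:R / n%:R, j.+1%:R / n%:R]) f (lam * (1 - u))).
  rewrite /MI mulrN mulVKf ?gt_eqF// mulrN; congr (- (_ * _)).
  by rewrite -riemann_split// divff ?gt_eqF.
set S := \sum_(0 <= j < n) _ in E.
have rv (g : nat -> R) : \sum_(0 <= k < n) g (n - k)%N = \sum_(0 <= k < n) g k.+1.
  rewrite big_nat_rev/= add0n; apply: eq_big_nat => k /andP[_ kn].
  by congr g; rewrite subKn.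
have rv1 (g : nat -> R) : \sum_(0 <= k < n) g (n - k).-1%N = \sum_(0 <= k < n) g k.
  by rewrite (rv (fun i => g i.-1)).
have fs : \sum_(0 <= k < n) f (th n k.+1) = \sum_(1 <= i < n) f (th n i).
  rewrite -(big_add1 _ _ 0 n.+1 xpredT (fun i => f (th n i))) big_nat_recr//=.
  by rewrite thnn// flam addr0.
have L : \sum_(1 <= i < n) f (th n i) / n%:R -
   \sum_(0 <= k < n) mu (th n k.+1) * (lam / (2 * n%:R ^+ 2)) <= S.
  rewrite -!mulr_suml -fs -(rv (fun i => f (th n i))) -(rv (fun i => mu (th n i))).
  rewrite !mulr_suml -sumrB; apply: ler_sum_nat => k /andP[_ kn].
  by have /andP[] := riemann_cell n0 kn.
have U : S <= \sum_(1 <= i < n) f (th n i) / n%:R -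
   \sum_(0 <= k < n) mu (th n k) * (lam / (2 * n%:R ^+ 2)).
  rewrite -!mulr_suml -fs -(rv (fun i => f (th n i))) -(rv1 (fun i => mu (th n i))).
  rewrite !mulr_suml -sumrB; apply: ler_sum_nat => k /andP[_ kn].
  by have /andP[] := riemann_cell n0 kn.
rewrite -!mulr_suml in L U.
have e : \sum_(0 <= i < n) mu (th n i.+1) = \sum_(0 <= i < n) mu (th n i) + mu lam - mu 0.
  have r1 : \sum_(0 <= i < n.+1) mu (th n i) =
    mu (th n 0) + \sum_(0 <= i < n) mu (th n i.+1) by rewrite big_nat_recl.
  have r2 : \sum_(0 <= i < n.+1) mu (th n i) =
    \sum_(0 <= i < n) mu (th n i) + mu (th n n) by rewrite big_nat_recr.
  by rewrite thnn// in r2; rewrite th0 in r1; move: r1; rewrite r2; lra.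
have h1 := slope_sum_le0 n0; have h2 := slope_sum_ge0 n0.
set M1 := \sum_(0 <= k < n) mu (th n k.+1) in e h2 L.
set M0 := \sum_(0 <= k < n) mu (th n k) in e h1 U.
set F := \sum_(1 <= i < n) f (th n i) in L U *.
have b1 := ler_norm (mu lam); have b2 := ler_norm (- mu 0); rewrite normrN in b2.
have n1 := normr_ge0 (mu lam); have n2 := normr_ge0 (mu 0).
rewrite E ler_norml.
have L' : F - M1 * (lam / (2 * n%:R)) <= n%:R * S.
  move: L; rewrite -(ler_pM2l nn0); congr (_ <= _); field; rewrite gt_eqF//.
have U' : n%:R * S <= F - M0 * (lam / (2 * n%:R)).
  move: U; rewrite -(ler_pM2l nn0); congr (_ <= _); field; rewrite gt_eqF//.
have c0 : 0 <= lam / (2 * n%:R) by rewrite divr_ge0 ?ltW// mulr_gt0.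
have M1B : M1 <= 2 * B by rewrite /B; lra.
have M0B : - (2 * B) <= M0 by rewrite /B; lra.
have q1 := ler_wpM2r c0 M1B; have q2 := ler_wpM2r c0 M0B.
have eB : lam * B / n%:R = 2 * B * (lam / (2 * n%:R)) by field; rewrite gt_eqF.
rewrite eB; apply/andP; split; lra.
Qed.

Lemma abel_next (g : nat -> R) (N : nat) : (0 < N)%N ->
  \sum_(1 <= i < N) i%:R * (g i.+1 - g i) = N%:R * g N - \sum_(1 <= i < N.+1) g i.
Proof.
case: N => // N _; elim: N => [|N ih].
  by rewrite big_geq// big_nat1 mul1r subrr.
rewrite big_nat_recr//= ih [in RHS]big_nat_recr//= -[N.+2%:R]natr1; ring.
Qed.

Lemma abel_prev (g : nat -> R) (N : nat) : (0 < N)%N ->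
  \sum_(1 <= i < N) i%:R * (g i - g i.-1) = N%:R * g N.-1 - \sum_(0 <= i < N) g i.
Proof.
case: N => // N _; elim: N => [|N ih].
  by rewrite big_geq// big_nat1 mul1r subrr.
rewrite big_nat_recr//= ih [in RHS]big_nat_recr//= -[N.+2%:R]natr1; ring.
Qed.

(** Slopes are bracketed by increments of [f], and summation by parts turns the weighted increments
    into the sum treated in [riemann_sum]. The error [O(n)] is negligible at the scale [n ^ (3/2)]
    of the area. *)
Lemma slope_moment (n : nat) : (0 < n)%N ->
  `|\sum_(1 <= i < n) i%:R * mu (th n i) - n%:R ^+ 2 * MI| <= 2 * B * n%:R.
Proof.
move=> n0; have nn0 : (0 : R) < n%:R by rewrite ltr0n.
pose F := \sum_(1 <= i < n) f (th n i).
pose h := lam / n%:R; have h0 : 0 < h by rewrite divr_gt0.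
set S := \sum_(1 <= i < n) _.
have U : h * S <= - F.
  have : h * S <= \sum_(1 <= i < n) i%:R * (f (th n i.+1) - f (th n i)).
    rewrite mulr_sumr; apply: ler_sum_nat => i /andP[_ i_n].
    by rewrite mulrCA ler_wpM2l//; exact: slope_le.
  by rewrite (abel_next (fun i => f (th n i)))// big_nat_recr//= thnn// flam mulr0 addr0 sub0r.
have L : n%:R * f (th n n.-1) - F <= h * S.
  have : \sum_(1 <= i < n) i%:R * (f (th n i) - f (th n i.-1)) <= h * S.
    rewrite mulr_sumr; apply: ler_sum_nat => -[//|i] /andP[_ i_n].
    by rewrite [leRHS]mulrCA ler_wpM2l//; apply: slope_ge => //; exact: ltnW.
  by rewrite (abel_prev (fun i => f (th n i)))// big_ltn// th0 f0 add0r.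
have hn : `|f (th n n.-1)| <= B * h.
  have := tangent_lipschitz (grid_itv (leq_pred n)) Il.
  have := gridS n.-1 n0; rewrite prednK// thnn// => e.
  by rewrite flam subr0 (distrC (th n n.-1)) e (ger0_norm (ltW h0)).
have rs := riemann_sum n0; rewrite -/F in rs.
have Bn : lam * B / n%:R <= lam * B.
  rewrite ler_pdivrMr// ler_peMr// ?ler1n//.
  by rewrite mulr_ge0// ltW// slope_bound_gt0.
have hnn : n%:R * (B * h) = lam * B by rewrite /h; field; rewrite gt_eqF.
have hS : `|h * S - n%:R * (lam * MI)| <= 2 * (lam * B).
  move: hn rs; rewrite !ler_norml => /andP[q1 q2] /andP[q3 q4].
  have := ler_wpM2l (ltW nn0) q1; rewrite mulrN hnn => q5.
  by apply/andP; split; lra.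
have -> : S - n%:R ^+ 2 * MI = (n%:R / lam) * (h * S - n%:R * (lam * MI)).
  by rewrite /h; field; rewrite !gt_eqF.
rewrite normrM gtr0_norm ?divr_gt0// mulrC.
apply: (le_trans (ler_wpM2r _ hS)); first by rewrite divr_ge0// ltW.
by rewrite le_eqVlt; apply/orP; left; apply/eqP; field; rewrite gt_eqF.
Qed.

Lemma mean_height_gt0 : 0 < MI.
Proof.
rewrite /MI oppr_gt0 pmulr_rlt0 ?invr_gt0//.
(* A smooth function above the two chord bounds, so that a single primitive yields a negative
   integral. *)
pose g u := f (lam / 2) * (2 * (u * (1 - u))).
have cg : continuous g.
  apply: (@is_derive_continuous _ _ (fun u => f (lam / 2) * (2 * (1 - 2 * u)))) => u.
  by rewrite /g; der; rewrite /=; ring.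
have dG (u : R) : is_derive u 1 (fun u => f (lam / 2) * (u ^+ 2 - u ^+ 3 * (2 / 3))) (g u).
  by rewrite /g; der; rewrite /=; field.
have ig : leb.-integrable `[0, 1] (EFin \o g).
  apply: continuous_compact_integrable; first exact: segment_compact.
  exact: continuous_subspaceT.
apply: (@le_lt_trans _ _ (\int[leb]_(u in `[0, 1]) g u)); last first.
  rewrite (int_itv_FTC ltr01 cg dG) !expr1n !expr0n/=; move: fmid; lra.
apply: le_Rintegral => //; first exact: itg_affine.
move=> u; rewrite /= in_itv/= => /andP[u0 u1].
have [h|h] := leP u (2^-1).
  have := @chord_right (lam * (1 - u)).
  have -> : 2 * ((lam - lam * (1 - u)) / lam) = 2 * u by field; rewrite gt_eqF.
  have A : lam / 2 <= lam * (1 - u) <= lam.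
    apply/andP; split; first by rewrite ler_pM2l//; lra.
    by rewrite ler_piMr ?(ltW lam0)//; lra.
  move=> /(_ A) H; apply: (le_trans H); rewrite /g mulrC.
  rewrite ler_nM2l// ler_pM2l// ler_piMr//; lra.
have := @chord_left (lam * (1 - u)).
have -> : 2 * (lam * (1 - u) / lam) = 2 * (1 - u) by field; rewrite gt_eqF.
have A : 0 <= lam * (1 - u) <= lam / 2.
  apply/andP; split; last by rewrite ler_pM2l//; lra.
  by rewrite mulr_ge0 ?(ltW lam0)//; lra.
move=> /(_ A) H; apply: (le_trans H); rewrite /g mulrC.
rewrite ler_nM2l// ler_pM2l// ler_piMl//; lra.
Qed.

Lemma nonincr_avg (a : nat -> R) (J j : nat) : (j <= J)%N ->
  (forall i k, (i <= k)%N -> (k < J)%N -> a k <= a i) ->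
  0 <= \sum_(0 <= k < J) a k -> 0 <= \sum_(0 <= k < j) a k.
Proof.
move=> jJ mono S0; have [ejJ|jJ'] := eqVneq j J; first by rewrite ejJ.
have jlt : (j < J)%N by rewrite ltn_neqAle jJ' jJ.
have [aj|aj] := leP 0 (a j).
  rewrite big_seq; apply: sumr_ge0 => k; rewrite mem_index_iota => /andP[_ kj].
  by apply: le_trans aj _; apply: mono => //; exact: ltnW.
move: S0; rewrite (big_cat_nat (leq0n j) jJ)/= => S0.
have : \sum_(j <= k < J) a k <= 0.
  rewrite big_seq; apply: sumr_le0 => k; rewrite mem_index_iota => /andP[jk kJ].
  by apply: le_trans (mono _ _ jk kJ) _; exact: ltW.
lra.
Qed.

(** Read downwards from [i0] the slopes decrease, so a lower bound on the sum over the whole stretch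
    down to [n / 4] passes to every initial part, even though single slopes may be negative. That
    total is at least a difference of values of [f], which is near 0 at the upper end and at most
    [- g / 4] at the lower end. The shift [del] is the parameter of the later exponential bounds. *)
Lemma drift_lower : exists del c eta : R, [/\ 0 < del <= lam / 8, 0 < c, 0 < eta &
  forall n i0 j : nat, (4 <= n)%N -> (i0 <= n)%N -> (1 - eta) * n%:R <= i0%:R ->
  (j <= i0 - (n + 3) %/ 4)%N ->
  c * j%:R <= \sum_(0 <= k < j) mu (th n (i0 - k)%N - del)].
Proof.
pose g := - f (lam / 2); have g0 : 0 < g by rewrite oppr_gt0.
have B0 := slope_bound_gt0.
(* [del] and [eta] each cost at most [g / 16] in the value of [f] at the upper end, and the bounds
   by [lam / 8] and [1 / 8] keep all shifted grid points inside [[0, lam]]. *)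
pose del := Num.min (lam / 8) (g / (16 * B)).
pose eta := Num.min 8^-1 (g / (16 * (B * lam))).
have del0 : 0 < del by rewrite lt_min !divr_gt0 ?mulr_gt0.
have eta0 : 0 < eta.
  by rewrite lt_min; apply/andP; split; [rewrite invr_gt0|rewrite divr_gt0 ?mulr_gt0].
have del8 : del <= lam / 8 by rewrite ge_min lexx.
have eta8 : eta <= 8^-1 by rewrite ge_min lexx.
have delB : B * del <= g / 16.
  apply: (@le_trans _ _ (B * (g / (16 * B)))).
    by rewrite ler_pM2l// ge_min lexx orbT.
  by rewrite le_eqVlt; apply/orP; left; apply/eqP; field; rewrite gt_eqF.
have etaB : B * (lam * eta) <= g / 16.
  apply: (@le_trans _ _ (B * (lam * (g / (16 * (B * lam)))))).
    by rewrite !ler_pM2l// ge_min lexx orbT.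
  by rewrite le_eqVlt; apply/orP; left; apply/eqP; field; rewrite !gt_eqF.
exists del, (g / (8 * lam)), eta; split => //.
- by rewrite del0 del8.
- by rewrite divr_gt0// mulr_gt0.
move=> n i0 j n4 i0n hi0; set J := (i0 - _)%N => jJ.
have n0 : (0 < n)%N by exact: leq_trans n4.
have nn0 : (0 : R) < n%:R by rewrite ltr0n.
pose x (k : nat) := th n (i0 - k)%N - del.
have i0J : (J <= i0)%N by rewrite leq_subr.
have qn : ((n + 3) %/ 4 <= i0)%N.
  rewrite -(ler_nat R); apply: le_trans hi0.
  apply: (@le_trans _ _ (n%:R * (7 / 8))); last first.
    by rewrite mulrC ler_wpM2r//; lra.
  have : (((n + 3) %/ 4)%:R : R) <= (n + 3)%:R / 4.
    by rewrite ler_pdivlMr// -natrM ler_nat; clear; lia.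
  have : (4 : R) <= n%:R by rewrite ler_nat.
  rewrite natrD; lra.
have i0JE : (i0 - J = (n + 3) %/ 4)%N by rewrite /J subKn.
have xI k : (k <= J)%N -> 0 <= x k <= lam.
  move=> kJ; rewrite /x.
  have /andP[_ t1] : 0 <= th n (i0 - k) <= lam.
    by apply: grid_itv; apply: leq_trans i0n; exact: leq_subr.
  have t2 : lam / 4 <= th n (i0 - k).
    rewrite ler_pM2l// ler_pdivlMr// mulrC.
    have : (n <= 4 * (i0 - k))%N by move: kJ; rewrite /J; clear -qn; lia.
    by rewrite -(ler_nat R) natrM; lra.
  apply/andP; split; lra.
pose h := lam / n%:R; have h0 : 0 < h by rewrite divr_gt0.
have xS k : (k < J)%N -> x k.+1 = x k - h.
  move=> kJ; rewrite /x /h.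
  have -> : (i0 - k = (i0 - k.+1).+1)%N by clear -kJ i0J; lia.
  by rewrite -natr1; field; rewrite gt_eqF.
have tot : h * \sum_(0 <= k < J) mu (x k) >= f (x 0%N) - f (x J).
  rewrite mulr_sumr.
  have -> : f (x 0%N) - f (x J) = \sum_(0 <= k < J) (f (x k) - f (x k.+1)).
    have := telescope_sumr (fun k => - f (x k)) (leq0n J).
    by rewrite opprK addrC => <-; apply: eq_bigr => k _; rewrite opprK addrC.
  apply: ler_sum_nat => k /andP[_ kJ].
  have := tangent (xI k (ltnW kJ)) (xI k.+1 kJ).
  by rewrite (xS k kJ); lra.
have fx0 : - (g / 8) <= f (x 0%N).
  have := tangent_lipschitz (xI 0%N (leq0n _)) Il; rewrite flam subr0.
  have /andP[_ hx] := xI 0%N (leq0n _).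
  rewrite (distrC (x 0%N)) (@ger0_norm _ (lam - x 0%N)) ?subr_ge0//.
  have : lam - x 0%N <= lam * eta + del.
    rewrite /x subn0.
    have : lam * (1 - eta) <= th n i0.
      by rewrite ler_pM2l// ler_pdivlMr.
    lra.
  move=> h1; have h2 := ler_wpM2l (ltW B0) h1; rewrite ler_norml => /andP[h3 _].
  by move: h2; rewrite mulrDr; lra.
have fxJ : f (x J) <= - (g / 4).
  have h1 : lam / 8 <= x J.
    rewrite /x i0JE; have : lam / 4 <= th n ((n + 3) %/ 4).
      rewrite ler_pM2l// ler_pdivlMr// mulrC.
      have : (n <= 4 * ((n + 3) %/ 4))%N by clear; lia.
      by rewrite -(ler_nat R) natrM; lra.
    lra.
  have h2 : x J <= lam / 2.
    rewrite /x i0JE; have : th n ((n + 3) %/ 4) <= lam / 2.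
      rewrite ler_pM2l// ler_pdivrMr//.
      have : (2 * ((n + 3) %/ 4) <= n)%N by clear -n4; lia.
      by rewrite -(ler_nat R) natrM; lra.
    lra.
  have hh : 0 <= x J <= lam / 2 by apply/andP; split => //; lra.
  have eg : f (lam / 2) = - g by rewrite /g opprK.
  apply: (le_trans (chord_left hh)); rewrite eg mulrN lerN2.
  have : 8^-1 <= x J / lam by rewrite ler_pdivlMr//; lra.
  move=> h3; have := ler_wpM2r (ltW g0) h3; lra.
have big : g / 8 <= h * \sum_(0 <= k < J) mu (x k) by lra.
pose a k := mu (x k) - g / (8 * lam).
have sumA (m : nat) : \sum_(0 <= k < m) a k = \sum_(0 <= k < m) mu (x k) - g / (8 * lam) * m%:R.
  by rewrite /a sumrB; congr (_ - _); rewrite big_const_nat iter_addr_0 subn0 mulr_natr.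
rewrite -subr_ge0 -sumA; apply: (@nonincr_avg _ J) => //.
  move=> i k ik kJ; rewrite /a lerD2r; apply: tangent_mono.
  - exact/xI/ltnW.
  - by apply: xI; exact: leq_trans (ltnW kJ).
  - rewrite /x lerD2r ler_pM2l// ler_pM2r ?invr_gt0// ler_nat; clear -ik; lia.
rewrite sumA subr_ge0; rewrite -(ler_pM2l h0); apply: le_trans big.
have -> : h * (g / (8 * lam) * J%:R) = g / 8 * (J%:R / n%:R).
  by rewrite /h; field; rewrite !gt_eqF.
by rewrite ler_piMr ?divr_ge0 ?(ltW g0)// ler_pdivrMr// mul1r ler_nat (leq_trans i0J).
Qed.

End convex_tangents.

(** * Exponential tilting of an integer-valued step *)

Module Tilting.

Record lattice_step d (T : measurableType d) (R : realType) (P : probability T R)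
    (X : T -> int) (lam : R) : Prop := LatticeStep {
  ls_lam : 0 < lam;
  ls_meas : forall A : set int, measurable (X @^-1` A);
  ls_int : Itg P (fun w => `|(X w)%:~R : R|);
  ls_exp : Itg P (fun w => expR (lam * (X w)%:~R));
  ls_exp1 : \int[P]_w expR (lam * (X w)%:~R) = 1;
  ls_sqr : Itg P (fun w => (X w)%:~R ^+ 2 * expR (lam * (X w)%:~R));
  ls_mean : \int[P]_w ((X w)%:~R : R) < 0;
  ls_gcd : is_gcd [set m | exists k n : int,
     0 < (\int[P]_w ((X w == k)%:R : R)) * (\int[P]_w ((X w == n)%:R : R)) /\ m = k - n] 1
}.

Section tilting.
Context d (T : measurableType d) (R : realType) (P : probability T R)
  (X : T -> int) (lam : R).
Hypothesis LS : lattice_step P X lam.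
Implicit Types (g h : int -> R) (a k : int).

Notation Ig g := (Itg P (fun w => g (X w))).
Definition Ex g : R := \int[P]_w g (X w).

Let lam0 := ls_lam LS.

Lemma mfun_X g : mfun_ (fun w => g (X w)).
Proof.
move=> _ B mB; rewrite setTI.
exact: (ls_meas LS (g @^-1` B)).
Qed.

Lemma ig_dom g h : Ig g -> (forall a, `|h a| <= g a) -> Ig h.
Proof. by move=> ig hg; apply: (itg_dominated (mfun_X h) ig). Qed.

Lemma ex_dct (h_ : nat -> int -> R) h g : Ig g ->
  (forall n a, `|h_ n a| <= g a) -> (forall a, h_ ^~ a @ \oo --> h a) ->
  Ex (h_ n) @[n --> \oo] --> Ex h.
Proof.
move=> ig hg hc.
by have [] := @int_dct _ _ _ P (fun n w => h_ n (X w)) (fun w => h (X w)) _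
  (fun n => mfun_X (h_ n)) ig (fun n w => hg n (X w)) (fun w => hc (X w)).
Qed.

Lemma ig_abs h : Ig h -> Ig (fun a => `|h a|).
Proof. exact: integrable_norm. Qed.

Lemma ig_cst (c : R) : Ig (fun=> c).
Proof. exact: finite_measure_integrable_cst. Qed.

Lemma ex_cst (c : R) : Ex (fun=> c) = c.
Proof.
transitivity (c * fine (P setT)); first exact: Rintegral_cst.
by rewrite probability_setT mulr1.
Qed.

Definition pmass a : R := Ex (fun b => (b == a)%:R).
Notation p := pmass.

Lemma ig_bounded h (c : R) : (forall a, `|h a| <= c) -> Ig h.
Proof. exact: ig_dom (ig_cst c). Qed.

Lemma ig_indic (q : pred int) : Ig (fun a => (q a)%:R).
Proof. by apply: (@ig_bounded _ 1) => a; case: (q a); rewrite ?normr1 ?normr0. Qed.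

Lemma exD g h : Ig g -> Ig h -> Ex (fun a => g a + h a) = Ex g + Ex h.
Proof. exact: intD. Qed.

Lemma exB g h : Ig g -> Ig h -> Ex (fun a => g a - h a) = Ex g - Ex h.
Proof. exact: intB. Qed.

Lemma exZ (c : R) g : Ig g -> Ex (fun a => c * g a) = c * Ex g.
Proof. exact: intZ. Qed.

Lemma ex_le g h : Ig g -> Ig h -> (forall a, g a <= h a) -> Ex g <= Ex h.
Proof. by move=> ig ih gh; apply: int_le. Qed.

Lemma ex_ge0 g : (forall a, 0 <= g a) -> 0 <= Ex g.
Proof. by move=> g0; apply: Rintegral_ge0. Qed.

Lemma p_ge0 a : 0 <= p a. Proof. exact: ex_ge0. Qed.

Definition truncf (K : nat) h a : R := (`|a| <= K)%N%:R * h a.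

Lemma ig_trunc K h : Ig h -> Ig (truncf K h).
Proof.
move=> ih; apply: (ig_dom (ig_abs ih)) => a.
by rewrite /truncf normrM ler_piMl//; case: (_ <= _)%N; rewrite ?normr1 ?normr0.
Qed.

Lemma step_sumE K h : Ig h -> step_sum K (fun a => p a * h a) = Ex (truncf K h).
Proof.
move=> ih.
have E a : truncf K h a = \sum_(k < K.*2.+1) h (k%:Z - K%:Z) * (a == k%:Z - K%:Z)%:R.
  rewrite /truncf; case: leqP => aK; last first.
    rewrite mul0r big1// => k _; case: eqP => [ae|_]; last by rewrite mulr0.
    by move: aK; rewrite ae ltnNge step_abs.
  have kP : (`|(a + K%:Z)%R| < K.*2.+1)%N by lia.
  have ak : a = (Ordinal kP)%:Z - K%:Z by rewrite /=; lia.
  rewrite (bigD1 (Ordinal kP))//= -ak eqxx mulr1 mul1r big1 ?addr0// => k kne.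
  case: eqP => [ae|_]; last by rewrite mulr0.
  by case/eqP: kne; apply: val_inj => /=; clear -ae; lia.
rewrite /Ex; under eq_Rintegral => w _ do rewrite E.
rewrite int_sum; last by move=> k; apply: itgZ; exact: (ig_indic (fun a => a == k%:Z - K%:Z)).
apply: eq_bigr => k _; rewrite mulrC; symmetry.
exact: (intZ _ (ig_indic (fun a => a == k%:Z - K%:Z))).
Qed.

Lemma step_sum_le_ex K h : Ig h -> (forall a, 0 <= h a) ->
  step_sum K (fun a => p a * h a) <= Ex h.
Proof.
move=> ih h0; rewrite step_sumE//; apply: ex_le => //; first exact: ig_trunc.
by move=> a; rewrite /truncf; case: (_ <= _)%N; rewrite ?mul1r ?mul0r.
Qed.

Lemma step_sum_cvg h : Ig h ->
  step_sum K (fun a => p a * h a) @[K --> \oo] --> Ex h.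
Proof.
move=> ih; apply: (@cvgn_eq _ 0 _ (fun K => Ex (truncf K h))) => [K _|]; first exact: step_sumE.
apply: (ex_dct (ig_abs ih)).
  move=> K a /=; rewrite /truncf normrM ler_piMl//.
  by case: (_ <= _)%N; rewrite ?normr1 ?normr0.
by move=> a; apply: (@cvgn_cst _ `|a|%N) => K aK; rewrite /truncf aK mul1r.
Qed.

Lemma le_p_ex k h : Ig h -> (forall a, 0 <= h a) -> p k * h k <= Ex h.
Proof.
move=> ih h0; rewrite [leLHS]mulrC -exZ; last exact: (ig_indic (fun a => a == k)).
apply: ex_le => //; first by apply: itgZ; exact: (ig_indic (fun a => a == k)).
by move=> a; case: eqP => [->|_]; rewrite ?mulr1 ?mulr0.
Qed.

Lemma int_abs_le_sqr a : `|a%:~R| <= a%:~R ^+ 2 :> R.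
Proof.
rewrite -(real_normK (num_real _)) expr2; have [->|a0] := eqVneq a 0.
  by rewrite normr0 mul0r.
by rewrite ler_peMl// -intr_norm ler1z; lia.
Qed.

Definition edom a : R := 1 + expR (lam * a%:~R).

Lemma ig_edom : Ig edom. Proof. exact: itgD (ig_cst 1) (ls_exp LS). Qed.

Lemma exp_le_edom th a : 0 <= th <= lam -> expR (th * a%:~R) <= edom a.
Proof.
move=> /andP[t0 tl]; rewrite /edom; have [a0|a0] := leP 0 a.
  apply: le_trans (_ : expR (lam * a%:~R) <= _); last by rewrite lerDr.
  by rewrite ler_expR ler_wpM2r ?ler0z.
apply: le_trans (_ : 1 <= _); last by rewrite lerDl expR_ge0.
rewrite expR_le1; apply: mulr_ge0_le0 => //; rewrite lerz0; exact: ltW.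
Qed.

Lemma ig_exp th : 0 <= th <= lam -> Ig (fun a => expR (th * a%:~R)).
Proof.
move=> h; apply: (ig_dom ig_edom) => a.
by rewrite ger0_norm ?expR_ge0// exp_le_edom.
Qed.

(** Majorant of [a * exp (th * a)] for all tilts at once: negative values are dominated at the tilt
    0 by the first moment, the others at [lam] by the second, as [|a| <= a ^ 2] on integers. [edom]
    does the same for [exp (th * a)]. *)
Definition adom a : R := `|a%:~R| + a%:~R ^+ 2 * expR (lam * a%:~R).

Lemma ig_adom : Ig adom. Proof. exact: itgD (ls_int LS) (ls_sqr LS). Qed.

Lemma abs_exp_le_adom th a : 0 <= th <= lam -> `|a%:~R * expR (th * a%:~R)| <= adom a.
Proof.
move=> /andP[t0 tl]; rewrite /adom normrM (ger0_norm (expR_ge0 _)).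
have [a0|a0] := leP 0 a.
  apply: le_trans (_ : a%:~R ^+ 2 * expR (lam * a%:~R) <= _); last by rewrite lerDr.
  apply: ler_pM; rewrite ?expR_ge0 ?int_abs_le_sqr//.
  by rewrite ler_expR ler_wpM2r ?ler0z.
apply: le_trans (_ : `|a%:~R| <= _).
  rewrite ler_piMr// expR_le1; apply: mulr_ge0_le0 => //; rewrite lerz0; exact: ltW.
by rewrite lerDl mulr_ge0 ?sqr_ge0 ?expR_ge0.
Qed.

Lemma ig_abs_exp th : 0 <= th <= lam -> Ig (fun a => a%:~R * expR (th * a%:~R)).
Proof. by move=> h; apply: (ig_dom ig_adom) => a; exact: abs_exp_le_adom. Qed.

Definition phi th : R := Ex (fun a => expR (th * a%:~R)).
Definition cum th : R := ln (phi th).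
Definition mu th : R := Ex (fun a => a%:~R * expR (th * a%:~R)) / phi th.

Let I0 : 0 <= (0 : R) <= lam. Proof. by rewrite lexx ltW. Qed.
Let Il : 0 <= lam <= lam. Proof. by rewrite lexx ltW. Qed.

Lemma phi0 : phi 0 = 1.
Proof.
by rewrite /phi /Ex; under eq_Rintegral => w _ do rewrite mul0r expR0; exact: ex_cst.
Qed.

Lemma philam : phi lam = 1. Proof. exact: ls_exp1 LS. Qed.

Lemma ex_a_neg : Ex (fun a => a%:~R) < 0. Proof. exact: ls_mean LS. Qed.

Lemma ig_a : Ig (fun a => a%:~R : R).
Proof. by apply: (@ig_dom (fun a => `|a%:~R|)) => //; exact: ls_int LS. Qed.

Lemma phi_gt0 th : 0 <= th <= lam -> 0 < phi th.
Proof.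
move=> h; apply: (@lt_le_trans _ _ (expR (th * Ex (fun a => a%:~R)))); first exact: expR_gt0.
set m := Ex _; have E : Ex (fun a => expR (th * m) * (1 + th * (a%:~R - m))) <= phi th.
  apply: ex_le.
  - apply: itgZ; apply: itgD; first exact: (ig_cst 1).
    by apply: itgZ; apply: itgB; [exact: ig_a|exact: (ig_cst m)].
  - exact: ig_exp.
  - move=> a; have -> : th * a%:~R = th * m + th * (a%:~R - m) by ring.
    by rewrite expRD ler_pM2l ?expR_gt0// expR_ge1Dx.
apply: le_trans E; rewrite exZ; last first.
  apply: itgD; first exact: (ig_cst 1).
  by apply: itgZ; apply: itgB; [exact: ig_a|exact: (ig_cst m)].
rewrite exD; [|exact: (ig_cst 1)|]; last first.
  by apply: itgZ; apply: itgB; [exact: ig_a|exact: (ig_cst m)].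
rewrite exZ; last by apply: itgB; [exact: ig_a|exact: (ig_cst m)].
rewrite exB; [|exact: ig_a|exact: (ig_cst m)].
by rewrite !ex_cst -/m subrr mulr0 addr0 mulr1.
Qed.

Lemma expR_cum th : 0 <= th <= lam -> expR (cum th) = phi th.
Proof. by move=> h; rewrite /cum lnK// posrE phi_gt0. Qed.

Lemma cum0 : cum 0 = 0. Proof. by rewrite /cum phi0 ln1. Qed.
Lemma cumlam : cum lam = 0. Proof. by rewrite /cum philam ln1. Qed.

(** Jensen under the law tilted by [x], through [exp v >= 1 + v] at the tilted mean. No derivative
    of [log phi] is taken, so the end points 0 and [lam] are included. *)
Lemma cum_tangent x y : 0 <= x <= lam -> 0 <= y <= lam ->
  cum x + mu x * (y - x) <= cum y.
Proof.
move=> hx hy; rewrite -ler_expR expRD !expR_cum//.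
have px := phi_gt0 hx; set m := mu x; set t := y - x.
have mE : Ex (fun a => a%:~R * expR (x * a%:~R)) = m * phi x.
  by rewrite /m /mu divfK// gt_eqF.
have i1 := ig_exp hx; have i2 := ig_abs_exp hx.
have i3 : Ig (fun a => t * (a%:~R * expR (x * a%:~R))) by exact: itgZ.
have i4 : Ig (fun a => (1 - t * m) * expR (x * a%:~R)) by exact: itgZ.
have i5 : Ig (fun a => t * (a%:~R * expR (x * a%:~R)) + (1 - t * m) * expR (x * a%:~R)).
  exact: itgD.
have : Ex (fun a => expR (m * t) * (t * (a%:~R * expR (x * a%:~R)) +
    (1 - t * m) * expR (x * a%:~R))) <= phi y.
  apply: ex_le; [exact: itgZ|exact: ig_exp|] => a.
  have -> : y * a%:~R = m * t + (x * a%:~R + t * (a%:~R - m)).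
    by rewrite /t; ring.
  rewrite !expRD ler_pM2l ?expR_gt0//.
  have -> : t * (a%:~R * expR (x * a%:~R)) + (1 - t * m) * expR (x * a%:~R) =
    expR (x * a%:~R) * (1 + t * (a%:~R - m)) by ring.
  by rewrite ler_pM2l ?expR_gt0// expR_ge1Dx.
rewrite (exZ _ i5) (exD i3 i4) (exZ _ i2) (exZ _ i1) mE -/(phi x).
by congr (_ <= _); ring.
Qed.

Lemma p_neg : exists2 k, (k < 0)%R & 0 < p k.
Proof.
apply: contrapT => h; have {}h k : (k < 0)%R -> p k = 0.
  move=> k0; apply/eqP; rewrite eq_le p_ge0 andbT leNgt; apply/negP => pk.
  by apply: h; exists k.
have := ex_a_neg; rewrite ltNge => /negP; apply.
apply: (@cvgn_ge _ 0 _ _ _ _ (step_sum_cvg ig_a)) => K _.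
apply: sumr_ge0 => k _.
have [k0|k0] := leP 0 (k%:Z - K%:Z); last by rewrite h// mul0r.
by rewrite mulr_ge0 ?p_ge0// ler0z.
Qed.

(** Without positive values [exp (lam * a) - 1] would be nonpositive on the support and negative at
    some negative value, against [phi lam = 1]. *)
Lemma p_pos : exists2 k, (0 < k)%R & 0 < p k.
Proof.
apply: contrapT => h; have {}h k : (0 < k)%R -> p k = 0.
  move=> k0; apply/eqP; rewrite eq_le p_ge0 andbT leNgt; apply/negP => pk.
  by apply: h; exists k.
have [k0 k0neg pk0] := p_neg.
pose g a : R := expR (lam * a%:~R) - 1.
have ig : Ig g by apply: itgB; [exact: ls_exp LS|exact: (ig_cst 1)].
have E : Ex g = 0.
  by rewrite exB ?ex_cst; [rewrite -/(phi lam) philam subrr|exact: ls_exp LS|exact: (ig_cst 1)].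
have gk0 : p k0 * g k0 < 0.
  rewrite pmulr_rlt0// subr_lt0 expR_lt1 pmulr_rlt0// ltrz0//.
suff : Ex g <= p k0 * g k0 by rewrite E leNgt gk0.
apply: (@cvgn_leq _ `|k0|%N _ _ _ _ (step_sum_cvg ig)) => K k0K.
have kP : (`|(k0 + K%:Z)%R| < K.*2.+1)%N by move: k0K; clear; lia.
have ak : k0 = (Ordinal kP)%:Z - K%:Z by rewrite /=; move: k0K; clear; lia.
rewrite /step_sum (bigD1 (Ordinal kP))//= -ak gerDl.
apply: sumr_le0 => k _; have [kk|kk] := leP (k%:Z - K%:Z) 0; last by rewrite h// mul0r.
apply: mulr_ge0_le0; first exact: p_ge0.
by rewrite subr_le0 expR_le1; apply: mulr_ge0_le0; rewrite ?(ltW lam0) ?lerz0.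
Qed.

Lemma cum_mid : cum (lam / 2) < 0.
Proof.
have Im : 0 <= lam / 2 <= lam by have l0 := lam0; apply/andP; split; lra.
have [k k0 pk] := p_neg.
rewrite /cum ln_lt0// phi_gt0//=.
(* Its expectation is [2 - 2 * phi (lam / 2)], and it is positive at a negative value charged by the
   law. *)
pose g a : R := (1 - expR (lam / 2 * a%:~R)) ^+ 2.
have gE a : g a = (1 + expR (lam * a%:~R)) - 2 * expR (lam / 2 * a%:~R).
  have -> : lam * a%:~R = lam / 2 * a%:~R + lam / 2 * a%:~R by field.
  by rewrite /g expRD; ring.
have i1 := ig_exp Im.
have ig : Ig g.
  have -> : (fun w => g (X w)) = fun w => (1 + expR (lam * (X w)%:~R)) - 2 * expR (lam / 2 * (X w)%:~R).
    by apply/funext => w; rewrite gE.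
  by apply: itgB; [exact: ig_edom|exact: itgZ].
have E : Ex g = 2 - 2 * phi (lam / 2).
  have -> : g = (fun a => edom a - 2 * expR (lam / 2 * a%:~R)) by apply/funext => a; rewrite gE.
  rewrite exB; [|exact: ig_edom|exact: itgZ].
  rewrite exZ// exD; [|exact: (ig_cst 1)|exact: ls_exp LS].
  by rewrite ex_cst -/(phi lam) philam -/(phi _); ring.
have := le_p_ex k ig (fun a => sqr_ge0 _); rewrite E => h.
have : 0 < p k * g k.
  rewrite mulr_gt0// exprn_even_gt0//= subr_eq0 eq_sym lt_eqF//.
  by rewrite expR_lt1 pmulr_rlt0 ?ltrz0// divr_gt0.
lra.
Qed.

Definition tw th a : R := p a * (expR (th * a%:~R) / phi th).

Lemma tw_ge0 th a : 0 <= th <= lam -> 0 <= tw th a.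
Proof. by move=> h; rewrite mulr_ge0 ?p_ge0// divr_ge0 ?expR_ge0// ltW// phi_gt0. Qed.

Lemma tw_stepE th K g : step_sum K (fun a => tw th a * g a) =
  (phi th)^-1 * step_sum K (fun a => p a * (expR (th * a%:~R) * g a)).
Proof. by rewrite -step_sumZl; apply: eq_step_sum => a _; rewrite /tw; ring. Qed.

Lemma tw_step_le1 th K : 0 <= th <= lam -> step_sum K (tw th) <= 1.
Proof.
move=> h; have := tw_stepE th K (fun=> 1).
have -> : step_sum K (fun a => tw th a * 1) = step_sum K (tw th).
  by apply: eq_step_sum => a _; rewrite mulr1.
move=> ->; rewrite mulrC ler_pdivrMr ?phi_gt0// mul1r.
have -> : step_sum K (fun a => p a * (expR (th * a%:~R) * 1)) =
   step_sum K (fun a => p a * expR (th * a%:~R)).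
  by apply: eq_step_sum => a _; rewrite mulr1.
by apply: step_sum_le_ex; [exact: ig_exp|move=> a; exact: expR_ge0].
Qed.

(** The transform is at most [phi (th + del) / phi th], which the supporting line of [log phi] at
    [th + del] bounds; hence the slopes at shifted tilts in [drift_lower]. *)
Lemma tw_chernoff th del K : 0 <= th <= lam -> 0 <= th + del <= lam ->
  step_sum K (fun a => tw th a * expR (del * a%:~R)) <= expR (del * mu (th + del)).
Proof.
move=> h hd; rewrite tw_stepE.
have -> : step_sum K (fun a => p a * (expR (th * a%:~R) * expR (del * a%:~R))) =
   step_sum K (fun a => p a * expR ((th + del) * a%:~R)).
  by apply: eq_step_sum => a _; rewrite -expRD -mulrDl.
apply: (@le_trans _ _ ((phi th)^-1 * phi (th + del))).
  rewrite ler_wpM2l ?invr_ge0 ?(ltW (phi_gt0 _))//.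
  by apply: step_sum_le_ex; [exact: ig_exp|move=> a; exact: expR_ge0].
rewrite -!expR_cum// -expRN -expRD ler_expR.
by have := cum_tangent hd h; lra.
Qed.

End tilting.

End Tilting.
Export Tilting.

Section trig_lipschitz.
Context {R : realType}.

Lemma cos_sin_lip (x y : R) : `|cos x - cos y| <= `|x - y| /\ `|sin x - sin y| <= `|x - y|.
Proof.
have e : (cos x - cos y) ^+ 2 + (sin x - sin y) ^+ 2 = 2 * (1 - cos (x - y)).
  rewrite cosB (_ : _ + _ = (cos x ^+ 2 + sin x ^+ 2) + (cos y ^+ 2 + sin y ^+ 2)
    - 2 * (cos x * cos y + sin x * sin y)); last by ring.
  by rewrite !cos2Dsin2; ring.
have h := onem_cos_le (x - y).
have e2 : `|x - y| ^+ 2 = (x - y) ^+ 2 by rewrite real_normK ?num_real.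
have s1 := sqr_ge0 (cos x - cos y); have s2 := sqr_ge0 (sin x - sin y).
split; rewrite -ler_sqr ?nnegrE// e2 real_normK ?num_real//; lra.
Qed.

End trig_lipschitz.

(** * Characteristic functions of tilted steps: decay and removal of the cut-off *)

Section characteristic_functions.
Context d (T : measurableType d) (R : realType) (P : probability T R)
  (X : T -> int) (lam : R).
Hypothesis LS : lattice_step P X lam.
Implicit Types (g h : int -> R) (a k : int) (u th : R).
Notation Ig g := (Itg P (fun w => g (X w))).
Notation Ex := (Ex P X).
Notation p := (pmass P X).
Notation phi := (phi P X).
Notation mu := (mu P X).
Notation cum := (cum P X).
Notation tw := (tw P X).
Let lam0 := ls_lam LS.
Let tg := @cum_tangent _ _ _ _ _ _ LS.

Definition chK (K : nat) th u : R[i] :=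
  step_sum K (fun a => (tw th a)%:C%C * cis (u * a%:~R)).

Lemma Re_chK K th u : complex.Re (chK K th u) = step_sum K (fun a => tw th a * cos (u * a%:~R)).
Proof. by rewrite /chK /step_sum Re_sum; apply: eq_bigr => k _; rewrite Re_realM. Qed.

Lemma Im_chK K th u : complex.Im (chK K th u) = step_sum K (fun a => tw th a * sin (u * a%:~R)).
Proof. by rewrite /chK /step_sum Im_sum; apply: eq_bigr => k _; rewrite Im_realM. Qed.

Lemma nc_sqr (z : R[i]) : nc z ^+ 2 = complex.Re z ^+ 2 + complex.Im z ^+ 2.
Proof. by rewrite ncE sqr_sqrtr// addr_ge0 ?sqr_ge0. Qed.

Lemma phi_le1 th : 0 <= th <= lam -> phi th <= 1.
Proof.
move=> h; rewrite -(expR_cum LS h) expR_le1.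
exact: (tangent_le0 lam0 tg (cum0 P X) (cumlam LS)).
Qed.

Lemma tw_ge th a : 0 <= th <= lam -> p a * expR (- (lam * `|a%:~R|)) <= tw th a.
Proof.
move=> h; rewrite ler_wpM2l ?p_ge0//.
have p0 := phi_gt0 LS h; rewrite ler_pdivlMr//.
apply: (@le_trans _ _ (expR (- (lam * `|a%:~R|)))).
  by rewrite ler_piMr ?expR_ge0 ?phi_le1.
rewrite ler_expR lerNl -mulrN; have /andP[t0 tl] := h.
apply: (@le_trans _ _ (th * `|a%:~R|)); last by rewrite ler_wpM2r.
by rewrite ler_wpM2l// -normrN ler_norm.
Qed.

(** The integers with this property form a subgroup that contains the differences of the support, so
    aperiodicity forces it to contain 1. The constants are uniform in the tilt and in the
    cut-off. *)
Definition decay_freq (g : int) : Prop := exists c : R, exists K0 : nat, 0 < c /\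
  forall K th u, (K0 <= K)%N -> 0 <= th <= lam ->
  c * (1 - cos (u * g%:~R)) <= 1 - nc (chK K th u) ^+ 2.

(** Symmetrisation: total mass squared minus squared modulus is the sum over pairs [(a, b)] of the
    weights times [1 - cos (u * (a - b))], of which only the pair [(k, n)] is kept. *)
Lemma decay_freq_diff k n : 0 < p k * p n -> decay_freq (k - n).
Proof.
move=> pkn.
pose w a := p a * expR (- (lam * `|a%:~R|)).
exists (w k * w n), (maxn `|k| `|n|); split.
  by rewrite /w mulrACA mulr_gt0// mulr_gt0 ?expR_gt0.
move=> K th u; rewrite geq_max => /andP[kK nK] hth.
have tw0 a := tw_ge0 LS a hth.
have kP : (`|(k + K%:Z)%R| < K.*2.+1)%N by move: kK; clear; lia.
have nP : (`|(n + K%:Z)%R| < K.*2.+1)%N by move: nK; clear; lia.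
pose ki := Ordinal kP; pose ni := Ordinal nP.
have ek : k = ki%:Z - K%:Z by rewrite /=; move: kK; clear; lia.
have en : n = ni%:Z - K%:Z by rewrite /=; move: nK; clear; lia.
rewrite nc_sqr Re_chK Im_chK.
set M := step_sum K (tw th).
have M1 : M <= 1 by exact: (tw_step_le1 LS K hth).
have M0 : 0 <= M by apply: sumr_ge0 => i _.
apply: (@le_trans _ _ (M ^+ 2 - (step_sum K (fun a => tw th a * cos (u * a%:~R)) ^+ 2 +
    step_sum K (fun a => tw th a * sin (u * a%:~R)) ^+ 2))); last first.
  by rewrite lerD2r expr_le1.
have E : M ^+ 2 - (step_sum K (fun a => tw th a * cos (u * a%:~R)) ^+ 2 +
    step_sum K (fun a => tw th a * sin (u * a%:~R)) ^+ 2) =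
  step_sum K (fun a => step_sum K (fun b => tw th a * tw th b * (1 - cos (u * (a - b)%:~R)))).
  rewrite /M /step_sum !expr2 !big_distrlr /= opprD addrA -!sumrB.
  apply: eq_bigr => i _; rewrite -!sumrB; apply: eq_bigr => j _.
  move: (i%:Z - K%:Z) (j%:Z - K%:Z) => a b.
  have -> : u * (a - b)%:~R = u * a%:~R - u * b%:~R by rewrite intrB mulrBr.
  by rewrite cosB; ring.
rewrite E /step_sum (bigD1 ki)//= (bigD1 ni)//= -addrA.
have t0 a b : 0 <= tw th a * tw th b * (1 - cos (u * (a - b)%:~R)).
  by apply: mulr_ge0; [apply: mulr_ge0; exact: tw0|exact: onem_cos_ge0].
apply: (@le_trans _ _ (tw th (ki%:Z - K%:Z) * tw th (ni%:Z - K%:Z) *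
   (1 - cos (u * ((ki%:Z - K%:Z) - (ni%:Z - K%:Z))%:~R)))); last first.
  rewrite lerDl addr_ge0//; first by apply: sumr_ge0 => *; exact: t0.
  by apply: sumr_ge0 => i _; apply: sumr_ge0 => *; exact: t0.
rewrite -ek -en ler_wpM2r ?onem_cos_ge0//.
have w0 a : 0 <= w a by rewrite mulr_ge0 ?p_ge0 ?expR_ge0.
by apply: ler_pM; rewrite ?w0//; exact: tw_ge.
Qed.

Lemma chK_le1 K th u : 0 <= th <= lam -> nc (chK K th u) <= 1.
Proof.
move=> hth; rewrite /chK; apply: le_trans (tw_step_le1 LS K hth).
rewrite /step_sum; elim/big_ind2: _ => [|x1 y1 x2 y2 h1 h2|k _].
- by rewrite Normc.normc0.
- by apply: (le_trans (ncD _ _)); exact: lerD.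
- by rewrite ncM nc_cis mulr1 nc_real ger0_norm// (tw_ge0 LS).
Qed.

Lemma decay_freq0 : decay_freq 0.
Proof.
exists 1, 0%N; split => // K th u _ hth.
by rewrite mulr0 cos0 subrr mulr0 subr_ge0 expr_le1 ?nc_ge0 ?chK_le1.
Qed.

Lemma decay_freqB (g1 g2 : int) : decay_freq g1 -> decay_freq g2 -> decay_freq (g1 - g2).
Proof.
move=> [c1 [K1 [c10 h1]]] [c2 [K2 [c20 h2]]].
exists (Num.min c1 c2 / 4), (maxn K1 K2); split.
  by rewrite divr_gt0// lt_min c10.
move=> K th u; rewrite geq_max => /andP[k1 k2] hth.
have {}h1 := h1 K th u k1 hth; have {}h2 := h2 K th u k2 hth.
have -> : u * (g1 - g2)%:~R = u * g1%:~R - u * g2%:~R by rewrite intrB mulrBr.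
set m := Num.min c1 c2.
have m1 : m <= c1 by rewrite ge_min lexx.
have m2 : m <= c2 by rewrite ge_min lexx orbT.
have m0 : 0 < m by rewrite lt_min c10.
have B := onem_cosB (u * g1%:~R) (u * g2%:~R).
have q1 := ler_wpM2r (onem_cos_ge0 (u * g1%:~R)) m1.
have q2 := ler_wpM2r (onem_cos_ge0 (u * g2%:~R)) m2.
have q3 := ler_wpM2l (ltW m0) B.
lra.
Qed.

Lemma decay_freqM (g q : int) : decay_freq g -> decay_freq (q * g).
Proof.
move=> hg; have hN x : decay_freq x -> decay_freq (- x).
  by move=> hx; rewrite -sub0r; apply: decay_freqB => //; exact: decay_freq0.
have hn (n : nat) : decay_freq (n%:Z * g).
  elim: n => [|n ih]; first by rewrite mul0r; exact: decay_freq0.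
  rewrite -addn1 PoszD mulrDl mul1r -[g in _ + g]opprK.
  by apply: decay_freqB => //; exact: hN.
by case: q => n; [exact: hn|rewrite NegzE mulNr; exact/hN/hn].
Qed.

(** The least positive element divides every element, hence all support differences, hence 1. If
    there were no positive element, all differences would vanish and 0 would divide 1. *)
Lemma decay_freq1 : decay_freq 1.
Proof.
have D k n := @decay_freq_diff k n.
have [_ _ gcd] := ls_gcd LS.
have [[g [g0 hg]]|none] := pselect (exists g : nat, (0 < g)%N /\ decay_freq g%:Z).
  have ex : exists n : nat, (0 < n)%N && `[< decay_freq n%:Z >].
    by exists g; rewrite g0; apply/asboolP.
  case: (ex_minnP ex) => m /andP[m0 /asboolP hm] mmin.
  have md x : decay_freq x -> (m%:Z %| x)%Z.
    move=> hx; apply/dvdz_mod0P.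
    have hr : decay_freq (x %% m)%Z.
      have -> : (x %% m)%Z = x - (x %/ m)%Z * m.
        by rewrite {2}(divz_eq x m) addrC addrA [- _ + _]addrC subrr add0r.
      by apply: decay_freqB => //; exact: decay_freqM.
    have m0' : m%:Z != 0 by move: m0; clear; lia.
    have r0 := modz_ge0 x m0'.
    have rm := ltz_mod x m0'.
    case: (x %% m)%Z r0 hr rm => // r _ hr rm.
    have [->//|rn0] := eqVneq r 0%N.
    have := mmin r; rewrite lt0n rn0/= => /(_ (asboolT hr)).
    by move: rm; rewrite /= ltz_nat => rm; rewrite leqNgt rm.
  have := gcd m; rewrite dvdz1 => /(_ _) h1.
  have : `|m%:Z|%N == 1%N.
    by apply: h1 => x [k [n [pk ->]]]; apply: md; exact: D.
  by move=> /eqP/= m1; move: hm; rewrite m1.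
have z x : decay_freq x -> x = 0.
  move=> hx; have [//|x0] := eqVneq x 0; exfalso; apply: none.
  exists `|x|%N; split; first by rewrite absz_gt0.
  have -> : (`|x|%N : int) = sgz x * x.
    exact: abszEsg.
  exact: decay_freqM.
have := gcd 0; rewrite dvd0z => h; exfalso.
have : (1 : int) == 0.
  by apply: h => x [k [n [pk ->]]]; rewrite dvd0z; apply/eqP/z/D.
by [].
Qed.

Lemma chK_decay : exists c : R, exists K0 : nat, 0 < c /\
  forall K th u, (K0 <= K)%N -> 0 <= th <= lam ->
  nc (chK K th u) <= expR (- (c * (1 - cos u))).
Proof.
have [c [K0 [c0 h]]] := decay_freq1.
exists (c / 2), K0; split; first by rewrite divr_gt0.
move=> K th u kK hth; have := h K th u kK hth; rewrite mulr1 => {}h.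
rewrite -ler_sqr ?nnegrE ?nc_ge0 ?expR_ge0//.
rewrite -expRM_natl.
have -> : 2%:R * - (c / 2 * (1 - cos u)) = - (c * (1 - cos u)) by field.
by apply: le_trans (expR_ge1Dx _); lra.
Qed.

Definition chF th u : R[i] := Complex (Ex (fun a => expR (th * a%:~R) * cos (u * a%:~R)) / phi th)
  (Ex (fun a => expR (th * a%:~R) * sin (u * a%:~R)) / phi th).

(** Controls the effect of the cut-off at [K] for all tilts and frequencies simultaneously, up to
    the factor [1 / phi th]. *)
Definition tail K : R := Ex (fun a => (K < `|a|)%N%:R * edom lam a).

Lemma tail_cvg : tail @ \oo --> (0 : R).
Proof.
have h : Ex (fun a => (K < `|a|)%N%:R * edom lam a) @[K --> \oo] --> Ex (fun=> 0).
  apply: (ex_dct LS (ig_edom LS)) => [K a|a].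
    rewrite normrM (@ger0_norm _ (edom _ _)) ?addr_ge0 ?expR_ge0//.
    by rewrite ler_piMl ?addr_ge0 ?expR_ge0//; case: (_ < _)%N; rewrite ?normr1 ?normr0.
  by apply: (@cvgn_cst _ `|a|%N) => K aK; rewrite ltnNge aK mul0r.
by rewrite ex_cst in h.
Qed.

Lemma ig_exp_bd th (h : int -> R) : 0 <= th <= lam -> (forall a, `|h a| <= 1) ->
  Ig (fun a => expR (th * a%:~R) * h a).
Proof.
move=> hth h1; apply: (ig_dom LS (ig_exp LS hth)) => a.
by rewrite normrM (ger0_norm (expR_ge0 _)) ler_piMr ?expR_ge0.
Qed.

Lemma ex_trunc_tail th K (h : int -> R) : 0 <= th <= lam -> (forall a, `|h a| <= 1) ->
  `|step_sum K (fun a => tw th a * h a) - Ex (fun a => expR (th * a%:~R) * h a) / phi th|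
   <= tail K / phi th.
Proof.
move=> hth h1; have p0 := phi_gt0 LS hth; have ig := ig_exp_bd hth h1.
rewrite tw_stepE (step_sumE LS)// mulrC -mulrBl normrM (@gtr0_norm _ (_^-1)) ?invr_gt0//.
rewrite ler_pM2r ?invr_gt0// -(exB (ig_trunc LS K ig) ig).
apply: int_abs_le; first exact: (mfun_X LS (fun a => truncf K (fun a => expR (th * a%:~R) * h a) a - expR (th * a%:~R) * h a)).
  apply: (ig_dom LS (ig_edom LS) (h := fun a => (K < `|a|)%N%:R * edom lam a)) => a.
  rewrite normrM (@ger0_norm _ (edom _ _)) ?addr_ge0 ?expR_ge0//.
  by rewrite ler_piMl ?addr_ge0 ?expR_ge0//; case: (_ < _)%N; rewrite ?normr1 ?normr0.
move=> w; rewrite /truncf; case: leqP => _; first by rewrite mul1r subrr normr0 mul0r.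
rewrite mul0r sub0r normrN mul1r normrM (ger0_norm (expR_ge0 _)).
apply: (@le_trans _ _ (expR (th * (X w)%:~R))); last exact: exp_le_edom.
by rewrite ler_piMr ?expR_ge0.
Qed.

Lemma ReB (z w : R[i]) : complex.Re (z - w) = complex.Re z - complex.Re w.
Proof. by case: z; case: w. Qed.

Lemma ImB (z w : R[i]) : complex.Im (z - w) = complex.Im z - complex.Im w.
Proof. by case: z; case: w. Qed.

Lemma chK_chF K th u : 0 <= th <= lam -> nc (chK K th u - chF th u) <= 2 * (tail K / phi th).
Proof.
move=> hth; apply: (le_trans (nc_le_ReIm _)); rewrite ReB ImB Re_chK Im_chK /=.
have h1 := @ex_trunc_tail th K (fun a => cos (u * a%:~R)) hth (fun a => cos_max _).
have h2 := @ex_trunc_tail th K (fun a => sin (u * a%:~R)) hth (fun a => sin_max _).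
by apply: (le_trans (lerD h1 h2)); lra.
Qed.

Lemma tail_ge0 K : 0 <= tail K.
Proof.
by apply: ex_ge0 => a; rewrite mulr_ge0// addr_ge0 ?expR_ge0.
Qed.

Lemma phi_lower : exists2 c0 : R, 0 < c0 & forall th, 0 <= th <= lam -> c0 <= phi th.
Proof.
exists (expR (- (slope_bound mu lam * lam))); first exact: expR_gt0.
move=> th hth; rewrite -(expR_cum LS hth) ler_expR.
have I0 : 0 <= (0 : R) <= lam by rewrite lexx ltW.
have := tangent_lipschitz lam0 tg hth I0.
rewrite cum0 !subr0 ler_norml => /andP[h _]; apply: le_trans h.
rewrite lerN2 ler_wpM2l ?(ltW (slope_bound_gt0 _ _))//.
by have /andP[t0 tl] := hth; rewrite ger0_norm.
Qed.

Lemma chF_limit th u (c : R) K0 : 0 <= th <= lam ->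
  (forall K, (K0 <= K)%N -> nc (chK K th u) <= c) -> nc (chF th u) <= c.
Proof.
move=> hth h; rewrite leNgt; apply/negP => cl.
have p0 := phi_gt0 LS hth.
have e0 : 0 < (nc (chF th u) - c) * phi th / 4.
  by rewrite divr_gt0// mulr_gt0// subr_gt0.
have [M hM] := cvgn_dist tail_cvg e0.
have := hM _ (leq_maxr K0 M); rewrite subr0 ger0_norm ?tail_ge0// => t1.
have := h _ (leq_maxl K0 M) => h1.
have := @chK_chF (maxn K0 M) th u hth; rewrite ncBC => h2.
have h3 : nc (chF th u) <= nc (chF th u - chK (maxn K0 M) th u) + nc (chK (maxn K0 M) th u).
  by apply: le_trans (ncD _ _); rewrite subrK.
have h4 : tail (maxn K0 M) / phi th <= (nc (chF th u) - c) / 4.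
  by rewrite ler_pdivrMr// [leRHS]mulrAC.
lra.
Qed.

Lemma chF_le1 th u : 0 <= th <= lam -> nc (chF th u) <= 1.
Proof. by move=> hth; apply: (@chF_limit _ _ _ 0) => // K _; exact: chK_le1. Qed.

Lemma chF_decay : exists c : R, exists K0 : nat, [/\ 0 < c,
  forall K th u, (K0 <= K)%N -> 0 <= th <= lam ->
  nc (chK K th u) <= expR (- (c * (1 - cos u))) &
  forall th u, 0 <= th <= lam -> nc (chF th u) <= expR (- (c * (1 - cos u)))].
Proof.
have [c [K0 [c0 h]]] := chK_decay; exists c, K0; split => // th u hth.
by apply: (chF_limit (K0 := K0)) => // K kK; exact: h.
Qed.

Lemma ex_diff_le th (h1 h2 : int -> R) (e : R) : 0 <= th <= lam -> 0 <= e ->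
  (forall a, `|h1 a| <= 1) -> (forall a, `|h2 a| <= 1) ->
  (forall a, `|h1 a - h2 a| <= e * `|a%:~R|) ->
  `|Ex (fun a => expR (th * a%:~R) * h1 a) - Ex (fun a => expR (th * a%:~R) * h2 a)| <=
  e * Ex (adom lam).
Proof.
move=> hth e0 b1 b2 hd.
rewrite -(exB (ig_exp_bd hth b1) (ig_exp_bd hth b2)) -exZ; last exact: ig_adom LS.
apply: int_abs_le.
- exact: (mfun_X LS (fun a => expR (th * a%:~R) * h1 a - expR (th * a%:~R) * h2 a)).
- exact: (itgZ e (ig_adom LS)).
- move=> w; rewrite -mulrBr normrM (ger0_norm (expR_ge0 _)).
  apply: (@le_trans _ _ (e * `|(X w)%:~R * expR (th * (X w)%:~R)|)).
    by rewrite normrM (ger0_norm (expR_ge0 _)) mulrC mulrA ler_wpM2r ?expR_ge0.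
  by rewrite ler_wpM2l// (abs_exp_le_adom LS).
Qed.

Lemma cont_lip (f : R -> R) (c : R) : 0 <= c -> (forall x y, `|f x - f y| <= c * `|x - y|) ->
  continuous f.
Proof.
move=> c0 h x; apply/cvgrPdist_le => e e0.
have c1 : 0 < c + 1 by rewrite ltr_wpDl.
apply/nbhs_ballP; exists (e / (c + 1)); first by rewrite /= divr_gt0.
move=> y; rewrite /ball/= => hy; apply: (le_trans (h x y)).
apply: (@le_trans _ _ ((c + 1) * `|x - y|)); first by rewrite ler_wpM2r// lerDl.
by rewrite mulrC -ler_pdivlMr// ltW.
Qed.

Lemma cont_chF th : 0 <= th <= lam ->
  continuous (fun u => complex.Re (chF th u)) /\ continuous (fun u => complex.Im (chF th u)).
Proof.
move=> hth; have p0 := phi_gt0 LS hth.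
have A0 : 0 <= Ex (adom lam).
  by apply: ex_ge0 => a; rewrite addr_ge0// mulr_ge0 ?sqr_ge0 ?expR_ge0.
have c0 : 0 <= Ex (adom lam) / phi th by rewrite divr_ge0// ltW.
split; apply: (cont_lip c0) => x y /=; rewrite -mulrBl normrM (@gtr0_norm _ (_^-1)) ?invr_gt0//;
  rewrite mulrAC ler_pM2r ?invr_gt0// mulrC; apply: ex_diff_le => // a;
  rewrite ?cos_max ?sin_max//.
- by apply: (le_trans (cos_sin_lip _ _).1); rewrite -mulrBl normrM.
- by apply: (le_trans (cos_sin_lip _ _).2); rewrite -mulrBl normrM.
Qed.

End characteristic_functions.

(** * Dominated convergence for Riemann sums *)

Section riemann_sums.
Context {R : realType}.
Notation leb := (@lebesgue_measure R).

(** Index [k] of the cell []k, k + 1]] that contains a positive [x]. Cells closed on the right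
    compare a point with a grid point at or above it, where a nonincreasing majorant is smaller. *)
Definition ceil_pred (x : R) : nat :=
  if (Num.Def.truncn x)%:R == x then (Num.Def.truncn x).-1 else Num.Def.truncn x.

Lemma ceil_predP x : 0 < x -> (ceil_pred x)%:R < x <= (ceil_pred x).+1%:R.
Proof.
move=> x0; have /andP[t1 t2] := truncn_itv (ltW x0).
rewrite /ceil_pred; case: eqP => [e|ne].
  have t0 : (0 < Num.Def.truncn x)%N by rewrite -(ltr_nat R) e.
  rewrite -{2 3}e prednK// lexx andbT.
  by rewrite -{2}(prednK t0) ltr_nat.
by rewrite (ltW t2) andbT lt_neqAle t1 andbT; apply/eqP.
Qed.

Definition cell (a b : R) (x : R) : R := indic `]a, b]%classic x.

Lemma cellE a b x : cell a b x = ((a < x <= b)%R : nat)%:R.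
Proof. by rewrite /cell indicE mem_setE in_itv. Qed.

Lemma cell_itg a b : Itg leb (cell a b).
Proof.
exact: integrable_indic_itv.
Qed.

Lemma int_cell a b : a <= b -> \int[leb]_x cell a b x = b - a.
Proof.
move=> ab; rewrite /Rintegral /cell integral_indic//= setIT lebesgue_measure_itv /= lte_fin.
by move: ab; rewrite le_eqVlt => /orP[/eqP ->|->//]; rewrite ltxx subrr.
Qed.

Definition step_fun (h c : R) (N : nat) (a : nat -> R) (x : R) : R :=
  \sum_(k < N) a k * cell (c + k%:R * h) (c + k.+1%:R * h) x.

Lemma step_fun_itg h c N a : Itg leb (step_fun h c N a).
Proof. by apply: itg_sum => k; apply: itgZ; exact: cell_itg. Qed.

Lemma int_step_fun h c N a : 0 < h ->
  \int[leb]_x step_fun h c N a x = h * \sum_(k < N) a k.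
Proof.
move=> h0; rewrite int_sum; last by move=> k; apply: itgZ; exact: cell_itg.
rewrite mulr_sumr; apply: eq_bigr => k _.
rewrite intZ; last exact: cell_itg.
rewrite int_cell; last by rewrite lerD2l ler_pM2r// ler_nat.
by rewrite -natr1; ring.
Qed.

Lemma step_fun_at h c N a x k : 0 < h -> (k < N)%N ->
  c + k%:R * h < x <= c + k.+1%:R * h -> step_fun h c N a x = a k.
Proof.
move=> h0 kN hx; rewrite /step_fun (bigD1 (Ordinal kN))//= cellE hx mulr1 big1 ?addr0// => j jk.
rewrite cellE; case: andP => [[x1 x2]|_]; last by rewrite mulr0.
case/andP: hx => y1 y2; case/eqP: jk; apply: val_inj => /=.
have l1 := lt_le_trans x1 y2; have l2 := lt_le_trans y1 x2.
rewrite ltrD2l ltr_pM2r// ltr_nat ltnS in l1; rewrite ltrD2l ltr_pM2r// ltr_nat ltnS in l2.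
by apply/eqP; rewrite eqn_leq l1 l2.
Qed.

Lemma step_fun_out h c N a x : 0 < h -> ~~ (c < x <= c + N%:R * h) -> step_fun h c N a x = 0.
Proof.
move=> h0 hx; rewrite /step_fun big1// => j _; rewrite cellE.
case: andP => [[x1 x2]|_]; last by rewrite mulr0.
case/negP: hx; apply/andP; split.
  by apply: le_lt_trans x1; rewrite lerDl mulr_ge0// ltW.
by apply: (le_trans x2); rewrite lerD2l ler_pM2r// ler_nat ltn_ord.
Qed.

Lemma step_fun_cell h c (x : R) : 0 < h -> c < x ->
  c + (ceil_pred ((x - c) / h))%:R * h < x <= c + (ceil_pred ((x - c) / h)).+1%:R * h.
Proof.
move=> h0 cx; have := @ceil_predP ((x - c) / h).
rewrite divr_gt0 ?subr_gt0// => /(_ isT).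
by rewrite ltr_pdivlMr// ler_pdivrMr// ltrBrDl lerBlDl.
Qed.

Definition unit_ind (x : R) : R := indic `]0, 1[%classic x.

Lemma unit_indE x : unit_ind x = ((0 < x < 1)%R : nat)%:R.
Proof. by rewrite /unit_ind indicE mem_setE in_itv. Qed.

(** The sum is the integral of a step function taking on each cell the value at its right end, so
    [W (i / n) <= W y] there and [W] may be unbounded at 0. Dropping [m] indices at either end does
    not affect the pointwise limits. *)
Lemma riemann_dct (F : nat -> nat -> R) (L W : R -> R) (m : nat) :
  (forall y z, 0 < y -> y <= z -> z < 1 -> W z <= W y) ->
  (forall y, 0 < y < 1 -> 0 <= W y) ->
  Itg leb (fun y => unit_ind y * W y) ->
  (forall n i, (m < i)%N -> (i < n - m)%N -> `|n%:R * F n i| <= W (i%:R / n%:R)) ->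
  (forall y (i_ : nat -> nat), 0 < y < 1 ->
    (forall n, (0 < n)%N -> y <= (i_ n)%:R / n%:R < y + n%:R^-1) ->
    n%:R * F n (i_ n) @[n --> \oo] --> L y) ->
  Itg leb (fun y => unit_ind y * L y) /\
  (\sum_(m.+1 <= i < n - m) F n i) @[n --> \oo] --> \int[leb]_y (unit_ind y * L y).
Proof.
move=> mono W0 iW dom lim.
pose mid n i := (m < i < n - m)%N.
pose G n y := step_fun n%:R^-1 0 n (fun k => (mid n k.+1)%:R * (n%:R * F n k.+1)) y.
have cp (n : nat) (y : R) : (0 < n)%N -> 0 < y ->
   (ceil_pred (n%:R * y))%:R * n%:R^-1 < y <= (ceil_pred (n%:R * y)).+1%:R * n%:R^-1.
  move=> n0 y0; have nn0 : (0 : R) < n%:R^-1 by rewrite invr_gt0 ltr0n.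
  by have := step_fun_cell nn0 y0; rewrite subr0 invrK !add0r [y * _]mulrC.
have GE n y : (0 < n)%N -> 0 < y < 1 ->
   let i := (ceil_pred (n%:R * y)).+1 in G n y = (mid n i)%:R * (n%:R * F n i).
  move=> n0 /andP[y0 y1] i; have nn0 : (0 : R) < n%:R^-1 by rewrite invr_gt0 ltr0n.
  have h := cp n y n0 y0.
  rewrite /G (@step_fun_at _ _ _ _ _ (ceil_pred (n%:R * y)))// ?add0r//.
  have /andP[h1 _] := h; have := lt_trans h1 y1.
  by rewrite -ltr_pdivlMr// invrK mul1r ltr_nat.
have G0 n y : ~~ (0 < y < 1) -> G n y = 0.
  move=> hy; have [->|n0] := posnP n; first by rewrite /G /step_fun big_ord0.
  have nn0 : (0 : R) < n%:R^-1 by rewrite invr_gt0 ltr0n.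
  have [y1|y1] := boolP (y == 1).
    rewrite /G (@step_fun_at _ _ _ _ _ n.-1)// ?prednK//.
      by rewrite /mid [(n < _)%N]ltnNge leq_subr/= andbF mul0r.
    rewrite (eqP y1) !add0r divff ?pnatr_eq0 -?lt0n// lexx andbT.
    by rewrite ltr_pdivrMr ?ltr0n// mul1r ltr_nat prednK.
  rewrite /G step_fun_out// add0r divff ?pnatr_eq0 -?lt0n//.
  apply: contra hy => /andP[-> y2] /=; by rewrite lt_neqAle y1.
have domG n y : `|G n y| <= unit_ind y * W y.
  rewrite unit_indE; case: (boolP (0 < y < 1)) => hy; last by rewrite G0// normr0 mul0r.
  rewrite mul1r; have [n0|n0] := posnP n.
    by rewrite n0 /G /step_fun big_ord0 normr0 W0.
  rewrite GE//; have /andP[y0 y1] := hy.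
  have /andP[h1 h2] := cp n y n0 y0.
  set i := (ceil_pred (n%:R * y)).+1 in h2 *.
  case: (boolP (mid n i)) => [/andP[mi im]|_]; last by rewrite mul0r normr0 W0.
  rewrite mul1r; apply: (le_trans (dom n i mi im)); apply: mono => //.
  rewrite ltr_pdivrMr ?ltr0n// mul1r ltr_nat; apply: leq_trans im _; exact: leq_subr.
have mG n : mfun_ (G n) by apply: (itg_measurable (step_fun_itg _ _ _ _)).
have limG y : G n y @[n --> \oo] --> unit_ind y * L y.
  rewrite unit_indE; case: (boolP (0 < y < 1)) => hy; last first.
    by rewrite mul0r; apply: (@cvgn_cst _ 0) => n _; rewrite G0.
  rewrite mul1r; have /andP[y0 y1] := hy.
  pose i_ n := (ceil_pred (n%:R * y)).+1.
  have iP n : (0 < n)%N -> y <= (i_ n)%:R / n%:R < y + n%:R^-1.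
    move=> n0; have /andP[h1 h2] := cp n y n0 y0.
    by rewrite h2/= /i_ -natr1 mulrDl mul1r ltrD2r.
  have [N1 hN1] := cvgn_dist (@invn_cvg0 R) (divr_gt0 y0 (ltr0n R m.+2)).
  have y1' : 0 < 1 - y by rewrite subr_gt0.
  have [N2 hN2] := cvgn_dist (@invn_cvg0 R) (divr_gt0 y1' (ltr0n R m.+2)).
  apply: (@cvgn_eq _ (maxn 1 (maxn N1 N2))) (lim y i_ hy iP) => n.
  rewrite !geq_max => /and3P[n0 n1 n2].
  rewrite GE// -/(i_ n) (_ : mid n (i_ n)) ?mul1r//.
  have nn0 : (0 : R) < n%:R by rewrite ltr0n.
  have /andP[h1 h2] := iP n n0.
  have inv0 : 0 < n%:R^-1 :> R by rewrite invr_gt0.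
  have := hN1 n n1; rewrite subr0 (gtr0_norm inv0) ler_pdivlMr ?ltr0n// => q1.
  have := hN2 n n2; rewrite subr0 (gtr0_norm inv0) ler_pdivlMr ?ltr0n// => q2.
  rewrite /mid; apply/andP; split.
    rewrite -(ltr_nat R) -(ltr_pM2r inv0); apply: lt_le_trans h1.
    apply: lt_le_trans q1; rewrite mulrC ltr_pM2l// ltr_nat//.
  rewrite ltn_subRL -(ltr_nat R) natrD -(ltr_pM2r inv0) divff ?gt_eqF// mulrDl.
  have : m.+2%:R * n%:R^-1 = m%:R * n%:R^-1 + 2 * n%:R^-1 :> R.
    by rewrite -addn2 natrD mulrDl.
  rewrite mulrC in q2; move=> e; rewrite e in q2; lra.
have [i1 c1] := @int_dct _ _ R leb G _ _ mG iW domG limG.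
split => //; apply: (cvgn_eq _ c1) => n n1.
rewrite int_step_fun ?invr_gt0 ?ltr0n//; last exact: n1.
rewrite mulr_sumr.
have nn0 : (n%:R : R) != 0 by rewrite pnatr_eq0 -lt0n.
transitivity (\sum_(k < n) (mid n k.+1)%:R * F n k.+1); last first.
  by apply: eq_bigr => k _; rewrite [RHS]mulrCA mulKf.
rewrite -(big_mkord xpredT (fun k => (mid n k.+1)%:R * F n k.+1)).
rewrite -(big_add1 _ _ 0 n.+1 xpredT (fun i => (mid n i)%:R * F n i)).
have [hm|hm] := leqP m.+1 (n - m); last first.
  have -> : \sum_(m.+1 <= i < n - m) F n i = 0 by rewrite big_geq// ltnW.
  symmetry; rewrite big1_seq// => i _.
  rewrite /mid; case: andP => [[q1 q2]|_]; last by rewrite mul0r.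
  by move: q1 q2 hm; clear; lia.
rewrite [RHS](@big_cat_nat _ _ _ m.+1)//=; last by move: hm n1; clear; lia.
rewrite [X in _ = X + _]big1_seq ?add0r; last first.
  by move=> i; rewrite mem_index_iota => /andP[_ /andP[_ im]]; rewrite /mid ltnNge -ltnS im/= mul0r.
rewrite [RHS](@big_cat_nat _ _ _ (n - m))//=; last by move: n1; clear; lia.
rewrite [X in _ = _ + X]big1_seq ?addr0; last first.
  by move=> i; rewrite mem_index_iota => /andP[_ /andP[im _]]; rewrite /mid [(i < _)%N]ltnNge im andbF mul0r.
by apply: eq_big_nat => i /andP[mi im]; rewrite /mid mi im mul1r.
Qed.

End riemann_sums.

(** * Centred characteristic functions and their second-order expansion *)

Module Centering.

Section centered_characteristic_functions.
Context d (T : measurableType d) (R : realType) (P : probability T R)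
  (X : T -> int) (lam : R).
Hypothesis LS : lattice_step P X lam.
Notation leb := (@lebesgue_measure R).
Implicit Types (a : int) (u th : R).
Notation Ig g := (Itg P (fun w => g (X w))).
Notation Ex := (Ex P X).
Notation phi := (phi P X).
Notation mu := (mu P X).
Notation chF := (chF P X).
Let lam0 := ls_lam LS.
Let tg := @cum_tangent _ _ _ _ _ _ LS.
Notation B := (slope_bound mu lam).

Lemma mu_bound th : 0 <= th <= lam -> `|mu th| <= B.
Proof. exact: (tangent_bound lam0 tg). Qed.

(** Dominates second moments for every tilt between [th] and [lam]: on negative values the smallest
    tilt is the worst, and for [th > 0] it still makes all moments finite there. *)
Definition ddom th a : R := (1 + a%:~R ^+ 2) * (if (0 <= a)%R then expR (lam * a%:~R) else expR (th * a%:~R)).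

Lemma ddom_ge0 th a : 0 <= ddom th a.
Proof. by rewrite mulr_ge0 ?addr_ge0 ?sqr_ge0//; case: ifP => _; exact: expR_ge0. Qed.

Lemma ig_ddom th : 0 < th -> Ig (ddom th).
Proof.
move=> t0; pose c := 1 + 4 / th ^+ 2.
have ig : Ig (fun a => c + (expR (lam * a%:~R) + a%:~R ^+ 2 * expR (lam * a%:~R))).
  by apply: itgD; [exact: ig_cst|exact: itgD (ls_exp LS) (ls_sqr LS)].
have c0 : 0 <= c by apply: addr_ge0 => //; apply: divr_ge0 => //; exact: sqr_ge0.
apply: (ig_dom LS (g := fun a => c + (expR (lam * a%:~R) + a%:~R ^+ 2 * expR (lam * a%:~R))) ig (h := ddom th)) => a.
rewrite ger0_norm ?ddom_ge0// /ddom.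
have [a0|a0] := leP 0 a.
  by rewrite mulrDl mul1r lerDr.
apply: (@le_trans _ _ c); last first.
  by rewrite lerDl addr_ge0 ?expR_ge0// mulr_ge0 ?sqr_ge0 ?expR_ge0.
pose x : R := - a%:~R; have x0 : 0 <= x by rewrite oppr_ge0 lerz0 ltW.
have -> : th * a%:~R = - (th * x) by rewrite /x; ring.
have -> : a%:~R ^+ 2 = x ^+ 2 by rewrite /x sqrrN.
have := @expR_ge_pow R 1 (th * x) (mulr_ge0 (ltW t0) x0) => h.
rewrite expRN ler_pdivrMr ?expR_gt0// /c mulrDl mul1r lerD//.
  by rewrite -expR0 ler_expR mulr_ge0// ltW.
have q : 0 <= 4 / th ^+ 2 by rewrite divr_ge0 ?sqr_ge0.
apply: le_trans (ler_wpM2l q h).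
by rewrite le_eqVlt; apply/orP; left; apply/eqP; field; rewrite gt_eqF.
Qed.

Lemma exp_le_ddom th th' a : th <= th' <= lam ->
  (1 + a%:~R ^+ 2) * expR (th' * a%:~R) <= ddom th a.
Proof.
move=> /andP[h1 h2]; rewrite ler_wpM2l ?addr_ge0 ?sqr_ge0//.
case: ifP => a0; rewrite ler_expR; first by rewrite ler_wpM2r ?ler0z.
by rewrite ler_wnM2r// lerz0 ltW// ltNge a0.
Qed.

Definition Vth th : R := Ex (fun a => expR (th * a%:~R) * (a%:~R - mu th) ^+ 2) / phi th.
(** [kap] is one minus the real part of the centred characteristic function [chC], and [io] bounds
    the modulus of its imaginary part ([Re_chC], [Im_chC]). *)
Definition kap th u : R := Ex (fun a => expR (th * a%:~R) * (1 - cos (u * (a%:~R - mu th)))) / phi th.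
Definition io th u : R := Ex (fun a => expR (th * a%:~R) *
  `|sin (u * (a%:~R - mu th)) - u * (a%:~R - mu th)|) / phi th.

Definition posth th := 0 < th <= lam.

Let posthW th : posth th -> 0 <= th <= lam.
Proof. by move=> /andP[h ->]; rewrite ltW. Qed.

Lemma sqr_shift_le th a : 0 <= th <= lam ->
  (a%:~R - mu th) ^+ 2 <= 2 * (1 + B ^+ 2) * (1 + a%:~R ^+ 2).
Proof.
move=> h; have b := mu_bound h.
have b2 : mu th ^+ 2 <= B ^+ 2.
  by rewrite -(real_normK (num_real (mu th))) ler_sqr ?nnegrE// (le_trans _ b).
have s1 := sqr_ge0 (a%:~R + mu th); have s2 := sqr_ge0 (a%:~R : R).
have s3 := sqr_ge0 B.
have s4 : 0 <= B ^+ 2 * a%:~R ^+ 2 by rewrite mulr_ge0.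
have e : (a%:~R - mu th) ^+ 2 = 2 * a%:~R ^+ 2 + 2 * mu th ^+ 2 - (a%:~R + mu th) ^+ 2 by ring.
rewrite e; move: b2 s1 s2 s3 s4.
set p := a%:~R ^+ 2; set q := mu th ^+ 2; set r := B ^+ 2; set t := (_ + mu th) ^+ 2.
move=> *; nra.
Qed.

Let CB := 2 * (1 + B ^+ 2).
Let CB0 : 0 <= CB. Proof. by rewrite mulr_ge0// addr_ge0// sqr_ge0. Qed.

Lemma ig_sqr_shift th : posth th -> Ig (fun a => expR (th * a%:~R) * (a%:~R - mu th) ^+ 2).
Proof.
move=> h; have /andP[t0 tl] := h.
apply: (ig_dom LS (g := fun a => CB * ddom th a) (itgZ CB (ig_ddom t0)) (h := fun a => expR (th * a%:~R) * (a%:~R - mu th) ^+ 2)) => a.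
rewrite (ger0_norm (mulr_ge0 (expR_ge0 _) (sqr_ge0 _))).
apply: (@le_trans _ _ (CB * ((1 + a%:~R ^+ 2) * expR (th * a%:~R)))).
  by rewrite mulrC mulrA ler_wpM2r ?expR_ge0 ?sqr_shift_le ?posthW.
by rewrite ler_wpM2l// exp_le_ddom// lexx.
Qed.

Lemma ig_kap th u : 0 <= th <= lam -> Ig (fun a => expR (th * a%:~R) * (1 - cos (u * (a%:~R - mu th)))).
Proof.
move=> h; apply: (ig_dom LS (g := fun a => 2 * expR (th * a%:~R)) (itgZ 2 (ig_exp LS h)) (h := fun a => expR (th * a%:~R) * (1 - cos (u * (a%:~R - mu th))))) => a.
rewrite ger0_norm ?mulr_ge0 ?expR_ge0 ?onem_cos_ge0// mulrC ler_wpM2r ?expR_ge0//.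
by have := cos_geN1 (u * (a%:~R - mu th)); lra.
Qed.

Lemma ig_io th u : posth th -> Ig (fun a => expR (th * a%:~R) *
  `|sin (u * (a%:~R - mu th)) - u * (a%:~R - mu th)|).
Proof.
move=> h; apply: (ig_dom LS (g := fun a => u ^+ 2 * (expR (th * a%:~R) * (a%:~R - mu th) ^+ 2)) (itgZ (u ^+ 2) (ig_sqr_shift h)) (h := fun a => expR (th * a%:~R) *
  `|sin (u * (a%:~R - mu th)) - u * (a%:~R - mu th)|)) => a.
rewrite ger0_norm ?mulr_ge0 ?expR_ge0// mulrCA ler_wpM2l ?expR_ge0//.
by apply: (le_trans (sin_sub_le2 _)); rewrite exprMn.
Qed.

Lemma kap_ge0 th u : 0 <= th <= lam -> 0 <= kap th u.
Proof.
move=> h; rewrite divr_ge0 ?(ltW (phi_gt0 LS h))//; apply: ex_ge0 => a.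
by rewrite mulr_ge0 ?expR_ge0 ?onem_cos_ge0.
Qed.

Lemma io_ge0 th u : 0 <= th <= lam -> 0 <= io th u.
Proof.
move=> h; rewrite divr_ge0 ?(ltW (phi_gt0 LS h))//; apply: ex_ge0 => a.
by rewrite mulr_ge0 ?expR_ge0.
Qed.

Lemma Vth_ge0 th : 0 <= th <= lam -> 0 <= Vth th.
Proof.
move=> h; rewrite divr_ge0 ?(ltW (phi_gt0 LS h))//; apply: ex_ge0 => a.
by rewrite mulr_ge0 ?expR_ge0 ?sqr_ge0.
Qed.

Lemma kap_le th u : posth th -> kap th u <= u ^+ 2 * Vth th.
Proof.
move=> h; rewrite /kap /Vth mulrA ler_pM2r ?invr_gt0 ?(phi_gt0 LS (posthW h))//.
rewrite -(exZ _ (ig_sqr_shift h)); apply: (ex_le (ig_kap u (posthW h)) (itgZ _ (ig_sqr_shift h))) => a.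
rewrite mulrCA ler_wpM2l ?expR_ge0//; apply: (le_trans (onem_cos_le _)).
by rewrite exprMn; have := mulr_ge0 (sqr_ge0 u) (sqr_ge0 (a%:~R - mu th)); lra.
Qed.

Lemma io_le th u : posth th -> io th u <= u ^+ 2 * Vth th.
Proof.
move=> h; rewrite /io /Vth mulrA ler_pM2r ?invr_gt0 ?(phi_gt0 LS (posthW h))//.
rewrite -(exZ _ (ig_sqr_shift h)); apply: (ex_le (ig_io u h) (itgZ _ (ig_sqr_shift h))) => a.
rewrite mulrCA ler_wpM2l ?expR_ge0//; apply: (le_trans (sin_sub_le2 _)).
by rewrite exprMn.
Qed.

Definition chC th u : R[i] := chF th u * cis (- (u * mu th)).

Lemma Re_chC th u : 0 <= th <= lam -> complex.Re (chC th u) = 1 - kap th u.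
Proof.
move=> h; have p0 := phi_gt0 LS h.
have ic := @ig_exp_bd _ _ _ _ _ _ LS th (fun a => cos (u * a%:~R)) h (fun a => cos_max _).
have is_ := @ig_exp_bd _ _ _ _ _ _ LS th (fun a => sin (u * a%:~R)) h (fun a => sin_max _).
rewrite /chC /chF /= cosN sinN.
have e1 : phi th / phi th = 1 by rewrite divff// gt_eqF.
rewrite /kap -[X in _ = X - _]e1 -mulrBl -(exB (ig_exp LS h) (ig_kap u h)).
transitivity ((cos (u * mu th) * Ex (fun a => expR (th * a%:~R) * cos (u * a%:~R)) +
  sin (u * mu th) * Ex (fun a => expR (th * a%:~R) * sin (u * a%:~R))) / phi th); first by ring.
rewrite -(exZ _ ic) -(exZ _ is_) -(exD (itgZ _ ic) (itgZ _ is_)); congr (_ / _).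
congr Tilting.Ex; apply/funext => a; rewrite (mulrBr u) cosB; ring.
Qed.

Lemma Im_chC th u : posth th -> `|complex.Im (chC th u)| <= io th u.
Proof.
move=> hp; have h := posthW hp; have p0 := phi_gt0 LS h.
have ic := @ig_exp_bd _ _ _ _ _ _ LS th (fun a => cos (u * a%:~R)) h (fun a => cos_max _).
have is_ := @ig_exp_bd _ _ _ _ _ _ LS th (fun a => sin (u * a%:~R)) h (fun a => sin_max _).
have ia := ig_abs_exp LS h; have ie := ig_exp LS h.
(* The centred variable has mean 0, so its linear term may be subtracted from the sine at no
   cost. *)
have z : u * Ex (fun a => a%:~R * expR (th * a%:~R)) - u * mu th * phi th = 0.
  by rewrite /mu -mulrA divfK ?subrr// gt_eqF.
have -> : complex.Im (chC th u) = Ex (fun a => expR (th * a%:~R) *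
  (sin (u * (a%:~R - mu th)) - u * (a%:~R - mu th))) / phi th.
  rewrite /chC /chF /= cosN sinN.
  transitivity (((cos (u * mu th) * Ex (fun a => expR (th * a%:~R) * sin (u * a%:~R)) -
    sin (u * mu th) * Ex (fun a => expR (th * a%:~R) * cos (u * a%:~R))) -
    (u * Ex (fun a => a%:~R * expR (th * a%:~R)) - u * mu th * phi th)) / phi th).
    by rewrite z subr0; ring.
  rewrite -(exZ _ ic) -(exZ _ is_) -(exZ _ ia) -(exZ _ ie).
  rewrite -(exB (itgZ _ is_) (itgZ _ ic)) -(exB (itgZ _ ia) (itgZ _ ie)).
  rewrite -(exB (itgB (itgZ _ is_) (itgZ _ ic)) (itgB (itgZ _ ia) (itgZ _ ie))).
  congr (_ / _); congr Tilting.Ex; apply/funext => a; rewrite (mulrBr u a%:~R) sinB; ring.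
rewrite normrM (@gtr0_norm _ (_^-1)) ?invr_gt0// ler_pM2r ?invr_gt0//.
apply: int_abs_le; last first.
- by move=> w; rewrite normrM (ger0_norm (expR_ge0 _)).
- exact: (ig_io u hp).
- exact: (mfun_X LS (fun a => expR (th * a%:~R) *
  (sin (u * (a%:~R - mu th)) - u * (a%:~R - mu th)))).
Qed.

Lemma nc_chC_le1 th u : 0 <= th <= lam -> nc (chC th u) <= 1.
Proof. by move=> h; rewrite ncM nc_cis mulr1 (chF_le1 LS). Qed.

Lemma kap_le2 th u : 0 <= th <= lam -> kap th u <= 2.
Proof.
move=> h; have := le_trans (nc_Re _) (nc_chC_le1 u h).
by rewrite Re_chC// ler_norml => /andP[h1 _]; lra.
Qed.

(** Uses [1 - k <= exp (- k) <= 1 - k + k ^ 2] for the real part. Summed over a path at the rescaled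
    frequencies, the error tends to 0 ([io_sum]). *)
Lemma chC_expR th u : posth th ->
  nc (chC th u - (expR (- kap th u))%:C%C) <= io th u + kap th u ^+ 2.
Proof.
move=> hp; have h := posthW hp.
apply: (le_trans (nc_le_ReIm _)); rewrite ReB ImB.
have -> : complex.Re ((expR (- kap th u))%:C%C) = expR (- kap th u) by [].
have -> : complex.Im ((expR (- kap th u))%:C%C) = 0 by [].
rewrite subr0 Re_chC// addrC lerD ?Im_chC//.
 have k0 := kap_ge0 u h; set k := kap th u in k0 *.
have e1 := expR_ge1Dx (- k).
rewrite ler_norml; apply/andP; split; last by have := sqr_ge0 k; lra.
have := expRN_le_inv k0 => e2.
have : (1 + k)^-1 <= 1 - k + k ^+ 2.
  by rewrite -[leLHS]mul1r ler_pdivrMr; [have : 0 <= k ^+ 3 by rewrite exprn_ge0|];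
    rewrite ?exprS; lra.
lra.
Qed.

Lemma cvgn_exp (u : nat -> R) (l : R) k : u @ \oo --> l -> u n ^+ k @[n --> \oo] --> l ^+ k.
Proof.
move=> h; elim: k => [|k ih]; first by rewrite expr0; under eq_fun do rewrite expr0; exact: cvg_cst.
by rewrite exprS; under eq_fun do rewrite exprS; exact: cvgM.
Qed.

Section pointwise_limits.
Variables (th : R) (th_ u_ : nat -> R) (w C : R).
Hypothesis th0 : 0 < th.
Hypothesis thl : th <= lam.
Hypothesis th_ge : forall n, th <= th_ n <= lam.
Hypothesis th_cvg : th_ @ \oo --> th.
Hypothesis u_bd : forall n, `|Num.sqrt n%:R * u_ n| <= C.
Hypothesis u_cvg : Num.sqrt n%:R * u_ n @[n --> \oo] --> w.

Let pth n : posth (th_ n).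
Proof. by have /andP[h1 h2] := th_ge n; rewrite /posth h2 (lt_le_trans th0). Qed.
Let pth0 : posth th. Proof. by rewrite /posth th0 thl. Qed.
Let C0 : 0 <= C. Proof. exact: le_trans (u_bd 0). Qed.

Lemma cvg_expM a : expR (th_ n * a%:~R) @[n --> \oo] --> expR (th * a%:~R).
Proof.
apply: continuous_cvg; first exact: continuous_expR.
by apply: cvgM => //; exact: cvg_cst.
Qed.

Lemma phi_cvg : phi (th_ n) @[n --> \oo] --> phi th.
Proof.
apply: (ex_dct LS (g := ddom th) (ig_ddom th0) (h_ := fun n a => expR (th_ n * a%:~R))) => [n a|a].
  rewrite ger0_norm ?expR_ge0//; apply: le_trans (exp_le_ddom _ (th_ge n)).
  by rewrite ler_peMl ?expR_ge0// lerDl sqr_ge0.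
exact: cvg_expM.
Qed.

Lemma mu_cvg : mu (th_ n) @[n --> \oo] --> mu th.
Proof.
apply: cvgM; last first.
  by apply: cvgV; [rewrite gt_eqF// (phi_gt0 LS (posthW pth0))|exact: phi_cvg].
apply: (ex_dct LS (g := ddom th) (ig_ddom th0) (h_ := fun n a => a%:~R * expR (th_ n * a%:~R))) => [n a|a].
  rewrite normrM (ger0_norm (expR_ge0 _)); apply: le_trans (exp_le_ddom _ (th_ge n)).
  rewrite ler_wpM2r ?expR_ge0//; apply: (le_trans (int_abs_le_sqr LS _)).
  by rewrite lerDr.
by apply: cvgM; [exact: cvg_cst|exact: cvg_expM].
Qed.

Let y_ n a := u_ n * (a%:~R - mu (th_ n)).

Let yE n a : Num.sqrt n%:R * y_ n a = (Num.sqrt n%:R * u_ n) * (a%:~R - mu (th_ n)).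
Proof. by rewrite mulrA. Qed.

Let y_cvg a : Num.sqrt n%:R * y_ n a @[n --> \oo] --> w * (a%:~R - mu th).
Proof.
under eq_fun do rewrite yE.
by apply: cvgM => //; apply: cvgB; [exact: cvg_cst|exact: mu_cvg].
Qed.

Let ny2 n a : n%:R * y_ n a ^+ 2 = (Num.sqrt n%:R * y_ n a) ^+ 2.
Proof. by rewrite [in RHS]exprMn sqr_sqrtr. Qed.

Let ny2_le n a : n%:R * y_ n a ^+ 2 <= C ^+ 2 * (a%:~R - mu (th_ n)) ^+ 2.
Proof.
rewrite ny2 yE exprMn ler_wpM2r ?sqr_ge0//.
by rewrite -(real_normK (num_real _)) ler_sqr ?nnegrE.
Qed.

Lemma sqrt_inv_cvg : (Num.sqrt n%:R)^-1 @[n --> \oo] --> (0 : R).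
Proof.
apply: cvgn_le => e e0; have [N hN] := cvgn_dist (@invn_cvg0 R) (exprn_gt0 2 e0).
exists N => n Nn; have := hN n Nn; rewrite !subr0 => h.
rewrite -ler_sqr ?nnegrE ?(ltW e0)// real_normK ?num_real// exprVn sqr_sqrtr//.
by apply: le_trans h; exact: ler_norm.
Qed.

Let dom1 n a : n%:R * (expR (th_ n * a%:~R) * y_ n a ^+ 2) <= C ^+ 2 * CB * ddom th a.
Proof.
rewrite mulrCA; apply: (@le_trans _ _ (expR (th_ n * a%:~R) * (C ^+ 2 * (CB * (1 + a%:~R ^+ 2))))).
  rewrite ler_wpM2l ?expR_ge0//; apply: (le_trans (ny2_le n a)).
  by rewrite ler_wpM2l ?sqr_ge0// sqr_shift_le// posthW.
rewrite -mulrA mulrCA ler_wpM2l ?sqr_ge0// mulrCA ler_wpM2l//.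
by rewrite mulrC exp_le_ddom.
Qed.

(** Second-order expansion of the cosine under dominated convergence. The tilts [th_ n] lie above
    their limit, so [ddom th] dominates all of them. *)
Lemma kap_cvg : n%:R * kap (th_ n) (u_ n) @[n --> \oo] --> w ^+ 2 * Vth th / 2.
Proof.
have K n : n%:R * kap (th_ n) (u_ n) =
   Ex (fun a => n%:R * (expR (th_ n * a%:~R) * (1 - cos (y_ n a)))) / phi (th_ n).
  by rewrite /kap mulrA (exZ _ (ig_kap (u_ n) (posthW (pth n)))).
under eq_fun do rewrite K.
have -> : w ^+ 2 * Vth th / 2 = Ex (fun a => (w ^+ 2 / 2) * (expR (th * a%:~R) * (a%:~R - mu th) ^+ 2)) / phi th.
  by rewrite (exZ _ (ig_sqr_shift pth0)) /Vth; ring.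
apply: cvgM; last first.
  by apply: cvgV; [rewrite gt_eqF// (phi_gt0 LS (posthW pth0))|exact: phi_cvg].
apply: (ex_dct LS (g := fun a => C ^+ 2 * CB * ddom th a) (itgZ (C ^+ 2 * CB) (ig_ddom th0)) (h_ := fun n a => n%:R * (expR (th_ n * a%:~R) * (1 - cos (y_ n a))))) => [n a|a].
  rewrite ger0_norm ?mulr_ge0 ?expR_ge0 ?onem_cos_ge0//; apply: le_trans (dom1 n a).
  rewrite ler_wpM2l// ler_wpM2l ?expR_ge0//; apply: (le_trans (onem_cos_le _)).
  by rewrite ler_pdivrMr// ler_peMr ?sqr_ge0//; lra.
have -> : w ^+ 2 / 2 * (expR (th * a%:~R) * (a%:~R - mu th) ^+ 2) =
  expR (th * a%:~R) * ((w * (a%:~R - mu th)) ^+ 2 / 2) by rewrite exprMn; ring.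
under eq_fun do rewrite mulrCA.
apply: cvgM; first exact: cvg_expM.
have -> : (fun n => n%:R * (1 - cos (y_ n a))) =
  (fun n => (Num.sqrt n%:R * y_ n a) ^+ 2 / 2 + n%:R * (1 - cos (y_ n a) - y_ n a ^+ 2 / 2)).
  by apply/funext => n; rewrite -ny2; ring.
rewrite -[X in _ --> X]addr0; apply: cvgD.
  apply: cvgM; last exact: cvg_cst.
  by apply: cvgn_exp; exact: y_cvg.
have lim : (Num.sqrt n%:R * y_ n a) ^+ 4 / 24 * (n%:R)^-1 @[n --> \oo] --> (w * (a%:~R - mu th)) ^+ 4 / 24 * 0.
  apply: cvgM; last exact: invn_cvg0.
  apply: cvgM; last exact: cvg_cst.
  by apply: cvgn_exp; exact: y_cvg.
rewrite mulr0 in lim; apply: (@cvgn_squeeze0 _ 1 _ _ _ lim) => n n0.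
have nn0 : (0 : R) < n%:R by rewrite ltr0n.
have cosq (y : R) : `|1 - cos y - y ^+ 2 / 2| <= y ^+ 4 / 24.
  have -> : 1 - cos y = 2 * sin (y / 2) ^+ 2.
    have h2 : (y / 2) *+ 2 = y by rewrite -mulr_natr; field.
    by rewrite -{1}h2 cos_mulr2n cos2sin2; ring.
  have h := sin_sub_le (y / 2); have h' := norm_sin_le (y / 2).
  have -> : 2 * sin (y / 2) ^+ 2 - y ^+ 2 / 2 = 2 * ((sin (y / 2) - y / 2) * (sin (y / 2) + y / 2)) by field.
  rewrite normrM (@ger0_norm _ 2)// normrM.
  have q : `|sin (y / 2) + y / 2| <= 2 * `|y / 2|.
    by apply: (le_trans (ler_normD _ _)); lra.
  have := ler_pM (normr_ge0 _) (normr_ge0 _) h q.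
  have -> : y ^+ 4 / 24 = 2 * (`|y / 2| ^+ 3 / 6 * (2 * `|y / 2|)).
    have -> : 2 * (`|y / 2| ^+ 3 / 6 * (2 * `|y / 2|)) = (`|y / 2| ^+ 2) ^+ 2 * (2 / 3) by field.
    by rewrite real_normK ?num_real//; field.
  by move=> ?; rewrite ler_pM2l.
have -> : (Num.sqrt n%:R * y_ n a) ^+ 4 = n%:R ^+ 2 * y_ n a ^+ 4.
  by rewrite [LHS]exprMn -[in RHS](@sqr_sqrtr _ n%:R)// -exprM.
rewrite normrM ger0_norm//.
apply: (le_trans (ler_wpM2l (ltW nn0) (cosq _))).
by rewrite le_eqVlt; apply/orP; left; apply/eqP; field; rewrite gt_eqF.
Qed.

(** The cubic bound on [sin y - y] gives the pointwise limit, the quadratic one the domination; no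
    third moment is needed. *)
Lemma io_cvg : n%:R * io (th_ n) (u_ n) @[n --> \oo] --> (0 : R).
Proof.
have K n : n%:R * io (th_ n) (u_ n) =
   Ex (fun a => n%:R * (expR (th_ n * a%:~R) * `|sin (y_ n a) - y_ n a|)) / phi (th_ n).
  by rewrite /io mulrA (exZ _ (ig_io (u_ n) (pth n))).
under eq_fun do rewrite K.
have -> : 0 = Ex (fun=> 0) / phi th :> R by rewrite ex_cst mul0r.
apply: cvgM; last first.
  by apply: cvgV; [rewrite gt_eqF// (phi_gt0 LS (posthW pth0))|exact: phi_cvg].
apply: (ex_dct LS (g := fun a => C ^+ 2 * CB * ddom th a) (itgZ (C ^+ 2 * CB) (ig_ddom th0)) (h_ := fun n a => n%:R * (expR (th_ n * a%:~R) * `|sin (y_ n a) - y_ n a|))) => [n a|a].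
  rewrite ger0_norm ?mulr_ge0 ?expR_ge0//; apply: le_trans (dom1 n a).
  by rewrite ler_wpM2l// ler_wpM2l ?expR_ge0//; exact: sin_sub_le2.
under eq_fun do rewrite mulrCA.
rewrite -(mulr0 (expR (th * a%:~R))); apply: cvgM; first exact: cvg_expM.
have lim : `|Num.sqrt n%:R * y_ n a| ^+ 3 / 6 * (Num.sqrt n%:R)^-1 @[n --> \oo] --> `|w * (a%:~R - mu th)| ^+ 3 / 6 * 0.
  apply: cvgM; last exact: sqrt_inv_cvg.
  apply: cvgM; last exact: cvg_cst.
  by apply: cvgn_exp; apply: cvg_norm; exact: y_cvg.
rewrite mulr0 in lim; apply: (@cvgn_squeeze0 _ 1 _ _ _ lim) => n n0.
have nn0 : (0 : R) < n%:R by rewrite ltr0n.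
have s0 : 0 < Num.sqrt (n%:R : R) by rewrite sqrtr_gt0.
rewrite normrM ger0_norm// normr_id normrM (gtr0_norm s0).
apply: (le_trans (ler_wpM2l (ltW nn0) (sin_sub_le _))).
have e : n%:R = Num.sqrt (n%:R : R) ^+ 2 by rewrite sqr_sqrtr.
rewrite {1}e le_eqVlt; apply/orP; left; apply/eqP; field; rewrite gt_eqF//.
Qed.

End pointwise_limits.

End centered_characteristic_functions.

End Centering.
Export Centering.

(** * Second moment of the negative part as a function of the tilt *)

Section negative_part_moments.
Context d (T : measurableType d) (R : realType) (P : probability T R)
  (X : T -> int) (lam : R).
Hypothesis LS : lattice_step P X lam.
Notation leb := (@lebesgue_measure R).
Implicit Types (a : int) (u th : R).
Notation Ig g := (Itg P (fun w => g (X w))).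
Notation Ex := (Ex P X).
Notation phi := (phi P X).
Notation mu := (mu P X).
Notation Vth := (Vth P X).
Notation kap := (kap P X).
Notation io := (io P X).
Let lam0 := ls_lam LS.
Let tg := @cum_tangent _ _ _ _ _ _ LS.
Notation B := (slope_bound mu lam).

Definition negdom th a : R := (a < 0)%R%:R * (a%:~R ^+ 2 * expR (th * a%:~R)).
(** The part of the variance that may be unbounded as the tilt decreases to 0; the remainder is
    bounded uniformly ([Vth_bound]). Being nonincreasing, it can serve as majorant in
    [riemann_dct]. *)
Definition Mneg th : R := Ex (negdom th).

Lemma negdom_ge0 th a : 0 <= negdom th a.
Proof. by rewrite mulr_ge0// mulr_ge0 ?sqr_ge0 ?expR_ge0. Qed.

Lemma Mneg_ge0 th : 0 <= Mneg th.
Proof. by apply: ex_ge0 => a; exact: negdom_ge0. Qed.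

Lemma ig_negdom th : 0 < th -> Ig (negdom th).
Proof.
move=> t0; apply: (ig_dom LS (g := ddom lam th) (ig_ddom LS t0) (h := negdom th)) => a.
rewrite ger0_norm ?negdom_ge0// /negdom /ddom; case: ltP => a0.
  by rewrite mul1r ler_wpM2r ?expR_ge0// lerDr.
by rewrite mul0r mulr_ge0 ?expR_ge0// addr_ge0// sqr_ge0.
Qed.

Lemma Mneg_nonincr th th' : 0 < th -> th <= th' -> Mneg th' <= Mneg th.
Proof.
move=> t0 tt; apply: (ex_le (ig_negdom (lt_le_trans t0 tt)) (ig_negdom t0)) => a.
rewrite /negdom; case: ltP => a0; last by rewrite !mul0r.
by rewrite !mul1r ler_wpM2l ?sqr_ge0// ler_expR ler_wnM2r// lerz0 ltW.
Qed.

Lemma Vth_bound : exists2 C : R, 0 <= C &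
  forall th, 0 < th <= lam -> Vth th <= C * (1 + Mneg th).
Proof.
have [c0 c00 hc] := phi_lower LS.
pose g a : R := 1 + (expR (lam * a%:~R) + a%:~R ^+ 2 * expR (lam * a%:~R)).
have ig : Ig g.
  by apply: itgD; [exact: ig_cst|exact: itgD (ls_exp LS) (ls_sqr LS)].
have g0 a : 0 <= g a by rewrite addr_ge0// addr_ge0 ?expR_ge0// mulr_ge0 ?sqr_ge0 ?expR_ge0.
have Eg0 : 0 <= Ex g by exact: ex_ge0.
pose CB := 2 * (1 + B ^+ 2).
have CB0 : 0 <= CB by rewrite mulr_ge0// addr_ge0// sqr_ge0.
have m0 : 0 <= c0^-1 * CB * (1 + Ex g).
  by apply: mulr_ge0; [apply: mulr_ge0 => //; rewrite invr_ge0 ltW|rewrite addr_ge0].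
exists (c0^-1 * CB * (1 + Ex g)) => // th ht; have /andP[t0 tl] := ht.
have ht' : 0 <= th <= lam by rewrite tl ltW.
have p0 := phi_gt0 LS ht'.
have M0 := Mneg_ge0 th.
have h : Ex (fun a => expR (th * a%:~R) * (a%:~R - mu th) ^+ 2) <= CB * (Ex g + Mneg th).
  have ign := ig_negdom t0.
  rewrite -(exD ig ign) -(exZ _ (itgD ig ign)).
  apply: (ex_le (ig_sqr_shift LS ht) (itgZ _ (itgD ig ign))) => a.
  apply: (@le_trans _ _ (CB * ((1 + a%:~R ^+ 2) * expR (th * a%:~R)))).
    by rewrite mulrC mulrA ler_wpM2r ?expR_ge0// (sqr_shift_le LS).
  rewrite ler_wpM2l// /g /negdom; case: ltP => a0; last first.
    rewrite mul0r addr0 -[X in _ <= _ + (X + _)]mul1r -mulrDl.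
    apply: (@le_trans _ _ ((1 + a%:~R ^+ 2) * expR (lam * a%:~R))); last by rewrite lerDr.
    by rewrite ler_wpM2l ?addr_ge0 ?sqr_ge0// ler_expR ler_wpM2r ?ler0z.
  rewrite mul1r mulrDl mul1r lerD2r.
  apply: (@le_trans _ _ 1).
    by rewrite expR_le1; apply: mulr_ge0_le0; rewrite ?lerz0 ltW.
  by rewrite lerDl addr_ge0 ?expR_ge0// mulr_ge0 ?sqr_ge0 ?expR_ge0.
rewrite /Centering.Vth.
rewrite ler_pdivrMr//; apply: (le_trans h).
have e : c0^-1 * CB * (1 + Ex g) * (1 + Mneg th) * phi th =
  CB * ((1 + Ex g) * (1 + Mneg th)) * (phi th / c0) by ring.
rewrite e; have q : 1 <= phi th / c0 by rewrite ler_pdivlMr// mul1r hc.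
apply: (@le_trans _ _ (CB * ((1 + Ex g) * (1 + Mneg th)))).
  by rewrite ler_wpM2l//; have := mulr_ge0 Eg0 M0; lra.
by rewrite ler_peMr// mulr_ge0// mulr_ge0// addr_ge0.
Qed.

Let icl (x : R) : R := indic `[0, 1]%classic x.

Let int_icl f F : continuous f -> (forall x : R, is_derive x 1 F (f x)) ->
  Itg leb (fun x => icl x * f x) /\ \int[leb]_x (icl x * f x) = F 1 - F 0.
Proof.
move=> cf dF; split.
  apply: (@eq_integrable _ _ _ leb setT measurableT (EFin \o (f \_ `[0, 1]%classic))) => //.
    by move=> x _; rewrite /= patchE /icl indicE; case: ifPn => _; rewrite ?mul1r ?mul0r.
  rewrite -restrict_EFin; apply/integrable_restrict => //=; rewrite setTI.
  apply: continuous_compact_integrable; first exact: segment_compact.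
  exact: continuous_subspaceT.
rewrite -(int_itv_FTC ltr01 cf dF) [RHS]Rintegral_mkcond; apply: eq_Rintegral => x _.
by rewrite patchE /icl indicE; case: ifPn => _; rewrite ?mul1r ?mul0r.
Qed.

(** Integrating [a ^ 2 * exp (lam * y * a)] over the tilt gains one power of [|a|]. *)
Lemma int_negdom_le a :
  Itg leb (fun y => unit_ind y * negdom (lam * y) a) /\
  \int[leb]_y (unit_ind y * negdom (lam * y) a) <= lam^-1 * `|a%:~R|.
Proof.
have ra : 0 <= lam^-1 * `|a%:~R| :> R by rewrite mulr_ge0// invr_ge0 ltW.
have [a0|a0] := ltP a 0; last first.
  have E : (fun y => unit_ind y * negdom (lam * y) a) = fun=> 0.
    by apply/funext => y; rewrite /negdom ltNge a0 mul0r mulr0.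
  by rewrite E int0; split => //; exact: itg0.
pose r : R := a%:~R; have r0 : r < 0 by rewrite ltrz0.
pose f y := r ^+ 2 * expR (lam * y * r); pose F y := r / lam * expR (lam * y * r).
have dF (x : R) : is_derive x 1 F (f x).
  by rewrite /F /f; der; rewrite /=; field; rewrite gt_eqF.
have df (x : R) : is_derive x 1 f (r ^+ 2 * (lam * r * expR (lam * x * r))).
  by rewrite /f; der; rewrite /=; ring.
have cf : continuous f := is_derive_continuous df.
have [i1 e1] := int_icl cf dF.
have m : mfun_ (fun y => unit_ind y * negdom (lam * y) a).
  apply: measurable_funM; first exact: measurable_indic.
  by rewrite /negdom a0; apply: cont_mfun; under eq_fun do rewrite mul1r; exact: cf.
have le y : `|unit_ind y * negdom (lam * y) a| <= icl y * f y.
  rewrite normrM (ger0_norm (negdom_ge0 _ _)) /negdom a0 mul1r -/r -/(f y).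
  rewrite (ler_wpM2r (mulr_ge0 (sqr_ge0 _) (expR_ge0 _)))// unit_indE ger0_norm//.
  rewrite /icl indicE mem_setE in_itv/= ler_nat.
  by case: (ltP 0 y) => // y0; case: (ltP y 1) => // y1; rewrite (ltW y0) (ltW y1).
split; first exact: (@itg_dominated _ _ R leb _ _ m i1 le).
apply: (le_trans (ler_norm _)); apply: (le_trans (@int_abs_le _ _ R leb _ _ m i1 le)).
rewrite e1 /F mulr0 mul0r expR0 !mulr1 (ltr0_norm r0).
have := @expR_ge0 R (lam * r); set e := expR _ => e0.
have il : 0 < lam^-1 by rewrite invr_gt0.
have : r / lam * e <= 0 by rewrite mulr_le0_ge0// mulr_le0_ge0 ?ltW.
have -> : lam^-1 * - r = - (r / lam) by ring.
lra.
Qed.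

(** Exchanging the integrals over the tilt and over the step reduces the claim to [E|X| < oo]. *)
Lemma itg_Mneg : Itg leb (fun y => unit_ind y * Mneg (lam * y)).
Proof.
pose f (z : R * T) : R := unit_ind z.1 * negdom (lam * z.1) (X z.2).
have mX (g : int -> R) : measurable_fun setT (fun z : R * T => g (X z.2)).
  exact: (measurableT_comp (mfun_X LS g) measurable_snd).
have mf : measurable_fun setT f.
  apply: measurable_funM.
    have mu1 : mfun_ (@unit_ind R) by apply: measurable_indic; exact: measurable_itv.
    exact: (measurableT_comp mu1 measurable_fst).
  apply: measurable_funM; first exact: (mX (fun a => (a < 0)%R%:R)).
  apply: measurable_funM; first exact: (mX (fun a => a%:~R ^+ 2)).
  apply: measurableT_comp => //; apply: measurable_funM; last exact: (mX (fun a => a%:~R)).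
  by apply: measurable_funM => //; exact: measurable_fst.
have mEf : measurable_fun setT (EFin \o f) by apply/measurable_EFinP.
have u0 y : 0 <= unit_ind y :> R by rewrite unit_indE.
have f0 z : 0 <= f z by rewrite mulr_ge0 ?negdom_ge0.
have itf : (leb \x P)%E.-integrable setT (EFin \o f).
  apply/(@integrable21ltyP _ _ _ _ R leb P _ mEf).
  have E w : (\int[leb]_x `|(EFin \o f) (x, w)| = (\int[leb]_x (unit_ind x * negdom (lam * x) (X w)))%:E)%E.
    have [i1 _] := int_negdom_le (X w).
    rewrite /Rintegral fineK; last exact: (integrable_fin_num measurableT i1).
    by apply: eq_integral => y _; rewrite /= ger0_norm// mulr_ge0 ?negdom_ge0.
  under eq_integral => w _ do rewrite E.
  have iX : Itg P (fun w => lam^-1 * `|(X w)%:~R|) by exact: itgZ (ls_int LS).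
  have mE : mfun_ (fun w => \int[leb]_x (unit_ind x * negdom (lam * x) (X w))).
    exact: (mfun_X LS (fun a => \int[leb]_x (unit_ind x * negdom (lam * x) a))).
  have le w : `|\int[leb]_x (unit_ind x * negdom (lam * x) (X w))| <= lam^-1 * `|(X w)%:~R|.
    rewrite ger0_norm; first exact: (int_negdom_le _).2.
    by apply: Rintegral_ge0 => y _; rewrite mulr_ge0 ?negdom_ge0.
  have /integrableP[_] := @itg_dominated _ _ R P _ _ mE iX le.
  apply: le_lt_trans; apply: ge0_le_integral => //.
  - by move=> w _; rewrite lee_fin; apply: Rintegral_ge0 => y _; rewrite mulr_ge0 ?negdom_ge0.
  - exact/measurable_EFinP.
  - by apply: measurableT_comp => //; exact/measurable_EFinP.
  - by move=> w _; rewrite lee_fin ler_norm.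
have := integrable_fubini_F itf; apply: eq_integrable => // y _.
rewrite /fubini_F /=; have [y01|y01] := boolP (0 < y < 1).
  have /andP[y0 y1] := y01.
  have ig := ig_negdom (mulr_gt0 lam0 y0).
  rewrite /Mneg /Tilting.Ex -(intZ _ ig) /Rintegral fineK//.
  exact: (integrable_fin_num measurableT (itgZ _ ig)).
rewrite unit_indE (negbTE y01) mul0r.
by rewrite (eq_integral (fun=> 0%E)) ?integral0// => w _; rewrite /f /= unit_indE (negbTE y01) mul0r.
Qed.

End negative_part_moments.

(** * The limiting quadratic form of the exponents *)

Module QuadraticForm.

Section quadratic_form_limit.
Context d (T : measurableType d) (R : realType) (P : probability T R)
  (X : T -> int) (lam : R).
Hypothesis LS : lattice_step P X lam.
Notation leb := (@lebesgue_measure R).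
Implicit Types (u th : R).
Notation Ex := (Ex P X).
Notation phi := (phi P X).
Notation mu := (mu P X).
Notation Vth := (Vth P X).
Notation kap := (kap P X).
Notation io := (io P X).
Notation Mneg := (Mneg P X).
Let lam0 := ls_lam LS.

(** The frequency seen by the step with index [i = r * n] when the end point has frequency
    [sg / sqrt n] and the area [ta / (n * sqrt n)]. *)
Definition grid_freq (n : nat) (sg ta r : R) : R := (sg + ta * r) / Num.sqrt n%:R.

Lemma grid_freq_bound n sg ta r : 0 <= r <= 1 ->
  `|Num.sqrt n%:R * grid_freq n sg ta r| <= `|sg| + `|ta|.
Proof.
move=> /andP[r0 r1]; rewrite /grid_freq mulrCA.
have h : `|sg + ta * r| <= `|sg| + `|ta|.
  by apply: (le_trans (ler_normD _ _)); rewrite lerD2l normrM ler_piMr// ger0_norm.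
rewrite normrM; apply: le_trans h; rewrite ler_piMr//.
have [->|n0] := eqVneq (Num.sqrt (n%:R : R)) 0; first by rewrite mul0r normr0.
by rewrite divff// normr1.
Qed.

Lemma grid_point (y sg ta : R) (i_ : nat -> nat) : 0 < y < 1 ->
  (forall n, (0 < n)%N -> y <= (i_ n)%:R / n%:R < y + n%:R^-1) ->
  exists th_ u_ : nat -> R, exists N : nat,
  [/\ forall n, lam * y <= th_ n <= lam, th_ @ \oo --> lam * y,
      forall n, `|Num.sqrt n%:R * u_ n| <= `|sg| + `|ta|,
      Num.sqrt n%:R * u_ n @[n --> \oo] --> sg + ta * y &
      forall n, (N <= n)%N -> th_ n = lam * ((i_ n)%:R / n%:R) /\
        u_ n = grid_freq n sg ta ((i_ n)%:R / n%:R)].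
Proof.
move=> /andP[y0 y1] hi.
pose r n : R := if ((0 < n)%N && ((i_ n)%:R / n%:R <= 1 :> R)) then (i_ n)%:R / n%:R else y.
have hr n : y <= r n <= 1.
  rewrite /r; case: ifP => [/andP[n0 ->]|_]; last by rewrite lexx ltW.
  by have /andP[-> _] := hi n n0.
have rE : exists N, forall n, (N <= n)%N -> (0 < n)%N /\ r n = (i_ n)%:R / n%:R.
  have [|N hN] := cvgn_dist (@invn_cvg0 R) (e := 1 - y); first by rewrite subr_gt0.
  exists N.+1 => n Nn; have n0 : (0 < n)%N by exact: leq_trans Nn.
  split => //; rewrite /r n0 ifT//=; have /andP[_ h2] := hi n n0.
  by have := hN n (ltnW Nn); rewrite subr0 ger0_norm//; lra.
have [N hN] := rE.
have rc : r @ \oo --> y.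
  apply: cvgn_le => e e0; have [M hM] := cvgn_dist (@invn_cvg0 R) e0.
  exists (maxn N M) => n; rewrite geq_max => /andP[Nn Mn].
  have [n0 ->] := hN n Nn; have /andP[h1 h2] := hi n n0.
  have := hM n Mn; rewrite subr0 ger0_norm// => h3.
  by rewrite ger0_norm ?subr_ge0//; lra.
exists (fun n => lam * r n), (fun n => grid_freq n sg ta (r n)), N.
split.
- move=> n; have /andP[h1 h2] := hr n.
  by rewrite ler_wpM2l ?(ltW lam0)//= ler_piMr// ltW.
- by apply: cvgM => //; exact: cvg_cst.
- move=> n; have /andP[h1 h2] := hr n.
  by apply: grid_freq_bound; rewrite h2 (le_trans _ h1)// ltW.
- apply: (@cvgn_eq _ 1 _ (fun n => sg + ta * r n)) => [n n0|].
    by rewrite /grid_freq mulrCA divff ?mulr1// gt_eqF// sqrtr_gt0 ltr0n.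
  by apply: cvgD; [exact: cvg_cst|apply: cvgM => //; exact: cvg_cst].
- by move=> n Nn; have [_ <-] := hN n Nn.
Qed.

Lemma grid_posth n i m : (m < i)%N -> (i < n - m)%N ->
  [/\ (0 < n)%N, 0 < i%:R / n%:R :> R, i%:R / n%:R < 1 :> R & posth lam (lam * (i%:R / n%:R))].
Proof.
move=> mi inm; have n0 : (0 < n)%N by lia.
have nn0 : (0 : R) < n%:R by rewrite ltr0n.
have h1 : 0 < i%:R / n%:R :> R by rewrite divr_gt0// ltr0n; lia.
have h2 : i%:R / n%:R < 1 :> R by rewrite ltr_pdivrMr// mul1r ltr_nat; lia.
by split => //; rewrite /posth mulr_gt0//= ler_piMr// ltW.
Qed.

Lemma freq_sqr n sg ta r : (0 < n)%N -> 0 <= r <= 1 ->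
  n%:R * grid_freq n sg ta r ^+ 2 <= (`|sg| + `|ta|) ^+ 2.
Proof.
move=> n0 hr; have h := @grid_freq_bound n sg ta r hr.
have -> : n%:R * grid_freq n sg ta r ^+ 2 = `|Num.sqrt n%:R * grid_freq n sg ta r| ^+ 2.
  by rewrite real_normK ?num_real//; rewrite [in RHS]exprMn sqr_sqrtr.
by rewrite ler_sqr ?nnegrE// addr_ge0.
Qed.

Lemma riemann_Mneg (F : nat -> nat -> R) (L : R -> R) (m : nat) (C : R) :
  0 <= C ->
  (forall n i, (m < i)%N -> (i < n - m)%N ->
    `|n%:R * F n i| <= C * (1 + Mneg (lam * (i%:R / n%:R)))) ->
  (forall y (i_ : nat -> nat), 0 < y < 1 ->
    (forall n, (0 < n)%N -> y <= (i_ n)%:R / n%:R < y + n%:R^-1) ->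
    n%:R * F n (i_ n) @[n --> \oo] --> L y) ->
  Itg leb (fun y => unit_ind y * L y) /\
  (\sum_(m.+1 <= i < n - m) F n i) @[n --> \oo] --> \int[leb]_y (unit_ind y * L y).
Proof.
move=> C0 hF hL.
apply: (@riemann_dct _ F L (fun y => C * (1 + Mneg (lam * y))) m) => //.
- move=> y z y0 yz z1; rewrite ler_wpM2l// lerD2l (Mneg_nonincr LS) ?mulr_gt0//.
  by rewrite ler_wpM2l// ltW.
- by move=> y _; rewrite mulr_ge0// addr_ge0// Mneg_ge0.
- have iu : Itg leb (@unit_ind R).
    apply: (@itg_dominated _ _ R leb _ _ _ (cell_itg 0 1)) => [|y].
      by apply: measurable_indic; exact: measurable_itv.
    rewrite unit_indE cellE ger0_norm// ler_nat.
    by case: (ltP 0 y) => //= _; case: (ltP y 1) => // /ltW ->.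
  have -> : (fun y => unit_ind y * (C * (1 + Mneg (lam * y)))) =
     fun y => C * (unit_ind y + unit_ind y * Mneg (lam * y)).
    by apply/funext => y; ring.
  by apply: itgZ; apply: itgD => //; exact: itg_Mneg LS.
Qed.

(** [quad_cov0], [quad_cov1] and [quad_cov2] are the limiting variance of the end point over [n],
    covariance over [n ^ 2], and variance of the area over [n ^ 3]. *)
Definition quad_cov0 : R := \int[leb]_y (unit_ind y * Vth (lam * y)).
Definition quad_cov1 : R := \int[leb]_y (unit_ind y * (y * Vth (lam * y))).
Definition quad_cov2 : R := \int[leb]_y (unit_ind y * (y ^+ 2 * Vth (lam * y))).
Notation al := quad_cov0.
Notation be := quad_cov1.
Notation ga := quad_cov2.

Definition quad (z : R * R) : R := al * z.1 ^+ 2 + 2 * be * z.1 * z.2 + ga * z.2 ^+ 2.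

Let kap_sum_ m sg ta :
  Itg leb (fun y => unit_ind y * ((sg + ta * y) ^+ 2 * Vth (lam * y) / 2)) /\
  (\sum_(m.+1 <= i < n - m) kap (lam * (i%:R / n%:R)) (grid_freq n sg ta (i%:R / n%:R)))
    @[n --> \oo] --> \int[leb]_y (unit_ind y * ((sg + ta * y) ^+ 2 * Vth (lam * y) / 2)).
Proof.
have [CV CV0 hV] := Vth_bound LS.
have s0 := sqr_ge0 (`|sg| + `|ta|).
apply: (@riemann_Mneg _ _ m ((`|sg| + `|ta|) ^+ 2 * CV)); first exact: mulr_ge0.
  move=> n i mi inm; have [n0 r0 r1 hp] := grid_posth mi inm.
  have /andP[t0 tl] := hp; have hp' : 0 <= lam * (i%:R / n%:R) <= lam by rewrite tl ltW.
  have k0 := kap_ge0 LS (grid_freq n sg ta (i%:R / n%:R)) hp'.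
  rewrite ger0_norm; last exact: mulr_ge0.
  apply: (le_trans (ler_wpM2l _ (kap_le LS _ hp))) => //.
  have fs : n%:R * grid_freq n sg ta (i%:R / n%:R) ^+ 2 <= (`|sg| + `|ta|) ^+ 2.
    by apply: freq_sqr => //; rewrite !ltW.
  have f0 : 0 <= n%:R * grid_freq n sg ta (i%:R / n%:R) ^+ 2 by rewrite mulr_ge0 ?sqr_ge0.
  have := ler_pM f0 (Vth_ge0 LS hp') fs (hV _ hp).
  by rewrite -[leLHS]mulrA [leRHS]mulrA.
move=> y i_ hy hi; have [th_ [u_ [N [h1 h2 h3 h4 h5]]]] := grid_point sg ta hy hi.
have /andP[y0 y1] := hy.
apply: (@cvgn_eq _ N _ (fun n => n%:R * kap (th_ n) (u_ n))) => [n Nn|].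
  by have [-> ->] := h5 n Nn.
apply: (@kap_cvg _ _ _ _ _ _ LS (lam * y) th_ u_ _ (`|sg| + `|ta|)) => //.
  exact: mulr_gt0.
by rewrite ler_piMr// ltW.
Qed.

(** Polarisation: the integrands are combinations of those already treated at the frequencies
    [(1, 0)], [(0, 1)] and [(1, 1)]. *)
Lemma itg_quad : [/\ Itg leb (fun y => unit_ind y * Vth (lam * y)),
  Itg leb (fun y => unit_ind y * (y * Vth (lam * y))) &
  Itg leb (fun y => unit_ind y * (y ^+ 2 * Vth (lam * y)))].
Proof.
have [i1 _] := kap_sum_ 0 1 0; have [i2 _] := kap_sum_ 0 0 1; have [i3 _] := kap_sum_ 0 1 1.
have E1 : (fun y => unit_ind y * Vth (lam * y)) = fun y =>
   2 * (unit_ind y * ((1 + 0 * y) ^+ 2 * Vth (lam * y) / 2)).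
  by apply/funext => y; field.
have E2 : (fun y => unit_ind y * (y ^+ 2 * Vth (lam * y))) = fun y =>
   2 * (unit_ind y * ((0 + 1 * y) ^+ 2 * Vth (lam * y) / 2)).
  by apply/funext => y; field.
have E3 : (fun y => unit_ind y * (y * Vth (lam * y))) = fun y =>
   unit_ind y * ((1 + 1 * y) ^+ 2 * Vth (lam * y) / 2) -
   (unit_ind y * ((1 + 0 * y) ^+ 2 * Vth (lam * y) / 2) +
    unit_ind y * ((0 + 1 * y) ^+ 2 * Vth (lam * y) / 2)).
  by apply/funext => y; field.
split; first by rewrite E1; exact: itgZ.
  by rewrite E3; apply: itgB => //; exact: itgD.
by rewrite E2; exact: itgZ.
Qed.

Lemma kap_sum m z :
  (\sum_(m.+1 <= i < n - m) kap (lam * (i%:R / n%:R)) (grid_freq n z.1 z.2 (i%:R / n%:R)))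
    @[n --> \oo] --> quad z / 2.
Proof.
have [_ c] := kap_sum_ m z.1 z.2; have [i1 i2 i3] := itg_quad.
suff -> : quad z / 2 = \int[leb]_y (unit_ind y * ((z.1 + z.2 * y) ^+ 2 * Vth (lam * y) / 2)) by [].
have -> : (fun y => unit_ind y * ((z.1 + z.2 * y) ^+ 2 * Vth (lam * y) / 2)) = fun y =>
  2^-1 * (z.1 ^+ 2 * (unit_ind y * Vth (lam * y)) +
   (2 * z.1 * z.2 * (unit_ind y * (y * Vth (lam * y))) +
    z.2 ^+ 2 * (unit_ind y * (y ^+ 2 * Vth (lam * y))))).
  by apply/funext => y; field.
have j1 := itgZ (z.1 ^+ 2) i1; have j2 := itgZ (2 * z.1 * z.2) i2.
have j3 := itgZ (z.2 ^+ 2) i3.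
rewrite (intZ _ (itgD j1 (itgD j2 j3))) (intD j1 (itgD j2 j3)) (intD j2 j3).
by rewrite (intZ _ i1) (intZ _ i2) (intZ _ i3) /quad /al /be /ga; ring.
Qed.

Lemma io_sum m z :
  (\sum_(m.+1 <= i < n - m) (io (lam * (i%:R / n%:R)) (grid_freq n z.1 z.2 (i%:R / n%:R)) +
    kap (lam * (i%:R / n%:R)) (grid_freq n z.1 z.2 (i%:R / n%:R)) ^+ 2))
    @[n --> \oo] --> (0 : R).
Proof.
have [CV CV0 hV] := Vth_bound LS.
set sg := z.1; set ta := z.2.
have s0 := sqr_ge0 (`|sg| + `|ta|).
have Z : \int[leb]_y (unit_ind y * 0) = 0 :> R.
  by have -> : (fun y => unit_ind y * 0) = (fun=> 0 : R); [apply/funext => y; rewrite mulr0|rewrite int0].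
rewrite -[X in _ --> X]Z.
(* The 3 is [1 + 2]: [io] is at most [u ^ 2 * Vth], and so is [kap], whose square costs a further
   factor 2 by [kap <= 2]. *)
apply: (@riemann_Mneg _ (fun=> 0) m (3 * ((`|sg| + `|ta|) ^+ 2 * CV)) _ _ _).2.
- by rewrite mulr_ge0// mulr_ge0.
- move=> n i mi inm; have [n0 r0 r1 hp] := grid_posth mi inm.
  have /andP[t0 tl] := hp; have hp' : 0 <= lam * (i%:R / n%:R) <= lam by rewrite tl ltW.
  set u := grid_freq _ _ _ _.
  have k0 := kap_ge0 LS u hp'; have k2 := kap_le2 LS u hp'; have k1 := kap_le LS u hp.
  have o0 := io_ge0 LS u hp'; have o1 := io_le LS u hp.
  rewrite ger0_norm; last by rewrite mulr_ge0// addr_ge0 ?sqr_ge0.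
  have v0 := Vth_ge0 LS hp'; have v1 := hV _ hp.
  have fs : n%:R * u ^+ 2 <= (`|sg| + `|ta|) ^+ 2.
    by apply: freq_sqr => //; rewrite !ltW.
  have h : n%:R * (u ^+ 2 * Vth (lam * (i%:R / n%:R))) <=
      (`|sg| + `|ta|) ^+ 2 * (CV * (1 + Mneg (lam * (i%:R / n%:R)))).
    have f0 : 0 <= n%:R * u ^+ 2 by rewrite mulr_ge0 ?sqr_ge0.
    by have := ler_pM f0 v0 fs v1; rewrite -[leLHS]mulrA.
  apply: (@le_trans _ _ (n%:R * (3 * (u ^+ 2 * Vth (lam * (i%:R / n%:R)))))).
    rewrite ler_wpM2l//; move: k0 k1 k2 o1; set k := kap _ _; set v := u ^+ 2 * _; move=> *; nra.
  by rewrite mulrCA -[leRHS]mulrA ler_wpM2l// -[leRHS]mulrA.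
move=> y i_ hy hi; have [th_ [u_ [N [h1 h2 h3 h4 h5]]]] := grid_point sg ta hy hi.
have /andP[y0 y1] := hy.
apply: (@cvgn_eq _ N.+1 _ (fun n => n%:R * io (th_ n) (u_ n) +
   (n%:R * kap (th_ n) (u_ n)) ^+ 2 * n%:R^-1)) => [n Nn|].
  have [-> ->] := h5 n (ltnW Nn).
  have n0 : n%:R != 0 :> R by rewrite pnatr_eq0 -lt0n; exact: leq_ltn_trans Nn.
  have E (a b : R) : n%:R * (a + b ^+ 2) = n%:R * a + (n%:R * b) ^+ 2 * n%:R^-1 by field.
  exact: E.
have ly0 : 0 < lam * y by exact: mulr_gt0.
have ly1 : lam * y <= lam by rewrite ler_piMr// ltW.
rewrite -[X in _ --> X]addr0; apply: cvgD; first exact: (@io_cvg _ _ _ _ _ _ LS (lam * y) th_ u_ (sg + ta * y) (`|sg| + `|ta|)).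
rewrite -[X in _ --> X](mulr0 (((sg + ta * y) ^+ 2 * Vth (lam * y) / 2) ^+ 2)).
apply: cvgM; last exact: invn_cvg0.
apply: cvgn_exp.
exact: (@kap_cvg _ _ _ _ _ _ LS (lam * y) th_ u_ _ (`|sg| + `|ta|) ly0 ly1 h1 h2 h3 h4).
Qed.

End quadratic_form_limit.

End QuadraticForm.
Export QuadraticForm.

(** * Tilted weights along a path and uniform local bounds *)

Module PathWeights.

Section tilted_path_weights.
Context d (T : measurableType d) (R : realType) (P : probability T R)
  (X : T -> int) (lam : R).
Hypothesis LS : lattice_step P X lam.
Notation leb := (@lebesgue_measure R).
Notation leb2 := (leb \x leb)%E.
Implicit Types (z : R * R).
Notation phi := (phi P X).
Notation mu := (mu P X).
Notation chF := (chF P X).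
Notation chK := (chK P X).
Notation tw := (tw P X).
Let lam0 := ls_lam LS.

(* The [minn] only serves to keep the tilt inside [0, lam] for every [i]. *)
Definition gth (n i : nat) : R := lam * ((minn i n)%:R / n%:R).

Lemma gthE n i : (i <= n)%N -> gth n i = lam * (i%:R / n%:R).
Proof. by move=> h; rewrite /gth (minn_idPl h). Qed.

Lemma gth_itv n i : 0 <= gth n i <= lam.
Proof. by apply: grid_itv => //; exact: geq_minr. Qed.

Definition wtn n i : int -> R := tw (gth n i).

Lemma wtn_ge0 n i a : 0 <= wtn n i a.
Proof. exact: (tw_ge0 LS _ (gth_itv n i)). Qed.

Lemma wtn_le1 n K i : step_sum K (wtn n i) <= 1.
Proof. exact: (tw_step_le1 LS K (gth_itv n i)). Qed.

Notation P1 n := (Num.sqrt (n%:R : R)).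
Notation P2 n := ((n%:R : R) * Num.sqrt n%:R).
Definition frq (n i : nat) z : R := z.1 / P1 n + z.2 / P2 n * i%:R.

Lemma frqE n i z : (0 < n)%N -> frq n i z = grid_freq n z.1 z.2 (i%:R / n%:R).
Proof.
move=> n0; have h : n%:R != 0 :> R by rewrite pnatr_eq0 -lt0n.
have h2 : P1 n != 0 by rewrite gt_eqF// sqrtr_gt0 ltr0n.
by rewrite /frq /grid_freq; field; apply/andP.
Qed.

Lemma P1_gt0 n : (0 < n)%N -> 0 < P1 n. Proof. by move=> n0; rewrite sqrtr_gt0 ltr0n. Qed.
Lemma P2_gt0 n : (0 < n)%N -> 0 < P2 n.
Proof. by move=> n0; rewrite mulr_gt0 ?ltr0n ?P1_gt0. Qed.

Lemma P12 n : P1 n * P2 n = n%:R ^+ 2.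
Proof. by rewrite mulrCA -expr2 sqr_sqrtr// -expr2. Qed.

(** A block of consecutive indices holding a fifth of the path already yields an integrable
    majorant. This covers each half of the path as well as the middle block. *)
Lemma prod_dom : exists C : R, exists K0 : nat, 0 < C /\
  forall n a L z, (a + L <= n)%N -> (n <= 5 * L)%N -> (6 <= L)%N ->
  `|z.1| <= pi * P1 n -> `|z.2| <= pi * P2 n ->
  (forall K, (K0 <= K)%N ->
    \prod_(a <= i < a + L) nc (chK K (gth n i) (frq n i z)) <= C * invquad z) /\
  \prod_(a <= i < a + L) nc (chF (gth n i) (frq n i z)) <= C * invquad z.
Proof.
have [c [K0 [c0 hK hF]]] := chF_decay LS.
have [c1 c10 hc] := @onem_cos_sum_coercive R.
have [C C0 hC] := expR_min_le_invquad (mulr_gt0 c0 c10).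
exists C, K0; split => // n a L z aL nL L6 z1 z2.
have n0 : (0 < n)%N by lia.
have nn0 : (0 : R) < n%:R by rewrite ltr0n.
have p1 := P1_gt0 n0; have p2 := P2_gt0 n0.
have key : expR (- (c * \sum_(a <= i < a + L) (1 - cos (frq n i z)))) <= C * invquad z.
  rewrite [z]surjective_pairing; apply: le_trans (hC n z.1 z.2 n0 z1 z2).
  rewrite ler_expR lerN2 -mulrA ler_pM2l//.
  have := hc n a L (z.1 / P1 n) (z.2 / P2 n) aL nL L6.
  rewrite !normrM !normfV (gtr0_norm p1) (gtr0_norm p2).
  rewrite !ler_pdivrMr// => /(_ z1 z2); congr (_ * Num.min _ _ <= _).
  rewrite !expr_div_n exprMn sqr_sqrtr; last exact: ltW.
  by field; rewrite gt_eqF.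
have gen (ch : R -> R -> R[i]) : (forall th u, 0 <= th <= lam -> nc (ch th u) <= expR (- (c * (1 - cos u)))) ->
    \prod_(a <= i < a + L) nc (ch (gth n i) (frq n i z)) <= C * invquad z.
  move=> h; apply: le_trans key.
  rewrite mulr_sumr -sumrN expR_sum.
  by apply: ler_prod => i _; rewrite nc_ge0 h// gth_itv.
split; last exact: gen.
by move=> K KK; apply: (gen (chK K)) => th u hth; exact: hK.
Qed.

(** The scale is [n ^ 2 = sqrt n * (n * sqrt n)]. Uniformity in [s] and [x] is what allows one half
    of the path to be arbitrary while the other supplies the density ([half_left], [half_right]). *)
Lemma local_bound : exists C : R, exists K0 : nat, 0 < C /\
  forall n a L K l (s x : int), perm_eq l (index_iota a (a + L)) ->
  (a + L <= n)%N -> (n <= 5 * L)%N -> (6 <= L)%N -> (K0 <= K)%N ->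
  n%:R ^+ 2 * local_prob (wtn n) K l s x <= C.
Proof.
have [C [K0 [C0 h]]] := prod_dom.
pose M := \int[leb2]_z (C * invquad z).
exists (`|M| + 1), K0; split; first by rewrite ltr_wpDl.
move=> n a L K l s x pl aL nL L6 KK.
have n0 : (0 < n)%N by lia.
have p1 := P1_gt0 n0; have p2 := P2_gt0 n0.
have iM : Itg leb2 (fun z : R * R => C * invquad z) by apply: itgZ; exact: itg_invquad.
have := @local_prob_le _ (wtn n) K (P1 n) (P2 n) l s x (fun z => C * invquad z) p1 p2 iM.
have -> : 4 * pi ^+ 2 * P1 n * P2 n * local_prob (wtn n) K l s x =
  4 * pi ^+ 2 * (n%:R ^+ 2 * local_prob (wtn n) K l s x) by rewrite -P12; ring.
rewrite -/M => /(_ _ _) hh; apply: le_trans (_ : M <= _); last first.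
  by apply: (le_trans (ler_norm _)); rewrite lerDl.
apply: le_trans (hh _ _); last first.
- by move=> z; rewrite mulr_ge0 ?invquad_ge0 ?ltW.
- move=> z z1 z2; rewrite (perm_big _ pl)/=.
  by have [hK _] := h n a L z aL nL L6 z1 z2; exact: hK.
rewrite ler_peMl//.
  rewrite mulr_ge0 ?sqr_ge0// path_sum_ge0// => i *; exact: wtn_ge0.
have p2' : (2 : R) <= pi := pi_ge2 R.
have : (2 : R) ^+ 2 <= pi ^+ 2 by rewrite ler_sqr ?nnegrE ?pi_ge0.
by lra.
Qed.

End tilted_path_weights.

End PathWeights.
Export PathWeights.

(** * Convergence of the transform of the middle block *)

Module MiddleBlock.

Section local_limit_middle.
Context d (T : measurableType d) (R : realType) (P : probability T R)
  (X : T -> int) (lam : R).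
Hypothesis LS : lattice_step P X lam.
Notation leb := (@lebesgue_measure R).
Notation leb2 := (leb \x leb)%E.
Implicit Types (z : R * R).
Notation phi := (phi P X).
Notation mu := (mu P X).
Notation chF := (chF P X).
Notation chK := (chK P X).
Notation chC := (chC P X).
Notation kap := (kap P X).
Notation io := (io P X).
Notation quad := (quad P X lam).
Notation gth := (gth lam).
Notation wtn := (wtn P X lam).
Notation MI := (mean_height (cum P X) lam).
Notation B := (slope_bound mu lam).
Notation P1 n := (Num.sqrt (n%:R : R)).
Notation P2 n := ((n%:R : R) * Num.sqrt n%:R).
Let lam0 := ls_lam LS.
Let tg := @cum_tangent _ _ _ _ _ _ LS.
Let c0 := cum0 P X.
Let cl := cumlam LS.

(** Transform, without cut-off, of the rescaled end point and area of the middle block, centred at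
    [s] and at [MI * n ^ 2]. *)
Definition Dn m (s : int) n z : R[i] := cis (- (z.1 * (s%:~R / P1 n)) - z.2 * (MI * P1 n)) *
  \prod_(m.+1 <= i < n - m) chF (gth n i) (frq n i z).

(** [slope_sum] and [slope_moment] evaluate the mean phase of the whole path; the [2 * m] omitted
    indices contribute [O(1 / sqrt n)] each, and so does the fixed end point [s]. *)
Lemma phase_small m (s : int) z : exists C : R, forall n, (0 < n)%N -> (m.*2 < n)%N ->
  `|\sum_(m.+1 <= i < n - m) frq n i z * mu (gth n i) - z.1 * (s%:~R / P1 n)
    - z.2 * (MI * P1 n)| <= C / P1 n.
Proof.
pose W := `|z.1| + `|z.2|; have W0 : 0 <= W by rewrite addr_ge0.
have B0 : 0 <= B by rewrite ltW// slope_bound_gt0.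
exists (m%:R * (W * B) + m%:R * (W * B) + `|z.1| * B + 2 * B * `|z.2| + `|z.1| * `|s%:~R|).
move=> n n0 mn; have p1 := @P1_gt0 R n n0; have p2 := @P2_gt0 R n n0.
have nn0 : (0 : R) < n%:R by rewrite ltr0n.
have p1n : P1 n != 0 by rewrite gt_eqF.
have nn : n%:R != 0 :> R by rewrite gt_eqF.
pose F i := frq n i z * mu (gth n i).
have Fb i : (i <= n)%N -> `|F i| <= W * B / P1 n.
  move=> i_n; rewrite /F normrM mulrAC ler_pM//.
    rewrite frqE// ler_pdivlMr// mulrC -(gtr0_norm p1) -normrM.
    apply: grid_freq_bound; rewrite divr_ge0//= ler_pdivrMr// mul1r ler_nat//.
  exact: (tangent_bound lam0 tg (gth_itv LS n i)).
have Fs a b : (a <= b <= n)%N -> `|\sum_(a <= i < b) F i| <= (b - a)%:R * (W * B / P1 n).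
  move=> /andP[ab bn]; apply: (le_trans (ler_norm_sum _ _ _)).
  apply: (@le_trans _ _ (\sum_(a <= i < b) (W * B / P1 n))).
    by apply: ler_sum_nat => i /andP[_ ib]; apply: Fb; lia.
  by rewrite sumr_const_nat mulr_natl.
have E : \sum_(m.+1 <= i < n - m) F i = \sum_(1 <= i < n) F i
    - \sum_(1 <= i < m.+1) F i - \sum_(n - m <= i < n) F i.
  rewrite (big_cat_nat (n := m.+1) (p := n))//=; last by lia.
  rewrite (big_cat_nat (m := m.+1) (n := n - m) (p := n))//=; [ring|lia|lia].
have b1 : `|\sum_(1 <= i < m.+1) F i| <= m%:R * (W * B / P1 n).
  by have := Fs 1%N m.+1; rewrite subn1; apply; lia.
have b2 : `|\sum_(n - m <= i < n) F i| <= m%:R * (W * B / P1 n).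
  have := Fs (n - m)%N n; rewrite (_ : (n - (n - m) = m)%N); last by lia.
  by apply; lia.
have S1 : \sum_(1 <= i < n) F i = z.1 / P1 n * \sum_(1 <= i < n) mu (lam * (i%:R / n%:R)) +
   z.2 / P2 n * \sum_(1 <= i < n) i%:R * mu (lam * (i%:R / n%:R)).
  rewrite !mulr_sumr -big_split; apply: eq_big_nat => i /andP[_ i_n].
  rewrite /F /frq gthE; last exact: ltnW.
  rewrite /=; generalize (mu (lam * (i%:R / n%:R))) => w.
  by rewrite mulrDl -(mulrA (z.2 / P2 n)).
have s1 := slope_sum lam0 tg c0 cl n0; have s2 := slope_moment lam0 tg c0 cl n0.
move: s1 s2 S1; set A1 := \sum_(1 <= i < n) mu _; set A2 := \sum_(1 <= i < n) _ * _ => s1 s2 S1.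
have e2 : z.2 * (MI * P1 n) = z.2 / P2 n * (n%:R ^+ 2 * MI).
  by rewrite -(P12 R n); field; rewrite p1n nn.
have e3 : 2 * B * `|z.2| / P1 n = `|z.2| / P2 n * (2 * B * n%:R).
  by field; rewrite p1n nn.
rewrite -/(F _) E S1 e2.
have -> : z.1 / P1 n * A1 + z.2 / P2 n * A2 - \sum_(1 <= i < m.+1) F i - \sum_(n - m <= i < n) F i -
   z.1 * (s%:~R / P1 n) - z.2 / P2 n * (n%:R ^+ 2 * MI) =
   - \sum_(1 <= i < m.+1) F i - \sum_(n - m <= i < n) F i + z.1 / P1 n * A1
    + z.2 / P2 n * (A2 - n%:R ^+ 2 * MI) - z.1 * s%:~R / P1 n by ring.
apply: (le_trans (ler_normB _ _)); rewrite [leRHS]mulrDl lerD//; last first.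
  by rewrite !normrM normfV (gtr0_norm p1).
apply: (le_trans (ler_normD _ _)); rewrite [leRHS]mulrDl lerD//; last first.
  by rewrite e3 !normrM normfV (gtr0_norm p2) ler_wpM2l// divr_ge0// ltW.
apply: (le_trans (ler_normD _ _)); rewrite [leRHS]mulrDl lerD//; last first.
  by rewrite !normrM normfV (gtr0_norm p1) mulrAC ler_wpM2r ?ler_wpM2l// invr_ge0 ltW.
apply: (le_trans (ler_normB _ _)); rewrite normrN mulrDl.
by rewrite -!mulrA in b1 b2 *; rewrite lerD.
Qed.

Lemma prod_chF_chC (l : seq nat) (th u : nat -> R) :
  \prod_(i <- l) chF (th i) (u i) =
  cis (\sum_(i <- l) u i * mu (th i)) * \prod_(i <- l) chC (th i) (u i).
Proof.
elim: l => [|i l ih]; first by rewrite !big_nil cis0 mul1r.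
rewrite !big_cons ih cisD /Centering.chC.
have e : cis (u i * mu (th i)) * cis (- (u i * mu (th i))) = 1.
  by rewrite -cisD subrr cis0.
have E (a b c f g : R[i]) : a * b = 1 -> c * (f * g) = a * f * (c * b * g).
  by move=> ab; rewrite -[LHS]mul1r -ab; ring.
exact: E.
Qed.

Lemma prod_realC (I : Type) (l : seq I) (f : I -> R) :
  \prod_(i <- l) (f i)%:C%C = (\prod_(i <- l) f i)%:C%C :> R[i].
Proof.
elim: l => [|i l ih]; first by rewrite !big_nil.
by rewrite !big_cons ih rmorphM.
Qed.

Lemma nc_cis1 (x : R) : nc (cis x - 1) <= 2 * `|x|.
Proof.
apply: (le_trans (nc_le_ReIm _)); rewrite ReB ImB /=.
have [h1 h2] := cos_sin_lip x 0; rewrite cos0 sin0 !subr0 in h1 h2.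
by rewrite subr0; lra.
Qed.

(** Three errors vanish: the residual phase [de], the replacement of each centred factor by
    [exp (- kap)], and the distance of the sum of [kap] from [quad z / 2]. *)
Lemma Dn_cvg m s z :
  nc (Dn m s n z - (expR (- (quad z / 2)))%:C%C) @[n --> \oo] --> (0 : R).
Proof.
have [C hC] := phase_small m s z.
pose ks n := \sum_(m.+1 <= i < n - m) kap (lam * (i%:R / n%:R)) (grid_freq n z.1 z.2 (i%:R / n%:R)).
pose is_ n := \sum_(m.+1 <= i < n - m) (io (lam * (i%:R / n%:R)) (grid_freq n z.1 z.2 (i%:R / n%:R)) +
    kap (lam * (i%:R / n%:R)) (grid_freq n z.1 z.2 (i%:R / n%:R)) ^+ 2).
have k1 : ks n @[n --> \oo] --> quad z / 2 := @kap_sum _ _ _ _ _ _ LS m z.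
have i1 : is_ n @[n --> \oo] --> (0 : R) := @io_sum _ _ _ _ _ _ LS m z.
apply: (@cvgn_squeeze0 _ (m.*2.+1) _ (fun n => 2 * (C * (P1 n)^-1) + is_ n +
   `|expR (- ks n) - expR (- (quad z / 2))|)); last first.
  have h1 : 2 * (C * (P1 n)^-1) @[n --> \oo] --> (0 : R).
    rewrite -[X in _ --> X](mulr0 2); apply: cvgM; first exact: cvg_cst.
    by rewrite -[X in _ --> X](mulr0 C); apply: cvgM; [exact: cvg_cst|exact: sqrt_inv_cvg].
  have h3 : `|expR (- ks n) - expR (- (quad z / 2))| @[n --> \oo] --> (0 : R).
    rewrite -(normr0 R) -(subrr (expR (- (quad z / 2)))); apply: cvg_norm; apply: cvgB; last exact: cvg_cst.
    by apply: continuous_cvg; [exact: continuous_expR|exact: cvgN].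
  rewrite -[X in _ --> X]addr0; apply: cvgD; last exact: h3.
  by rewrite -[X in _ --> X]addr0; apply: cvgD; [exact: h1|exact: i1].
move=> n mn; have n0 : (0 < n)%N by lia.
have p1 := @P1_gt0 R n n0.
rewrite ger0_norm ?nc_ge0// /Dn prod_chF_chC mulrA -cisD.
set de := - _ - _ + _.
have dE : de = \sum_(m.+1 <= i < n - m) frq n i z * mu (gth n i) - z.1 * (s%:~R / P1 n)
    - z.2 * (MI * P1 n) by rewrite /de; ring.
have hde : `|de| <= C / P1 n by rewrite dE; apply: hC.
set PC := \prod_(_ <= i < _) _; set e := (expR (- (quad z / 2)))%:C%C.
pose PE := \prod_(m.+1 <= i < n - m) (expR (- kap (gth n i) (frq n i z)))%:C%C.
have idx i : i \in index_iota m.+1 (n - m) -> (i <= n)%N /\ posth lam (gth n i).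
  rewrite mem_index_iota => /andP[a1 a2].
  have i_n : (i <= n)%N by lia.
  split => //; rewrite gthE//; have /(_ _ _ _ a1 a2)[_ _ _ ->//] := @grid_posth _ _ _ _ _ _ LS.
have PC1 : nc PC <= 1.
  by rewrite /PC; apply: nc_prod_le1 => i; exact: (nc_chC_le1 LS _ (gth_itv LS n i)).
have D1 : nc (PC - PE) <= is_ n.
  apply: (le_trans (nc_prodB _ _)).
  - by move=> i _; exact: (nc_chC_le1 LS _ (gth_itv LS n i)).
  - move=> i _; rewrite nc_real ger0_norm ?expR_ge0// expR_le1 oppr_le0.
    exact: (kap_ge0 LS _ (gth_itv LS n i)).
  - rewrite /is_ big_seq [leRHS]big_seq; apply: ler_sum => i hi.
    have [i_n hp] := idx i hi.
    by rewrite -frqE// -gthE//; exact: (chC_expR LS).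
have PEe : PE = (expR (- ks n))%:C%C.
  rewrite /ks -sumrN expR_sum /PE.
  rewrite -prod_realC; apply: eq_big_seq => i hi; have [i_n hp] := idx i hi.
  by rewrite (@frqE R n i z n0) (@gthE R lam n i i_n).
have E (a b c f : R[i]) : a * b - f = (a - 1) * b + ((b - c) + (c - f)) by ring.
rewrite [X in nc X](E (cis de) PC PE e).
apply: (le_trans (ncD _ _)); rewrite -[leRHS]addrA; apply: lerD.
  rewrite ncM; apply: (@le_trans _ _ (nc (cis de - 1))); first by rewrite ler_piMr ?nc_ge0.
  by apply: (le_trans (nc_cis1 de)); rewrite ler_wpM2l.
apply: (le_trans (ncD _ _)); rewrite lerD// PEe /e.
by rewrite -rmorphB nc_real.
Qed.

End local_limit_middle.

End MiddleBlock.
Export MiddleBlock.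

(** * Local limit theorem for end point and area of the middle block *)

Section complex_measurability.
Context d (T : measurableType d) (R : realType).
Implicit Types (f g : T -> R[i]).

Definition cmfun f := mfun_ (fun z => complex.Re (f z)) /\ mfun_ (fun z => complex.Im (f z)).

Lemma cmfunM f g : cmfun f -> cmfun g -> cmfun (fun z => f z * g z).
Proof.
move=> [f1 f2] [g1 g2]; split.
  have -> : (fun z => complex.Re (f z * g z)) = fun z =>
    complex.Re (f z) * complex.Re (g z) - complex.Im (f z) * complex.Im (g z).
    by apply/funext => z; case: (f z) (g z) => ? ? [].
  by apply: measurable_funB; exact: measurable_funM.
have -> : (fun z => complex.Im (f z * g z)) = fun z =>
  complex.Re (f z) * complex.Im (g z) + complex.Im (f z) * complex.Re (g z).
  by apply/funext => z; case: (f z) (g z) => ? ? [].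
by apply: measurable_funD; exact: measurable_funM.
Qed.

Lemma cmfun_prod (I : Type) (l : seq I) (f : I -> T -> R[i]) :
  (forall i, cmfun (f i)) -> cmfun (fun z => \prod_(i <- l) f i z).
Proof.
move=> h; elim: l => [|i l ih].
  by split; under eq_fun do rewrite big_nil; exact: measurable_cst.
have -> : (fun z => \prod_(j <- i :: l) f j z) = fun z => f i z * \prod_(j <- l) f j z.
  by apply/funext => z; rewrite big_cons.
exact: cmfunM.
Qed.

Lemma cmfun_comp (chi : R -> R[i]) (u : T -> R) :
  continuous (fun x => complex.Re (chi x)) -> continuous (fun x => complex.Im (chi x)) ->
  mfun_ u -> cmfun (fun z => chi (u z)).
Proof.
by move=> c1 c2 mu_; split; [exact: (measurableT_comp (cont_mfun c1) mu_)|
  exact: (measurableT_comp (cont_mfun c2) mu_)].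
Qed.

End complex_measurability.

Section local_limit_theorem.
Context d (T : measurableType d) (R : realType) (P : probability T R)
  (X : T -> int) (lam : R).
Hypothesis LS : lattice_step P X lam.
Notation leb := (@lebesgue_measure R).
Notation leb2 := (leb \x leb)%E.
Implicit Types (z : R * R).
Notation chF := (chF P X).
Notation chK := (chK P X).
Notation quad := (quad P X lam).
Notation gth := (gth lam).
Notation wtn := (wtn P X lam).
Notation MI := (mean_height (cum P X) lam).
Notation P1 n := (Num.sqrt (n%:R : R)).
Notation P2 n := ((n%:R : R) * Num.sqrt n%:R).
Notation Dn := (Dn P X lam).
Notation al := (quad_cov0 P X lam).
Notation be := (quad_cov1 P X lam).
Notation ga := (quad_cov2 P X lam).
Let lam0 := ls_lam LS.
Notation gauss z := (expR (- (quad z / 2))).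
Notation inbox n z := ((`|z.1| <= pi * P1 n)%R && (`|z.2| <= pi * P2 n)%R).

Lemma Dn_bound : exists2 C : R, 0 < C & forall m s n z, (10 * m.+1 <= n)%N ->
  inbox n z -> nc (Dn m s n z) <= C * invquad z.
Proof.
have [C [K0 [C0 h]]] := prod_dom LS.
exists C => // m s n z mn /andP[z1 z2].
have [|||_] := h n m.+1 (n - m - m.+1)%N z _ _ _ z1 z2; [lia|lia|lia|].
rewrite (_ : (m.+1 + (n - m - m.+1) = n - m)%N); last by lia.
by rewrite /Dn ncM nc_cis mul1r nc_prod.
Qed.

Lemma inbox_eventually z : exists N : nat, forall n, (N <= n)%N -> inbox n z.
Proof.
pose c := z.1 ^+ 2 + z.2 ^+ 2; exists (Num.Def.truncn c).+1 => n Nn.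
have n0 : (0 < n)%N by exact: leq_trans Nn.
have n1 : (1 : R) <= n%:R by rewrite ler1n.
have cn : c <= n%:R by rewrite ltW// (lt_le_trans (truncnS_gt _))// ler_nat.
have p1 := @P1_gt0 R n n0.
have pi1 : (1 : R) <= pi by have := pi_ge2 R; lra.
have sq (x : R) : x ^+ 2 <= n%:R -> `|x| <= P1 n.
  by move=> h; rewrite -sqrtr_sqr ler_wsqrtr.
have s1 := sqr_ge0 z.1; have s2 := sqr_ge0 z.2.
apply/andP; split.
  by apply: le_trans (sq _ _) _; [rewrite /c in cn; lra|rewrite ler_peMl// ltW].
apply: le_trans (sq _ _) _; first by rewrite /c in cn; lra.
by rewrite mulrA ler_peMl ?(ltW p1)// mulr_ege1.
Qed.

(** The majorant of the transforms passes to the limit. This bound on the Gaussian precedes any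
    knowledge of the definiteness of [quad], which is deduced from it. *)
Lemma gauss_dom : exists2 C : R, 0 < C & forall z, gauss z <= C * invquad z.
Proof.
have [C C0 h] := Dn_bound; exists C => // z.
have [N hN] := inbox_eventually z.
rewrite -subr_le0; apply: (@cvgn_ge _ (maxn N 10) _ _ _ _ (@Dn_cvg _ _ _ _ _ _ LS 0 0 z)).
move=> n; rewrite geq_max => /andP[Nn n10].
have h1 := h 0%N 0 n z n10 (hN n Nn).
have e0 : nc ((gauss z)%:C%C) = gauss z by rewrite nc_real ger0_norm ?expR_ge0.
have := ncD (Dn 0 0 n z) (- (Dn 0 0 n z - (gauss z)%:C%C)).
rewrite opprB addrC subrK e0 => h2.
by rewrite lerBlDr; apply: (le_trans h2); rewrite ncBC addrC lerD.
Qed.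

(** If [quad z <= 0], the Gaussian would stay above 1 along the line through [z], while [invquad]
    tends to 0 there. *)
Lemma quad_gt0 z : z.1 != 0 \/ z.2 != 0 -> 0 < quad z.
Proof.
move=> nz; rewrite ltNge; apply/negP => q0.
have [C C0 hC] := gauss_dom.
have h (t : R) : 1 <= C * invquad (t * z.1, t * z.2).
  apply: le_trans (hC _); rewrite -expR0 ler_expR oppr_ge0.
  rewrite (_ : quad _ = t ^+ 2 * quad z); last by rewrite /QuadraticForm.quad /=; ring.
  by rewrite pmulr_lle0// mulr_ge0_le0 ?sqr_ge0.
have inv1 (x : R) : 0 < (1 + x ^+ 2)^-1 <= 1.
  have s := sqr_ge0 x; have p : 0 < 1 + x ^+ 2 by lra.
  by rewrite invr_gt0 p/= invf_le1//; lra.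
have key (x : R) : x != 0 -> exists t, C * (1 + (t * x) ^+ 2)^-1 < 1.
  move=> x0; exists (Num.sqrt C / x).
  have -> : Num.sqrt C / x * x = Num.sqrt C by rewrite divfK.
  by rewrite sqr_sqrtr ?(ltW C0)// ltr_pdivrMr ?mul1r; lra.
case: nz => /key[t ht].
  have := h t; rewrite leNgt => /negP; apply; apply: le_lt_trans ht.
  have /andP[a0 a1] := inv1 (t * z.1); have /andP[b0 b1] := inv1 (t * z.2).
  by rewrite /invquad /= ler_pM2l// ler_piMr// ltW.
have := h t; rewrite leNgt => /negP; apply; apply: le_lt_trans ht.
have /andP[a0 a1] := inv1 (t * z.1); have /andP[b0 b1] := inv1 (t * z.2).
by rewrite /invquad /= ler_pM2l// ler_piMl// ltW.
Qed.

Lemma quad_disc : 0 < al /\ 0 < al * ga - be ^+ 2.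
Proof.
have a0 : 0 < al.
  have := @quad_gt0 (1, 0) (or_introl (oner_neq0 _)).
  by rewrite /QuadraticForm.quad /= !mulr0 expr0n /= mulr0 !addr0 expr1n mulr1.
split => //; have := @quad_gt0 (- be / al, 1) (or_intror (oner_neq0 _)).
rewrite /QuadraticForm.quad /= => h.
have e : al * (be / al) = be by rewrite mulrC divfK// gt_eqF.
have := mulr_gt0 a0 h; congr (_ < _).
by field; rewrite gt_eqF.
Qed.

Lemma frq_mfun n i : mfun_ (fun z => frq n i z).
Proof.
apply: measurable_funD; first by apply: measurable_funM => //; exact: measurable_fst.
apply: measurable_funM => //.
by apply: measurable_funM => //; exact: measurable_snd.
Qed.

Lemma Dn_mfun m s n : cmfun (Dn m s n).
Proof.
apply: cmfunM.
  apply: (@cmfun_comp _ _ R cis (fun z => - (z.1 * (s%:~R / P1 n)) - z.2 * (MI * P1 n))).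
  - exact: continuous_cos.
  - exact: continuous_sin.
  - apply: measurable_funB.
      by apply: measurableT_comp => //; apply: measurable_funM => //; exact: measurable_fst.
    by apply: measurable_funM => //; exact: measurable_snd.
apply: cmfun_prod => i; have [c1 c2] := cont_chF LS (gth_itv LS n i).
exact: (cmfun_comp c1 c2 (frq_mfun n i)).
Qed.

Notation bx n z := (box2 (pi * P1 n) (pi * P2 n) z).

Lemma bxE n z : bx n z = (inbox n z : nat)%:R.
Proof. by rewrite /box2 !boxE; do 2 case: (_ <= _)%R; rewrite ?mulr1 ?mulr0. Qed.

Lemma bx_mfun n : mfun_ (fun z => bx n z).
Proof.
apply: measurable_funM.
  exact: (measurableT_comp (box_measurable _) measurable_fst).
exact: (measurableT_comp (box_measurable _) measurable_snd).
Qed.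

Lemma bx_itg n : (0 < n)%N -> Itg leb2 (fun z => bx n z) /\
  \int[leb2]_z bx n z = 4 * pi ^+ 2 * n%:R ^+ 2.
Proof.
move=> n0.
have E : (fun z => bx n z) = fun z => bx n z * cos (z.1 * (0%:~R / P1 n) + z.2 * (0%:~R / P2 n)).
  by apply/funext => z; rewrite !mul0r !mulr0 addr0 cos0 mulr1.
split; first by rewrite E; exact: itg_box2_cos.
rewrite [X in Rintegral _ _ X]E (int_box2_cos 0 0 (P1_gt0 R n0) (P2_gt0 R n0)).
by rewrite eqxx mulr1 -mulrA P12.
Qed.

(** Inside the box of frequencies the distance of the transform from its limit, outside it the
    Gaussian itself, which the inversion formula does not see. *)
Definition err m s z n : R := bx n z *
  (`|complex.Re (Dn m s n z - (gauss z)%:C%C)| + `|complex.Im (Dn m s n z - (gauss z)%:C%C)|) +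
  (1 - bx n z) * gauss z.

Variables (G0 V : R).
Hypothesis G0V : forall b, Itg leb2 (fun z => gauss z * cos (z.2 * b)) /\
  \int[leb2]_z (gauss z * cos (z.2 * b)) = G0 * expR (- (b ^+ 2 / (2 * V))).

Let gauss_itg : Itg leb2 (fun z => gauss z).
Proof.
have [i _] := G0V 0; move: i; congr (is_true (integrable _ _ _)).
by apply/funext => z /=; rewrite mulr0 cos0 mulr1.
Qed.

Lemma err_mfun m s n : mfun_ (fun z => err m s z n).
Proof.
have [d1 d2] := Dn_mfun m s n; have mg := itg_measurable gauss_itg.
apply: measurable_funD; apply: measurable_funM => //; first exact: bx_mfun.
- apply: measurable_funD; apply: measurableT_comp => //.
    have -> : (fun z => complex.Re (Dn m s n z - (gauss z)%:C%C)) =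
      fun z => complex.Re (Dn m s n z) - gauss z by apply/funext => z; rewrite ReB.
    exact: measurable_funB.
  have -> : (fun z => complex.Im (Dn m s n z - (gauss z)%:C%C)) =
    fun z => complex.Im (Dn m s n z) by apply/funext => z; rewrite ImB /= subr0.
  exact: d2.
- by apply: measurable_funB => //; exact: bx_mfun.
Qed.

Lemma err_cvg m s : exists N : nat,
  (forall n, (N <= n)%N -> Itg leb2 (fun z => err m s z n)) /\
  (\int[leb2]_z err m s z (n + N)%N) @[n --> \oo] --> (0 : R).
Proof.
have [C C0 hC] := Dn_bound; have [C' C0' hC'] := gauss_dom.
pose N := (10 * m.+1)%N; exists N.
have iD : Itg leb2 (fun z => 2 * (C + C') * invquad z + C' * invquad z).
  by apply: itgD; apply: itgZ; exact: itg_invquad.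
have ReIm (w : R[i]) : `|complex.Re w| + `|complex.Im w| <= 2 * nc w.
  by have := nc_Re w; have := nc_Im w; lra.
have dom n z : (N <= n)%N -> `|err m s z n| <= 2 * (C + C') * invquad z + C' * invquad z.
  move=> Nn; have q0 := invquad_ge0 z; have g0 := expR_ge0 (- (quad z / 2)); have g1 := hC' z.
  rewrite /err bxE; case: (boolP (inbox n z)) => zb; last first.
    rewrite mul0r add0r subr0 mul1r ger0_norm//; apply: (le_trans g1).
    by rewrite lerDr mulr_ge0// mulr_ge0// addr_ge0// ltW.
  rewrite mul1r subrr mul0r addr0 ger0_norm ?addr_ge0//.
  apply: (le_trans (ReIm _)); have := ncB (Dn m s n z) ((gauss z)%:C%C).
  rewrite nc_real (ger0_norm g0); have := hC m s n z Nn zb.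
  have : 0 <= C' * invquad z by rewrite mulr_ge0// ltW.
  by lra.
split.
  by move=> n Nn; apply: (@itg_dominated _ _ R leb2 _ _ (err_mfun m s n) iD) => z; exact: dom.
have Z : \int[leb2]_z (0 : R) = 0 by exact: int0.
rewrite -[X in _ --> X]Z.
have [] // := @int_dct _ _ R leb2 (fun n z => err m s z (n + N)%N) (fun=> 0) _ _ iD _ _.
- by move=> n; exact: err_mfun.
- by move=> n z; apply: dom; rewrite leq_addl.
move=> z; have [M hM] := inbox_eventually z.
have := @Dn_cvg _ _ _ _ _ _ LS m s z => /cvgn_dist hd.
apply: cvgn_le => e e0; have [M2 hM2] := hd (e / 2) (divr_gt0 e0 (ltr0n _ 2)).
exists (maxn M M2) => n; rewrite geq_max => /andP[Mn M2n].
rewrite /err bxE hM; last by lia.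
rewrite mul1r subrr mul0r addr0 subr0 ger0_norm ?addr_ge0//.
apply: (le_trans (ReIm _)).
have := hM2 (n + N)%N (leq_trans M2n (leq_addr _ _)).
by rewrite subr0 ger0_norm ?nc_ge0//; lra.
Qed.

(** The second term is the cut-off error: at most [n] factors, each changed by [2 * tail / c0],
    times the area of the box. It grows with [n] but vanishes as [K] increases for fixed [n], which
    dictates the order of the quantifiers in [local_limit]. *)
Lemma llt_error m s n K l x : (0 < n)%N -> perm_eq l (index_iota m.+1 (n - m)) ->
  forall c0 : R, 0 < c0 -> (forall th, 0 <= th <= lam -> c0 <= phi P X th) ->
  Itg leb2 (fun z => err m s z n) ->
  4 * pi ^+ 2 * `|n%:R ^+ 2 * local_prob (wtn n) K l s x -
    G0 / (4 * pi ^+ 2) * expR (- (((x%:~R - MI * n%:R ^+ 2) / P2 n) ^+ 2 / (2 * V)))| <=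
  \int[leb2]_z err m s z n + n%:R * (2 * (tail P X lam K / c0)) * (4 * pi ^+ 2 * n%:R ^+ 2).
Proof.
move=> n0 pl c0 c00 hc ie.
have p1 := P1_gt0 R n0; have p2 := P2_gt0 R n0; have [ib eb] := bx_itg n0.
have pi0 : 0 < 4 * pi ^+ 2 :> R by rewrite mulr_gt0// exprn_gt0// pi_gt0.
set b := (_ - _) / _; set ta := n%:R * (2 * _).
have ta0 : 0 <= ta by rewrite mulr_ge0// mulr_ge0// divr_ge0 ?(ltW c00)//; exact: tail_ge0.
have [il el] := local_probE (wtn n) K l s x p1 p2; have [ig eg] := G0V b.
rewrite -(gtr0_norm pi0) -normrM (gtr0_norm pi0) mulrBr.
have -> : 4 * pi ^+ 2 * (n%:R ^+ 2 * local_prob (wtn n) K l s x) =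
   4 * pi ^+ 2 * P1 n * P2 n * local_prob (wtn n) K l s x by rewrite -P12; ring.
have -> : 4 * pi ^+ 2 * (G0 / (4 * pi ^+ 2) * expR (- (b ^+ 2 / (2 * V)))) =
   G0 * expR (- (b ^+ 2 / (2 * V))) by rewrite mulrA mulrCA divff ?mulr1// gt_eqF.
rewrite el -eg -(intB il ig) -eb -(intZ _ ib) -(intD ie (itgZ _ ib)).
apply: (@int_abs_le _ _ R leb2 _ _ (itg_measurable (itgB il ig)) (itgD ie (itgZ _ ib))) => z.
rewrite /loc_integrand /err !bxE; case: (boolP (inbox n z)) => zb; last first.
  rewrite !mul0r subr0 mul1r !add0r mulr0 addr0 normrN normrM (ger0_norm (expR_ge0 _)).
  by rewrite ler_piMr ?expR_ge0// cos_max.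
rewrite !mul1r subrr mul0r addr0 mulr1.
have xE : x%:~R / P2 n = b + MI * P1 n.
  rewrite /b; have e : MI * n%:R ^+ 2 / P2 n = MI * P1 n.
    by rewrite -P12 -mulrA mulfK// gt_eqF.
  by rewrite mulrBl e subrK.
pose PK := \prod_(i <- l) chK K (gth n i) (frq n i z).
pose PF := \prod_(i <- l) chF (gth n i) (frq n i z).
pose ph := cis (- (z.1 * (s%:~R / P1 n)) - z.2 * (MI * P1 n)).
have DnE : Dn m s n z = ph * PF by rewrite /MiddleBlock.Dn /PF (perm_big _ pl).
have -> : cis (- (z.1 * (s%:~R / P1 n) + z.2 * (x%:~R / P2 n))) = cis (- (z.2 * b)) * ph.
  by rewrite -cisD; congr cis; rewrite xE; ring.
rewrite -/PK.
have PKF : nc (PK - PF) <= ta.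
  apply: (le_trans (nc_prodB _ _)).
  - by move=> i _; exact: chK_le1 LS _ _ _ (gth_itv LS n i).
  - by move=> i _; exact: chF_le1 LS _ _ (gth_itv LS n i).
  apply: (@le_trans _ _ (\sum_(i <- l) 2 * (tail P X lam K / c0))).
    apply: ler_sum => i _; apply: (le_trans (chK_chF LS _ _ (gth_itv LS n i))).
    have pg := phi_gt0 LS (gth_itv LS n i).
    by rewrite ler_pM2l// ler_wpM2l ?tail_ge0// lef_pV2 ?posrE// (hc _ (gth_itv LS n i)).
  rewrite big_const_seq count_predT (perm_size pl) size_iota iter_addr_0 -[leLHS]mulr_natl.
  have t0 : 0 <= 2 * (tail P X lam K / c0).
    by rewrite mulr_ge0// divr_ge0 ?(ltW c00)//; exact: tail_ge0.
  have sz : (n - m - m.+1 <= n)%N by clear; lia.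
  apply: (ler_wpM2r t0); rewrite ler_nat; exact: sz.
have cE : gauss z * cos (z.2 * b) = complex.Re (cis (- (z.2 * b)) * (gauss z)%:C%C).
  by rewrite /= cosN mulr0 subr0 mulrC.
have -> : complex.Re (cis (- (z.2 * b)) * ph * PK) - gauss z * cos (z.2 * b) =
  complex.Re (cis (- (z.2 * b)) * ph * (PK - PF)) +
  complex.Re (cis (- (z.2 * b)) * (Dn m s n z - (gauss z)%:C%C)).
  have AR (w1 w2 : R[i]) : complex.Re w1 + complex.Re w2 = complex.Re (w1 + w2).
    by case: w1 w2 => ? ? [].
  rewrite cE -ReB AR DnE; congr complex.Re.
  have E (a c k f g : R[i]) : a * c * k - a * g = a * c * (k - f) + a * (c * f - g) by ring.
  exact: E.
apply: (le_trans (ler_normD _ _)); rewrite addrC lerD//.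
  by apply: (le_trans (nc_Re _)); rewrite ncM nc_cis mul1r; exact: nc_le_ReIm.
by apply: (le_trans (nc_Re _)); rewrite !ncM !nc_cis !mul1r.
Qed.

End local_limit_theorem.

Section local_limit_statement.
Context d (T : measurableType d) (R : realType) (P : probability T R)
  (X : T -> int) (lam : R).
Hypothesis LS : lattice_step P X lam.
Notation MI := (mean_height (cum P X) lam).

Lemma local_limit : exists G V : R, [/\ 0 < G, 0 < V &
  forall m (s : int) (e : R), 0 < e -> exists N : nat, forall n, (N <= n)%N ->
  exists K1 : nat, forall K, (K1 <= K)%N -> forall l (x : int),
  perm_eq l (index_iota m.+1 (n - m)) ->
  `|n%:R ^+ 2 * local_prob (wtn P X lam n) K l s x -
    G * expR (- (((x%:~R - MI * n%:R ^+ 2) / (n%:R * Num.sqrt n%:R)) ^+ 2 / (2 * V)))| <= e].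
Proof.
have [a0 D0] := quad_disc LS.
have [G0 [V [G00 V0 hG]]] := gaussian_plane a0 D0.
have pi0 : 0 < 4 * pi ^+ 2 :> R by rewrite mulr_gt0// exprn_gt0// pi_gt0.
have pi1 : 1 <= 4 * pi ^+ 2 :> R.
  have p2 : (2 : R) <= pi := pi_ge2 R.
  have : (2 : R) ^+ 2 <= pi ^+ 2 by rewrite ler_sqr ?nnegrE ?pi_ge0.
  by lra.
exists (G0 / (4 * pi ^+ 2)), V; split => //; first exact: divr_gt0.
move=> m s e e0; have [N0 [iN /cvgn_dist cN]] := err_cvg LS hG m s.
have e2 : 0 < e / 2 by rewrite divr_gt0.
have [N1 hN1] := cN (e / 2) e2.
have [c0 c00 hc] := phi_lower LS.
exists (N0 + N1).+1 => n Nn; have n0 : (0 < n)%N by exact: leq_trans Nn.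
have nE : ((n - N0) + N0 = n)%N by rewrite subnK//; exact: leq_trans (leq_addr _ _) (ltnW Nn).
have := hN1 (n - N0)%N; rewrite nE => /(_ _) hE.
pose c := n%:R * (2 / c0) * (4 * pi ^+ 2 * n%:R ^+ 2).
have cc0 : 0 < c by rewrite !mulr_gt0 ?exprn_gt0 ?ltr0n ?invr_gt0 ?pi_gt0.
have [K1 hK1] := cvgn_dist (tail_cvg LS) (divr_gt0 e2 cc0).
exists K1 => K KK l x pl.
have ie : Itg (lebesgue_measure \x lebesgue_measure)%E (fun z => err P X lam m s z n).
  by apply: iN; exact: leq_trans (leq_addr _ _) (ltnW Nn).
have h := llt_error LS hG K x n0 pl c00 hc ie.
apply: (@le_trans _ _ (4 * pi ^+ 2 * `|n%:R ^+ 2 * local_prob (wtn P X lam n) K l s x -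
    G0 / (4 * pi ^+ 2) * expR (- (((x%:~R - MI * n%:R ^+ 2) / (n%:R * Num.sqrt n%:R)) ^+ 2 / (2 * V)))|)).
  by rewrite ler_peMl.
apply: (le_trans h).
have : \int[(lebesgue_measure \x lebesgue_measure)%E]_z err P X lam m s z n <= e / 2.
  apply: (le_trans (ler_norm _)); have := hE; rewrite subr0; apply.
  by rewrite leq_subRL; [exact: ltnW|exact: leq_trans (leq_addr _ _) (ltnW Nn)].
have := hK1 K KK; rewrite subr0 ger0_norm ?tail_ge0// ler_pdivlMr// => ht.
have -> : n%:R * (2 * (tail P X lam K / c0)) * (4 * pi ^+ 2 * n%:R ^+ 2) = tail P X lam K * c.
  by rewrite /c; ring.
by move=> ?; lra.
Qed.

End local_limit_statement.

(** * Decomposition of paths into blocks and positivity estimates *)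

Section path_blocks.
Context {R : realType}.
Implicit Types (wt : nat -> int -> R) (l : seq nat) (b : seq int) (F : seq int -> R).

Lemma path_sum_map wt K (f : nat -> nat) l F :
  path_sum wt K (map f l) F = path_sum (fun i => wt (f i)) K l F.
Proof. by elim: l F => [//|i l ih] F /=; apply: eq_step_sum => a _; rewrite ih. Qed.

Lemma path_sum_cvg (wt_ : nat -> nat -> int -> R) wt K l F :
  (forall i a, i \in l -> wt_ n i a @[n --> \oo] --> wt i a) ->
  path_sum (wt_ n) K l F @[n --> \oo] --> path_sum wt K l F.
Proof.
elim: l F => [|i l ih] F h /=; first exact: cvg_cst.
have sumc (I : Type) (q : seq I) (f_ : I -> nat -> R) (f : I -> R) :
    (forall k, f_ k @ \oo --> f k) -> \sum_(k <- q) f_ k n @[n --> \oo] --> \sum_(k <- q) f k.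
  move=> hf; elim: q => [|k q ihq]; first by rewrite big_nil; under eq_fun do rewrite big_nil; exact: cvg_cst.
  by rewrite big_cons; under eq_fun do rewrite big_cons; exact: cvgD.
apply: sumc => k; apply: cvgM.
  by apply: h; rewrite inE eqxx.
by apply: ih => j a jl; apply: h; rewrite inE jl orbT.
Qed.

Lemma step_sum_trunc (M K : nat) (g : int -> R) : (M <= K)%N ->
  step_sum K (fun a => (`|a| <= M)%N%:R * g a) = step_sum M g.
Proof.
move=> MK; rewrite /step_sum.
rewrite -(big_mkord xpredT (fun k : nat => (`|k%:Z - K%:Z| <= M)%N%:R * g (k%:Z - K%:Z))).
rewrite -(big_mkord xpredT (fun k : nat => g (k%:Z - M%:Z))).
rewrite (@big_cat_nat _ _ _ (K - M)%N)//=; last by lia.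
rewrite (@big_cat_nat _ _ _ (K + M).+1 (K - M)%N)//=; [|lia|lia].
rewrite [X in X + _]big_nat_cond big1 ?add0r; last first.
  move=> k; rewrite andbT => /andP[_ h]; rewrite (_ : (_ <= M)%N = false) ?mul0r//; lia.
rewrite [X in _ + X]big_nat_cond [X in _ + X]big1 ?addr0; last first.
  move=> k; rewrite andbT => /andP[h1 h2]; rewrite (_ : (_ <= M)%N = false) ?mul0r//; lia.
rewrite -{1}[(K - M)%N]add0n big_addn (_ : ((K + M).+1 - (K - M) = M.*2.+1)%N); last by lia.
apply: eq_big_nat => k /andP[_ h].
have -> : (k + (K - M))%N%:Z - K%:Z = k%:Z - M%:Z by lia.
by rewrite (_ : (_ <= M)%N = true) ?mul1r//; lia.
Qed.

Lemma path_sum_all wt (M K : nat) l F : (M <= K)%N ->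
  path_sum wt K l (fun b => (bounded_path M b)%:R * F b) = path_sum wt M l F.
Proof.
move=> MK; elim: l F => [|i l ih] F /=; first by rewrite mul1r.
rewrite -[RHS](step_sum_trunc _ MK); apply: eq_step_sum => a _.
have -> : (fun b => ((`|a| <= M)%N && bounded_path M b)%:R * F (a :: b)) =
  fun b => (`|a| <= M)%N%:R * ((bounded_path M b)%:R * F (a :: b)) :> R.
  by apply/funext => b; rewrite mulrA -natrM mulnb.
by rewrite path_sumZl ih; ring.
Qed.

Lemma stays_pos_rev (h : int) b : (0 < h) && stays_pos 1 h b =
  (0 < h + tot b) && stays_pos (- 1) (h + tot b) (rev b).
Proof.
have cat e h' b1 b2 : stays_pos e h' (b1 ++ b2) =
    stays_pos e h' b1 && stays_pos e (h' + e * tot b1) b2.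
  elim: b1 h' => [|a b1 ih] h'; first by rewrite /tot big_nil mulr0 addr0.
  by rewrite /= ih andbA /tot big_cons mulrDr addrA.
elim: b h => [|a b ih] h; first by rewrite /tot big_nil addr0.
have tE : tot (a :: b) = a + tot b by rewrite /tot big_cons.
rewrite rev_cons -cats1 cat /= mul1r ih tE addrA.
have trev : tot (rev b) = tot b by rewrite /tot (perm_big _ (permEl (perm_rev b))).
rewrite trev !mulN1r andbT.
have -> : h + a + tot b - tot b - a = h by ring.
by case: (0 < h); rewrite ?andbT ?andbF.
Qed.

Lemma stays_pos_cat e h b1 b2 : stays_pos e h (b1 ++ b2) =
    stays_pos e h b1 && stays_pos e (h + e * tot b1) b2.
Proof.
elim: b1 h => [|a b1 ih] h'; first by rewrite /tot big_nil mulr0 addr0.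
by rewrite /= ih andbA /tot big_cons mulrDr addrA.
Qed.

Definition block (M : nat) (e h : int) b : bool := bounded_path M b && stays_pos e h b.

Lemma area_cat l1 l2 b1 b2 : size b1 = size l1 ->
  area (l1 ++ l2) (b1 ++ b2) = area l1 b1 + area l2 b2.
Proof.
elim: l1 b1 => [|i l1 ih] [|a b1] //=; first by rewrite add0r.
by move=> /eqP; rewrite eqSS => /eqP s1; rewrite ih// addrA.
Qed.

Lemma tot_cat b1 b2 : tot (b1 ++ b2) = tot b1 + tot b2.
Proof. by rewrite /tot big_cat. Qed.

Section late_violation.
Variables (wt : nat -> int -> R) (K : nat).
Hypothesis wt0 : forall i a, 0 <= wt i a.
Hypothesis wt1 : forall i, step_sum K (wt i) <= 1.
Notation PS := (path_sum wt K).

(** The two indicators differ only if one of the first [m] steps exceeds [M], with probability at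
    most [tb] each, or if positivity first fails after time [m], which the exponential bound
    controls. *)
Lemma late_diff (e h : int) (del tb : R) (m M : nat) l (r : nat -> R) : 0 <= del -> 0 <= tb ->
  (forall i, 0 <= r i) ->
  (forall i, i \in l -> step_sum K (fun a => wt i a * expR (- (del * (e * a)%:~R))) <= r i) ->
  (forall i, i \in l -> step_sum K (fun a => wt i a * (M < `|a|)%N%:R) <= tb) ->
  PS l (fun b => `|(stays_pos e h b)%:R - (block M e h (take m b))%:R|) <=
  m%:R * tb + expR (- (del * h%:~R)) * \sum_(m.+1 <= j < (size l).+1) \prod_(i <- take j l) r i.
Proof.
move=> d0 tb0 r0; elim: m l h => [|m ih] l h rl tl.
  rewrite mul0r add0r; apply: le_trans (path_sum_viol wt0 h d0 wt1 r0 rl).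
  apply: le_path_sum => // b _ _; rewrite take0 /block /=.
  by case: (stays_pos _ _ _); rewrite ?subrr ?normr0// sub0r normrN normr1.
case: l rl tl => [|i l] rl tl.
  rewrite /= /block /= subrr normr0 addr_ge0// ?mulr_ge0 ?expR_ge0//.
  by apply: sumr_ge0 => j _; apply: prodr_ge0.
have rl' k : k \in l -> step_sum K (fun a => wt k a * expR (- (del * (e * a)%:~R))) <= r k.
  by move=> kl; apply: rl; rewrite inE kl orbT.
have tl' k : k \in l -> step_sum K (fun a => wt k a * (M < `|a|)%N%:R) <= tb.
  by move=> kl; apply: tl; rewrite inE kl orbT.
set Y := \sum_(m.+1 <= j < (size l).+1) \prod_(i <- take j l) r i.
have Y0 : 0 <= Y by apply: sumr_ge0 => j _; apply: prodr_ge0.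
have -> : \sum_(m.+2 <= j < (size (i :: l)).+1) \prod_(i0 <- take j (i :: l)) r i0 = r i * Y.
  by rewrite big_add1/= mulr_sumr; apply: eq_bigr => j _; rewrite big_cons.
apply: (@le_trans _ _ (step_sum K (fun a => wt i a * (M < `|a|)%N%:R + wt i a * (m%:R * tb) +
   wt i a * expR (- (del * (e * a)%:~R)) * (expR (- (del * h%:~R)) * Y)))); last first.
  rewrite !step_sumD !step_sumZr -natr1 mulrDl mul1r.
  have h1 := tl i (mem_head _ _); have h2 := rl i (mem_head _ _).
  have h3 : step_sum K (wt i) * (m%:R * tb) <= m%:R * tb by rewrite ler_piMl ?mulr_ge0.
  have h4 := ler_wpM2r (mulr_ge0 (expR_ge0 (- (del * h%:~R))) Y0) h2.
  have -> : expR (- (del * h%:~R)) * (r i * Y) = r i * (expR (- (del * h%:~R)) * Y) by ring.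
  by rewrite addrC [X in _ <= X + _]addrC; lra.
apply: le_step_sum => a _.
have -> : wt i a * (M < `|a|)%N%:R + wt i a * (m%:R * tb) +
   wt i a * expR (- (del * (e * a)%:~R)) * (expR (- (del * h%:~R)) * Y) =
  wt i a * ((M < `|a|)%N%:R + (m%:R * tb + expR (- (del * (h + e * a)%:~R)) * Y)).
  have -> : expR (- (del * (h + e * a)%:~R)) = expR (- (del * (e * a)%:~R)) * expR (- (del * h%:~R)).
    by rewrite -expRD intrD; congr expR; ring.
  by ring.
apply: ler_wpM2l => //.
have rest0 : 0 <= m%:R * tb + expR (- (del * (h + e * a)%:~R)) * Y.
  by rewrite addr_ge0 ?mulr_ge0 ?expR_ge0.
rewrite /block /=; have [aM|aM] := leqP `|a| M; last first.
  apply: (@le_trans _ _ 1); last by rewrite lerDl.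
  apply: path_sum_le_cst => // b _.
  by rewrite subr0; case: (_ && _); rewrite ?normr1 ?normr0.
rewrite add0r; have [p|p] := ltP 0 (h + e * a); last first.
  apply: le_trans rest0; rewrite -(path_sum0 wt K l); apply: le_path_sum => // b _ _.
  by rewrite andbF subrr normr0.
apply: le_trans (ih l (h + e * a) rl' tl'); apply: le_path_sum => // b _ _.
Qed.

(** Given the first half, the second must hit a prescribed end point and area, which costs [C]
    whatever the first half has done. *)
Lemma half_left (C : R) l1 l2 (D : seq int -> R) (z x : int) : (forall b, 0 <= D b) ->
  (forall s y, local_prob wt K l2 s y <= C) ->
  PS (l1 ++ l2) (fun b => D (take (size l1) b) * ((tot b == z) && (area (l1 ++ l2) b == x))%:R)
    <= C * PS l1 D.
Proof.
move=> D0 hC; rewrite path_sum_cat -path_sumZl; apply: le_path_sum => // b1 s1 _.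
apply: (@le_trans _ _ (D b1 * local_prob wt K l2 (z - tot b1) (x - area l1 b1))).
  rewrite /local_prob -path_sumZl; apply: le_path_sum => // b2 _ _.
  rewrite -s1 take_size_cat// ler_wpM2l//.
  rewrite tot_cat area_cat//.
  by rewrite (eq_sym (tot b2)) (eq_sym (area l2 b2)) !subr_eq (addrC (tot b1))
    (addrC (area l1 b1)) (eq_sym z) (eq_sym x).
by rewrite mulrC ler_wpM2r.
Qed.

Lemma half_right (C : R) l1 l2 (D : seq int -> R) (z x : int) : (forall b, 0 <= D b) ->
  (forall s y, local_prob wt K l1 s y <= C) ->
  PS (l1 ++ l2) (fun b => D (drop (size l1) b) * ((tot b == z) && (area (l1 ++ l2) b == x))%:R)
    <= C * PS l2 D.
Proof.
move=> D0 hC; rewrite path_sum_cat.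
rewrite (@path_sum_exchange R wt K l1 l2 (fun b1 b2 => D (drop (size l1) (b1 ++ b2)) *
  ((tot (b1 ++ b2) == z) && (area (l1 ++ l2) (b1 ++ b2) == x))%:R)).
rewrite -path_sumZl; apply: le_path_sum => // b2 s2 _.
apply: (@le_trans _ _ (D b2 * local_prob wt K l1 (z - tot b2) (x - area l2 b2))).
  rewrite /local_prob -path_sumZl; apply: le_path_sum => // b1 s1 _.
  rewrite -s1 drop_size_cat// ler_wpM2l//.
  rewrite tot_cat area_cat//.
  by rewrite (eq_sym (tot b1)) (eq_sym (area l1 b1)) !subr_eq (eq_sym z) (eq_sym x).
by rewrite mulrC ler_wpM2r.
Qed.

End late_violation.

Lemma path_sum1_ge (w : int -> R) M (t : R) l : (forall a, 0 <= w a) -> 0 <= t ->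
  step_sum M w <= 1 -> 1 - t <= step_sum M w ->
  1 - (size l)%:R * t <= path_sum (fun=> w) M l (fun=> 1).
Proof.
move=> w0 t0 w1 wt; elim: l => [|i l ih] /=; first by rewrite mul0r subr0.
rewrite step_sumZr -natr1; set s := (size l)%:R in ih *; have s0 : 0 <= s by [].
set p := path_sum _ _ _ _ in ih *; set q := step_sum _ _ in w1 wt *.
have p1 : p <= 1 by apply: path_sum_le_cst.
have p0 : 0 <= p by apply: path_sum_ge0.
have q0 : 0 <= q by apply: sumr_ge0.
nra.
Qed.

Lemma step_sum_ge_term M (g : int -> R) a0 : (forall a, 0 <= g a) -> (`|a0| <= M)%N ->
  g a0 <= step_sum M g.
Proof.
move=> g0 aM; have h : (absz (a0 + M%:Z)%R < M.*2.+1)%N by lia.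
rewrite /step_sum (bigD1 (Ordinal h))//= (_ : (absz (a0 + M%:Z)%R)%:Z - M%:Z = a0); last by lia.
by rewrite lerDl sumr_ge0.
Qed.

Lemma geom_le (q : R) n : 0 <= q < 1 -> \sum_(1 <= j < n.+1) q ^+ j <= (1 - q)^-1.
Proof.
move=> /andP[q0 q1]; have p : 0 < 1 - q by rewrite subr_gt0.
rewrite -[leRHS]mul1r ler_pdivlMr//.
have -> : (\sum_(1 <= j < n.+1) q ^+ j) * (1 - q) = q - q ^+ n.+1.
  elim: n => [|n ih]; first by rewrite big_geq// mul0r expr1 subrr.
  by rewrite big_nat_recr//= mulrDl ih !exprS; ring.
by have := exprn_ge0 n.+1 q0; lra.
Qed.

Lemma pos_lower (w : int -> R) M (t del c : R) (e a0 h : int) k0 l :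
  (forall a, 0 <= w a) -> 0 <= t -> step_sum M w <= 1 -> 1 - t <= step_sum M w ->
  0 <= del -> 0 < c -> 0 <= h -> 1 <= e * a0 -> (`|a0| <= M)%N -> (k0 <= size l)%N ->
  step_sum M (fun a => w a * expR (- (del * (e * a)%:~R))) <= expR (- c) ->
  w a0 ^+ k0 * (1 - (size l)%:R * t - expR (- (del * k0%:R)) * ((1 - expR (- c))^-1)) <=
  path_sum (fun=> w) M l (fun b => (stays_pos e h b)%:R).
Proof.
move=> w0 t0 w1 wt1 d0 c0 h0 ea aM kl hw.
have r1 : 0 <= expR (- c) < 1 by rewrite expR_ge0 expR_lt1 oppr_lt0.
set y := (1 - expR (- c))^-1; have y0 : 0 <= y by rewrite invr_ge0; lra.
have main : w a0 ^+ k0 * (1 - (size l)%:R * t - expR (- (del * (h%:~R + k0%:R))) * y) <=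
  path_sum (fun=> w) M l (fun b => (stays_pos e h b)%:R).
  elim: k0 h l h0 kl => [|k ih] h' l' h0' kl'.
    rewrite expr0 mul1r addr0.
    have -> : (fun b => (stays_pos e h' b)%:R) = fun b => 1 - (~~ stays_pos e h' b)%:R :> R.
      by apply/funext => b; case: (stays_pos _ _ _); rewrite /= ?subr0 ?subrr.
    rewrite path_sumB lerB ?path_sum1_ge//.
    have rr (i : nat) : 0 <= expR (- c) by exact: expR_ge0.
    apply: (le_trans (@path_sum_viol R (fun=> w) M (fun _ a => w0 a) e h' del l' (fun=> expR (- c))
      d0 (fun=> w1) rr (fun _ _ => hw))).
    rewrite ler_wpM2l ?expR_ge0//; apply: le_trans (geom_le (size l') r1).
    rewrite le_eqVlt; apply/orP; left; apply/eqP; apply: eq_big_nat => j /andP[_ hj].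
    by rewrite big_const_seq count_predT size_take iter_mulr_1; case: ltnP => // hs; congr (_ ^+ _); clear -hj hs; lia.
  case: l' kl' => // i l' kl' /=.
  have g0 a : 0 <= w a * path_sum (fun=> w) M l' (fun b => ((0 < h' + e * a) && stays_pos e (h' + e * a) b)%:R).
    by rewrite mulr_ge0// path_sum_ge0.
  apply: le_trans (step_sum_ge_term g0 aM).
  rewrite exprS -mulrA ler_wpM2l//.
  have hp : 0 < h' + e * a0 by lia.
  rewrite hp; apply: le_trans (ih (h' + e * a0) l' (ltW hp) kl').
  rewrite ler_wpM2l ?exprn_ge0// lerB//.
    by rewrite lerD2l lerN2 ler_wpM2r// ler_nat.
  rewrite ler_wpM2r// ler_expR lerN2 ler_wpM2l// intrD -natr1.
  have : (1 : R) <= (e * a0)%:~R by rewrite ler1z.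
  by lra.
apply: le_trans main; rewrite ler_wpM2l ?exprn_ge0// lerB//.
rewrite ler_wpM2r// ler_expR lerN2 ler_wpM2l// lerDr ler0z//.
Qed.

End path_blocks.

Lemma cat_rev_iota (a b c : nat) : (a <= b <= c)%N ->
  rev (index_iota a c) = rev (index_iota b c) ++ rev (index_iota a b).
Proof.
move=> /andP[ab bc]; rewrite -rev_cat /index_iota; congr rev.
by rewrite (_ : (c - a = (b - a) + (c - b))%N) ?iotaD ?subnKC//; lia.
Qed.

Lemma rev_iotaE (a n : nat) : rev (index_iota a n) = [seq (n.-1 - k)%N | k <- iota 0 (n - a)].
Proof.
apply: (@eq_from_nth _ 0%N); first by rewrite size_rev size_map !size_iota.
move=> i; rewrite size_rev size_iota => hi.
rewrite nth_rev ?size_iota// (nth_map 0%N) ?size_iota// !nth_iota//; lia.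
Qed.

Lemma prod_geom (R : realType) (r : nat -> R) (q : R) l m : 0 <= q < 1 ->
  (forall j, (j <= size l)%N -> \prod_(i <- take j l) r i <= q ^+ j) ->
  \sum_(m.+1 <= j < (size l).+1) \prod_(i <- take j l) r i <= q ^+ m * (1 - q)^-1.
Proof.
move=> hq h; have /andP[q0 q1] := hq.
apply: (@le_trans _ _ (\sum_(m.+1 <= j < (size l).+1) q ^+ j)).
  by apply: ler_sum_nat => j /andP[_ hj]; apply: h.
have [ml|ml] := leqP (size l) m.
  by rewrite big_geq// mulr_ge0 ?exprn_ge0// invr_ge0; lra.
rewrite -(add1n m) big_addn.
have -> : \sum_(1 <= i < (size l).+1 - m) q ^+ (i + m) = q ^+ m * \sum_(1 <= i < (size l - m).+1) q ^+ i.
  rewrite mulr_sumr (_ : ((size l).+1 - m = (size l - m).+1)%N); last by lia.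
  by apply: eq_bigr => i _; rewrite addnC exprD.
by rewrite ler_wpM2l ?exprn_ge0// geom_le.
Qed.

(** * The final step of an excursion and the drift at both ends *)

Section undershoot.
Context d (T : measurableType d) (R : realType) (P : probability T R)
  (X : T -> int) (lam : R).
Hypothesis LS : lattice_step P X lam.
Notation Ex := (Ex P X).

(** Probability that a single untilted step from the height [z] ends the excursion. *)
Definition below (z : int) : R := Ex (fun a => (a <= - z)%R%:R).
Notation H := (Ex (fun a => `|a%:~R|)).

Lemma below_ge0 z : 0 <= below z. Proof. exact: ex_ge0. Qed.

(** Tail-sum formula for the negative part: for a given step [a], at most [|a|] values of [z]
    contribute. *)
Lemma below_sum Z : \sum_(1 <= z < Z.+1) below z%:Z <= H.
Proof.
have igi z : Itg P (fun w => (X w <= - z%:Z)%R%:R : R) := ig_indic LS (fun a => a <= - z%:Z).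
have -> : \sum_(1 <= z < Z.+1) below z%:Z =
    Ex (fun a => \sum_(1 <= z < Z.+1) (a <= - z%:Z)%R%:R).
  by symmetry; exact: (@int_sum _ _ R P _ _ (fun (z : nat) w => (X w <= - z%:Z)%R%:R) igi).
rewrite /Tilting.Ex; apply: (@int_le _ _ R P (fun w => \sum_(1 <= z < Z.+1) (X w <= - z%:Z)%R%:R) (fun w => `|(X w)%:~R|)).
- exact: (@itg_sum _ _ R P _ _ (fun (z : nat) w => (X w <= - z%:Z)%R%:R) igi).
- exact: (ls_int LS).
move=> w; move: (X w) => a; have hZ k : \sum_(1 <= z < k.+1) (a <= - z%:Z)%R%:R <= k%:R :> R.
  elim: k => [|k ih]; first by rewrite big_geq.
  rewrite big_nat_recr//= -(natr1 k); apply: lerD => //. by case: (a <= _).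
elim: Z => [|Z ih]; first by rewrite big_geq.
have [h|h] := leP a (- Z.+1%:Z).
  apply: (le_trans (hZ _)); rewrite -intr_norm -[Z.+1%:R]/(Z.+1%:Z%:~R) ler_int; lia.
by rewrite big_nat_recr//= (lt_geF h) addr0.
Qed.

Lemma below_tail (e : R) : 0 < e -> exists M0 : nat, forall M Z, (M0 <= M)%N ->
  \sum_(M.+1 <= z < Z.+1) below z%:Z <= e.
Proof.
move=> e0; pose S Z := \sum_(1 <= z < Z.+1) below z%:Z.
have mono : nondecreasing_seq S.
  apply/nondecreasing_seqP => n; rewrite /S (big_nat_recr n.+1)//= lerDl; exact: below_ge0.
have ub : has_ubound (range S) by exists H => _ [n _ <-]; exact: below_sum.
have cv := nondecreasing_is_cvgn mono ub.
have [M0 hM] := cvgn_dist cv (divr_gt0 e0 (ltr0n _ 2)).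
exists M0 => M Z MM; have [ZM|MZ] := leqP Z M; first by rewrite big_geq// ltW.
have E : S Z = S M + \sum_(M.+1 <= z < Z.+1) below z%:Z.
  by rewrite /S (@big_cat_nat _ _ _ M.+1)//= ltnW.
have h1 := hM M MM; have h2 := hM Z (leq_trans MM (ltnW MZ)).
have : `|S Z - S M| <= e.
  rewrite (_ : S Z - S M = (S Z - limn S) - (S M - limn S)); last by ring.
  by apply: (le_trans (ler_normB _ _)); lra.
by move=> h; apply: le_trans h; rewrite E addrC addKr ler_norm.
Qed.

Notation mu := (mu P X).
Notation wtn := (wtn P X lam).
Notation gth := (gth lam).
Notation tail := (tail P X lam).
Let lam0 := ls_lam LS.
Let tg := @cum_tangent _ _ _ _ _ _ LS.
Let c0 := cum0 P X.
Let cl := cumlam LS.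

Lemma wtn_tail (cc : R) K M n i : 0 < cc -> (forall th, 0 <= th <= lam -> cc <= phi P X th) ->
  step_sum K (fun a => wtn n i a * (M < `|a|)%N%:R) <= tail M / cc.
Proof.
move=> c00 hc; have hth := gth_itv LS n i; have p0 := phi_gt0 LS hth.
rewrite tw_stepE; apply: (@le_trans _ _ ((phi P X (gth n i))^-1 * tail M)).
  rewrite ler_wpM2l ?invr_ge0 ?(ltW p0)//.
  pose g1 a := expR (gth n i * a%:~R) * (M < `|a|)%N%:R.
  pose g2 a := (M < `|a|)%N%:R * edom lam a.
  have ig : Itg P (fun w => g1 (X w)).
    apply: (ig_exp_bd LS (h := fun a => (M < `|a|)%N%:R) hth) => a.
    by case: (_ < _)%N; rewrite ?normr1 ?normr0.
  have g10 a : 0 <= g1 a by rewrite mulr_ge0 ?expR_ge0.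
  apply: (le_trans (@step_sum_le_ex _ _ _ _ _ _ LS K g1 ig g10)).
  have ig2 : Itg P (fun w => g2 (X w)).
    apply: (ig_dom LS (ig_edom LS) (h := g2)) => a.
    have e0 : 0 <= edom lam a by rewrite addr_ge0 ?expR_ge0.
    rewrite normrM (ger0_norm e0) ler_piMl//.
    by case: (_ < _)%N; rewrite ?normr1 ?normr0.
  apply: (@ex_le _ _ _ _ _ g1 g2 ig ig2) => a.
  rewrite /g1 /g2 mulrC ler_wpM2l//; apply: exp_le_edom => //.
by rewrite mulrC ler_wpM2l ?tail_ge0// lef_pV2 ?posrE// hc.
Qed.

(** A single bound [r i] may exceed 1, since slopes can be negative; only the products over initial
    stretches decay, by [drift_lower] with [i0 = n.-1]. The last clause is the same bound at the
    limiting tilt [lam]. *)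
Lemma forward_drift : exists del q : R, exists N : nat, [/\ 0 < del, 0 < q < 1,
  (forall n K, (N <= n)%N -> exists r : nat -> R, [/\ forall i, 0 <= r i,
    forall i, i \in rev (index_iota n./2.+1 n) ->
     step_sum K (fun a => wtn n i a * expR (- (del * (1 * a)%:~R))) <= r i &
    forall j, (j <= size (rev (index_iota n./2.+1 n)))%N ->
     \prod_(i <- take j (rev (index_iota n./2.+1 n))) r i <= q ^+ j]) &
  forall K, step_sum K (fun a => tw P X lam a * expR (- (del * (1 * a)%:~R))) <= q].
Proof.
have [del [c [eta [/andP[d0 dl] cp e0 dr]]]] := drift_lower lam0 tg c0 cl (cum_mid LS).
exists del, (expR (- (del * c))).
have [N hN] := cvgn_dist (@invn_cvg0 R) e0.
exists (maxn 4 N); split => //.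
- by rewrite expR_gt0 expR_lt1 oppr_lt0 mulr_gt0.
- move=> n K; rewrite geq_max => /andP[n4 Nn].
  have n0 : (0 < n)%N by lia.
  have nn0 : (0 : R) < n%:R by rewrite ltr0n.
  exists (fun i => expR (- (del * mu (gth n i - del)))); split.
  + by move=> i; exact: expR_ge0.
  + move=> i; rewrite mem_rev mem_index_iota => /andP[i1 i2].
    have i_n : (i <= n)%N by lia.
    have hth := gth_itv LS n i.
    have h2 : lam / 2 <= gth n i.
      rewrite gthE// ler_pM2l// ler_pdivlMr// mulrC ler_pdivrMr// -natrM ler_nat; lia.
    have := @tw_chernoff _ _ _ _ _ _ LS (gth n i) (- del) K hth.
    have -> : (fun a => tw P X (gth n i) a * expR (- del * a%:~R)) =
      fun a => wtn n i a * expR (- (del * (1 * a)%:~R)).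
      by apply/funext => a; rewrite mul1r mulNr.
    rewrite mulNr; apply; have /andP[h3 h4] := hth; apply/andP; split; lra.
  + move=> j; rewrite size_rev size_iota => hj.
    rewrite rev_iotaE -map_take take_iota (minn_idPl hj) big_map.
    rewrite -expR_sum -expRM_natl ler_expR.
    have -> : \sum_(i <- iota 0 j) - (del * mu (gth n (n.-1 - i) - del)) =
      - (del * \sum_(0 <= k < j) mu (lam * ((n.-1 - k)%N%:R / n%:R) - del)).
      rewrite mulr_sumr -sumrN /index_iota subn0; apply: eq_bigr => k _.
      by rewrite gthE//; lia.
    rewrite mulrN lerN2 mulrCA ler_pM2l// mulrC; apply: dr => //; [lia| |lia].
    have := hN n Nn; rewrite subr0 ger0_norm// => h.
    have -> : n.-1%:R = n%:R - 1 :> R by rewrite -[in RHS](prednK n0) -natr1 addrK.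
    have : n%:R^-1 * n%:R <= eta * n%:R by rewrite ler_pM2r.
    by rewrite mulVf ?gt_eqF//; lra.
- move=> K.
  have h1 : c <= mu (lam - del).
    have := dr 4%N 4%N 1%N isT isT; rewrite big_nat1 mulr1 subn0 divff ?mulr1 ?pnatr_eq0//; apply => //.
    by have := mulr_ge0 (ltW e0) (ler0n R 4); lra.
  have hl : 0 <= lam <= lam by rewrite lexx ltW.
  have := @tw_chernoff _ _ _ _ _ _ LS lam (- del) K hl.
  have -> : (fun a => tw P X lam a * expR (- del * a%:~R)) =
    fun a => tw P X lam a * expR (- (del * (1 * a)%:~R)).
    by apply/funext => a; rewrite mul1r mulNr.
  move=> /(_ _) h; apply: le_trans (h _) _; first by have l0 := lam0; apply/andP; split; lra.
  by rewrite ler_expR mulNr lerN2 ler_pM2l.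
Qed.

(** The reflection of the tilt about [lam / 2] preserves convexity and the zeros at the ends, and
    reverses the slopes; [drift_lower] then applies to the path read backwards from its end. *)
Let ct := fun th => cum P X (lam - th).
Let mt := fun th => - mu (lam - th).

Lemma backward_drift : exists del q : R, exists N : nat, [/\ 0 < del, 0 < q < 1,
  (forall n K, (N <= n)%N -> exists r : nat -> R, [/\ forall i, 0 <= r i,
    forall i, i \in index_iota 1 n./2.+1 ->
     step_sum K (fun a => wtn n i a * expR (- (del * (- 1 * a)%:~R))) <= r i &
    forall j, (j <= size (index_iota 1 n./2.+1))%N ->
     \prod_(i <- take j (index_iota 1 n./2.+1)) r i <= q ^+ j]) &
  forall K, step_sum K (fun a => tw P X 0 a * expR (- (del * (- 1 * a)%:~R))) <= q].
Proof.
have num : 2^-1 + 8^-1 <= 1 :> R by lra.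
have tt x y : 0 <= x <= lam -> 0 <= y <= lam -> ct x + mt x * (y - x) <= ct y.
  move=> /andP[x0 xl] /andP[y0 yl].
  have hx : 0 <= lam - x <= lam by apply/andP; split; lra.
  have hy : 0 <= lam - y <= lam by apply/andP; split; lra.
  by have := tg hx hy; rewrite /ct /mt (_ : lam - y - (lam - x) = - (y - x)) ?mulrN ?mulNr//; ring.
have t0 : ct 0 = 0 by rewrite /ct subr0.
have tl : ct lam = 0 by rewrite /ct subrr.
have tm : ct (lam / 2) < 0.
  by rewrite /ct (_ : lam - lam / 2 = lam / 2); [exact: (cum_mid LS)|field].
have [del [c [eta [/andP[d0 dl] cp e0 dr]]]] := drift_lower lam0 tt t0 tl tm.
exists del, (expR (- (del * c))).
have [N hN] := cvgn_dist (@invn_cvg0 R) e0.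
have eE (g : int -> R) K : step_sum K (fun a => g a * expR (- (del * (- 1 * a)%:~R))) =
    step_sum K (fun a => g a * expR (del * a%:~R)).
  by apply: eq_step_sum => a _; rewrite mulN1r mulrNz mulrN opprK.
exists (maxn 4 N); split => //.
- by rewrite expR_gt0 expR_lt1 oppr_lt0 mulr_gt0.
- move=> n K; rewrite geq_max => /andP[n4 Nn].
  have n0 : (0 < n)%N by lia.
  have nn0 : (0 : R) < n%:R by rewrite ltr0n.
  exists (fun i => expR (del * mu (gth n i + del))); split.
  + by move=> i; exact: expR_ge0.
  + move=> i; rewrite mem_index_iota => /andP[i1 i2].
    have i_n : (i <= n)%N by lia.
    have hth := gth_itv LS n i.
    have h2 : gth n i <= lam / 2.
      rewrite gthE// ler_pM2l// ler_pdivrMr// mulrC ler_pdivlMr// -natrM ler_nat; lia.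
    rewrite eE; apply: (tw_chernoff LS) => //.
    have /andP[h3 h4] := hth; rewrite (addr_ge0 h3 (ltW d0))/=.
    by apply: (le_trans (lerD h2 dl)); rewrite -mulrDr ler_piMr// ltW.
  + move=> j; rewrite size_iota => hj.
    rewrite take_iota (minn_idPl hj).
    rewrite -expR_sum -expRM_natl ler_expR.
    have -> : \sum_(i <- iota 1 j) del * mu (gth n i + del) =
      - (del * \sum_(0 <= k < j) mt (lam * ((n.-1 - k)%N%:R / n%:R) - del)).
      rewrite mulr_sumr -sumrN /index_iota subn0 (iotaDl 1 0) big_map.
      apply: eq_big_seq => k; rewrite mem_iota => /andP[_ hk].
      rewrite /mt mulrN opprK gthE; last by lia.
      congr (del * mu _).
      have -> : (n.-1 - k)%N%:R = n%:R - (1 + k)%N%:R :> R.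
        by rewrite -natrB; [congr _%:R; lia|lia].
      by field; rewrite gt_eqF.
    rewrite mulrN lerN2 mulrCA ler_pM2l// mulrC; apply: dr => //; [lia| |lia].
    have := hN n Nn; rewrite subr0 ger0_norm// => h.
    have -> : n.-1%:R = n%:R - 1 :> R by rewrite -[in RHS](prednK n0) -natr1 addrK.
    have : n%:R^-1 * n%:R <= eta * n%:R by rewrite ler_pM2r.
    by rewrite mulVf ?gt_eqF// mulrBl mul1r lerD2l lerN2.
- move=> K.
  have h1 : c <= - mu del.
    have := dr 4%N 4%N 1%N isT isT; rewrite big_nat1 mulr1 subn0 divff ?mulr1 ?pnatr_eq0//.
    rewrite /mt subKr; apply => //.
    by rewrite ler_piMl// gerBl ltW.
  have hl : 0 <= (0 : R) <= lam by rewrite lexx ltW.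
  rewrite eE; apply: (le_trans (tw_chernoff LS K hl _)).
    by rewrite add0r; have l0 := lam0; apply/andP; split; lra.
  by rewrite add0r ler_expR -mulrN ler_pM2l//; lra.
Qed.

End undershoot.

(** * Replacing positivity by constraints on two end blocks *)

Module Excursions.

Lemma bool_diff (R : realDomainType) (A B A' B' s : bool) :
  `|(A && B)%:R - (s && (A' && B'))%:R| <= `|A%:R - A'%:R| + `|B%:R - B'%:R| + (~~ s)%:R :> R.
Proof.
by case: A; case: B; case: A'; case: B'; case: s => /=;
  rewrite ?subrr ?subr0 ?sub0r ?normrN ?normr1 ?normr0; lra.
Qed.

Lemma stays_pos_tot (h : int) b : b != [::] -> stays_pos 1 h b -> 0 < h + tot b.
Proof.
elim: b h => [//|a [|a' b] ih] h _ /=.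
  by rewrite mul1r andbT /tot big_seq1.
move=> /andP[_ hb]; have := ih (h + 1 * a) isT hb.
by rewrite /tot mul1r big_cons [X in _ -> _ < _ + X]big_cons big_cons !addrA.
Qed.

(** Positivity of the second half is read backwards from the prescribed end point, so that each
    condition starts at its own end of the path. *)
Lemma split_pos b1 b2 (z : int) : b1 != [::] -> 0 < z -> tot (b1 ++ b2) = z ->
  stays_pos 1 0 (b1 ++ b2) = stays_pos 1 0 b1 && stays_pos (- 1) z (rev b2).
Proof.
move=> b1n z0 tz; rewrite stays_pos_cat mul1r add0r.
have [p|//] := boolP (stays_pos 1 0 b1); have t0 := stays_pos_tot b1n p.
rewrite add0r in t0; have := stays_pos_rev (tot b1) b2.
by rewrite t0 -tot_cat tz z0.
Qed.

Lemma tot_bound M b : bounded_path M b -> (`|tot b| <= size b * M)%N.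
Proof.
elim: b => [|a b ih] /=; first by rewrite /tot big_nil.
move=> /andP[h1 /ih h2]; rewrite /tot big_cons -/(tot b) mulSn.
by apply: leq_trans (leq_add h1 h2); clear; lia.
Qed.

Lemma area_bound (M n : nat) l b : bounded_path M b -> (forall i, i \in l -> (i <= n)%N) ->
  (`|area l b| <= size l * (n * M))%N.
Proof.
elim: l b => [|i l ih] [|a b] //= /andP[h1 h2] hl.
have i_n : (i <= n)%N by apply: hl; rewrite inE eqxx.
have h3 : (`|area l b| <= size l * (n * M))%N.
  by apply: ih => // j jl; apply: hl; rewrite inE jl orbT.
rewrite mulSn; have h4 := leq_mul i_n h1.
apply: leq_trans (leq_add h4 h3); rewrite -[X in (X + _)%N]/(`|i%:Z| * `|a|)%N -abszM.
by clear; lia.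
Qed.

(** The function [|p| * exp (- p ^ 2 / (2 * V))] is bounded. The lemma absorbs the contribution of
    the end blocks to the area, which is [O(1 / sqrt n)] after scaling. *)
Lemma gauss_lip (R : realType) (V : R) : 0 < V -> exists2 C : R, 0 < C &
  forall p q : R, `|p - q| <= 1 ->
  `|expR (- (p ^+ 2 / (2 * V))) - expR (- (q ^+ 2 / (2 * V)))| <= C * `|p - q|.
Proof.
move=> V0; have V2 : 0 < (2 * V)^-1 by rewrite invr_gt0 mulr_gt0.
pose g (p : R) := expR (- (p ^+ 2 / (2 * V))).
pose L := 1 + 2 * V; have L0 : 0 < L by rewrite addr_gt0// mulr_gt0.
exists ((2 * L + 1) / (2 * V)); first by rewrite divr_gt0 ?mulr_gt0 ?addr_gt0// mulr_gt0.
have gb (p : R) : `|p| * g p <= L.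
  rewrite /g expRN ler_pdivrMr ?expR_gt0//.
  apply: le_trans (ler_wpM2l (ltW L0) (expR_ge1Dx _)).
  have e : L * (1 + p ^+ 2 / (2 * V)) = 1 + 2 * V + p ^+ 2 + p ^+ 2 / (2 * V).
    by rewrite /L; field; rewrite gt_eqF.
  rewrite e; have h0 : 0 <= p ^+ 2 / (2 * V) by rewrite mulr_ge0 ?sqr_ge0 ?ltW.
  have : 0 <= (`|p| - 1) ^+ 2 by exact: sqr_ge0.
  rewrite -(real_normK (num_real p)) in h0 *.
  have : 0 <= `|p| by []. 
  set y := `|p|; set w := y ^+ 2 / _ in h0 *; move=> *; nra.
have main (p q : R) : `|p - q| <= 1 -> `|p| <= `|q| -> g p - g q <= (2 * L + 1) / (2 * V) * `|p - q|.
  move=> pq1 pq; pose dl := `|q| - `|p|.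
  have d0 : 0 <= dl by rewrite subr_ge0.
  have d1 : dl <= `|p - q| by rewrite distrC; apply: le_trans (ler_norm _) (ler_dist_dist _ _).
  have e1 : g q = g p * expR (- ((q ^+ 2 - p ^+ 2) / (2 * V))).
    by rewrite /g -expRD; congr expR; ring.
  have e2 : g p - g q <= g p * ((q ^+ 2 - p ^+ 2) / (2 * V)).
    rewrite e1; have := expR_ge1Dx (- ((q ^+ 2 - p ^+ 2) / (2 * V))) => h.
    have := ler_wpM2l (expR_ge0 (- (p ^+ 2 / (2 * V)))) h; rewrite -/(g p); lra.
  apply: (le_trans e2).
  have -> : q ^+ 2 - p ^+ 2 = dl * (2 * `|p| + dl).
    by rewrite /dl -(real_normK (num_real q)) -(real_normK (num_real p)); ring.
  have g1 : g p <= 1 by rewrite /g expR_le1 oppr_le0 mulr_ge0 ?sqr_ge0 ?ltW.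
  have g0 : 0 <= g p by exact: expR_ge0.
  have -> : g p * (dl * (2 * `|p| + dl) / (2 * V)) = (2 * (`|p| * g p) + dl * g p) * dl / (2 * V) by ring.
  rewrite [leRHS]mulrAC ler_pM2r//.
  have t0 : 0 <= 2 * (`|p| * g p) + dl * g p.
    by apply: addr_ge0; apply: mulr_ge0 => //; apply: mulr_ge0.
  apply: (ler_pM t0 d0) => //.
  rewrite lerD ?ler_pM2l//; apply: mulr_ile1 => //; exact: le_trans pq1.
move=> p q pq1; have [h|h] := leP `|p| `|q|.
  rewrite ger0_norm; first exact: main.
  rewrite subr_ge0 ler_expR lerN2 ler_pM2r// -(real_normK (num_real q)) -(real_normK (num_real p)).
  by rewrite ler_sqr ?nnegrE.
rewrite distrC (distrC p) ger0_norm; first by apply: main; rewrite 1?distrC// ltW.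
rewrite subr_ge0 ler_expR lerN2 ler_pM2r// -(real_normK (num_real q)) -(real_normK (num_real p)).
by rewrite ler_sqr ?nnegrE// ltW.
Qed.

Section excursion_blocks.
Context d (T : measurableType d) (R : realType) (P : probability T R)
  (X : T -> int) (lam : R).
Hypothesis LS : lattice_step P X lam.
Notation Ex := (Ex P X).
Notation below := (below P X).
Notation H := (Ex (fun a => `|a%:~R|)).
Notation wtn := (wtn P X lam).
Notation gth := (gth lam).
Notation tail := (tail P X lam).
Notation MI := (mean_height (cum P X) lam).
Implicit Types (z x : int).

(** Indices count the positions that follow, so they decrease along the path: [lf] indexes its first
    half and [lb] its second. *)
Definition lf n := rev (index_iota n./2.+1 n).
Definition lb n := rev (index_iota 1 n./2.+1).
Notation ln_ n := (lf n ++ lb n).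

(** Up to the explicit exponential factor and [n ^ 2], the probability of an excursion of length [n]
    and area [x] ([tilt_weight]): the path has [n.-1] steps, and [below] is the step that ends
    it. *)
Definition Gn n K x : R := n%:R ^+ 2 * path_sum (wtn n) K (ln_ n) (fun b =>
  (stays_pos 1 0 b)%:R * ((area (ln_ n) b == x)%:R * below (tot b))).

(** Only the first and the last [m] steps are constrained, the latter read backwards from the end
    point [z]. *)
Definition Tnz m M n K x z : R := path_sum (wtn n) K (ln_ n) (fun b =>
  (block M 1 0 (take m b) && block M (- 1) z (take m (rev b)))%:R *
   ((tot b == z) && (area (ln_ n) b == x))%:R).

Definition Tn m M n K x : R := n%:R ^+ 2 *
  \sum_(1 <= z < M.+1) below z%:Z * Tnz m M n K x z%:Z.

Let w0 n : forall i a, 0 <= wtn n i a := fun i a => wtn_ge0 LS n i a.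
Let w1 n K : forall i, step_sum K (wtn n i) <= 1 := fun i => wtn_le1 LS n K i.

Lemma Gn_sum n K x Z : (3 <= n)%N -> (n * K <= Z)%N ->
  Gn n K x = n%:R ^+ 2 * \sum_(1 <= z < Z.+1) below z%:Z * path_sum (wtn n) K (ln_ n) (fun b =>
    (stays_pos 1 0 b)%:R * ((tot b == z%:Z) && (area (ln_ n) b == x))%:R).
Proof.
move=> n3 nZ; congr (_ * _).
under [RHS]eq_bigr => z _ do rewrite -path_sumZl.
rewrite -path_sum_sum; apply: eq_path_sum => b sb bb.
have [p|_] := boolP (stays_pos 1 0 b); last first.
  by rewrite mul0r big1// => z _; rewrite mul0r mulr0.
have sz : size b = n.-1.
  by rewrite sb size_cat !size_rev !size_iota; clear -n3; lia.
have bn : b != [::] by rewrite -size_eq0 sz; clear -n3; lia.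
have t0 := stays_pos_tot bn p; rewrite add0r in t0.
have tb := tot_bound bb.
have tZ : (0 < `|tot b| <= Z)%N.
  apply/andP; split; first by clear -t0; lia.
  apply: (leq_trans tb); apply: leq_trans nZ; rewrite sz leq_mul2r leq_pred orbT//.
have tE : tot b = (`|tot b|%N)%:Z by clear -t0; lia.
rewrite (bigD1_seq `|tot b|%N) ?iota_uniq ?mem_index_iota ?ltnS//= -tE eqxx mul1r.
rewrite big1 ?addr0 ?mul1r 1?mulrC// => z zt.
rewrite (_ : (tot b == z%:Z) = false) ?mulr0//; apply/eqP => e.
by move/eqP: zt; apply; rewrite e.
Qed.

Lemma perm_lf n : perm_eq (lf n) (index_iota n./2.+1 n).
Proof. by rewrite /lf perm_rev. Qed.
Lemma perm_lb n : perm_eq (lb n) (index_iota 1 n./2.+1).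
Proof. by rewrite /lb perm_rev. Qed.

(** Late violations cost a geometric term in [m], steps beyond [M] in the end blocks cost
    [m * tail M], and end heights beyond [M] the tail of the sum of [below]. Each is multiplied by
    the local bound of a half of the path. Since [m * tail M] has to be small, [M] is chosen after
    [m]. *)
Lemma G_T_close (e : R) : 0 < e -> exists m0 : nat, forall m, (m0 <= m)%N ->
  exists M0 : nat, forall M, (M0 <= M)%N -> exists N K0 : nat, forall n K x,
  (N <= n)%N -> (K0 <= K)%N -> `|Gn n K x - Tn m M n K x| <= e.
Proof.
move=> e0; have [C [K1 [C0 hC]]] := local_bound LS.
have [c0 c00 hc] := phi_lower LS.
have [d1 [q1 [N1 [d10 q10 hf _]]]] := forward_drift LS.
have [d2 [q2 [N2 [d20 q20 hb _]]]] := backward_drift LS.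
have H0 : 0 <= H by exact: ex_ge0.
pose y1 := (1 - q1)^-1; pose y2 := (1 - q2)^-1.
have /andP[q1p q1l] := q10; have /andP[q2p q2l] := q20.
have c1 : (fun m : nat => C * H * (q1 ^+ m * y1 + q2 ^+ m * y2)) @ \oo --> (0 : R).
  have qc (q : R) : 0 < q -> q < 1 -> q ^+ m @[m --> \oo] --> (0 : R).
    by move=> h1 h2; apply: cvg_expr; rewrite gtr0_norm.
  rewrite -[X in _ --> X](mulr0 (C * H)); apply: cvgM; first exact: cvg_cst.
  rewrite -[X in _ --> X]addr0; apply: cvgD.
    by rewrite -[X in _ --> X](mul0r y1); apply: cvgM; [exact: qc|exact: cvg_cst].
  by rewrite -[X in _ --> X](mul0r y2); apply: cvgM; [exact: qc|exact: cvg_cst].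
have [m0 hm0] := cvgn_dist c1 (divr_gt0 e0 (ltr0n _ 3)).
exists m0 => m mm; have := hm0 m mm; rewrite subr0 => /(le_trans (ler_norm _)) em.
have c2 : (fun M : nat => C * H * (2 * m%:R / c0) * tail M) @ \oo --> (0 : R).
  by rewrite -[X in _ --> X](mulr0 (C * H * (2 * m%:R / c0))); apply: cvgM; [exact: cvg_cst|exact: tail_cvg LS].
have [M1 hM1] := cvgn_dist c2 (divr_gt0 e0 (ltr0n _ 3)).
have [|M2 hM2] := below_tail LS (e := e / (3 * C)); first by rewrite divr_gt0 ?mulr_gt0.
exists (maxn M1 M2) => M; rewrite geq_max => /andP[MM1 MM2].
have := hM1 M MM1; rewrite subr0 => /(le_trans (ler_norm _)) eM.
exists (maxn (N1 + N2) (maxn 20 (m.*2.+4))), (maxn K1 M) => n K x.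
rewrite !geq_max => /andP[nN /andP[n20 nm]] /andP[KK1 KM].
(* Beyond every end height of a cut-off path and beyond [M], so that both sums over [z] have a
   common range. *)
pose Z := maxn (n * K) M.
have n3 : (3 <= n)%N by clear -n20; lia.
rewrite (@Gn_sum n K x Z n3) ?leq_maxl// /Tn.
have -> : \sum_(1 <= z < M.+1) below z%:Z * Tnz m M n K x z%:Z =
   \sum_(1 <= z < Z.+1) below z%:Z * ((z <= M)%N%:R * Tnz m M n K x z%:Z).
  have MZ : (M <= Z)%N by exact: leq_maxr.
  rewrite [RHS](@big_cat_nat _ _ _ M.+1)//= [X in _ = _ + X]big_nat_cond [X in _ = _ + X]big1 ?addr0.
    by apply: eq_big_nat => z /andP[_ zM]; rewrite -ltnS zM mul1r.
  by move=> z; rewrite andbT => /andP[zM _]; rewrite leqNgt zM mul0r mulr0.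
rewrite -mulrBr -sumrB.
pose tb := tail M / c0.
have tb0 : 0 <= tb by rewrite divr_ge0 ?(ltW c00)//; exact: tail_ge0.
have Cl s y : n%:R ^+ 2 * local_prob (wtn n) K (lf n) s y <= C.
  apply: (hC n n./2.+1 (n - n./2.+1)%N) => //; [|clear -n20; lia|clear -n20; lia|clear -n20; lia].
  by rewrite subnKC ?perm_lf//; clear -n20; lia.
have Cr s y : n%:R ^+ 2 * local_prob (wtn n) K (lb n) s y <= C.
  apply: (hC n 1%N n./2) => //; [|clear -n20; lia|clear -n20; lia|clear -n20; lia].
  by rewrite add1n perm_lb.
have n20' : 0 < (n%:R : R) ^+ 2 by rewrite exprn_gt0// ltr0n; clear -n20; lia.
have Cl' s y : local_prob (wtn n) K (lf n) s y <= C / n%:R ^+ 2 by rewrite ler_pdivlMr// mulrC.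
have Cr' s y : local_prob (wtn n) K (lb n) s y <= C / n%:R ^+ 2 by rewrite ler_pdivlMr// mulrC.
pose dA b : R := `|(stays_pos 1 0 b)%:R - (block M 1 0 (take m b))%:R|.
pose dB z b : R := `|(stays_pos (- 1) z (rev b))%:R - (block M (- 1) z (take m (rev b)))%:R|.
have EA : path_sum (wtn n) K (lf n) dA <= m%:R * tb + q1 ^+ m * y1.
  have [r [r0 hr hp]] := hf n K (leq_trans (leq_addr _ _) nN).
  apply: (le_trans (@late_diff R (wtn n) K (w0 n) (w1 n K) 1 0 d1 tb m M (lf n) r (ltW d10) tb0 r0 hr _)).
    by move=> i _; exact: (wtn_tail LS).
  rewrite lerD2l mulr0 oppr0 expR0 mul1r; apply: prod_geom => //; by rewrite ltW.
have EB z : 0 <= z -> path_sum (wtn n) K (lb n) (dB z) <= m%:R * tb + q2 ^+ m * y2.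
  move=> z0; have [r [r0 hr hp]] := hb n K (leq_trans (leq_addl _ _) nN).
  rewrite /lb path_sum_rev /dB.
  rewrite (_ : (fun b => _) = fun b => `|(stays_pos (- 1) z b)%:R - (block M (- 1) z (take m b))%:R|); last first.
    by apply/funext => b; rewrite revK.
  apply: (le_trans (@late_diff R (wtn n) K (w0 n) (w1 n K) (- 1) z d2 tb m M _ r (ltW d20) tb0 r0 hr _)).
    by move=> i _; exact: (wtn_tail LS).
  rewrite lerD2l; apply: (@le_trans _ _ (\sum_(m.+1 <= j < (size (index_iota 1 n./2.+1)).+1) \prod_(i <- take j (index_iota 1 n./2.+1)) r i)).
    rewrite ler_piMl//; first by apply: sumr_ge0 => j _; apply: prodr_ge0.
    by rewrite expR_le1 oppr_le0 mulr_ge0 ?(ltW d20)// ler0z.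
  by apply: prod_geom => //; rewrite ltW.
have slf : (m < size (lf n))%N by rewrite size_rev size_iota; clear -nm; lia.
have slb : (m <= size (lb n))%N by rewrite size_rev size_iota; clear -nm; lia.
have key z : 0 < z -> n%:R ^+ 2 * `|path_sum (wtn n) K (ln_ n) (fun b =>
     (stays_pos 1 0 b)%:R * ((tot b == z) && (area (ln_ n) b == x))%:R) -
     (`|z| <= M)%N%:R * Tnz m M n K x z| <=
   C * ((m%:R * tb + q1 ^+ m * y1) + (m%:R * tb + q2 ^+ m * y2) + (M < `|z|)%N%:R).
  move=> z0; rewrite /Tnz -[_%:R * path_sum _ _ _ _]path_sumZl -path_sumB mulrC -ler_pdivlMr//.
  apply: le_trans; [by apply: path_sum_abs; exact: w0|].
  pose tt b : R := ((tot b == z) && (area (ln_ n) b == x))%:R.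
  pose l1 := size (lf n).
  apply: (@le_trans _ _ (path_sum (wtn n) K (ln_ n) (fun b => dA (take l1 b) * tt b) +
     path_sum (wtn n) K (ln_ n) (fun b => dB z (drop l1 b) * tt b) +
     path_sum (wtn n) K (ln_ n) (fun b => (fun=> (M < `|z|)%N%:R) (take l1 b) * tt b))).
    rewrite -!path_sumD; apply: (le_path_sum (w0 n)) => b sb _.
    rewrite -!mulrDl mulrA -mulrBl normrM (@ger0_norm _ _%:R)//.
    rewrite /tt; have [tz|_] := eqVneq (tot b) z; last by rewrite /= !mulr0.
    rewrite ler_wpM2r//.
    have bE := cat_take_drop l1 b.
    have s1 : size (take l1 b) = l1 by rewrite size_takel// sb size_cat leq_addr.
    have s2 : size (drop l1 b) = size (lb n) by rewrite size_drop sb size_cat addKn.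
    have b1n : take l1 b != [::] by rewrite -size_eq0 s1 /l1 -lt0n; exact: leq_trans slf.
    have tz' : tot (take l1 b ++ drop l1 b) = z by rewrite bE.
    have pE := split_pos b1n z0 tz'; rewrite bE in pE; rewrite pE -{3 4}bE.
    rewrite rev_cat !takel_cat ?s1 ?size_rev ?s2//; last exact: ltnW.
    by rewrite -natrM mulnb ltnNge; exact: bool_diff.
  have n2 : 0 <= C / n%:R ^+ 2 by rewrite divr_ge0 ?ltW.
  have kA := @half_left R (wtn n) K (w0 n) _ (lf n) (lb n) dA z x (fun=> normr_ge0 _) Cr'.
  have kB := @half_right R (wtn n) K (w0 n) _ (lf n) (lb n) (dB z) z x (fun=> normr_ge0 _) Cl'.
  have kC := @half_left R (wtn n) K (w0 n) _ (lf n) (lb n) (fun=> (M < `|z|)%N%:R) z x (fun=> ler0n _ _) Cr'.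
  apply: (le_trans (lerD (lerD kA kB) kC)); rewrite -!mulrDr [leRHS]mulrAC ler_wpM2l//.
  apply: lerD; first by apply: lerD; [exact: EA|apply: EB; exact: ltW].
  by apply: path_sum_cst_le; [exact: w0|exact: w1|].
rewrite mulr_sumr; apply: (le_trans (ler_norm_sum _ _ _)).
pose E1 := (m%:R * tb + q1 ^+ m * y1) + (m%:R * tb + q2 ^+ m * y2).
have y10 : 0 <= y1 by rewrite invr_ge0; lra.
have y20 : 0 <= y2 by rewrite invr_ge0; lra.
have E10 : 0 <= E1.
  by rewrite !addr_ge0// mulr_ge0// exprn_ge0// ltW.
apply: (@le_trans _ _ (\sum_(1 <= z < Z.+1) (C * E1 * below z%:Z + C * ((M < z)%N%:R * below z%:Z)))).
  apply: ler_sum_nat => z /andP[z1 _].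
  have b0 := below_ge0 P X z%:Z.
  rewrite -mulrBr mulrCA normrM (ger0_norm b0) normrM (ger0_norm (ltW n20')).
  have kz := key z%:Z (_ : 0 < z%:Z); rewrite absz_nat in kz.
  have {}kz := kz z1.
  apply: (le_trans (ler_wpM2l b0 kz)); rewrite le_eqVlt; apply/orP; left; apply/eqP.
  by rewrite -/E1; ring.
rewrite big_split /= -!mulr_sumr.
have S1 := below_sum LS Z; have S2 : \sum_(1 <= z < Z.+1) (M < z)%N%:R * below z%:Z <= e / (3 * C).
  have MZ : (M <= Z)%N by exact: leq_maxr.
  rewrite (@big_cat_nat _ _ _ M.+1)//= big_nat_cond big1 ?add0r; last first.
    by move=> z; rewrite andbT ltnS => /andP[_ zM]; rewrite ltnNge zM mul0r.
  apply: le_trans (hM2 M Z MM2); apply: ler_sum_nat => z /andP[zM _].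
  by rewrite zM mul1r.
have h1 : C * E1 * \sum_(1 <= z < Z.+1) below z%:Z <= C * E1 * H by rewrite ler_wpM2l// mulr_ge0// ltW.
have h2 := ler_wpM2l (ltW C0) S2.
have e3 : C * (e / (3 * C)) = e / 3 by field; rewrite gt_eqF.
have e4 : C * E1 * H = C * H * (q1 ^+ m * y1 + q2 ^+ m * y2) + C * H * (2 * m%:R / c0) * tail M.
  by rewrite /E1 /tb; ring.
rewrite e3 in h2; rewrite e4 in h1; clear -h1 h2 em eM; lra.
Qed.

End excursion_blocks.

End Excursions.
Export Excursions.

(** * Limit of the block approximation *)

Section excursion_limit.
Context d (T : measurableType d) (R : realType) (P : probability T R)
  (X : T -> int) (lam : R).
Hypothesis LS : lattice_step P X lam.
Notation Ex := (Ex P X).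
Notation below := (below P X).
Notation H := (Ex (fun a => `|a%:~R|)).
Notation wtn := (wtn P X lam).
Notation gth := (gth lam).
Notation tail := (tail P X lam).
Notation tw := (tw P X).
Notation MI := (mean_height (cum P X) lam).
Notation Tn := (Tn P X lam).
Notation Gn := (Gn P X lam).
Implicit Types (z x s : int).
Let lam0 := ls_lam LS.
Let w0 n : forall i a, 0 <= wtn n i a := fun i a => wtn_ge0 LS n i a.
Let w1 n K : forall i, step_sum K (wtn n i) <= 1 := fun i => wtn_le1 LS n K i.
Notation bn n x := ((x%:~R - MI * n%:R ^+ 2) / (n%:R * Num.sqrt n%:R)).
Notation ga V y := (expR (- (y ^+ 2 / (2 * V)))).

Variables (G V : R).
Hypothesis G0 : 0 < G.
Hypothesis V0 : 0 < V.
Hypothesis llt : forall m s (e : R), 0 < e -> exists N : nat, forall n, (N <= n)%N ->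
  exists K1 : nat, forall K, (K1 <= K)%N -> forall l x,
  perm_eq l (index_iota m.+1 (n - m)) ->
  `|n%:R ^+ 2 * local_prob (wtn n) K l s x - G * ga V (bn n x)| <= e.

Lemma llt_uniform m (S : nat) (e : R) : 0 < e -> exists N : nat, forall n, (N <= n)%N ->
  exists K1 : nat, forall K, (K1 <= K)%N -> forall s l x, (`|s| <= S)%N ->
  perm_eq l (index_iota m.+1 (n - m)) ->
  `|n%:R ^+ 2 * local_prob (wtn n) K l s x - G * ga V (bn n x)| <= e.
Proof.
move=> e0; elim: S => [|S [N hN]].
  have [N hN] := llt m 0 e0; exists N => n /hN[K1 hK]; exists K1 => K KK s l x s0 pl.
  by rewrite (_ : s = 0) ?hK//; clear -s0; lia.
have [Na hNa] := llt m S.+1%:Z e0; have [Nb hNb] := llt m (- S.+1%:Z) e0.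
exists (maxn N (maxn Na Nb)) => n; rewrite !geq_max => /andP[/hN[K1 h1] /andP[/hNa[K2 h2] /hNb[K3 h3]]].
exists (maxn K1 (maxn K2 K3)) => K; rewrite !geq_max => /andP[k1 /andP[k2 k3]] s l x sS pl.
have [h|h] := leqP `|s| S; first exact: h1.
have [->|->] : s = S.+1%:Z \/ s = - S.+1%:Z by clear -sS h; lia.
  exact: h2.
exact: h3.
Qed.

Lemma cvg_gth_tw (f : nat -> nat) (th : R) : 0 <= th <= lam ->
  (fun n => gth n (f n)) @ \oo --> th -> forall a, tw (gth n (f n)) a @[n --> \oo] --> tw th a.
Proof.
move=> hth hf a; apply: cvgM; first exact: cvg_cst.
have tg := @cum_tangent _ _ _ _ _ _ LS.
have E th' : 0 <= th' <= lam -> expR (th' * a%:~R) / phi P X th' = expR (th' * a%:~R - cum P X th').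
  by move=> h; rewrite expRD expRN (expR_cum LS h).
rewrite E//; under eq_fun do rewrite (E _ (gth_itv LS _ _)).
apply: continuous_cvg; first exact: continuous_expR.
apply: cvgB; first by apply: cvgM => //; exact: cvg_cst.
have B0 := slope_bound_gt0 (mu P X) lam.
apply: cvgn_le => e e0; have [N hN] := cvgn_dist hf (divr_gt0 e0 B0).
exists N => n Nn; apply: (le_trans (tangent_lipschitz lam0 tg (gth_itv LS _ _) hth)).
by rewrite mulrC -ler_pdivlMr// hN.
Qed.

(** [uM] and [vM] use the limiting tilts: [lam] at the beginning of the excursion and 0 at its end,
    where the walk is read backwards from the height [z]. *)
Definition uM m M : R := path_sum (fun=> tw lam) M (iota 0 m) (fun b => (stays_pos 1 0 b)%:R).
Definition vM m M z : R := path_sum (fun=> tw 0) M (iota 0 m) (fun b => (stays_pos (- 1) z b)%:R).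
Definition cM m M : R := \sum_(1 <= z < M.+1) below z%:Z * (uM m M * vM m M z%:Z).

(** The first steps have indices [n.-1 - k] and tilts tending to [lam]; the last ones, read
    backwards, have indices [k.+1] and tilts tending to 0. *)
Let un n m M : R := path_sum (fun k => wtn n (n.-1 - k)%N) M (iota 0 m) (fun b => (stays_pos 1 0 b)%:R).
Let vn n m M z : R := path_sum (fun k => wtn n k.+1) M (iota 0 m) (fun b => (stays_pos (- 1) z b)%:R).

Let un_cvg m M : un n m M @[n --> \oo] --> uM m M.
Proof.
apply: path_sum_cvg => k a _; apply: (cvg_gth_tw (f := fun n => (n.-1 - k)%N)).
  by rewrite lexx ltW.
apply: (@cvgn_eq _ k.+1 _ (fun n => lam - lam * k.+1%:R * n%:R^-1)) => [n kn|].
  have n0 : (n%:R : R) != 0 by rewrite pnatr_eq0; clear -kn; lia.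
  rewrite gthE; last by clear; lia.
  have -> : (n.-1 - k)%N%:R = n%:R - k.+1%:R :> R.
    by rewrite -natrB//; congr _%:R; clear -kn; lia.
  by field.
rewrite -[X in _ --> X]subr0 -[X in _ --> _ - X](mulr0 (lam * k.+1%:R)).
apply: cvgB; first exact: cvg_cst.
by apply: cvgM; [exact: cvg_cst|exact: invn_cvg0].
Qed.

Let vn_cvg m M z : vn n m M z @[n --> \oo] --> vM m M z.
Proof.
apply: path_sum_cvg => k a _; apply: (cvg_gth_tw (f := fun n => k.+1)).
  by rewrite lexx ltW.
apply: (@cvgn_eq _ k.+1 _ (fun n => lam * k.+1%:R * n%:R^-1)) => [n kn|].
  by rewrite gthE// mulrA.
rewrite -[X in _ --> X](mulr0 (lam * k.+1%:R)).
by apply: cvgM; [exact: cvg_cst|exact: invn_cvg0].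
Qed.

(** Given the two end blocks, the middle block must reach an end point bounded by [M + 2 * m * M]
    and an area within [2 * m * n * M] of [x]. The local limit theorem, uniform over such end
    points, applies, and the Gaussian barely notices the shift. *)
Lemma T_limit m M (e : R) : 0 < e -> exists N : nat, forall n, (N <= n)%N ->
  exists K1 : nat, forall K, (K1 <= K)%N -> forall x,
  `|Tn m M n K x - cM m M * G * ga V (bn n x)| <= e.
Proof.
move=> e0; have H0 : 0 <= H by exact: ex_ge0.
have [Cl Cl0 hl] := gauss_lip V0.
pose e1 := e / (3 * (H + 1)).
have H1 : 0 < H + 1 by rewrite ltr_wpDl.
have e10 : 0 < e1 by rewrite divr_gt0// mulr_gt0.
have [N1 hN1] := llt_uniform m (M + (m * M + m * M))%N e10.
have cc : (fun n => \sum_(1 <= z < M.+1) below z%:Z * (un n m M * vn n m M z%:Z)) @ \oo --> cM m M.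
  rewrite /cM; elim: (index_iota 1 M.+1) => [|z l ih].
    by rewrite big_nil; under eq_fun do rewrite big_nil; exact: cvg_cst.
  rewrite big_cons; under eq_fun do rewrite big_cons.
  apply: cvgD => //; apply: cvgM; first exact: cvg_cst.
  by apply: cvgM; [exact: un_cvg|exact: vn_cvg].
have e3G : 0 < e / (3 * G) by rewrite divr_gt0// mulr_gt0.
have [N2 hN2] := cvgn_dist cc e3G.
(* The end blocks move the area by at most [D * n], hence the scaled argument by at most
   [D / sqrt n]. *)
pose D := (m * M + m * M)%N.
have sc : (fun n : nat => D%:R * (Num.sqrt n%:R)^-1) @ \oo --> (0 : R).
  by rewrite -[X in _ --> X](mulr0 D%:R); apply: cvgM; [exact: cvg_cst|exact: sqrt_inv_cvg].
have [N3 hN3] := cvgn_dist sc (ltr01 : 0 < (1 : R)).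
have [N4 hN4] := cvgn_dist sc (divr_gt0 e10 (mulr_gt0 G0 Cl0)).
exists (maxn (maxn N1 N2) (maxn (maxn N3 N4) (m.*2.+4))) => n.
rewrite !geq_max => /andP[/andP[n1 n2] /andP[/andP[n3 n4] nm]].
have [K1 hK1] := hN1 n n1; exists (maxn K1 M) => K; rewrite geq_max => /andP[KK KM] x.
have n0 : (0 < n)%N by clear -nm; lia.
pose l1 := rev (index_iota (n - m) n); pose md := rev (index_iota m.+1 (n - m)).
pose l2 := rev (index_iota 1 m.+1).
have lE : lf n ++ lb n = l1 ++ (md ++ l2).
  rewrite -[RHS]/(l1 ++ (md ++ l2)) /lf /lb -cat_rev_iota; last by clear -nm; lia.
  rewrite /md /l2 -(@cat_rev_iota 1 m.+1 (n - m)); last by clear -nm; lia.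
  by rewrite /l1 -cat_rev_iota//; clear -nm; lia.
have s1E : size l1 = m by rewrite size_rev size_iota; clear -nm; lia.
have s2E : size l2 = m by rewrite size_rev size_iota; clear; lia.
have in1 i : i \in l1 -> (i <= n)%N.
  by rewrite mem_rev mem_index_iota => /andP[_]; clear; lia.
have in2 i : i \in l2 -> (i <= n)%N.
  by rewrite mem_rev mem_index_iota => /andP[_]; clear -nm; lia.
pose g := G * ga V (bn n x).
have ga1 y : 0 <= ga V y <= 1.
  rewrite expR_ge0 expR_le1 oppr_le0 mulr_ge0 ?sqr_ge0// invr_ge0 ltW// mulr_gt0//.
have p1 := P1_gt0 R n0; have p2 := P2_gt0 R n0.
have loc b1 b2 z : (0 < z <= M%:Z)%R -> size b1 = m -> size b2 = m -> bounded_path M b1 -> bounded_path M b2 ->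
  `|n%:R ^+ 2 * local_prob (wtn n) K md (z - tot b1 - tot b2) (x - area l1 b1 - area l2 b2) - g| <= 2 * e1.
  move=> hz s1 s2 B1 B2.
  have t1 := tot_bound B1; have t2 := tot_bound B2; rewrite s1 in t1; rewrite s2 in t2.
  have a1 := area_bound B1 in1; have a2 := area_bound B2 in2; rewrite s1E in a1; rewrite s2E in a2.
  set s := z - _ - _; set x' := x - _ - _.
  have sS : (`|s| <= M + (m * M + m * M))%N.
    by rewrite /s; move: (m * M)%N t1 t2 => q t1 t2; clear -t1 t2 hz; lia.
  have h1 := hK1 K KK s md x' sS (permEl (perm_rev _)).
  have dE : bn n x - bn n x' = (area l1 b1 + area l2 b2)%:~R / (n%:R * Num.sqrt n%:R).
    by rewrite /x' -mulrBl !rmorphB /= rmorphD /=; congr (_ / _); ring.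
  have dd : `|bn n x - bn n x'| <= D%:R * (Num.sqrt n%:R)^-1.
    rewrite dE normrM normfV (gtr0_norm p2) ler_pdivrMr//.
    have -> : D%:R / Num.sqrt n%:R * (n%:R * Num.sqrt n%:R) = (D * n)%N%:R :> R.
      by rewrite natrM; field; rewrite gt_eqF.
    rewrite -intr_norm -[(D * n)%N%:R]/((D * n)%N%:Z%:~R) ler_int.
    have -> : (D * n = m * (n * M) + m * (n * M))%N.
      by rewrite /D mulnDl -!mulnA (mulnC M).
    by move: (m * (n * M))%N a1 a2 => q a1 a2; clear -a1 a2; lia.
  have := hN3 n n3; rewrite subr0 => /(le_trans (ler_norm _)) d1.
  have := hN4 n n4; rewrite subr0 => /(le_trans (ler_norm _)) d2.
  have h2 := hl _ _ (le_trans dd d1).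
  have h3 : G * `|ga V (bn n x) - ga V (bn n x')| <= e1.
    apply: (le_trans (ler_wpM2l (ltW G0) h2)); rewrite mulrA.
    apply: (le_trans (ler_wpM2l (ltW (mulr_gt0 G0 Cl0)) (le_trans dd d2))).
    by rewrite mulrC divfK// gt_eqF// mulr_gt0.
  rewrite -(gtr0_norm G0) -normrM mulrBr in h3.
  have -> : n%:R ^+ 2 * local_prob (wtn n) K md s x' - g =
    (n%:R ^+ 2 * local_prob (wtn n) K md s x' - G * ga V (bn n x')) - (g - G * ga V (bn n x')).
    by ring.
  by apply: (le_trans (ler_normB _ _)); rewrite (_ : 2 * e1 = e1 + e1) ?lerD//; ring.
have uE : path_sum (wtn n) K l1 (fun b => (block M 1 0 b)%:R) = un n m M.
  rewrite /un /l1 rev_iotaE (_ : (n - (n - m) = m)%N); last by clear -nm; lia.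
  rewrite path_sum_map -(path_sum_all _ _ _ KM).
  by apply: eq_path_sum => b _ _; rewrite -natrM mulnb.
have vE z : path_sum (wtn n) K l2 (fun b => (block M (- 1) z (rev b))%:R) = vn n m M z.
  rewrite /vn /l2 path_sum_rev /index_iota subn1 (iotaDl 1 0) path_sum_map -(path_sum_all _ _ _ KM).
  by apply: eq_path_sum => b _ _; rewrite revK -natrM mulnb.
have Tz z : (0 < z <= M%:Z)%R -> `|n%:R ^+ 2 * Tnz P X lam m M n K x z - un n m M * vn n m M z * g| <= 2 * e1.
  move=> hz; have e20 : 0 <= 2 * e1 by rewrite mulr_ge0 ?ltW.
  have E : Tnz P X lam m M n K x z = path_sum (wtn n) K l1 (fun b1 => (block M 1 0 b1)%:R *
     path_sum (wtn n) K l2 (fun b2 => (block M (- 1) z (rev b2))%:R *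
       local_prob (wtn n) K md (z - tot b1 - tot b2) (x - area l1 b1 - area l2 b2))).
    rewrite /Tnz lE path_sum_cat; apply: eq_path_sum => b1 s1 _.
    rewrite path_sum_cat (@path_sum_exchange R (wtn n) K md l2 (fun bm b2 =>
      (block M 1 0 (take m (b1 ++ (bm ++ b2))) && block M (- 1) z (take m (rev (b1 ++ (bm ++ b2)))))%:R *
      ((tot (b1 ++ (bm ++ b2)) == z) && (area (l1 ++ md ++ l2) (b1 ++ (bm ++ b2)) == x))%:R)).
    rewrite -path_sumZl; apply: eq_path_sum => b2 s2 _.
    rewrite /local_prob -!path_sumZl; apply: eq_path_sum => bm sm _.
    rewrite s1E in s1; rewrite s2E in s2.
    rewrite take_size_cat// !rev_cat -catA take_size_cat ?size_rev//.
    rewrite !area_cat ?s1 ?s1E// !tot_cat mulrA -[X in _ = X * _]natrM mulnb; congr (_ * (_ && _)%:R).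
      by apply/eqP/eqP => h; clear -h; lia.
    by apply/eqP/eqP => h; clear -h; lia.
  rewrite E -uE -vE -path_sumZl -!path_sumZr -path_sumB.
  apply: le_trans; [by apply: path_sum_abs; exact: w0|].
  apply: path_sum_le_cst => //.
  move=> b1 s1; rewrite s1E in s1.
  have fac (a c p q h : R) : a * (c * p) - c * q * h = c * (a * p - q * h) by ring.
  rewrite fac normrM normr_nat.
  have [/andP[B1 _]|_] := boolP (block M 1 0 b1); last by rewrite mul0r.
  rewrite mul1r -path_sumZl -path_sumZr -path_sumB.
  apply: le_trans; [by apply: path_sum_abs; exact: w0|].
  apply: path_sum_le_cst => //.
  move=> b2 s2; rewrite s2E in s2.
  rewrite mulrCA -mulrBr normrM normr_nat.
  have [/andP[B2 _]|_] := boolP (block M (- 1) z (rev b2)); last by rewrite mul0r.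
  by rewrite mul1r; apply: loc => //; rewrite /bounded_path all_rev in B2.
have TE : Tn m M n K x - cM m M * G * ga V (bn n x) =
  \sum_(1 <= z < M.+1) below z%:Z * (n%:R ^+ 2 * Tnz P X lam m M n K x z%:Z - un n m M * vn n m M z%:Z * g)
  + (\sum_(1 <= z < M.+1) below z%:Z * (un n m M * vn n m M z%:Z) - cM m M) * g.
  under eq_bigr do rewrite mulrBr.
  rewrite sumrB /Excursions.Tn.
  have q1 : \sum_(1 <= z < M.+1) below z%:Z * (n%:R ^+ 2 * Tnz P X lam m M n K x z%:Z) =
    n%:R ^+ 2 * \sum_(1 <= z < M.+1) below z%:Z * Tnz P X lam m M n K x z%:Z.
    by rewrite mulr_sumr; apply: eq_bigr => z _; rewrite mulrCA.
  have q2 : \sum_(1 <= z < M.+1) below z%:Z * (un n m M * vn n m M z%:Z * g) =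
    (\sum_(1 <= z < M.+1) below z%:Z * (un n m M * vn n m M z%:Z)) * g.
    by rewrite mulr_suml; apply: eq_bigr => z _; rewrite mulrA.
  by rewrite q1 q2 /g; ring.
have /andP[ga0 ga_1] := ga1 (bn n x).
have g0 : 0 <= g := mulr_ge0 (ltW G0) ga0.
have gG : g <= G by rewrite /g ler_piMr// (ltW G0).
rewrite TE; apply: (le_trans (ler_normD _ _)).
have b1 : `|\sum_(1 <= z < M.+1) below z%:Z * (n%:R ^+ 2 * Tnz P X lam m M n K x z%:Z - un n m M * vn n m M z%:Z * g)| <= 2 * e1 * H.
  apply: (le_trans (ler_norm_sum _ _ _)); apply: (@le_trans _ _ (\sum_(1 <= z < M.+1) 2 * e1 * below z%:Z)).
    apply: ler_sum_nat => z /andP[z1 zM]; rewrite normrM (ger0_norm (below_ge0 P X _)) mulrC.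
    by rewrite ler_wpM2r ?below_ge0//; apply: Tz; clear -z1 zM; lia.
  by rewrite -mulr_sumr; apply: ler_wpM2l; [rewrite mulr_ge0 ?(ltW e10)|exact: (below_sum LS)].
have b2 : `|(\sum_(1 <= z < M.+1) below z%:Z * (un n m M * vn n m M z%:Z) - cM m M) * g| <= e / 3.
  rewrite normrM (ger0_norm g0); apply: (@le_trans _ _ (e / (3 * G) * G)).
    by apply: ler_pM => //; exact: hN2.
  by rewrite le_eqVlt; apply/orP; left; apply/eqP; field; rewrite gt_eqF.
have b3 : 2 * e1 * H <= 2 * (e / 3).
  have -> : 2 * e1 * H = 2 * (e / 3) * (H / (H + 1)) by rewrite /e1; field; rewrite gt_eqF.
  apply: ler_piMr; first by rewrite mulr_ge0 ?divr_ge0 ?(ltW e0).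
  by rewrite ler_pdivrMr// mul1r lerDl.
apply: (le_trans (lerD (le_trans b1 b3) b2)).
by rewrite le_eqVlt; apply/orP; left; apply/eqP; field.
Qed.

End excursion_limit.

(** * Positivity and existence of the limiting constant *)

Section excursion_constant.
Context d (T : measurableType d) (R : realType) (P : probability T R)
  (X : T -> int) (lam : R).
Hypothesis LS : lattice_step P X lam.
Notation tw := (tw P X).
Notation below := (below P X).
Notation tail := (tail P X lam).
Notation MI := (mean_height (cum P X) lam).
Notation Gn := (Gn P X lam).
Notation bn n x := ((x%:~R - MI * n%:R ^+ 2) / (n%:R * Num.sqrt n%:R)).
Notation ga V y := (expR (- (y ^+ 2 / (2 * V)))).
Let lam0 := ls_lam LS.

Lemma tw_mass (cc : R) th M : 0 < cc -> (forall th, 0 <= th <= lam -> cc <= phi P X th) ->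
  0 <= th <= lam -> 1 - tail M / cc <= step_sum M (tw th).
Proof.
move=> c00 hc hth; have p0 := phi_gt0 LS hth.
have h := @ex_trunc_tail _ _ _ _ _ _ LS th M (fun=> 1) hth (fun=> ltac:(by rewrite normr1)).
have E1 : step_sum M (fun a => tw th a * 1) = step_sum M (tw th).
  by apply: eq_step_sum => a _; rewrite mulr1.
have E2 : Ex P X (fun a => expR (th * a%:~R) * 1) = phi P X th.
  by rewrite /phi; congr (Tilting.Ex _ _ _); apply/funext => a; rewrite mulr1.
rewrite E1 E2 divff ?gt_eqF// in h.
have h2 : tail M / phi P X th <= tail M / cc.
  by rewrite ler_wpM2l ?tail_ge0// lef_pV2 ?posrE// hc.
move: h; rewrite distrC => /(le_trans (ler_norm _)) h.
by rewrite lerBlDr -lerBlDl; exact: le_trans h2.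
Qed.

(** Only the end height 1 is kept. Prescribed steps upwards at the start, and downwards at the end,
    lift the walk on either side; the cut-off and the later violations then lose at most a quarter
    each. The bound depends on neither [m] nor [M]. *)
Lemma cM_lower : exists2 c : R, 0 < c & exists m0 : nat, forall m, (m0 <= m)%N ->
  exists M0 : nat, forall M, (M0 <= M)%N -> c <= cM P X lam m M.
Proof.
have [c0 c00 hc] := phi_lower LS.
have [d1 [q1 [N1 [d10 /andP[q1p q1l] _ hf]]]] := forward_drift LS.
have [d2 [q2 [N2 [d20 /andP[q2p q2l] _ hb]]]] := backward_drift LS.
have [kp kp0 pk] := p_pos LS; have [kn kn0 pn] := p_neg LS.
have Il : 0 <= lam <= lam by rewrite lexx ltW.
have I0 : 0 <= (0 : R) <= lam by rewrite lexx ltW.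
have twp th a : 0 <= th <= lam -> 0 < pmass P X a -> 0 < tw th a.
  by move=> h pa; rewrite mulr_gt0// divr_gt0 ?expR_gt0// (phi_gt0 LS).
have ex_k0 (del q : R) : 0 < del -> 0 < q -> q < 1 ->
    exists k0 : nat, expR (- (del * k0%:R)) * (1 - q)^-1 <= 1 / 4.
  move=> d0 q0 ql; have y0 : 0 < (1 - q)^-1 by rewrite invr_gt0 subr_gt0.
  (* Large enough that [del * k0 >= 4 / (1 - q)]; then [exp v >= v] gives the quarter. *)
  pose k0 := (Num.Def.truncn (4 * (1 - q)^-1 / del)).+1; exists k0.
  have h : 4 * (1 - q)^-1 <= del * k0%:R.
    by rewrite [leRHS]mulrC -ler_pdivrMr// ltW// /k0 truncnS_gt.
  have h2 : del * k0%:R <= expR (del * k0%:R).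
    by apply: le_trans (expR_ge1Dx _); rewrite lerDr.
  rewrite expRN mulrC ler_pdivrMr ?expR_gt0//.
  by have := le_trans h h2; lra.
have [k1 hk1] := ex_k0 d1 q1 d10 q1p q1l.
have [k2 hk2] := ex_k0 d2 q2 d20 q2p q2l.
pose u0 := tw lam kp ^+ k1 * (1 / 2); pose v0 := tw 0 kn ^+ k2 * (1 / 2).
have u00 : 0 < u0 by rewrite mulr_gt0// exprn_gt0// twp.
have v00 : 0 < v0 by rewrite mulr_gt0// exprn_gt0// twp.
have b1 : 0 < below 1.
  apply: (lt_le_trans pn); rewrite /pmass /below; apply: ex_le.
  - exact: (ig_indic LS (fun b => b == kn)).
  - exact: (ig_indic LS (fun a => a <= - 1)).
  by move=> a; case: eqP => [->|_] //; rewrite (_ : (kn <= - 1)%R = true).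
exists (below 1 * (u0 * v0)); first by apply: mulr_gt0 => //; apply: mulr_gt0.
exists (maxn k1 k2) => m; rewrite geq_max => /andP[mk1 mk2].
have c2 : (fun M : nat => m%:R / c0 * tail M) @ \oo --> (0 : R).
  by rewrite -[X in _ --> X](mulr0 (m%:R / c0)); apply: cvgM; [exact: cvg_cst|exact: tail_cvg LS].
have [M1 hM1] := cvgn_dist c2 (divr_gt0 ltr01 (ltr0n _ 4)).
exists (maxn (maxn 1 M1) (maxn `|kp| `|kn|)) => M.
rewrite !geq_max => /andP[/andP[M0 MM1] /andP[Mp Mn]].
have := hM1 M MM1; rewrite subr0 => /(le_trans (ler_norm _)) tM.
have t0 : 0 <= tail M / c0 by rewrite divr_ge0 ?(ltW c00)//; exact: tail_ge0.
have low (th del q : R) (e a0 h : int) k0 : 0 <= th <= lam -> 0 < del -> 0 < q -> q < 1 ->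
    step_sum M (fun a => tw th a * expR (- (del * (e * a)%:~R))) <= q ->
    0 <= h -> 1 <= e * a0 -> (`|a0| <= M)%N -> (k0 <= m)%N ->
    expR (- (del * k0%:R)) * (1 - q)^-1 <= 1 / 4 ->
    tw th a0 ^+ k0 * (1 / 2) <= path_sum (fun=> tw th) M (iota 0 m) (fun b => (stays_pos e h b)%:R).
  move=> hth d0 q0 ql hq h0 ea aM km hk.
  have qE : expR (- (- ln q)) = q by rewrite opprK lnK.
  have lq : 0 < - ln q by rewrite oppr_gt0 ln_lt0// q0.
  have := @pos_lower R (tw th) M (tail M / c0) del (- ln q) e a0 h k0 (iota 0 m)
    (fun a => tw_ge0 LS a hth) t0 (tw_step_le1 LS M hth) (tw_mass M c00 hc hth) (ltW d0) lq h0 ea aM.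
  rewrite size_iota qE => /(_ km hq); apply: le_trans.
  rewrite ler_wpM2l ?exprn_ge0 ?(tw_ge0 LS)//.
  have e1 : m%:R * (tail M / c0) = m%:R / c0 * tail M by ring.
  by rewrite e1; lra.
have hu : u0 <= uM P X lam m M.
  apply: (low lam d1 q1) => //; [by clear -kp0; lia].
have hv : v0 <= vM P X m M 1.
  apply: (low 0 d2 q2) => //; [by clear -kn0; lia].
rewrite /cM big_ltn//; apply: (@le_trans _ _ (below 1 * (uM P X lam m M * vM P X m M 1))).
  by rewrite ler_pM2l//; apply: ler_pM => //; exact: ltW.
rewrite lerDl; apply: sumr_ge0 => z _; rewrite mulr_ge0 ?below_ge0// mulr_ge0//.
  by apply: path_sum_ge0 => // i a; exact: (tw_ge0 LS a Il).
by apply: path_sum_ge0 => // i a; exact: (tw_ge0 LS a I0).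
Qed.

(** For every precision some constant works, with a common positive lower bound. Two such constants
    approximate the same [Gn], so they are close wherever the Gaussian is bounded below; the
    constants are thus Cauchy and [C] is their limit. *)
Lemma excursion_llt : exists C V : R, [/\ 0 < C, 0 < V & forall e : R, 0 < e ->
  exists N : nat, forall n, (N <= n)%N -> exists K1 : nat, forall K, (K1 <= K)%N ->
  forall x : int, `|Gn n K x - C * ga V (bn n x)| <= e].
Proof.
have [G [V [G0 V0 llt]]] := local_limit LS.
have [cl cl0 [ml hml]] := cM_lower.
have step (e : R) : 0 < e -> exists2 c : R, cl * G <= c & exists N : nat, forall n, (N <= n)%N ->
    exists K1 : nat, forall K, (K1 <= K)%N -> forall x : int, `|Gn n K x - c * ga V (bn n x)| <= e.
  move=> e0; have e2 : 0 < e / 2 by rewrite divr_gt0.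
  have [m0 hm0] := G_T_close LS e2.
  pose m := maxn m0 ml.
  have [M0 hM0] := hm0 m (leq_maxl _ _); have [M1 hM1] := hml m (leq_maxr _ _).
  pose M := maxn M0 M1.
  have [N [K0 h1]] := hM0 M (leq_maxl _ _); have h2 := hM1 M (leq_maxr _ _).
  have [N' h3] := T_limit LS G0 V0 llt m M e2.
  exists (cM P X lam m M * G); first by rewrite ler_pM2r.
  exists (maxn N N') => n; rewrite geq_max => /andP[nN /h3[K1 h4]].
  exists (maxn K0 K1) => K; rewrite geq_max => /andP[k0 k1] x.
  have := h1 n K x nN k0; have := h4 K k1 x.
  set a := Gn n K x; set b := Excursions.Tn _ _ _ _ _ _ _ _; set c := _ * ga V _ => q1 q2.
  have -> : a - c = (a - b) + (b - c) by ring.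
  by apply: (le_trans (ler_normD _ _)); lra.
have /choice[c hc] : forall k : nat, exists c : R, cl * G <= c /\ exists N : nat, forall n, (N <= n)%N ->
    exists K1 : nat, forall K, (K1 <= K)%N -> forall x : int, `|Gn n K x - c * ga V (bn n x)| <= k.+1%:R^-1.
  by move=> k; have [|c h1 h2] := step k.+1%:R^-1; [rewrite invr_gt0|exists c].
pose E0 := ga V 1; have E00 : 0 < E0 by exact: expR_gt0.
have diff k j : `|c k - c j| <= (k.+1%:R^-1 + j.+1%:R^-1) / E0.
  have [_ [N1 h1]] := hc k; have [_ [N2 h2]] := hc j.
  pose n := (maxn N1 N2).+1.
  have [K1 g1] := h1 n (leq_trans (leq_maxl _ _) (leqnSn _)).
  have [K2 g2] := h2 n (leq_trans (leq_maxr _ _) (leqnSn _)).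
  (* An area at the centre of the Gaussian, up to rounding: the scaled argument is at most 1 in
     modulus and the Gaussian at least [E0]. *)
  pose K := maxn K1 K2; pose x : int := Num.floor (MI * n%:R ^+ 2).
  have := g1 K (leq_maxl _ _) x; have := g2 K (leq_maxr _ _) x.
  have b1 : `|bn n x| <= 1.
    have n1 : (1 : R) <= n%:R by rewrite ler1n.
    have s1 : 1 <= Num.sqrt (n%:R : R) by rewrite -[leLHS]sqrtr1 ler_wsqrtr.
    have p : 1 <= n%:R * Num.sqrt (n%:R : R) by rewrite mulr_ege1.
    have p0 : 0 < n%:R * Num.sqrt (n%:R : R) by exact: lt_le_trans p.
    rewrite normrM normfV (gtr0_norm p0) ler_pdivrMr// mul1r; apply: le_trans p.
    have /andP[f1 f2] := real_floor_itv (num_real (MI * n%:R ^+ 2)).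
    rewrite distrC ger0_norm ?subr_ge0//.
    by move: f2; rewrite intrD => f2; rewrite lerBlDl ltW.
  have gE : E0 <= ga V (bn n x).
    rewrite ler_expR lerN2 ler_pM2r ?invr_gt0 ?mulr_gt0// expr1n.
    by rewrite -(real_normK (num_real (bn n x))) expr_le1.
  set a := Gn n K x; set g := ga V _ in gE *; move=> q1 q2.
  rewrite ler_pdivlMr//; apply: (@le_trans _ _ (`|c k - c j| * g)); first by rewrite ler_wpM2l.
  have g0 : 0 <= g := expR_ge0 _.
  rewrite -[X in _ * X](ger0_norm g0) -normrM.
  have -> : (c k - c j) * g = (a - c j * g) - (a - c k * g) by ring.
  apply: (le_trans (ler_normB _ _)); rewrite addrC.
  by first [exact: (lerD q1 q2)|exact: (lerD q2 q1)].
have cv : cvgn c.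
  apply/cauchy_cvgP/cauchy_exP => e e0.
  have e1 : 0 < e * E0 / 4 by rewrite divr_gt0// mulr_gt0.
  have [N hN] := cvgn_dist (@invn_cvg0 R) e1.
  exists (c N); exists N => //= n Nn; rewrite /ball_ /=.
  apply: (le_lt_trans (diff N n)).
  have hs k : (N <= k)%N -> k.+1%:R^-1 <= e * E0 / 4.
    by move=> Nk; have := hN k.+1 (leqW Nk); rewrite subr0 ger0_norm.
  rewrite ltr_pdivrMr//; apply: (le_lt_trans (lerD (hs N (leqnn _)) (hs n Nn))).
  have p : 0 < e * E0 by rewrite mulr_gt0.
  by lra.
pose C := limn c.
have C0 : cl * G <= C by apply: (@cvgn_ge _ 0 c _ _ _ cv) => k _; have [] := hc k.
exists C, V; split => //; first by apply: lt_le_trans C0; rewrite mulr_gt0.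
move=> e e0; have e2 : 0 < e / 2 by rewrite divr_gt0.
have [k1 h1] := cvgn_dist cv e2; have [k2 h2] := cvgn_dist (@invn_cvg0 R) e2.
pose k := maxn k1 k2; have [_ [N hN]] := hc k.
exists N => n /hN[K1 hK]; exists K1 => K /hK h x.
have := h x; have := h1 k (leq_maxl _ _); rewrite -/C.
have := h2 k.+1 (leqW (leq_maxr _ _)); rewrite subr0 ger0_norm// => q1 q2 q3.
set a := Gn n K x in q3 *; set g := ga V _ in q3 *.
have g1 : 0 <= g <= 1 by rewrite expR_ge0 expR_le1 oppr_le0 mulr_ge0 ?sqr_ge0// invr_ge0 mulr_ge0// ltW.
have /andP[g0 gl] := g1.
have -> : a - C * g = (a - c k * g) + (c k - C) * g by ring.
apply: (le_trans (ler_normD _ _)); rewrite (normrM (c k - C)) (ger0_norm g0).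
have h3 : `|c k - C| * g <= `|c k - C| by rewrite ler_piMr.
by rewrite [leRHS](splitr e); exact: (lerD (le_trans q3 q1) (le_trans h3 q2)).
Qed.

End excursion_constant.

(** * Combinatorics of heights and areas *)

Section path_combinatorics.
Context {R : realType}.
Implicit Types (b : seq int).

Lemma rev_iotaS n : rev (index_iota 1 n.+2) = n.+1 :: rev (index_iota 1 n.+1).
Proof. by rewrite (@cat_rev_iota 1 n.+1 n.+2) ?leqnSn// /index_iota subSnn. Qed.

Lemma ln_rev n : (0 < n)%N -> lf n ++ lb n = rev (index_iota 1 n).
Proof.
case: n => [//|[|n] _]; first by [].
by rewrite /lf /lb -cat_rev_iota//; lia.
Qed.

Lemma sum_heights b :
  \sum_(1 <= k < (size b).+1) tot (take k b) = area (rev (index_iota 1 (size b).+1)) b.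
Proof.
elim: b => [|a b ih]; first by rewrite big_geq.
rewrite [RHS](_ : _ = (size b).+1%:Z * a + area (rev (index_iota 1 (size b).+1)) b); last first.
  by rewrite [size _]/= rev_iotaS.
rewrite -ih big_add1 /= (eq_bigr (fun k => a + tot (take k b))) => [|k _]; last by rewrite /tot big_cons.
rewrite big_split /= sumr_const_nat subn0 (@big_ltn _ _ _ 0)// take0 [tot [::]]/tot big_nil add0r.
by congr (_ + _); rewrite -mulr_natl natz.
Qed.

(** All heights are positive and their sum is at most [x], so each is at most [x], and a step is a
    difference of two heights. This makes the cut-off exact for a given area. *)
Lemma bounded_heights b (h : int) (x : nat) : 0 <= h -> stays_pos 1 h b ->
  0 <= area (rev (index_iota 1 (size b).+1)) b + h * (size b)%:Z /\
  (h <= x%:Z -> area (rev (index_iota 1 (size b).+1)) b + h * (size b)%:Z <= x%:Z -> bounded_path x b).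
Proof.
elim: b h => [|a b ih] h h0; first by rewrite mulr0.
rewrite [stays_pos _ _ _]/= mul1r => /andP[p hb].
have [q1 q2] := ih (h + a) (ltW p) hb.
have e : area (rev (index_iota 1 (size (a :: b)).+1)) (a :: b) + h * (size (a :: b))%:Z =
   (h + a) + (area (rev (index_iota 1 (size b).+1)) b + (h + a) * (size b)%:Z).
  rewrite [size (a :: b)]/= rev_iotaS [area _ _]/= -addn1 PoszD; ring.
rewrite e; move: q1 q2; set w := area _ b + _ => q1 q2; split.
  by rewrite addr_ge0// ltW.
move=> hx wx /=; apply/andP; split; first by clear -h0 p hx wx q1; lia.
by apply: q2; clear -p wx q1; lia.
Qed.

Lemma stays_posP b : reflect (forall j, (0 < j <= size b)%N -> 0 < tot (take j b)) (stays_pos 1 0 b).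
Proof.
have gen h : reflect (forall j, (0 < j <= size b)%N -> 0 < h + tot (take j b)) (stays_pos 1 h b).
  elim: b h => [|a b ih] h; first by apply: ReflectT => j; case: j.
  have tE j : tot (take j.+1 (a :: b)) = a + tot (take j b) by rewrite /= /tot big_cons.
  rewrite [stays_pos _ _ _]/= mul1r; apply: (iffP andP) => [[p /ih hb] [//|j] /andP[_ jb]|hb].
    rewrite tE addrA; case: j jb => [_|j jb]; first by rewrite take0 /tot big_nil addr0.
    by apply: hb.
  split; first by have := hb 1%N isT; rewrite tE take0 /tot big_nil addr0.
  by apply/ih => j /andP[j0 jb]; have := hb j.+1; rewrite tE addrA; apply.
by apply: (iffP (gen 0)) => h j /h; rewrite add0r.
Qed.

Lemma path_sum_dirac (K : nat) l (F : seq int -> R) b0 : size b0 = size l -> bounded_path K b0 ->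
  path_sum (fun _ _ => 1) K l (fun b => F b * (b == b0)%:R) = F b0.
Proof.
elim: l b0 F => [|i l ih] [|a0 b0] F //= => [_ _|/eqP]; first by rewrite mulr1.
rewrite eqSS => /eqP sb /andP[aK bK].
have S (h : int -> R) : step_sum K (fun a => h a * (a == a0)%:R) = h a0.
  have hk : (absz (a0 + K%:Z)%R < K.*2.+1)%N by clear -aK; lia.
  rewrite /step_sum (bigD1 (Ordinal hk))//= (_ : (absz (a0 + K%:Z)%R)%:Z - K%:Z = a0); last by clear -aK; lia.
  rewrite eqxx mulr1 big1 ?addr0// => k kk; case: eqP => [e|]; last by rewrite mulr0.
  by case/eqP: kk; apply: val_inj => /=; clear -e aK; lia.
transitivity (step_sum K (fun a => F (a :: b0) * (a == a0)%:R)); last exact: S.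
apply: eq_step_sum => a _; rewrite mul1r.
have -> : (fun b => F (a :: b) * (a :: b == a0 :: b0)%:R) =
  fun b => (F (a :: b) * (b == b0)%:R) * (a == a0)%:R.
  by apply/funext => b; rewrite eqseq_cons -mulnb natrM; ring.
by rewrite path_sumZr (ih b0 (fun b => F (a :: b))).
Qed.

Lemma path_sum_weight (q : int -> R) (K : nat) l (F : seq int -> R) :
  path_sum (fun _ _ => 1) K l (fun b => (\prod_(a <- b) q a) * F b) = path_sum (fun=> q) K l F.
Proof.
elim: l F => [|i l ih] F /=; first by rewrite big_nil mul1r.
apply: eq_step_sum => a _; rewrite mul1r -ih -path_sumZl; apply: eq_path_sum => b _ _.
by rewrite big_cons mulrA.
Qed.

End path_combinatorics.

(** * The tilting identity for path sums *)

Section tilting_identity.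
Context d (T : measurableType d) (R : realType) (P : probability T R)
  (X : T -> int) (lam : R).
Hypothesis LS : lattice_step P X lam.
Notation phi := (phi P X).
Notation cum := (cum P X).
Notation wtn := (wtn P X lam).

Lemma path_sum_tilt n K l F : (forall i, i \in l -> (i <= n)%N) ->
  path_sum (fun=> pmass P X) K l F =
  (\prod_(i <- l) phi (gth lam n i)) *
  path_sum (wtn n) K l (fun b => expR (- (lam / n%:R * (area l b)%:~R)) * F b).
Proof.
elim: l F => [|i l ih] F hl /=.
  by rewrite big_nil mul1r mulr0 oppr0 expR0 mul1r.
rewrite big_cons -mulrA -step_sumZl -step_sumZl; apply: eq_step_sum => a _.
rewrite ih; last by move=> j jl; rewrite hl// inE jl orbT.
have i_n : (i <= n)%N by rewrite hl// inE eqxx.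
have p0 := phi_gt0 LS (gth_itv LS n i).
have wE : wtn n i a = pmass P X a * (expR (gth lam n i * a%:~R) / phi (gth lam n i)) by [].
rewrite wE.
have -> : path_sum (wtn n) K l (fun b => expR (- (lam / n%:R * (i%:Z * a + area l b)%:~R)) * F (a :: b)) =
  path_sum (wtn n) K l (fun b => expR (- (gth lam n i * a%:~R)) *
   (expR (- (lam / n%:R * (area l b)%:~R)) * F (a :: b))).
  apply: eq_path_sum => b _ _; rewrite mulrA -expRD; congr (expR _ * _).
  by rewrite gthE// intrD intrM; ring.
rewrite path_sumZl expRN; set p1 := path_sum _ _ _ _; set p2 := \prod_(_ <- l) _.
have e0 : expR (gth lam n i * a%:~R) != 0 by rewrite gt_eqF// expR_gt0.
have pn : phi (gth lam n i) != 0 by rewrite gt_eqF.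
by field; rewrite e0 pn.
Qed.

Lemma tilt_weight n K (x : int) : (0 < n)%N ->
  path_sum (fun=> pmass P X) K (rev (index_iota 1 n))
    (fun b => (stays_pos 1 0 b)%:R * ((area (rev (index_iota 1 n)) b == x)%:R * below P X (tot b))) =
  expR (\sum_(1 <= i < n) cum (lam * (i%:R / n%:R))) * expR (- (lam * (x%:~R / n%:R))) *
  (Gn P X lam n K x / n%:R ^+ 2).
Proof.
move=> n0; have nn : n%:R != 0 :> R by rewrite pnatr_eq0 -lt0n.
rewrite (@path_sum_tilt n); last by move=> i; rewrite mem_rev mem_index_iota => /andP[_ /ltnW].
have A : \prod_(i <- rev (index_iota 1 n)) phi (gth lam n i) =
   expR (\sum_(1 <= i < n) cum (lam * (i%:R / n%:R))).
  rewrite (perm_big (index_iota 1 n)) ?perm_rev//= expR_sum.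
  apply: eq_big_nat => i /andP[_ i_n].
  by rewrite -gthE ?(ltnW i_n)// (expR_cum LS)//; exact: (gth_itv LS).
rewrite A.
have -> : path_sum (wtn n) K (rev (index_iota 1 n)) (fun b => expR (- (lam / n%:R * (area (rev (index_iota 1 n)) b)%:~R)) *
   ((stays_pos 1 0 b)%:R * ((area (rev (index_iota 1 n)) b == x)%:R * below P X (tot b)))) =
  path_sum (wtn n) K (rev (index_iota 1 n)) (fun b => expR (- (lam * (x%:~R / n%:R))) * ((stays_pos 1 0 b)%:R *
  ((area (rev (index_iota 1 n)) b == x)%:R * below P X (tot b)))).
  apply: eq_path_sum => b _ _; have [->|_] := eqVneq (area _ b) x; last by rewrite !(mul0r, mulr0).
  by congr (expR _ * _); rewrite mulrAC mulrA.
by rewrite path_sumZl /Gn ln_rev//; field.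
Qed.

End tilting_identity.

(** * Law of the excursion as an exact path sum *)

Section law_of_excursion.
Context d (T : measurableType d) (R : realType) (P : probability T R)
  (X : nat -> {RV P >-> R}) (lam : R).
Hypothesis X_indep : independent_seq P X.
Hypothesis X_id : identically_distributed P X.
Hypothesis X_int : forall (n : nat) (w : T), X n w \is a Num.int.

Definition Xz n w : int := Num.floor (X n w).

Lemma XzE n w : X n w = (Xz n w)%:~R.
Proof. by rewrite /Xz; have /intrP[m ->] := X_int n w; rewrite intrKfloor. Qed.

Lemma mfloor (A : set int) : measurable [set r : R | A (Num.floor r) /\ r \is a Num.int].
Proof.
pose f (a : int) := [set r : R | A a /\ r = a%:~R].
have mf a : measurable (f a).
  have [Aa|nA] := pselect (A a).
    have -> : f a = [set a%:~R]; last exact: measurable_set1.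
    by apply/seteqP; split => r /=; [case|split].
  have -> : f a = set0; last exact: measurable0.
  by apply/seteqP; split => r //= [].
have -> : [set r : R | A (Num.floor r) /\ r \is a Num.int] = \bigcup_(k : nat) (f k%:Z `|` f (- k%:Z)).
  apply/seteqP; split => r /=.
    move=> [Ar /intrP[m rm]]; rewrite rm intrKfloor in Ar; exists (absz m) => //.
    have [m0|m0] := leP 0 m; [left|right]; split => //; rewrite ?rm.
    + by rewrite gez0_abs.
    + by rewrite gez0_abs.
    + by rewrite ltz0_abs// opprK.
    + by rewrite ltz0_abs// opprK.
  by move=> [k _ [[Aa ->]|[Aa ->]]]; rewrite intrKfloor intr_int.
by apply: bigcupT_measurable => k; exact: measurableU.
Qed.

Lemma XzP n (A : set int) : Xz n @^-1` A = X n @^-1` [set r : R | A (Num.floor r) /\ r \is a Num.int].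
Proof. by apply/seteqP; split => w /=; [move=> h; split|case]. Qed.

Lemma mXz n (A : set int) : measurable (Xz n @^-1` A).
Proof.
rewrite XzP -[X in measurable X]setTI.
have mX : measurable_fun setT (X n : T -> R) by [].
exact: (mX measurableT _ (mfloor A)).
Qed.

Lemma Xz_indep (A : nat -> set int) m :
  P (\bigcap_(i in `I_m) (Xz i @^-1` A i)) = (\prod_(0 <= i < m) P (Xz 0 @^-1` A i))%E.
Proof.
pose J := [fset i in iota 0 m]%fset.
have mB i : measurable [set r : R | A i (Num.floor r) /\ r \is a Num.int] := mfloor (A i).
have := X_indep J mB.
have -> : \bigcap_(i in [set` J]) (X i @^-1` [set r : R | A i (Num.floor r) /\ r \is a Num.int]) =
   \bigcap_(i in `I_m) (Xz i @^-1` A i).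
  apply/seteqP; split => w h i /= hi.
    have [] // : (X i @^-1` [set r : R | A i (Num.floor r) /\ r \is a Num.int]) w.
    by apply: h => /=; rewrite /J inE mem_iota.
  split; last exact: X_int.
  by apply: (h i); move: hi; rewrite /= /J inE mem_iota.
move=> ->; rewrite (perm_big (index_iota 0 m)); last first.
  apply: uniq_perm; [exact: fset_uniq|exact: iota_uniq|].
  by move=> i; rewrite inE mem_index_iota mem_iota.
by apply: eq_bigr => i _; rewrite X_id// XzP.
Qed.

Lemma fine_indep (A : nat -> set int) m :
  fine (P (\bigcap_(i in `I_m) (Xz i @^-1` A i))) = \prod_(0 <= i < m) fine (P (Xz 0 @^-1` A i)).
Proof.
rewrite Xz_indep; elim: m => [|m ih]; first by rewrite !big_geq.
rewrite !big_nat_recr//= fineM ?ih// ?fin_num_measure//; last exact: mXz.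
elim: m {ih} => [|m ih]; first by rewrite big_geq.
by rewrite big_nat_recr//= fin_numM// fin_num_measure//; exact: mXz.
Qed.

Lemma int_ind (A : set T) : measurable A -> \int[P]_w (`[< A w >])%:R = fine (P A) /\
  Itg P (fun w => (`[< A w >])%:R).
Proof.
move=> mA; have E : (fun w => (`[< A w >])%:R) = \1_A :> (T -> R).
  by apply/funext => w; rewrite indicE; congr (_ : bool)%:R; rewrite /in_mem/=.
split.
  by rewrite /Rintegral; under eq_integral => w _ do rewrite (congr1 (fun f => f w) E); rewrite integral_indic// setIT.
rewrite E; apply/integrableP; split; first by apply/measurable_EFinP.
under eq_integral => w _ do rewrite /= ger0_norm//.
by rewrite integral_indic// setIT ltey_eq fin_num_measure.
Qed.

Lemma pmassE a : pmass P (Xz 0) a = fine (P (Xz 0 @^-1` [set a])).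
Proof.
rewrite -(int_ind (mXz 0 [set a])).1; apply: eq_Rintegral => w _.
by congr ((_ : bool)%:R); apply/eqP/asboolP.
Qed.

Lemma belowE z : below P (Xz 0) z = fine (P (Xz 0 @^-1` [set a | (a <= - z)%R])).
Proof.
rewrite -(int_ind (mXz 0 [set a | (a <= - z)%R])).1; apply: eq_Rintegral => w _.
by congr ((_ : bool)%:R); apply/idP/asboolP.
Qed.

Lemma walkE n w : walk X n w = (tot (mkseq (fun i => Xz i w) n))%:~R.
Proof.
rewrite /walk /tot /mkseq big_map rmorph_sum /= /index_iota subn0.
by apply: eq_bigr => i _; rewrite XzE.
Qed.

Lemma take_mkseq (f : nat -> int) j n : (j <= n)%N -> take j (mkseq f n) = mkseq f j.
Proof. by move=> jn; rewrite /mkseq -map_take take_iota (minn_idPl jn). Qed.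

Definition excursion n (x : nat) : set T := [set w | tau X w = n] `&` [set w | A_tau X w = x%:R].

Lemma excursionE n x w : excursion n.+1 x w <->
  let b := mkseq (fun i => Xz i w) n in
  [/\ stays_pos 1 0 b, area (rev (index_iota 1 n.+1)) b = x%:Z & (Xz n w <= - tot b)%R].
Proof.
pose b := mkseq (fun i => Xz i w) n; have sb : size b = n by rewrite size_mkseq.
have wn : tot (mkseq (fun i => Xz i w) n.+1) = tot b + Xz n w.
  by rewrite mkseqS -cats1 tot_cat /b /tot big_seq1.
have tauE : tau X w = n.+1 <-> stays_pos 1 0 b /\ (Xz n w <= - tot b)%R.
  have pos_walk j : (0 < walk X j w) = (0 < tot (mkseq (fun i => Xz i w) j))%R by rewrite walkE ltr0z.
  have np_walk : (walk X n.+1 w <= 0) = (Xz n w <= - tot b)%R.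
    by rewrite walkE lerz0 wn; apply/idP/idP => h; lia.
  split.
    rewrite /tau; case: pselect => [ex|//]; case: ex_minnP => k /andP[k0 hk] mk kn.
    rewrite kn in hk mk; rewrite -np_walk; split => //.
    apply/stays_posP => j /andP[j0]; rewrite sb => jn.
    rewrite take_mkseq// -pos_walk ltNge; apply/negP => hj.
    by have := mk j; rewrite j0 hj => /(_ isT); clear -jn; lia.
  move=> [/stays_posP hp hn]; rewrite /tau; case: pselect => [ex|nex]; last first.
    by case: nex; exists n.+1; rewrite /= np_walk.
  case: ex_minnP => k /andP[k0 hk] mk; apply/eqP; rewrite eqn_leq mk ?np_walk// andTb leqNgt.
  apply/negP => kn; have := hp k; rewrite k0 sb take_mkseq// -pos_walk => /(_ kn).
  by rewrite ltNge hk.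
have AE : tau X w = n.+1 -> A_tau X w = (area (rev (index_iota 1 n.+1)) b)%:~R.
  move=> tn; rewrite /A_tau tn -{2}sb -sum_heights sb rmorph_sum /=.
  by apply: eq_big_nat => k /andP[_ kn]; rewrite walkE take_mkseq.
split => /=.
  move=> [tn Ax]; have [p1 p2] := tauE.1 tn; split => //.
  by apply/eqP; rewrite -(eqr_int R) -(AE tn) Ax.
move=> [p1 p2 p3]; have tn := tauE.2 (conj p1 p3); split => //=.
by rewrite (AE tn) p2.
Qed.

(** The indicator of the event is a finite sum of indicators of cylinders, because by
    [bounded_heights] the cut-off at [K >= x] excludes nothing. This gives measurability, and
    independence factors each cylinder. *)
Lemma excursion_path n x K : (x <= K)%N ->
  measurable (excursion n.+1 x) /\ fine (P (excursion n.+1 x)) =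
  path_sum (fun=> pmass P (Xz 0)) K (rev (index_iota 1 n.+1))
    (fun b => (stays_pos 1 0 b)%:R * ((area (rev (index_iota 1 n.+1)) b == x%:Z)%:R * below P (Xz 0) (tot b))).
Proof.
move=> xK; pose l := rev (index_iota 1 n.+1).
have sl : size l = n by rewrite size_rev size_iota subn1.
pose good b := stays_pos 1 0 b && (area l b == x%:Z).
(* The first [n] steps are prescribed; the step with number [n], counted from 0, only has to bring
   the walk to 0 or below. *)
pose A (b : seq int) (i : nat) : set int := if (i < n)%N then [set nth 0 b i] else [set a | (a <= - tot b)%R].
pose cyl b : set T := \bigcap_(i in `I_n.+1) (Xz i @^-1` A b i).
have mcyl b : measurable (cyl b).
  by apply: fin_bigcap_measurable => [|i _]; [exact: finite_II|exact: mXz].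
have cylE b w : size b = n -> cyl b w <-> b = mkseq (fun i => Xz i w) n /\ (Xz n w <= - tot b)%R.
  move=> sb; split => [h|[bE h] i /= hi].
    split; last by have := h n (ltnSn n); rewrite /A /= ltnn.
    apply: (@eq_from_nth _ 0); rewrite ?size_mkseq// sb => i hi.
    by have := h i (leqW hi); rewrite /A /= hi nth_mkseq// => ->.
  rewrite /A; case: ifP => hin /=; first by rewrite bE nth_mkseq.
  by rewrite (_ : i = n)//; apply/eqP; rewrite eqn_leq -ltnS hi leqNgt hin.
have pw w : (`[< excursion n.+1 x w >])%:R = path_sum (fun _ _ => 1) K l
    (fun b => (good b)%:R * (`[< cyl b w >])%:R) :> R.
  pose b0 := mkseq (fun i => Xz i w) n.
  have E b : size b = size l -> (good b)%:R * (`[< cyl b w >])%:R =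
     ((good b)%:R * (Xz n w <= - tot b)%R%:R) * (b == b0)%:R :> R.
    move=> sb; rewrite sl in sb; rewrite -mulrA; congr (_ * _).
    rewrite -natrM mulnb; congr (nat_of_bool _)%:R.
    by apply/asboolP/andP => [/(cylE _ _ sb)[-> ->]|[h1 /eqP h2]]; rewrite ?eqxx//; apply/cylE.
  have -> : path_sum (fun _ _ => 1) K l (fun b => (good b)%:R * (`[< cyl b w >])%:R) =
    path_sum (fun _ _ => 1) K l (fun b => ((good b)%:R * (Xz n w <= - tot b)%R%:R) * (b == b0)%:R) :> R.
    by apply: eq_path_sum => b sb _; exact: E.
  have [B|B] := boolP (bounded_path K b0).
    rewrite path_sum_dirac//; last by rewrite size_mkseq.
    rewrite -natrM mulnb; congr (nat_of_bool _)%:R; apply/asboolP/andP.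
      by move=> /excursionE[h1 h2 h3]; split => //; rewrite /good h1 h2 eqxx.
    by move=> [/andP[h1 /eqP h2] h3]; apply/excursionE.
  have -> : path_sum (fun _ _ => 1) K l (fun b => ((good b)%:R * (Xz n w <= - tot b)%R%:R) * (b == b0)%:R) = 0 :> R.
    rewrite -[RHS](path_sum0 (fun _ _ => 1) K l); apply: eq_path_sum => b _ bb.
    by case: eqP => [e|]; rewrite ?mulr0//; rewrite e (negbTE B) in bb.
  rewrite asboolF// => /excursionE[h1 h2 _]; case/negP: B.
  have [_ hh] := @bounded_heights b0 0 x (lexx _) h1.
  have : bounded_path x b0.
    by apply: hh => //; rewrite mul0r addr0 size_mkseq h2.
  by apply: sub_all => a; move=> h; exact: leq_trans xK.
have iF b : Itg P (fun w => (good b)%:R * (`[< cyl b w >])%:R) by apply: itgZ; exact: (int_ind (mcyl b)).2.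
have [iS eS] := @path_sum_int R (fun _ _ => 1) K _ _ P l (fun b w => (good b)%:R * (`[< cyl b w >])%:R) iF.
have mE : measurable (excursion n.+1 x).
  have mf := itg_measurable iS.
  have -> : excursion n.+1 x = (fun w => path_sum (fun _ _ => 1) K l
    (fun b => (good b)%:R * (`[< cyl b w >])%:R)) @^-1` [set 1 : R].
    apply/seteqP; split => w /=; rewrite -pw.
      by move=> h; rewrite asboolT.
    by case: asboolP => // _ /eqP; rewrite eq_sym oner_eq0.
  by rewrite -[X in measurable X]setTI; apply: mf => //; exact: measurable_set1.
split => //; rewrite -(int_ind mE).1.
transitivity (\int[P]_w path_sum (fun _ _ => 1) K l (fun b => (good b)%:R * (`[< cyl b w >])%:R)).
  by apply: eq_Rintegral => w _; exact: pw.
rewrite eS -[RHS]path_sum_weight; apply: eq_path_sum => b sb _; rewrite -/l sl in sb.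
rewrite (intZ _ (int_ind (mcyl b)).2) (int_ind (mcyl b)).1 fine_indep big_nat_recr//=.
have bigE : \prod_(0 <= i < n) fine (P (Xz 0 @^-1` A b i)) = \prod_(a <- b) pmass P (Xz 0) a.
  rewrite [RHS](big_nth 0) sb; apply: eq_big_nat => i /andP[_ hi].
  by rewrite /A hi pmassE.
have AE : fine (P (Xz 0 @^-1` A b n)) = below P (Xz 0) (tot b) by rewrite /A ltnn belowE.
by rewrite bigE AE /good -mulnb natrM /l; ring.
Qed.

End law_of_excursion.

(** * Gaussian profile of the joint weights in the excursion length *)

Module GaussianProfile.

Section gaussian_profile.
Context {R : realType}.
Notation leb := (@lebesgue_measure R).
Variables (I lam C V B Cg : R) (g : nat -> nat -> R) (E : nat -> R) (p : nat -> nat -> R) (S : nat -> R).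
Hypothesis I0 : 0 < I.
Hypothesis lam0 : 0 < lam.
Hypothesis C0 : 0 < C.
Hypothesis V0 : 0 < V.
Hypothesis B0 : 0 <= B.
Hypothesis EB : forall k, (0 < k)%N -> `|E k| <= B / k%:R.
Hypothesis g0 : forall k x, (0 < k)%N -> 0 <= g k x <= Cg.
Hypothesis glim : forall e : R, 0 < e -> exists N : nat, forall k, (N <= k)%N -> forall x,
  `|g k x - C * expR (- (((x%:R - I * k%:R ^+ 2) / (k%:R * Num.sqrt k%:R)) ^+ 2 / (2 * V)))| <= e.
Hypothesis pE : forall k x, (0 < k)%N -> (0 < x)%N ->
  p k x = g k x / k%:R ^+ 2 * expR (E k) * expR (- (lam * (x%:R / k%:R + k%:R * I))).
Hypothesis Ssum : forall x, (0 < x)%N -> (\sum_(0 <= k < N) p k.+1 x) @[N --> \oo] --> S x.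

Notation sq x := (Num.sqrt (x%:R : R)).
Notation qr x := (Num.sqrt (Num.sqrt (x%:R : R))).
Let rI := Num.sqrt I.
Let rI0 : 0 < rI. Proof. by rewrite sqrtr_gt0. Qed.
Let rI2 : rI ^+ 2 = I. Proof. by rewrite sqr_sqrtr// ltW. Qed.
(** Inverse order of magnitude of [p k x] at its peak [k = sqrt x / sqrt I], where [k ^ 2] is
    [x / I]; [yk] is the deviation from the peak in units of [x ^ (1/4)]. *)
Definition nrm x : R := x%:R * expR (2 * lam * rI * sq x).
Definition yk k x : R := (k%:R - sq x / rI) / qr x.
Definition ak k x : R := nrm x * p k x.
(** The first summand comes from the tilting factor and the second from the local limit theorem,
    both evaluated at the peak, where [k / sqrt x] is [1 / sqrt I]. *)
Definition rate : R := lam * rI ^+ 3 + 2 * rI ^+ 5 / V.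
Definition Phi (y : R) : R := I * C * expR (- (rate * y ^+ 2)).

Let rate0 : 0 < rate.
Proof. by rewrite addr_gt0// ?mulr_gt0 ?exprn_gt0 ?invr_gt0. Qed.
Let Cg0 : 0 <= Cg. Proof. by have /andP[h1 h2] := g0 0 (ltn0Sn 0); exact: le_trans h2. Qed.

Let sq0 x : (0 < x)%N -> 0 < sq x. Proof. by move=> h; rewrite sqrtr_gt0 ltr0n. Qed.
Let qr0 x : (0 < x)%N -> 0 < qr x. Proof. by move=> h; rewrite sqrtr_gt0 sq0. Qed.
Let sq2 x : sq x ^+ 2 = x%:R. Proof. by rewrite sqr_sqrtr. Qed.
Let qr2 x : qr x ^+ 2 = sq x. Proof. by rewrite sqr_sqrtr// sqrtr_ge0. Qed.

(* With t = k / sqrt x the normalised weight depends on (y, t) only. *)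
Lemma akE k x : (0 < k)%N -> (0 < x)%N ->
  ak k x = g k x * expR (E k) * ((k%:R / sq x) ^+ 2)^-1 *
    expR (- (lam * I * yk k x ^+ 2 / (k%:R / sq x))).
Proof.
move=> k0 x0; rewrite /ak pE// /nrm.
have kk : k%:R != 0 :> R by rewrite pnatr_eq0 -lt0n.
have s0 := sq0 x0; have q0 := qr0 x0; have s2 := sq2 x; have q2 := qr2 x.
rewrite /yk; set s := sq x in s0 s2 q2 q0 *; set q := Num.sqrt s in q0 q2 *; rewrite -s2.
have sn : s != 0 by rewrite gt_eqF.
have qn : q != 0 by rewrite gt_eqF.
have rn : rI != 0 by rewrite gt_eqF.
have -> : expR (- (lam * I * ((k%:R - s / rI) / q) ^+ 2 / (k%:R / s))) =
   expR (2 * lam * rI * s) * expR (- (lam * (s ^+ 2 / k%:R + k%:R * I))).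
  rewrite -expRD; congr expR; rewrite -rI2 -q2.
  by field; rewrite kk qn rn.
by field; rewrite kk sn.
Qed.

Lemma bE k x : (0 < k)%N -> (0 < x)%N ->
  ((x%:R - I * k%:R ^+ 2) / (k%:R * Num.sqrt k%:R)) ^+ 2 =
  I ^+ 2 * yk k x ^+ 2 * (k%:R / sq x + rI^-1) ^+ 2 / (k%:R / sq x) ^+ 3.
Proof.
move=> k0 x0; have kk : k%:R != 0 :> R by rewrite pnatr_eq0 -lt0n.
have s0 := sq0 x0; have q0 := qr0 x0; have s2 := sq2 x; have q2 := qr2 x.
rewrite expr_div_n [(_ * Num.sqrt _) ^+ 2]exprMn (@sqr_sqrtr _ k%:R)// /yk.
set s := sq x in s0 s2 q2 q0 *; set q := Num.sqrt s in q0 q2 *; rewrite -s2.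
have sn : s != 0 by rewrite gt_eqF.
have qn : q != 0 by rewrite gt_eqF.
have rn : rI != 0 by rewrite gt_eqF.
by rewrite -rI2 -q2; field; rewrite kk qn rn.
Qed.

Lemma tE k x : (0 < x)%N -> k%:R / sq x = rI^-1 + yk k x / qr x.
Proof.
move=> x0; have s0 := sq0 x0; have q0 := qr0 x0; have q2 := qr2 x.
have sn : sq x != 0 by rewrite gt_eqF.
have qn : qr x != 0 by rewrite gt_eqF.
have rn : rI != 0 by rewrite gt_eqF.
rewrite /yk; set s := sq x in s0 sn q0 qn q2 *; set q := Num.sqrt s in q0 qn q2 *.
by rewrite -q2; field; rewrite qn rn.
Qed.

Lemma iqr_cvg : (qr n)^-1 @[n --> \oo] --> (0 : R).
Proof.
apply: cvgn_le => e e0; have [N hN] := cvgn_dist (@invn_cvg0 R) (exprn_gt0 4 e0).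
exists N.+1 => n Nn; have n0 : (0 < n)%N by exact: leq_trans Nn.
have := hN n (ltnW Nn); rewrite !subr0 => /(le_trans (ler_norm _)) h.
have q0 := qr0 n0; rewrite ger0_norm ?invr_ge0 ?(ltW q0)//.
have h2 : (qr n)^-1 ^+ 4 = n%:R^-1 by rewrite exprVn -[4%N]/(2 * 2)%N exprM qr2 sq2.
by rewrite -h2 ler_pXn2r ?nnegrE ?invr_ge0 ?(ltW q0) ?(ltW e0) in h.
Qed.

Lemma exp_diff (a b : R) : 0 <= a -> 0 <= b -> `|expR (- a) - expR (- b)| <= `|a - b|.
Proof.
move=> a0 b0.
have main (u v : R) : 0 <= u -> u <= v -> expR (- u) - expR (- v) <= v - u.
  move=> u0 uv; have -> : expR (- v) = expR (- u) * expR (- (v - u)) by rewrite -expRD; congr expR; ring.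
  have := expR_ge1Dx (- (v - u)); have e1 : expR (- u) <= 1 by rewrite expR_le1 oppr_le0.
  have e0 := expR_ge0 (- u); set x := expR (- u) in e1 e0 *; set y := expR (- (v - u)).
  have uv' : 0 <= v - u by rewrite subr_ge0.
  move=> h; have h1 := ler_wpM2l e0 h; have h2 : x * (v - u) <= v - u by rewrite ler_piMl.
  by rewrite mulrDr mulr1 mulrN in h1; lra.
have [h|h] := leP a b.
  rewrite ger0_norm ?subr_ge0 ?ler_expR ?lerN2// distrC ger0_norm ?subr_ge0//; exact: main.
rewrite distrC ger0_norm ?subr_ge0 ?ler_expR ?lerN2 ?(ltW h)// ger0_norm ?subr_ge0 ?(ltW h)//.
by apply: main => //; exact: ltW.
Qed.

Let CE := Cg * expR B.
Let CE0 : 0 <= CE. Proof. by rewrite mulr_ge0 ?expR_ge0. Qed.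

Lemma gE_le k x : (0 < k)%N -> 0 <= g k x * expR (E k) <= CE.
Proof.
move=> k0; have /andP[h1 h2] := g0 x k0; rewrite mulr_ge0 ?expR_ge0//=.
apply: ler_pM; rewrite ?expR_ge0// ler_expR.
apply: (le_trans (ler_norm _)); apply: (le_trans (EB k0)).
by rewrite ler_piMr// invf_le1 ?ltr0n// ler1n.
Qed.

(** For [|y| <= 1] the ratio [t = k / sqrt x] stays above half its value at the peak. For [|y| > 1]
    the exponential absorbs [t ^ (-2)]: with [v = c * y ^ 2 / t], [exp (- v) <= 4 / v ^ 2] leaves
    [4 / (c * y ^ 2) ^ 2], free of [t]. The two regimes give the terms [8 * I] and [8 / c ^ 2] of
    [W], so very short and very long excursions are covered too. *)
Lemma ak_dom : exists W : R, exists N : nat, 0 < W /\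
  forall k x, (0 < k)%N -> (N <= x)%N -> (0 < x)%N -> 0 <= ak k x <= W * (1 + yk k x ^+ 2)^-1.
Proof.
pose c := lam * I; have c0 : 0 < c by rewrite mulr_gt0.
pose W := CE * (8 / c ^+ 2 + 8 * I) + 1.
have W0 : 0 < W.
  by rewrite ltr_wpDl// mulr_ge0// addr_ge0 ?mulr_ge0 ?invr_ge0 ?sqr_ge0 ?ltW.
have i2r : 0 < (2 * rI)^-1 by rewrite invr_gt0 mulr_gt0.
have [N hN] := cvgn_dist iqr_cvg i2r.
exists W, N; split => // k x k0 Nx x0.
have /andP[ge0 geC] := gE_le x k0; have s0 := sq0 x0.
rewrite akE//; set t := k%:R / sq x; set y := yk k x.
have t0 : 0 < t by rewrite divr_gt0// ltr0n.
have pos : 0 < 1 + y ^+ 2 by have := sqr_ge0 y; lra.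
have gt0 : 0 <= g k x * expR (E k) * (t ^+ 2)^-1 by apply: mulr_ge0 => //; rewrite invr_ge0 sqr_ge0.
apply/andP; split; first exact: (mulr_ge0 gt0 (expR_ge0 _)).
have [y1|y1] := leP `|y| 1.
  have tl : (2 * rI)^-1 <= t.
    rewrite /t tE// -/y; have := hN x Nx; rewrite subr0 => h1.
    have h2 : `|y / qr x| <= (2 * rI)^-1.
      by rewrite normrM; apply: le_trans h1; rewrite ler_piMl.
    have := ler_norm (- (y / qr x)); rewrite normrN => h3.
    have e : rI^-1 = 2 * (2 * rI)^-1 by field; rewrite gt_eqF.
    by rewrite e; lra.
  have ti : (t ^+ 2)^-1 <= 4 * I.
    have e4 : 4 * I = (((2 * rI)^-1) ^+ 2)^-1 by rewrite -rI2; field; rewrite gt_eqF.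
    rewrite e4 lef_pV2 ?posrE ?exprn_gt0//.
    by rewrite ler_sqr ?nnegrE ?(ltW i2r) ?(ltW t0).
  have e1 : expR (- (lam * I * y ^+ 2 / t)) <= 1.
    by rewrite expR_le1 oppr_le0 mulr_ge0 ?invr_ge0 ?(ltW t0)// mulr_ge0 ?sqr_ge0 ?ltW.
  have y2 : y ^+ 2 <= 1 by rewrite -(real_normK (num_real y)) expr_le1.
  rewrite ler_pdivlMr//.
  have h1 : g k x * expR (E k) * (t ^+ 2)^-1 <= CE * (4 * I).
    by apply: ler_pM => //; rewrite invr_ge0 sqr_ge0.
  have h2 : g k x * expR (E k) * (t ^+ 2)^-1 * expR (- (lam * I * y ^+ 2 / t)) <= CE * (4 * I).
    apply: le_trans h1; exact: (ler_piMr gt0 e1).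
  have p1 : 0 <= CE * (4 * I) by rewrite mulr_ge0// mulr_ge0// ltW.
  have p2 : 0 <= CE * (8 / c ^+ 2) by rewrite mulr_ge0// mulr_ge0 ?invr_ge0 ?sqr_ge0.
  apply: (@le_trans _ _ (CE * (4 * I) * 2)); last by rewrite /W mulrDr; lra.
  by apply: (ler_pM (mulr_ge0 gt0 (expR_ge0 _)) (ltW pos) h2); lra.
have yy1 : 1 < y ^+ 2 by rewrite -(real_normK (num_real y)) -[ltLHS](expr1n _ 2) ltr_pXn2r ?nnegrE.
have yy0 : 0 < y ^+ 2 by exact: lt_trans yy1.
have u0 : 0 <= lam * I * y ^+ 2 / t by rewrite mulr_ge0 ?invr_ge0 ?(ltW t0)// mulr_ge0 ?ltW// mulr_gt0.
have h := @expR_ge_pow R 1 _ u0.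
have cyn : c * y ^+ 2 != 0 by rewrite mulf_neq0 ?gt_eqF.
have tn : t != 0 by rewrite gt_eqF.
have cn : c != 0 by rewrite gt_eqF.
have yn : y != 0 by apply/eqP => y0; move: yy0; rewrite y0 expr0n ltxx.
have h1 : (t ^+ 2)^-1 * expR (- (lam * I * y ^+ 2 / t)) <= 4 / (c * y ^+ 2) ^+ 2.
  have up : 0 < lam * I * y ^+ 2 / t by rewrite -/c divr_gt0// mulr_gt0.
  have h' : expR (- (lam * I * y ^+ 2 / t)) <= ((lam * I * y ^+ 2 / t / 2) ^+ 2)^-1.
    have u2 : 0 < (lam * I * y ^+ 2 / t / 2) ^+ 2 by rewrite exprn_gt0// divr_gt0.
    by rewrite expRN lef_pV2 ?posrE ?expR_gt0 ?u2 ?h.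
  have t20 : 0 <= (t ^+ 2)^-1 by rewrite invr_ge0 sqr_ge0.
  apply: (le_trans (ler_wpM2l t20 h')); rewrite -/c.
  by rewrite le_eqVlt; apply/orP; left; apply/eqP; field; rewrite tn cn yn.
rewrite -mulrA; apply: (@le_trans _ _ (CE * (4 / (c * y ^+ 2) ^+ 2))).
  by apply: ler_pM => //; rewrite mulr_ge0 ?expR_ge0// invr_ge0 sqr_ge0.
have -> : 4 / (c * y ^+ 2) ^+ 2 = 4 / c ^+ 2 * ((y ^+ 2) ^- 2) by rewrite exprMn invfM mulrA.
rewrite ler_pdivlMr//.
have e2 : (y ^+ 2) ^- 2 * (1 + y ^+ 2) <= 2.
  rewrite mulrC ler_pdivrMr ?(exprn_gt0 2 yy0)//; move: yy1; set w := y ^+ 2 => yy1.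
  have w1 : 0 <= w - 1 by rewrite subr_ge0 ltW.
  have w2 : 0 <= 2 * w + 1 by lra.
  have := mulr_ge0 w1 w2; have -> : (w - 1) * (2 * w + 1) = 2 * w ^+ 2 - w - 1 by ring.
  by lra.
have q0 : 0 <= CE * (4 / c ^+ 2) by rewrite mulr_ge0// mulr_ge0 ?invr_ge0 ?sqr_ge0.
have := ler_wpM2l q0 e2; rewrite !mulrA => /le_trans; apply.
have p1 : 0 <= CE * (8 * I) by rewrite mulr_ge0// mulr_ge0// ltW.
have -> : CE * 4 / c ^+ 2 * 2 = CE * (8 / c ^+ 2) by ring.
by rewrite /W mulrDr; lra.
Qed.

(** The lengths [k_ x] are an arbitrary selection with bounded deviation; the flag [ok] silences
    those [x] for which no such length is available. Applied to a worst length for each [x], this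
    yields uniformity in [ak_unif]. *)
Lemma local_cvg (Y : R) (k_ : nat -> nat) (ok : nat -> bool) :
  (forall x, ok x -> [/\ (0 < k_ x)%N, (0 < x)%N & `|yk (k_ x) x| <= Y]) ->
  (ok x)%:R * (ak (k_ x) x - Phi (yk (k_ x) x)) @[x --> \oo] --> (0 : R).
Proof.
move=> hok; have Y0 : 0 <= `|Y| by [].
pose y x := (ok x)%:R * yk (k_ x) x; pose t x := rI^-1 + y x / qr x.
have yb x : `|y x| <= `|Y|.
  rewrite /y; case: (boolP (ok x)) => [/hok[_ _ h]|_]; last by rewrite mul0r normr0.
  by rewrite mul1r; apply: (le_trans h); exact: ler_norm.
have y2b x : y x ^+ 2 <= Y ^+ 2.
  by rewrite -(real_normK (num_real (y x))) -(real_normK (num_real Y)) ler_sqr ?nnegrE.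
have tc : t @ \oo --> rI^-1.
  rewrite -[X in _ --> X]addr0; apply: cvgD; first exact: cvg_cst.
  have z : `|Y| * (qr x)^-1 @[x --> \oo] --> (0 : R).
    by rewrite -[X in _ --> X](mulr0 `|Y|); apply: cvgM; [exact: cvg_cst|exact: iqr_cvg].
  apply: (@cvgn_squeeze0 _ 0 _ _ _ z) => x _.
  by rewrite normrM ler_pM// ger0_norm// invr_ge0 sqrtr_ge0.
have rn : rI != 0 by rewrite gt_eqF.
have rin : rI^-1 != 0 by rewrite invr_eq0.
have i1 : (t x)^-1 @[x --> \oo] --> rI by rewrite -[X in _ --> X]invrK; exact: cvgV.
have i2 : (t x ^+ 2)^-1 @[x --> \oo] --> I.
  by rewrite -rI2; under eq_fun do rewrite -exprVn; exact: cvgn_exp.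
have bd (f_ : nat -> R) (l : R) : f_ @ \oo --> l -> y x ^+ 2 * (f_ x - l) @[x --> \oo] --> (0 : R).
  move=> hf; have z : Y ^+ 2 * `|f_ x - l| @[x --> \oo] --> (0 : R).
    rewrite -[X in _ --> X](mulr0 (Y ^+ 2)); apply: cvgM; first exact: cvg_cst.
    rewrite -(normr0 R) -(subrr l); apply: cvg_norm; apply: cvgB => //; exact: cvg_cst.
  apply: (@cvgn_squeeze0 _ 0 _ _ _ z) => x _.
  by rewrite normrM (ger0_norm (sqr_ge0 _)) ler_wpM2r.
pose f1 x := lam * I * (t x)^-1; pose f2 x := I ^+ 2 * (t x + rI^-1) ^+ 2 * ((t x)^-1 ^+ 3) / (2 * V).
have c1 : f1 @ \oo --> lam * I * rI by apply: cvgM => //; exact: cvg_cst.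
have c2 : f2 @ \oo --> I ^+ 2 * (rI^-1 + rI^-1) ^+ 2 * rI ^+ 3 / (2 * V).
  apply: cvgM; last exact: cvg_cst.
  apply: cvgM; last exact: cvgn_exp.
  apply: cvgM; first exact: cvg_cst.
  by apply: cvgn_exp; apply: cvgD => //; exact: cvg_cst.
have rE : rate = lam * I * rI + I ^+ 2 * (rI^-1 + rI^-1) ^+ 2 * rI ^+ 3 / (2 * V).
  by rewrite /rate -rI2; field; rewrite rn gt_eqF.
have z1 := bd _ _ c1; have z2 := bd _ _ c2.
pose A1 x := y x ^+ 2 * f1 x; pose A2 x := y x ^+ 2 * f2 x.
have lE : forall e : R, 0 < e -> exists N : nat, forall x, (N <= x)%N -> ok x ->
   `|ak (k_ x) x - Phi (yk (k_ x) x)| <= e.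
  move=> e e0.
  have kbig M : exists N : nat, forall x, (N <= x)%N -> ok x -> (M <= k_ x)%N.
    pose r := (M%:R + 1) * (2 * rI).
    have i2r : 0 < (2 * rI)^-1 by rewrite invr_gt0 mulr_gt0.
    have [N1 hN1] := cvgn_dist tc i2r.
    exists (maxn N1 (Num.Def.truncn (r ^+ 2)).+1) => x; rewrite geq_max => /andP[n1 n2] okx.
    have [k0 x0 _] := hok x okx.
    have tx : t x = (k_ x)%:R / sq x by rewrite tE// /t /y okx mul1r.
    have := hN1 x n1; rewrite tx distrC => /(le_trans (ler_norm _)) h.
    have e1 : rI^-1 = 2 * (2 * rI)^-1 by field; rewrite gt_eqF.
    have h2 : (2 * rI)^-1 <= (k_ x)%:R / sq x by move: h; rewrite e1; lra.
    have s0 := sq0 x0; rewrite ler_pdivlMr// in h2.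
    have r0 : 0 <= r by rewrite mulr_ge0 ?addr_ge0// mulr_ge0// ltW.
    have rs : r <= sq x.
      rewrite -(ger0_norm r0) -sqrtr_sqr ler_wsqrtr// ltW// (lt_le_trans (truncnS_gt _))//.
      by rewrite ler_nat.
    have i0 : 0 <= (2 * rI)^-1 by rewrite invr_ge0 mulr_ge0// ltW.
    have := le_trans (ler_wpM2l i0 rs) h2.
    rewrite /r mulrCA mulVf ?mulr1; last by rewrite mulf_neq0.
    by move=> h3; rewrite -(ler_nat R); apply: le_trans h3; rewrite lerDl.
  pose T0 := I + 1.
  have T00 : 0 < T0 by rewrite addr_gt0.
  (* The denominator bounds the coefficients in the four errors [b1] to [b4]: local limit, Riemann
     remainder [E], prefactor [t ^ (-2)], exponent. *)
  pose e' := e / (4 * (T0 * expR B * (1 + C) + Cg + C * I + 1)).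
  have D0 : 0 < T0 * expR B * (1 + C) + Cg + C * I + 1.
    by rewrite ltr_wpDl// !addr_ge0 ?mulr_ge0 ?expR_ge0 ?addr_ge0 ?(ltW T00) ?(ltW C0) ?(ltW I0).
  have e'0 : 0 < e' by rewrite divr_gt0// mulr_gt0.
  have [Ng hg] := glim e'0.
  have [N1 h1] := kbig Ng.
  have [Mb hMb] : exists Mb : nat, forall k, (Mb <= k)%N -> (0 < k)%N -> `|expR (E k) - 1| <= e'.
    have cE : expR (B * k%:R^-1) - 1 @[k --> \oo] --> (0 : R).
      rewrite -(subrr 1) -{3}(expR0 R) -[X in expR X](mulr0 B); apply: cvgB; last exact: cvg_cst.
      apply: continuous_cvg; first exact: continuous_expR.
      by apply: cvgM; [exact: cvg_cst|exact: invn_cvg0].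
    have [M hM] := cvgn_dist cE e'0; exists M => k Mk k0.
    have := hM k Mk; rewrite subr0 => /(le_trans (ler_norm _)) h.
    have := EB k0; rewrite ler_norml => /andP[b1 b2].
    have u1 : expR (E k) <= expR (B / k%:R) by rewrite ler_expR.
    have u2 := expR_ge1Dx (E k); have u3 := expR_ge1Dx (B / k%:R).
    by rewrite ler_norml; apply/andP; split; lra.
  have [N2 h2] := kbig Mb.
  have m1e : 0 < Num.min 1 e' by rewrite lt_min ltr01 e'0.
  have [N3 h3] := cvgn_dist i2 m1e.
  have [N4 h4] := cvgn_dist z1 e'0; have [N5 h5] := cvgn_dist z2 e'0.
  exists (maxn (maxn N1 N2) (maxn N3 (maxn N4 N5))) => x.
  rewrite !geq_max => /andP[/andP[n1 n2] /andP[n3 /andP[n4 n5]]] okx.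
  have [k0 x0 _] := hok x okx; set k := k_ x in k0 *.
  have tx : t x = k%:R / sq x by rewrite tE// /t /y okx mul1r.
  have yx : y x = yk k x by rewrite /y okx mul1r.
  have t0 : 0 < t x by rewrite tx divr_gt0 ?sq0// ltr0n.
  have ti0 : 0 < (t x)^-1 by rewrite invr_gt0.
  have a10 : 0 <= A1 x.
    by apply: mulr_ge0; [exact: sqr_ge0|apply: mulr_ge0; [apply: mulr_ge0; exact: ltW|exact: ltW]].
  have a20 : 0 <= A2 x.
    apply: mulr_ge0; first exact: sqr_ge0.
    apply: mulr_ge0; last by rewrite invr_ge0 mulr_ge0// ltW.
    by apply: mulr_ge0; [apply: mulr_ge0; exact: sqr_ge0|exact: exprn_ge0 (ltW ti0)].
  have aE : ak k x = g k x * expR (E k) * (t x ^+ 2)^-1 * expR (- A1 x).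
    by rewrite akE// -tx -yx /A1 /f1; congr (_ * expR _); ring.
  have bE' : ((x%:R - I * k%:R ^+ 2) / (k%:R * Num.sqrt k%:R)) ^+ 2 / (2 * V) = A2 x.
    by rewrite bE// -tx -yx /A2 /f2 exprVn; ring.
  have := hg k (h1 x n1 okx) x; rewrite bE' => d1.
  have d2 := hMb k (h2 x n2 okx) k0.
  have := h3 x n3; rewrite le_min => /andP[d3a d3].
  have := h4 x n4; rewrite subr0 => d4; have := h5 x n5; rewrite subr0 => d5.
  have PhE : Phi (yk k x) = I * C * expR (- (y x ^+ 2 * (lam * I * rI) +
     y x ^+ 2 * (I ^+ 2 * (rI^-1 + rI^-1) ^+ 2 * rI ^+ 3 / (2 * V)))).
    by rewrite /Phi -yx rE; congr (_ * expR _); ring.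
  set Q := y x ^+ 2 * (lam * I * rI) + _ in PhE.
  have Q0 : 0 <= Q.
    apply: addr_ge0; apply: mulr_ge0; rewrite ?sqr_ge0//.
      by rewrite !mulr_ge0 ?ltW.
    apply: divr_ge0; last by rewrite mulr_ge0// ltW.
    by apply: mulr_ge0; [apply: mulr_ge0; exact: sqr_ge0|exact: (exprn_ge0 3 (ltW rI0))].
  have d6 : `|expR (- (A1 x + A2 x)) - expR (- Q)| <= 2 * e'.
    apply: (le_trans (exp_diff (addr_ge0 a10 a20) Q0)).
    have -> : A1 x + A2 x - Q = y x ^+ 2 * (f1 x - lam * I * rI) +
      y x ^+ 2 * (f2 x - I ^+ 2 * (rI^-1 + rI^-1) ^+ 2 * rI ^+ 3 / (2 * V)).
      by rewrite /A1 /A2 /Q; ring.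
    by apply: (le_trans (ler_normD _ _)); lra.
  rewrite aE PhE.
  set tt := (t x ^+ 2)^-1 in d3 d3a *; set G := g k x in d1 *; set EE := expR (E k) in d2 *.
  set x1 := expR (- A1 x); set x2 := expR (- A2 x) in d1.
  rewrite opprD expRD -/x1 -/x2 in d6; set xq := expR (- Q) in d6 *.
  have x11 : 0 <= x1 <= 1 by rewrite expR_ge0 expR_le1 oppr_le0.
  have x21 : 0 <= x2 <= 1 by rewrite expR_ge0 expR_le1 oppr_le0.
  have EE1 : 0 <= EE <= expR B.
    rewrite expR_ge0 ler_expR; apply: (le_trans (ler_norm _)); apply: (le_trans (EB k0)).
    by rewrite ler_piMr// invf_le1 ?ltr0n// ler1n.
  have tt1 : `|tt| <= T0.
    rewrite /T0 -(subrK I tt) [in leRHS]addrC; apply: (le_trans (ler_normD _ _)).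
    by rewrite lerD// ger0_norm// ltW.
  have -> : G * EE * tt * x1 - I * C * xq =
     (G - C * x2) * (EE * tt * x1) + C * x2 * x1 * tt * (EE - 1) +
     C * x2 * x1 * (tt - I) + C * I * (x1 * x2 - xq) by ring.
  have nx1 : `|x1| <= 1 by case/andP: x11 => q1 q2; rewrite ger0_norm.
  have nx2 : `|x2| <= 1 by case/andP: x21 => q1 q2; rewrite ger0_norm.
  have nE : `|EE| <= expR B by case/andP: EE1 => q1 q2; rewrite ger0_norm.
  have nC : `|C| = C by rewrite gtr0_norm.
  have b1 : `|(G - C * x2) * (EE * tt * x1)| <= e' * (T0 * expR B).
    rewrite !normrM; apply: ler_pM => //; rewrite ?mulr_ge0//.
    rewrite -[leRHS]mulr1; apply: ler_pM => //; rewrite ?mulr_ge0//.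
    by rewrite mulrC; apply: ler_pM.
  have xx : `|x2| * `|x1| <= 1 by rewrite mulr_ile1.
  have eB1 : 1 <= expR B by rewrite -expR0 ler_expR.
  have b2 : `|C * x2 * x1 * tt * (EE - 1)| <= C * T0 * e'.
    rewrite !normrM nC; apply: ler_pM => //; rewrite ?mulr_ge0 ?(ltW C0)//.
    apply: ler_pM => //; rewrite ?mulr_ge0 ?(ltW C0)// -mulrA ler_piMr// ltW//.
  have b3 : `|C * x2 * x1 * (tt - I)| <= C * e'.
    rewrite !normrM nC; apply: ler_pM => //; rewrite ?mulr_ge0 ?(ltW C0)//.
    by rewrite -mulrA ler_piMr// ltW.
  have b4 : `|C * I * (x1 * x2 - xq)| <= C * I * (2 * e').
    by rewrite normrM gtr0_norm ?mulr_gt0// ler_pM2l ?mulr_gt0.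
  apply: (le_trans (ler_normD _ _)); apply: (le_trans (lerD (ler_normD _ _) b4)).
  apply: (le_trans (lerD (lerD (ler_normD _ _) b3) (lexx _))).
  apply: (le_trans (lerD (lerD (lerD b1 b2) (lexx _)) (lexx _))).
  have T1 : 1 <= T0 by rewrite /T0 lerDr ltW.
  have -> : e = 4 * (T0 * expR B * (1 + C) + Cg + C * I + 1) * e'.
    by rewrite /e' mulrC divfK// gt_eqF// mulr_gt0.
  have m1 : C * T0 <= T0 * expR B * C.
    by rewrite mulrC ler_wpM2r ?(ltW C0)// ler_peMr// ltW.
  have m2 : C <= C * T0 by rewrite ler_peMr// ltW.
  have m3 : 0 <= T0 * expR B by rewrite mulr_ge0 ?expR_ge0// ltW.
  have m4 : 0 <= C * I by rewrite mulr_ge0 ?ltW.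
  have : e' * (T0 * expR B) + C * T0 * e' + C * e' + C * I * (2 * e') =
    (T0 * expR B + C * T0 + C + 2 * (C * I)) * e' by ring.
  move=> ->; rewrite ler_pM2r//.
  have C0' := ltW C0; have Cg0' := Cg0.
  have -> : T0 * expR B * (1 + C) = T0 * expR B + T0 * expR B * C by ring.
  by lra.
apply: cvgn_le => e e0; have [N hN] := lE e e0; exists N => x Nx.
rewrite subr0; case: (boolP (ok x)) => okx; last by rewrite mul0r normr0 ltW.
by rewrite mul1r hN.
Qed.

End gaussian_profile.

End GaussianProfile.
Export GaussianProfile.

(** * Uniform convergence, summation over lengths and the ratio *)

Section gaussian_ratio.
Context {R : realType}.
Notation leb := (@lebesgue_measure R).
Variables (I lam C V B Cg : R) (g : nat -> nat -> R) (E : nat -> R) (p : nat -> nat -> R) (S : nat -> R).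
Hypothesis I0 : 0 < I.
Hypothesis lam0 : 0 < lam.
Hypothesis C0 : 0 < C.
Hypothesis V0 : 0 < V.
Hypothesis B0 : 0 <= B.
Hypothesis EB : forall k, (0 < k)%N -> `|E k| <= B / k%:R.
Hypothesis g0 : forall k x, (0 < k)%N -> 0 <= g k x <= Cg.
Hypothesis glim : forall e : R, 0 < e -> exists N : nat, forall k, (N <= k)%N -> forall x,
  `|g k x - C * expR (- (((x%:R - I * k%:R ^+ 2) / (k%:R * Num.sqrt k%:R)) ^+ 2 / (2 * V)))| <= e.
Hypothesis pE : forall k x, (0 < k)%N -> (0 < x)%N ->
  p k x = g k x / k%:R ^+ 2 * expR (E k) * expR (- (lam * (x%:R / k%:R + k%:R * I))).
Hypothesis Ssum : forall x, (0 < x)%N -> (\sum_(0 <= k < N) p k.+1 x) @[N --> \oo] --> S x.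

Notation sq x := (Num.sqrt (x%:R : R)).
Notation qr x := (Num.sqrt (Num.sqrt (x%:R : R))).
Notation yk := (yk I).
Notation ak := (ak I lam p).
Notation nrm := (nrm I lam).
Notation rate := (rate I lam V).
Notation Phi := (Phi I lam C V).
Let rI := Num.sqrt I.
Let rI0 : 0 < rI. Proof. by rewrite sqrtr_gt0. Qed.
Let rate0 : 0 < rate.
Proof. by rewrite addr_gt0// ?mulr_gt0 ?exprn_gt0 ?invr_gt0. Qed.
Let IC0 : 0 < I * C. Proof. exact: mulr_gt0. Qed.
Let sq0 x : (0 < x)%N -> 0 < sq x. Proof. by move=> h; rewrite sqrtr_gt0 ltr0n. Qed.
Let qr0 x : (0 < x)%N -> 0 < qr x. Proof. by move=> h; rewrite sqrtr_gt0 sq0. Qed.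
Let qr2 x : qr x ^+ 2 = sq x. Proof. by rewrite sqr_sqrtr// sqrtr_ge0. Qed.

Lemma Phi_bounds y : 0 <= Phi y <= I * C * (1 + rate * y ^+ 2)^-1.
Proof.
have r0 : 0 <= rate * y ^+ 2 by rewrite mulr_ge0 ?sqr_ge0 ?(ltW rate0).
rewrite mulr_ge0 ?expR_ge0 ?(ltW IC0)//= ler_pM2l//; exact: expRN_le_inv.
Qed.

(** Large deviations [yk] are handled by the two majorants. For the others, choose for each [x] an
    offending length if there is one; [local_cvg] along this selection gives a contradiction. *)
Lemma ak_unif (e : R) : 0 < e -> exists N : nat, forall x, (N <= x)%N -> (0 < x)%N ->
  forall k, (0 < k)%N -> `|ak k x - Phi (yk k x)| <= e.
Proof.
move=> e0; have [W [N0 [W0 hW]]] := ak_dom I0 lam0 B0 EB g0 pE.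
(* Each summand makes one of the majorants at most [e] beyond [Y]; the 1 ensures that [|y| > Y]
   implies [y ^ 2 >= Y]. *)
pose Y := 1 + W / e + I * C / (rate * e).
have re0 : 0 < rate * e by rewrite mulr_gt0.
have a1 : 0 < W / e by rewrite divr_gt0.
have a2 : 0 < I * C / (rate * e) by rewrite divr_gt0.
have Y1 : 1 <= Y by rewrite /Y; lra.
have tailb y : Y < `|y| -> W * (1 + y ^+ 2)^-1 <= e /\ I * C * (1 + rate * y ^+ 2)^-1 <= e.
  move=> hy; have yy : Y <= y ^+ 2.
    rewrite -(real_normK (num_real y)); have y1 := le_lt_trans Y1 hy.
    by apply: (le_trans (ltW hy)); rewrite expr2 ler_peMr//; exact: ltW.
  have p1 : 0 < 1 + y ^+ 2 by have := sqr_ge0 y; lra.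
  have p2 : 0 < 1 + rate * y ^+ 2.
    have : 0 <= rate * y ^+ 2 by rewrite mulr_ge0 ?sqr_ge0 ?(ltW rate0).
    by lra.
  have z1 : W / e <= y ^+ 2 by rewrite /Y in yy; lra.
  have z2 : I * C / (rate * e) <= y ^+ 2 by rewrite /Y in yy; lra.
  rewrite ler_pdivrMr// in z1; rewrite ler_pdivrMr// in z2; split; rewrite ler_pdivrMr// mulrDr mulr1.
    by rewrite (mulrC e); lra.
  have -> : e * (rate * y ^+ 2) = y ^+ 2 * (rate * e) by ring.
  by lra.
pose bad x k := [/\ (0 < k)%N, `|yk k x| <= Y & e < `|ak k x - Phi (yk k x)|].
have /choice[k_ hk] : forall x : nat, exists k, (exists k', bad x k') -> bad x k.
  move=> x; have [[k h]|h] := pselect (exists k', bad x k'); first by exists k.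
  by exists 0%N.
pose ok x := (0 < k_ x)%N && (0 < x)%N && (`|yk (k_ x) x| <= Y).
have hok x : ok x -> [/\ (0 < k_ x)%N, (0 < x)%N & `|yk (k_ x) x| <= Y].
  by move=> /andP[/andP[h1 h2] h3].
have [N1 hN1] := cvgn_dist (local_cvg I0 lam0 C0 V0 B0 EB g0 glim pE hok) e0.
exists (maxn N0 N1) => x; rewrite geq_max => /andP[n0 n1] x0 k k0.
rewrite leNgt; apply/negP => be.
have [yY|yY] := leP `|yk k x| Y; last first.
  have [b1 b2] := tailb _ yY; have /andP[c1 c2] := hW k x k0 n0 x0.
  have /andP[d1 d2] := Phi_bounds (yk k x).
  move: be; apply/negP; rewrite -leNgt ler_norml; apply/andP; split.
    by have := le_trans d2 b2; lra.
  by have := le_trans c2 b1; lra.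
have [h1 h2 h3] := hk x (ex_intro _ k (And3 k0 yY be)).
have := hN1 x n1; rewrite /ok h1 x0 h2 mul1r subr0 => h4.
by move: (lt_le_trans h3 h4); rewrite ltxx.
Qed.

Lemma Phi_lip (y z : R) : `|Phi y - Phi z| <= I * C * (rate * `|y ^+ 2 - z ^+ 2|).
Proof.
rewrite /GaussianProfile.Phi -mulrBr normrM (gtr0_norm IC0) ler_pM2l//.
apply: (le_trans (exp_diff (mulr_ge0 (ltW rate0) (sqr_ge0 y)) (mulr_ge0 (ltW rate0) (sqr_ge0 z)))).
by rewrite -mulrBr normrM (gtr0_norm rate0).
Qed.

(** In the variable [yk] the lengths form a grid of mesh [x ^ (-1/4)], so the normalised sum is the
    integral of a step function dominated by a multiple of [1 / (1 + y ^ 2)]. *)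
Lemma sum_cvg : nrm x * S x / qr x @[x --> \oo] --> I * C * Num.sqrt (pi / rate).
Proof.
have [W [N0 [W0 hW]]] := ak_dom I0 lam0 B0 EB g0 pE.
have nrm0 x : (0 < x)%N -> 0 < nrm x by move=> x0; rewrite mulr_gt0 ?expR_gt0 ?ltr0n.
(* A finite number of lengths per [x] keeps the step functions finite sums. At least [x ^ 2] lengths
   make the grid reach every fixed [y] eventually, and the neglected remainder is at most
   [1 / x]. *)
have /choice[Nx hNx] : forall x, exists n, (x ^ 2 <= n)%N /\ ((0 < x)%N ->
    `|nrm x * S x / qr x - (qr x)^-1 * \sum_(k < n) ak k.+1 x| <= x%:R^-1).
  move=> x; have [x0|x0] := posnP x; first by exists (x ^ 2)%N; rewrite x0.
  have q0 := qr0 x0; have n0 := nrm0 x x0.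
  have d0 : 0 < x%:R^-1 * (qr x / nrm x) by rewrite mulr_gt0 ?invr_gt0 ?ltr0n// divr_gt0.
  have [M hM] := cvgn_dist (Ssum x0) d0.
  exists (maxn M (x ^ 2)); split; first exact: leq_maxr.
  move=> _; have := hM _ (leq_maxl M (x ^ 2)); set n := maxn _ _ => h.
  have -> : (qr x)^-1 * \sum_(k < n) ak k.+1 x = nrm x / qr x * \sum_(0 <= k < n) p k.+1 x.
    rewrite big_mkord /GaussianProfile.ak -mulr_sumr; ring.
  have -> : nrm x * S x / qr x - nrm x / qr x * \sum_(0 <= k < n) p k.+1 x =
    nrm x / qr x * (S x - \sum_(0 <= k < n) p k.+1 x) by ring.
  have nq : 0 < nrm x / qr x by rewrite divr_gt0.
  rewrite normrM (gtr0_norm nq) distrC mulrC -ler_pdivlMr//.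
  by rewrite invf_div.
pose c x := - (sq x / rI) / qr x; pose h x := (qr x)^-1.
pose F x y := step_fun (h x) (c x) (Nx x) (fun k => ak k.+1 x) y.
have ykE k x : (0 < x)%N -> c x + k%:R * h x = yk k x.
  by move=> x0; rewrite /c /h /GaussianProfile.yk mulrDl addrC.
have hc : h @ \oo --> (0 : R) := iqr_cvg.
have [N1 hN1] := cvgn_dist hc (ltr01 : 0 < (1 : R)).
have h0 x : (0 < x)%N -> 0 < h x by move=> x0; rewrite invr_gt0 qr0.
have iW : Itg leb (fun y => 3 * W * (1 + y ^+ 2)^-1) by apply: itgZ; exact: itg_inv1Dsqr.
have cellP x y : (0 < x)%N -> c x < y -> exists2 k, y <= c x + k.+1%:R * h x &
   [/\ `|y - yk k.+1 x| <= h x, (k < Nx x)%N -> F x y = ak k.+1 x & (Nx x <= k)%N -> F x y = 0 /\ c x + (Nx x)%:R * h x < y].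
  move=> x0 cy; have /andP[q1 q2] := step_fun_cell (h0 x x0) cy.
  set k := ceil_pred _ in q1 q2; exists k => //.
  have y1 := ykE k.+1 x x0; have hx := h0 x x0.
  split.
  - rewrite -y1 distrC ger0_norm ?subr_ge0// -natr1 mulrDl mul1r.
    by lra.
  - by move=> kN; rewrite /F (@step_fun_at _ _ _ _ _ _ k)// q1 q2.
  - move=> Nk; have lt : c x + (Nx x)%:R * h x < y.
      by apply: le_lt_trans q1; rewrite lerD2l ler_wpM2r ?(ltW hx)// ler_nat.
    by split => //; rewrite /F step_fun_out// negb_and -ltNge lt orbT.
(* The 3 comes from [1 + y ^ 2 <= 3 * (1 + z ^ 2)] when [|y - z| <= 1], where [z] is the grid point
   of the cell. *)
have dom x y : (N0 <= x)%N -> (N1 <= x)%N -> (0 < x)%N -> `|F x y| <= 3 * W * (1 + y ^+ 2)^-1.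
  move=> n0 n1 x0; have py (z : R) : 0 < 1 + z ^+ 2 by have := sqr_ge0 z; lra.
  have W3 : 0 <= 3 * W * (1 + y ^+ 2)^-1 by rewrite mulr_ge0 ?invr_ge0 ?(ltW (py y))// mulr_ge0// ltW.
  have [cy|cy] := ltP (c x) y; last first.
    by rewrite /F step_fun_out ?normr0 ?h0// negb_and -leNgt cy.
  have [k _ [d1 d2 d3]] := cellP x y x0 cy.
  have [kN|kN] := ltnP k (Nx x); last by have [-> _] := d3 kN; rewrite normr0.
  rewrite d2//; have /andP[a0 a1] := hW k.+1 x isT n0 x0; rewrite ger0_norm//.
  apply: (le_trans a1); rewrite -[leRHS]mulrA [leRHS]mulrCA ler_pM2l//.
  have hx1 : h x <= 1 by have := hN1 x n1; rewrite subr0 ger0_norm// ltW// h0.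
  set z := yk k.+1 x in d1 *; have p1 := py y; have p2 := py z.
  rewrite ler_pdivlMr// mulrC ler_pdivrMr//.
  have dd : (y - z) ^+ 2 <= 1 by rewrite -(real_normK (num_real _)) expr_le1// (le_trans d1).
  have := sqr_ge0 (y - 2 * z); have : y ^+ 2 + (y - 2 * z) ^+ 2 = 2 * (y - z) ^+ 2 + 2 * z ^+ 2 by ring.
  by have := sqr_ge0 z; lra.
have ptw y : F x y @[x --> \oo] --> Phi y.
  apply: cvgn_le => e e0; have e2 : 0 < e / 2 by rewrite divr_gt0.
  have [N2 hN2] := ak_unif e2.
  pose L := I * C * (rate * (2 * `|y| + 1)); have L0 : 0 < L.
    by rewrite mulr_gt0// mulr_gt0// ltr_wpDl// mulr_ge0.
  have dl : 0 < Num.min 1 (e / 2 / L) by rewrite lt_min ltr01 divr_gt0.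
  have [N3 hN3] := cvgn_dist hc dl.
  have ry : 0 < (rI * (`|y| + 1))^-1 by rewrite invr_gt0 mulr_gt0// ltr_wpDl.
  have [N4 hN4] := cvgn_dist hc ry.
  pose N5 := (Num.Def.truncn (rI^-1 + `|y|)).+1.
  exists (maxn (maxn N2 N3) (maxn N4 N5)) => x; rewrite !geq_max => /andP[/andP[n2 n3] /andP[n4 n5]].
  have x0 : (0 < x)%N by exact: leq_trans n5.
  have hx := h0 x x0; have q0 := qr0 x0; have s0 := sq0 x0.
  have qh : rI * (`|y| + 1) <= qr x.
    have := hN4 x n4; rewrite subr0 (gtr0_norm hx) /h lef_pV2 ?posrE//.
    by rewrite mulr_gt0// ltr_wpDl.
  have cy : c x < y.
    have cE : c x = - (qr x / rI).
      have ce (q : R) : q != 0 -> - (q ^+ 2 / rI) / q = - (q / rI).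
        by move=> qn; field; rewrite qn gt_eqF.
      by have := ce (qr x) (lt0r_neq0 q0); rewrite qr2.
    rewrite cE ltrNl; apply: (@lt_le_trans _ _ (`|y| + 1)); last by rewrite ler_pdivlMr// mulrC.
    by have := ler_norm (- y); rewrite normrN; lra.
  have [k yk1 [d1 d2 d3]] := cellP x y x0 cy.
  have kN : (k < Nx x)%N.
    rewrite ltnNge; apply/negP => /d3[_]; apply/negP; rewrite -leNgt.
    have [hN _] := hNx x.
    have x1 : (1 : R) <= x%:R by rewrite ler1n.
    have sx : sq x <= x%:R.
      by rewrite -[leRHS]sqr_sqrtr// expr2 ler_peMl ?(ltW s0)// -[leLHS]sqrtr1 ler_wsqrtr.
    have s1 : 1 <= sq x by rewrite -[leLHS]sqrtr1 ler_wsqrtr.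
    have qs : qr x <= sq x.
      have qle (s : R) : 1 <= s -> Num.sqrt s <= s.
        move=> s1'; have s0' : 0 <= s by exact: le_trans s1'.
        by rewrite -{2}(sqr_sqrtr s0') expr2 ler_peMl ?sqrtr_ge0// -[leLHS]sqrtr1 ler_wsqrtr.
      exact: qle.
    have rx : rI^-1 + `|y| <= x%:R.
      by rewrite ltW// (lt_le_trans (truncnS_gt _))// ler_nat.
    have xx : x%:R * x%:R <= (Nx x)%:R :> R by rewrite -natrM ler_nat -[(x * x)%N]/(x ^ 2)%N.
    rewrite (ykE _ _ x0) /GaussianProfile.yk ler_pdivlMr// -/rI.
    have t1 : y * qr x <= `|y| * x%:R.
      apply: (le_trans (ler_wpM2r (ltW q0) (ler_norm y))).
      by rewrite ler_wpM2l//; exact: le_trans qs sx.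
    have t2 : sq x / rI <= rI^-1 * x%:R by rewrite mulrC ler_pM2l ?invr_gt0.
    have t3 : (rI^-1 + `|y|) * x%:R <= x%:R * x%:R by rewrite ler_pM2r// (lt_le_trans ltr01).
    by rewrite mulrDl in t3; lra.
  rewrite d2//; set z := yk k.+1 x in d1 *.
  have := hN3 x n3; rewrite subr0 (gtr0_norm hx) le_min => /andP[hx1 hx2].
  have b1 := hN2 x n2 x0 k.+1 isT; rewrite -/z in b1.
  have b2 : `|Phi z - Phi y| <= e / 2.
    apply: (le_trans (Phi_lip z y)).
    have sz : `|z ^+ 2 - y ^+ 2| <= h x * (2 * `|y| + 1).
      rewrite subr_sqr normrM; apply: ler_pM => //; first by rewrite distrC.
      have -> : z + y = (z - y) + 2 * y by ring.
      apply: (le_trans (ler_normD _ _)); rewrite normrM (@gtr0_norm _ 2)// addrC lerD2l.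
      by rewrite distrC; exact: le_trans hx1.
    apply: (@le_trans _ _ (L * h x)); last by rewrite mulrC -ler_pdivlMr.
    rewrite /L -!mulrA ler_pM2l// ler_pM2l// ler_pM2l// mulrC //.
  have -> : ak k.+1 x - Phi y = (ak k.+1 x - Phi z) + (Phi z - Phi y) by ring.
  by apply: (le_trans (ler_normD _ _)); lra.
have [iP eP] := gaussian_int 0 rate0.
have PhE : \int[leb]_y Phi y = I * C * Num.sqrt (pi / rate).
  rewrite -eP -(intZ _ iP); apply: eq_Rintegral => y _.
  by rewrite /GaussianProfile.Phi subr0.
pose n0 := (maxn (maxn N0 N1) 1)%N.
have [_ cv] := @int_dct _ _ R leb (fun n y => F (n + n0)%N y) Phi (fun y => 3 * W * (1 + y ^+ 2)^-1)
  (fun n => itg_measurable (step_fun_itg _ _ _ _)) iW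
  (fun n y => dom _ _ (leq_trans (leq_trans (leq_maxl N0 N1) (leq_maxl _ 1)) (leq_addl n n0))
     (leq_trans (leq_trans (leq_maxr N0 N1) (leq_maxl _ 1)) (leq_addl n n0))
     (leq_trans (leq_maxr _ 1) (leq_addl n n0)))
  (fun y => ltac:(by rewrite (@cvg_shiftn n0 _ (F^~ y)))).
rewrite -PhE; apply: cvgn_le => e e0; have e2 : 0 < e / 2 by rewrite divr_gt0.
have [M1 hM1] := cvgn_dist cv e2; have [M2 hM2] := cvgn_dist (@invn_cvg0 R) e2.
exists (maxn (M1 + n0) (maxn M2 1)) => x; rewrite !geq_max => /andP[m1 /andP[m2 x0]].
have := hM1 (x - n0)%N; rewrite leq_subRL; last exact: leq_trans (leq_addl _ _) m1.
rewrite addnC m1 => /(_ isT); rewrite subnK; last exact: leq_trans (leq_addl _ _) m1.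
rewrite /F int_step_fun ?h0// => b1.
have [_ /(_ x0) b2] := hNx x; have := hM2 x m2; rewrite subr0 ger0_norm// => b3.
apply: (le_trans (ler_distD (h x * \sum_(k < Nx x) ak k.+1 x) _ _)).
by rewrite [leRHS](splitr e); apply: lerD; [exact: le_trans b2 b3|exact: b1].
Qed.

Lemma ratio_cvg : exists2 D : R, 0 < D & forall e : R, 0 < e -> exists N : nat,
  forall x, (N <= x)%N -> forall k, (0 < k)%N ->
  `|qr x * (p k x / S x) - (Num.sqrt (2 * pi * D))^-1 *
     expR (- ((k%:R - sq x / rI) ^+ 2 / (2 * D * sq x)))| <= e.
Proof.
(* The variance of the density proportional to [exp (- rate * y ^ 2)]; thus [sqrt (2 * pi * D)] is
   the integral found in [sum_cvg]. *)
pose D := (2 * rate)^-1; exists D; first by rewrite invr_gt0 mulr_gt0.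
have rn : rate != 0 by rewrite gt_eqF.
have sE : Num.sqrt (2 * pi * D) = Num.sqrt (pi / rate) by congr Num.sqrt; rewrite /D; field.
set G := Num.sqrt (2 * pi * D); have G0 : 0 < G by rewrite /G sE sqrtr_gt0 divr_gt0// pi_gt0.
pose L := I * C * G; have L0 : 0 < L by rewrite mulr_gt0.
have sc := sum_cvg; rewrite -sE -/G -/L in sc.
move=> e e0.
have d1 : 0 < e * L / 4 by rewrite divr_gt0// mulr_gt0.
(* The first bound keeps the denominator [Z] above [L / 2]; with it, the second makes the error due
   to replacing [Z] by [L] at most [e / 2]. *)
have d2 : 0 < Num.min (L / 2) (e * L ^+ 2 / (4 * (I * C))).
  rewrite lt_min divr_gt0//= divr_gt0//; first by rewrite mulr_gt0// exprn_gt0.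
  by rewrite mulr_gt0.
have [N1 h1] := ak_unif d1; have [N2 h2] := cvgn_dist sc d2.
exists (maxn (maxn N1 N2) 1) => x; rewrite !geq_max => /andP[/andP[n1 n2] x0] k k0.
have a1 := h1 x n1 x0 k k0; have := h2 x n2; rewrite le_min => /andP[a2 a3].
have q0 := qr0 x0; have nr0 : 0 < nrm x by rewrite mulr_gt0 ?expR_gt0 ?ltr0n.
set Z := nrm x * S x / qr x in a2 a3.
have Z0 : L / 2 <= Z by move: a2; rewrite ler_norml => /andP[h _]; lra.
have Zp : 0 < Z by apply: lt_le_trans Z0; rewrite divr_gt0.
have Sn : S x != 0.
  by apply/eqP => s0; move: Zp; rewrite /Z s0 mulr0 mul0r ltxx.
have qn : qr x != 0 by rewrite gt_eqF.
have nn : nrm x != 0 by rewrite gt_eqF.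
have -> : qr x * (p k x / S x) = ak k x / Z.
  by rewrite /Z /GaussianProfile.ak; field; rewrite Sn qn nn.
have ge (b q : R) : q != 0 -> b ^+ 2 / (2 * D * q ^+ 2) = rate * (b / q) ^+ 2.
  by move=> qn'; rewrite /D; field; rewrite rn qn'.
have -> : G^-1 * expR (- ((k%:R - sq x / rI) ^+ 2 / (2 * D * sq x))) = Phi (yk k x) / L.
  rewrite /GaussianProfile.Phi /L (_ : (k%:R - sq x / rI) ^+ 2 / (2 * D * sq x) = rate * yk k x ^+ 2); last first.
    by rewrite /GaussianProfile.yk -/rI -(ge _ _ qn) qr2.
  by field; rewrite !gt_eqF.
have /andP[f0 f1] := Phi_bounds (yk k x).
have fIC : Phi (yk k x) <= I * C.
  apply: (le_trans f1); rewrite ler_piMr ?(ltW IC0)// invf_le1.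
    by rewrite lerDl mulr_ge0 ?sqr_ge0 ?(ltW rate0).
  by rewrite ltr_wpDr// mulr_ge0 ?sqr_ge0 ?(ltW rate0).
set a := ak k x in a1 *; set f := Phi _ in a1 f0 f1 fIC *.
have Zn : Z != 0 by rewrite gt_eqF.
have Ln : L != 0 by rewrite gt_eqF.
have -> : a / Z - f / L = (a - f) / Z + f * ((L - Z) / (Z * L)) by field; rewrite Zn Ln.
have ZL : 0 < Z * L by rewrite mulr_gt0.
have m1 : `|(a - f) / Z| = `|a - f| / Z by rewrite normrM normfV (gtr0_norm Zp).
have m2 : `|f * ((L - Z) / (Z * L))| = f * (`|L - Z| / (Z * L)).
  by rewrite (normrM f) (ger0_norm f0) (normrM (L - Z)) normfV (gtr0_norm ZL).
apply: (le_trans (ler_normD _ _)); rewrite m1 m2 [leRHS](splitr e); apply: lerD.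
  rewrite ler_pdivrMr//; apply: (le_trans a1).
  apply: (@le_trans _ _ (e / 2 * (L / 2))); last by rewrite ler_pM2l ?divr_gt0.
  by rewrite le_eqVlt; apply/orP; left; apply/eqP; field.
apply: (@le_trans _ _ (I * C * (e * L ^+ 2 / (4 * (I * C)) / (L / 2 * L)))).
  apply: ler_pM => //; first by rewrite divr_ge0// ltW.
  apply: ler_pM => //; first by rewrite invr_ge0 ltW.
    by rewrite distrC.
  by rewrite lef_pV2 ?posrE// ?ler_pM2r// mulr_gt0// divr_gt0.
by rewrite le_eqVlt; apply/orP; left; apply/eqP; field; rewrite Ln !gt_eqF.
Qed.

End gaussian_ratio.

(** * From the hypotheses on the walk to those on an integer-valued step *)

Section lattice_step_of_walk.
Context d (T : measurableType d) (R : realType) (P : probability T R)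
  (X : nat -> {RV P >-> R}) (lam : R).
Hypothesis X_int : forall (n : nat) (w : T), X n w \is a Num.int.
Hypothesis X_mean_finite : P.-integrable setT (EFin \o X 0%N).
Hypothesis X_mean_neg : ('E_P[X 0%N] < 0)%E.
Hypothesis X_aperiodic : is_gcd (support_differences P (X 0%N)) 1.
Hypothesis lam0 : 0 < lam.
Hypothesis phi_lam : 'M_ P (X 0%N) lam = 1%E.
Hypothesis phi''_lam : ('E_P[fun w => (X 0%N w ^+ 2 * expR (lam * X 0%N w))%R] < +oo)%E.
Notation Y := (Xz X 0).

Let mX : mfun_ (X 0%N : T -> R). Proof. by []. Qed.
Let XE w : X 0%N w = (Y w)%:~R. Proof. exact: XzE. Qed.

Lemma mgfE th : 'M_ P (X 0%N) th = (\int[P]_w (expR (th * X 0%N w))%:E)%E.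
Proof.
rewrite /mmt_gen_fun unlock; apply: eq_integral => w _ /=.
by congr (expR _)%:E; rewrite mulrC.
Qed.

Lemma ge0_itg (f : T -> R) : mfun_ f -> (forall w, 0 <= f w) ->
  (\int[P]_w (f w)%:E < +oo)%E -> Itg P f.
Proof.
move=> mf f0 h; apply/integrableP; split; first exact/measurable_EFinP.
by under eq_integral => w _ do rewrite /= ger0_norm//.
Qed.

Lemma prob_eqE a : P [set w | X 0%N w = a%:~R] = (\int[P]_w ((Y w == a)%:R : R))%:E.
Proof.
have -> : [set w | X 0%N w = a%:~R] = Y @^-1` [set a].
  apply/seteqP; split => w /=; rewrite XE; last by move=> ->.
  by move/eqP; rewrite eqr_int => /eqP.
have := pmassE X_int a; rewrite /pmass /Tilting.Ex => ->.
by rewrite fineK// fin_num_measure//; exact: (mXz X_int).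
Qed.

Lemma walk_lattice_step : lattice_step P Y lam.
Proof.
have mexp : mfun_ (fun w => expR (lam * X 0%N w)).
  by apply: measurableT_comp => //; apply: measurable_funM.
have EXE : (fun w => expR (lam * (Y w)%:~R)) = fun w => expR (lam * X 0%N w).
  by apply/funext => w; rewrite XE.
have iexp : Itg P (fun w => expR (lam * X 0%N w)).
  by apply: ge0_itg => //; rewrite -mgfE phi_lam ltry.
split.
- exact: lam0.
- by move=> A; exact: (mXz X_int).
- have -> : (fun w => `|(Y w)%:~R : R|) = fun w => `|X 0%N w| by apply/funext => w; rewrite XE.
  exact: (integrable_norm X_mean_finite).
- by rewrite EXE.
- by rewrite EXE /Rintegral -mgfE phi_lam.
- have -> : (fun w => (Y w)%:~R ^+ 2 * expR (lam * (Y w)%:~R)) = fun w => X 0%N w ^+ 2 * expR (lam * X 0%N w).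
    by apply/funext => w; rewrite XE.
  apply: ge0_itg.
  + by apply: measurable_funM => //; apply: measurable_funX.
  + by move=> w; exact: (mulr_ge0 (sqr_ge0 _) (expR_ge0 _)).
  + by move: phi''_lam; rewrite unlock.
- have -> : (fun w => (Y w)%:~R : R) = X 0%N by apply/funext => w; rewrite XE.
  rewrite /Rintegral -lte_fin fineK; last exact: (integrable_fin_num measurableT X_mean_finite).
  by move: X_mean_neg; rewrite unlock.
- move: X_aperiodic; congr (is_gcd _ _); apply/funext => m; apply/propext.
  split => -[k [n [h e]]]; exists k, n; split => //.
    by move: h; rewrite !prob_eqE -EFinM lte_fin.
  by rewrite !prob_eqE -EFinM lte_fin.
Qed.

Lemma I_psiE : I_psi P (X 0%N) lam = mean_height (cum P Y) lam.
Proof.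
have LS := walk_lattice_step.
rewrite /I_psi /mean_height -mulNr.
have it := @itg_affine R (cum P Y) (mu P Y) lam lam0 (@cum_tangent _ _ _ _ _ _ LS) 0 1 (lexx 0) (lexx 1).
rewrite -RintegralZl//; apply: eq_Rintegral => u _.
rewrite /psi mulNr; congr (- (_ * ln _)).
rewrite mgfE /phi /Tilting.Ex /Rintegral; congr fine; apply: eq_integral => w _.
by rewrite XE.
Qed.

End lattice_step_of_walk.

(** * The law of the area as a sum over excursion lengths *)

Section total_excursion.
Context d (T : measurableType d) (R : realType) (P : probability T R)
  (X : nat -> {RV P >-> R}).
Hypothesis X_indep : independent_seq P X.
Hypothesis X_id : identically_distributed P X.
Hypothesis X_int : forall (n : nat) (w : T), X n w \is a Num.int.

(** The value 0 of [tau], which encodes infinity, goes with an empty sum and the area 0, so [x > 0]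
    excludes it and the remaining values partition the event. *)
Lemma area_law_sum x : (0 < x)%N ->
  \sum_(0 <= k < N) fine (P (excursion X k.+1 x)) @[N --> \oo] --> fine (P [set w | A_tau X w = x%:R]).
Proof.
move=> x0; pose F k := excursion X k.+1 x.
have mF k : measurable (F k) := (excursion_path X_indep X_id X_int k (leqnn x)).1.
have UE : [set w | A_tau X w = x%:R] = \bigcup_k F k.
  apply/seteqP; split => w /=; last by move=> [k _ []].
  move=> Aw; exists (tau X w).-1 => //; rewrite /F /excursion /=; split => //=.
  rewrite prednK// lt0n; apply/eqP => t0; move: Aw; rewrite /A_tau t0 big_geq// => /esym/eqP.
  by rewrite pnatr_eq0 -leqn0 leqNgt x0.
have tF : trivIset setT F.
  apply/trivIsetP => i j _ _ ij; rewrite -subset0 => w [[/= h1 _] [/= h2 _]].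
  by move: ij; rewrite -(inj_eq succn_inj) -h1 -h2 eqxx.
have h : (\sum_(0 <= k < N) P (F k))%E @[N --> \oo] --> P (\bigcup_k F k).
  by apply: measure_semi_sigma_additive => //; exact: bigcupT_measurable.
rewrite UE.
have fU : P (\bigcup_k F k) \is a fin_num by rewrite fin_num_measure//; exact: bigcupT_measurable.
rewrite -(fineK fU) in h.
have E N : \sum_(0 <= k < N) fine (P (F k)) = fine (\sum_(0 <= k < N) P (F k))%E.
  elim: N => [|N ih]; first by rewrite !big_geq.
  rewrite !big_nat_recr//= ih fineD ?fin_num_measure//.
  by apply/sum_fin_numP => k _ _; exact: fin_num_measure.
rewrite (_ : (fun N => _) = fun N => fine (\sum_(0 <= k < N) P (F k))%E); last by apply/funext => N; exact: E.
exact: (fine_cvg h).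
Qed.

End total_excursion.

(** * Assembly of the conditional limit theorem *)

Theorem theorem2 (d : measure_display) (T : measurableType d) (R : realType)
    (P : probability T R) (X : nat -> {RV P >-> R}) (lambda : R)
    (X_indep : independent_seq P X)
    (X_id : identically_distributed P X)
    (X_int : forall (n : nat) (w : T), X n w \is a Num.int)
    (X_mean_finite : P.-integrable setT (EFin \o X 0%N))
    (X_mean_neg : ('E_P[X 0%N] < 0)%E)
    (X_aperiodic : is_gcd (support_differences P (X 0%N)) 1)
    (lambda_gt0 : 0 < lambda)
    (phi_lambda : 'M_ P (X 0%N) lambda = 1%E)
    (phi'_lambda : ('E_P[fun w => (X 0%N w * expR (lambda * X 0%N w))%R] < +oo)%E)
    (phi''_lambda :
       ('E_P[fun w => (X 0%N w ^+ 2 * expR (lambda * X 0%N w))%R] < +oo)%E) :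
  exists Delta2 : R, 0 < Delta2 /\
    ereal_sup
      [set (`| x%:R `^ 4^-1 *
               cond_prob P [set w | tau X w = k] [set w | A_tau X w = x%:R]
             - (Num.sqrt (2 * pi * Delta2))^-1 *
               expR (- ((k%:R - I_psi P (X 0%N) lambda `^ (- 2^-1)
                                * x%:R `^ 2^-1) ^+ 2
                        / (2 * Delta2 * x%:R `^ 2^-1))) |)%:E
        | k in [set k : nat | (0 < k)%N]]
      @[x --> \oo] --> (0 : \bar R)%E.
Proof.
have LS := walk_lattice_step X_int X_mean_finite X_mean_neg X_aperiodic lambda_gt0 phi_lambda phi''_lambda.
have IE := I_psiE X_int X_mean_finite X_mean_neg X_aperiodic lambda_gt0 phi_lambda phi''_lambda.
have tg := @cum_tangent _ _ _ _ _ _ LS.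
have I0 : 0 < mean_height (cum P (Xz X 0)) lambda.
  exact: (mean_height_gt0 lambda_gt0 tg (cum0 P (Xz X 0)) (cumlam LS) (cum_mid LS)).
set I := mean_height _ _ in IE I0.
have [C [V [C0 V0 llt]]] := excursion_llt LS.
pose B := lambda * slope_bound (mu P (Xz X 0)) lambda.
have B0 : 0 <= B by rewrite mulr_ge0 ?(ltW lambda_gt0)// ltW// slope_bound_gt0.
(* The remainder between the logarithm of the product of normalising constants and its integral
   approximation; [riemann_sum] makes it [O(1/k)]. *)
pose E k := \sum_(1 <= i < k) cum P (Xz X 0) (lambda * (i%:R / k%:R)) + k%:R * (lambda * I).
have EB k : (0 < k)%N -> `|E k| <= B / k%:R.
  move=> k0; exact: (riemann_sum lambda_gt0 tg (cum0 P (Xz X 0)) (cumlam LS)).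
pose p k x := fine (P (excursion X k x)).
pose g k x := Gn P (Xz X 0) lambda k x x%:Z.
have pG k x K : (0 < k)%N -> (x <= K)%N -> p k x =
   Gn P (Xz X 0) lambda k K x%:Z / k%:R ^+ 2 * expR (E k) * expR (- (lambda * (x%:R / k%:R + k%:R * I))).
  case: k => // k _ xK; rewrite /p (excursion_path X_indep X_id X_int k xK).2 (tilt_weight LS)//.
  have -> : expR (E k.+1) = expR (\sum_(1 <= i < k.+1) cum P (Xz X 0) (lambda * (i%:R / k.+1%:R))) *
    expR (k.+1%:R * (lambda * I)) by rewrite -expRD.
  have -> : expR (- (lambda * (x%:R / k.+1%:R + k.+1%:R * I))) =
    expR (- (lambda * (x%:~R / k.+1%:R))) * (expR (k.+1%:R * (lambda * I)))^-1.
    by rewrite -expRN -expRD; congr expR; rewrite -[x%:~R]/(x%:R : R); ring.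
  have en : expR (k.+1%:R * (lambda * I)) != 0 by rewrite gt_eqF// expR_gt0.
  have kn : k.+1%:R != 0 :> R by rewrite pnatr_eq0.
  have Fd (a b c k1 G1 : R) : a != 0 -> k1 != 0 -> b * c * (G1 / k1 ^+ 2) = G1 / k1 ^+ 2 * (b * a) * (c / a).
    by move=> H1 H2; field; rewrite ?H1 ?H2.
  exact: (Fd _ _ _ _ _ en kn).
(* Both cut-offs represent the same probability, so [Gn] does not depend on [K >= x]. This transfers
   the limit theorem, stated for [K] large depending on the length, to the cut-off [x]. *)
have gK k x K : (0 < k)%N -> (x <= K)%N -> g k x = Gn P (Xz X 0) lambda k K x%:Z.
  move=> k0 xK; have := pG k x x k0 (leqnn x); rewrite (pG k x K k0 xK) /g.
  have inj (a b k1 u v : R) : k1 != 0 -> u != 0 -> v != 0 ->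
      a / k1 ^+ 2 * u * v = b / k1 ^+ 2 * u * v -> a = b.
    move=> h1 h2 h3 /(mulIf h3) /(mulIf h2); apply: mulIf.
    by rewrite invr_eq0 expf_neq0.
  have kn : k%:R != 0 :> R by rewrite pnatr_eq0 -lt0n.
  have en (u : R) : expR u != 0 by rewrite gt_eqF// expR_gt0.
  by move=> h; exact: (inj _ _ _ _ _ kn (en _) (en _) (esym h)).
have G0 k K x : 0 <= Gn P (Xz X 0) lambda k K x.
  rewrite mulr_ge0 ?sqr_ge0//; apply: path_sum_ge0; first by move=> i a; exact: (wtn_ge0 LS).
  by move=> b; rewrite mulr_ge0// mulr_ge0// below_ge0.
(* Crude bound, used only for the finitely many lengths before the limit theorem takes effect. *)
have GM k K x : Gn P (Xz X 0) lambda k K x <= k%:R ^+ 2.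
  rewrite ler_piMr ?sqr_ge0//; apply: path_sum_le_cst => //.
  - by move=> i a; exact: (wtn_ge0 LS).
  - by move=> i; exact: (wtn_le1 LS).
  move=> b _; rewrite mulr_ile1 ?mulr_ge0 ?below_ge0//; first by case: (stays_pos _ _ _).
  rewrite mulr_ile1 ?below_ge0//; first by case: (_ == _).
  rewrite -[leRHS](ex_cst P (Xz X 0)); apply: ex_le.
  - exact: (ig_indic LS (fun a => a <= - tot b)).
  - exact: (ig_cst P (Xz X 0)).
  - by move=> a; case: (a <= _).
have glim e : 0 < e -> exists N : nat, forall k, (N <= k)%N -> forall x,
  `|g k x - C * expR (- (((x%:R - I * k%:R ^+ 2) / (k%:R * Num.sqrt k%:R)) ^+ 2 / (2 * V)))| <= e.
  move=> e0; have [N hN] := llt e e0; exists N.+1 => k Nk x.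
  have [K1 hK] := hN k (ltnW Nk).
  have k0 : (0 < k)%N by exact: leq_trans Nk.
  rewrite (gK k x (maxn K1 x)) ?leq_maxr//.
  exact: (hK _ (leq_maxl _ _) x%:Z).
have [N1 hN1] := glim 1 ltr01.
pose Cg := C + 1 + N1%:R ^+ 2.
have gb k x : (0 < k)%N -> 0 <= g k x <= Cg.
  move=> k0; rewrite /g G0/=; have [kN|kN] := leqP N1 k.
    have := hN1 k kN x; rewrite -/(g k x) => /(le_trans (ler_norm _)) h.
    have e1 : C * expR (- (((x%:R - I * k%:R ^+ 2) / (k%:R * Num.sqrt k%:R)) ^+ 2 / (2 * V))) <= C.
      rewrite ler_piMr ?(ltW C0)// expR_le1 oppr_le0 mulr_ge0 ?sqr_ge0// invr_ge0 mulr_ge0// ltW//.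
    rewrite /Cg; have := sqr_ge0 (N1%:R : R); move: h e1; set u := C * _; set v := g k x; lra.
  apply: (le_trans (GM _ _ _)); rewrite /Cg; apply: (@le_trans _ _ (N1%:R ^+ 2)).
    by rewrite ler_sqr ?nnegrE ?ler0n// ler_nat ltnW.
  by rewrite lerDr addr_ge0// ltW.
have pE k x : (0 < k)%N -> (0 < x)%N ->
  p k x = g k x / k%:R ^+ 2 * expR (E k) * expR (- (lambda * (x%:R / k%:R + k%:R * I))).
  by move=> k0 _; exact: pG.
have Ssum x : (0 < x)%N -> (\sum_(0 <= k < N) p k.+1 x) @[N --> \oo] --> fine (P [set w | A_tau X w = x%:R]).
  exact: area_law_sum.
have [D D0 hD] := ratio_cvg I0 lambda_gt0 C0 V0 B0 EB gb glim pE Ssum.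
exists D; split => //.
have p2 (x : nat) : x%:R `^ 2^-1 = Num.sqrt x%:R :> R by rewrite powR12_sqrt.
have p4 (x : nat) : x%:R `^ 4^-1 = Num.sqrt (Num.sqrt x%:R) :> R.
  rewrite (_ : 4^-1 = 2^-1 * 2^-1 :> R); last by field.
  by rewrite powRrM p2 powR12_sqrt// sqrtr_ge0.
have pI : I_psi P (X 0%N) lambda `^ (- 2^-1) = (Num.sqrt I)^-1.
  by rewrite IE powRN powR12_sqrt// ltW.
set F := fun x : nat => ereal_sup _.
have FE e : 0 < e -> exists N : nat, forall x, (N <= x)%N -> (0 <= F x <= e%:E)%E.
  move=> e0; have [N hN] := hD e e0; exists N => x Nx; apply/andP; split.
    (* A supremum over a nonempty set of nonnegative numbers: the length 1 bounds it below by 0. *)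
    apply: (@le_trans _ _ (`|x%:R `^ 4^-1 *
               cond_prob P [set w | tau X w = 1%N] [set w | A_tau X w = x%:R]
             - (Num.sqrt (2 * pi * D))^-1 *
               expR (- ((1%:R - I_psi P (X 0%N) lambda `^ (- 2^-1)
                                * x%:R `^ 2^-1) ^+ 2
                        / (2 * D * x%:R `^ 2^-1)))|%:E)); first by rewrite lee_fin.
    by apply: ereal_sup_ubound; exists 1%N.
  apply: ge_ereal_sup => _ [k /= k0 <-]; rewrite lee_fin p4 p2 pI (mulrC (Num.sqrt I)^-1).
  exact: (hN x Nx k k0).
apply/fine_cvgP; split.
  have [N hN] := FE 1 ltr01; exists N => // x /= Nx; have /andP[h1 h2] := hN x Nx.
  by rewrite fin_numElt (lt_le_trans _ h1) ?ltNye//= (le_lt_trans h2) ?ltey.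
apply: cvgn_le => e e0; have [N hN] := FE e e0; exists N => x Nx.
have /andP[h1 h2] := hN x Nx; rewrite subr0 /=.
move: h1 h2; case: (F x) => [r| |] //= h1 h2; rewrite ?normr0 ?(ltW e0)//.
by rewrite !lee_fin in h1 h2; rewrite ger0_norm.
Qed.
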